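(* Let $c\in\mathbb{R}$, $J_+=[c,\infty)$, $J_-=(-\infty,c)$, fix a sign $\pm$, and suppose that zero belongs to the resolvent set of $\mathrm{T}_\pm$. The spectrum of the quadratic operator pencil $\mathrm{L}_\pm$ coincides with the spectrum of the self-adjoint linear relation $\mathrm{T}_\pm$. If some $z\in\mathbb{C}$ belongs to the resolvent set of $\mathrm{L}_\pm$, then $$\mathrm{L}_\pm(z)^{-1}g(x)=\langle g,G_\pm(x,\cdot)^\ast\rangle_{H^1(J_\pm)},\qquad x\in J_\pm,\ g\in H^1_0(J_\pm),$$ where the Green's function $G_\pm$ is given by $$G_+(x,s)=\frac{1}{W(\psi_+,\phi)}\begin{cases}\psi_+(x)\phi(s),& s\le x,\\ \psi_+(s)\phi(x),& s> x,\end{cases}\qquad G_-(x,s)=\frac{-1}{W(\psi_-,\phi)}\begin{cases}\psi_-(x)\phi(s),& s\ge x,\\ \psi_-(s)\phi(x),& s< x,\end{cases}$$ and $\psi_\pm$, $\phi$ are linearly independent solutions of the homogeneous differential equation $-f''+\frac14f=z\,\omega f+z^2\upsilon f$ such that $\psi_\pm$ lies in $H^1(\mathbb{R})$ near $\pm\infty$ and $\phi$ satisfies $\phi(c)=0$.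
   Context: Let $\omega$ be a real-valued Borel measure on $\mathbb{R}$ and $\upsilon$ a non-negative Borel measure on $\mathbb{R}$ (both locally finite; so $\omega$ is a signed measure assigning finite values to bounded Borel sets). The superscript $^\ast$ on numbers and functions denotes complex conjugation. For a Borel measure $\mu$, $\int_x^y f\,d\mu$ means $\int_{[x,y)}f\,d\mu$ if $y>x$, $0$ if $y=x$, and $-\int_{[y,x)}f\,d\mu$ if $y<x$. For $z\in\mathbb{C}$, a solution of $-f''+\frac14 f=z\,\omega f+z^2\upsilon f$ is a locally absolutely continuous function $f$ on $\mathbb{R}$ whose derivative has a left-continuous representative, always denoted $f'$, with $-f'(y)+f'(x)+\frac14\int_x^y f(s)\,ds=z\int_x^y f\,d\omega+z^2\int_x^y f\,d\upsilon$ for all $x,y\in\mathbb{R}$. For two solutions, the Wronskian $W(\theta,\phi)=\theta(x)\phi'(x)-\theta'(x)\phi(x)$ does not depend on $x$. Let $\mathcal{H}_{\mathrm{loc}}(\mathbb{R})=H^1_{\mathrm{loc}}(\mathbb{R})\times L^2_{\mathrm{loc}}(\mathbb{R};\upsilon)$, where $H^1_{\mathrm{loc}}(\mathbb{R})$ consists of locally absolutely continuous functions with locally square integrable derivative; components are denoted $f_1,f_2$. The linear relation $\mathrm{T}_{\mathrm{loc}}$ consists of all pairs $\mathbf f=(f,\tau f)\in\mathcal{H}_{\mathrm{loc}}(\mathbb{R})^2$ such that $-f_1''+\frac14 f_1=\omega\,\tau f_1+\upsilon\,\tau f_2$ in the sense of distributions and $f_2=\tau f_1$ almost everywhere with respect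 to $\upsilon$. $H^1(J_\pm)$ carries the scalar product $\langle f,g\rangle_{H^1(J_\pm)}=\frac14\int_{J_\pm} fg^\ast dx+\int_{J_\pm} f'(g')^\ast dx$; $H^1_0(J_\pm)$ is its subspace of functions vanishing at $c$, and $H^1_{\mathrm{c}}(J_\pm)$ is the dense subspace of $H^1_0(J_\pm)$ of functions with compact support in the interior of $J_\pm$. $\mathcal{H}_0(J_\pm)=H^1_0(J_\pm)\times L^2(J_\pm;\upsilon)$ is the Hilbert space with scalar product $\langle f_1,g_1\rangle_{H^1(J_\pm)}+\int_{J_\pm} f_2g_2^\ast d\upsilon$. The linear relation $\mathrm{T}_\pm$ in $\mathcal{H}_0(J_\pm)$ consists of all $\mathbf f=(f,\tau f)\in\mathcal{H}_0(J_\pm)\times\mathcal{H}_0(J_\pm)$ which are restrictions to $J_\pm$ of elements of $\mathrm{T}_{\mathrm{loc}}$; it is self-adjoint. The resolvent set of a closed linear relation $\mathrm{S}$ is the set of $z\in\mathbb{C}$ for which $(\mathrm{S}-z)^{-1}$, with $\mathrm{S}-z=\{(f,g-zf):(f,g)\in \mathrm{S}\}$, is (the graph of) an everywhere defined bounded operator; the spectrum is its complement. When zero belongs to the resolvent set of $\mathrm{T}_\pm$, the quadratic operator pencil $\mathrm{L}_\pm$ in $H^1_0(J_\pm)$ is $\mathrm{L}_\pm(z)=\mathrm{I}_\pm-z\,\Omega_\pm-z^2\Upsilon_\pm$, $z\in\mathbb{C}$, where $\mathrm{I}_\pm$ is the identity and $\Omega_\pm,\Upsilon_\pm$ are the bounded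 operators on $H^1_0(J_\pm)$ determined by $$\Omega_\pm g(x)=\int_{J_\pm}K_\pm(x,s)g(s)\,d\omega(s),\ g\in H^1_{\mathrm{c}}(J_\pm),\qquad \Upsilon_\pm g(x)=\int_{J_\pm}K_\pm(x,s)g(s)\,d\upsilon(s),\ g\in H^1_0(J_\pm),$$ where $K_+(x,s)=2\mathrm{e}^{-\frac{x-c}{2}}\sinh\left(\frac{s-c}{2}\right)$ for $s\le x$ and $K_+(x,s)=2\mathrm{e}^{-\frac{s-c}{2}}\sinh\left(\frac{x-c}{2}\right)$ for $s>x$, while $K_-(x,s)=-2\mathrm{e}^{\frac{x-c}{2}}\sinh\left(\frac{s-c}{2}\right)$ for $s\ge x$ and $K_-(x,s)=-2\mathrm{e}^{\frac{s-c}{2}}\sinh\left(\frac{x-c}{2}\right)$ for $s<x$. (Boundedness of these operators is a consequence of zero being in the resolvent set of $\mathrm{T}_\pm$.) The resolvent set of a pencil is the set of $z\in\mathbb{C}$ for which the operator at $z$ has an everywhere defined bounded inverse; the spectrum is the complement. A function lies in $H^1(\mathbb{R})$ near $\pm\infty$ if it and its derivative are square integrable near $\pm\infty$. *)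

(* Defs.v *)
From HB Require Import structures.
From mathcomp Require Import all_boot all_order all_algebra.
From mathcomp Require Import all_classical all_reals all_analysis.
From mathcomp Require Import complex.

Set Implicit Arguments.
Unset Strict Implicit.
Unset Printing Implicit Defensive.
Import Order.TTheory GRing.Theory Num.Theory.
Import numFieldNormedType.Exports.

Local Open Scope ring_scope.
Local Open Scope complex_scope.
Local Open Scope classical_set_scope.

(** * Linear relations *)

(** A normed space over [R[i]] is presented by representatives taken in an
    ambient vector space [V]: [pts] is the set of representatives, [eqv] says
    that two of them represent the same vector. *)
Record repr_space (R : realType) (V : lmodType R[i]) := ReprSpace {
  pts : set V ;
  eqv : V -> V -> Prop ;
  nrm : V -> R }.

Section LinearRelations.
Context {R : realType} {V : lmodType R[i]}.
Variable E : repr_space V.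
Implicit Types (S : set (V * V)) (A : V -> V) (z : R[i]).

Definition rel_shift S z : set (V * V) :=
  [set p | exists f g, S (f, g) /\ p = (f, g - z *: f)].

Definition rel_inv S : set (V * V) := [set p | S (p.2, p.1)].

Definition is_bounded_operator_graph S :=
  [/\ forall f, pts E f -> exists g, S (f, g),
      forall f g1 g2, S (f, g1) -> S (f, g2) -> eqv E g1 g2
    & exists k : R, forall f g, S (f, g) -> nrm E g <= k * nrm E f].

Definition resolvent_set S : set R[i] :=
  [set z | is_bounded_operator_graph (rel_inv (rel_shift S z))].

Definition spectrum S : set R[i] := ~` resolvent_set S.

Definition is_bounded_operator A :=
  [/\ forall f, pts E f -> pts E (A f),
      forall z f g, pts E f -> pts E g -> eqv E (A (z *: f + g)) (z *: A f + A g)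
    & exists k : R, forall f, pts E f -> nrm E (A f) <= k * nrm E f].

Definition op_graph A : set (V * V) :=
  [set p | [/\ pts E p.1, pts E p.2 & eqv E p.2 (A p.1)]].

Definition pencil_resolvent_set (L : R[i] -> V -> V) : set R[i] :=
  [set z | is_bounded_operator_graph (rel_inv (op_graph (L z)))].

Definition pencil_spectrum (L : R[i] -> V -> V) : set R[i] :=
  ~` pencil_resolvent_set L.

Definition quadratic_pencil (Omega Upsilon : V -> V) z : V -> V :=
  fun f => f - z *: Omega f - z ^+ 2 *: Upsilon f.

End LinearRelations.

(** * Measures and integrals *)

Section Measures.
Context {R : realType}.
Let B := measurableTypeR R.

Definition bounded_borel (A : set B) :=
  measurable A /\ bounded_set (A : set R).

(** A locally finite signed measure need not extend to unbounded Borel sets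
    ([oo - oo]); its values there are irrelevant. *)
Definition is_signed_measure (om : set B -> R) :=
  forall F : nat -> set B,
    (forall n, bounded_borel (F n)) -> trivIset setT F ->
    bounded_borel (\bigcup_n F n) ->
    (fun n => \sum_(i < n) om (F i)) @ \oo --> om (\bigcup_n F n).

Definition locally_finite (mu : set B -> \bar R) :=
  forall A, bounded_borel A -> (mu A < +oo)%E.

(** Jordan decomposition: upper and lower variation. *)
Definition upper_variation (om : set B -> R) (A : set B) : \bar R :=
  ereal_sup [set (om D)%:E | D in [set D | bounded_borel D /\ D `<=` A]].

Definition lower_variation (om : set B -> R) : set B -> \bar R :=
  upper_variation (fun A => - om A).

Definition cintegral (mu : set B -> \bar R) (D : set B) (f : R -> R[i]) : R[i] :=
  fine (\int[mu]_(x in D) (complex.Re (f x))%:E) +i*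
  fine (\int[mu]_(x in D) (complex.Im (f x))%:E).

Definition signed_integral (om : set B -> R) (D : set B) (f : R -> R[i]) : R[i] :=
  cintegral (upper_variation om) D f - cintegral (lower_variation om) D f.

(** [int_x^y] for an integral given as a function of the domain. *)
Definition oriented (I : set R -> R[i]) (x y : R) : R[i] :=
  if x < y then I `[x, y[ else if y < x then - I `[y, x[ else 0.

Definition L2 (mu : set B -> \bar R) (D : set B) (f : R -> R[i]) :=
  [/\ measurable_fun D (fun x : B => complex.Re (f x)),
      measurable_fun D (fun x : B => complex.Im (f x))
    & (\int[mu]_(x in D) ((ComplexField.Normc.normc (f x)) ^+ 2)%:E < +oo)%E].

End Measures.

(** * Absolutely continuous functions and Sobolev spaces *)

Section Sobolev.
Context {R : realType}.
Notation leb := (@lebesgue_measure R).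
Implicit Types (f g : R -> R[i]) (J : set R).

Definition abs_continuous_on (a b : R) f :=
  forall e : R, 0 < e -> exists2 d : R, 0 < d &
    forall (n : nat) (u v : 'I_n -> R),
      (forall i, a <= u i /\ u i <= v i /\ v i <= b) ->
      (forall i j, i != j -> `]u i, v i[ `&` `]u j, v j[ = set0) ->
      \sum_(i < n) (v i - u i) < d ->
      \sum_(i < n) ComplexField.Normc.normc (f (v i) - f (u i)) < e.

(** [J] is meant to be an interval. *)
Definition locally_abs_continuous J f :=
  forall a b, `[a, b] `<=` J -> abs_continuous_on a b f.

(** The pointwise derivative, with default value where it does not exist. *)
Definition cderiv f : R -> R[i] := fun x =>
  (fun t => complex.Re (f t))^`() x +i* (fun t => complex.Im (f t))^`() x.

Definition H1 J f :=
  [/\ locally_abs_continuous J f, L2 leb J f & L2 leb J (cderiv f)].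

Definition H1_dot J f g : R[i] :=
  4^-1 * cintegral leb J (fun x => f x * (g x)^*)
  + cintegral leb J (fun x => cderiv f x * (cderiv g x)^*).

Definition left_continuous f := forall a : R,
  complex.Re (f x) @[x --> a^'-] --> complex.Re (f a) /\
  complex.Im (f x) @[x --> a^'-] --> complex.Im (f a).

End Sobolev.

(** * The differential equation *)

(** Functions are given the codomain [R[i]^o] so that they form a vector
    space over [R[i]]. *)
Definition cfun (R : realType) : lmodType R[i] := (R -> R[i]^o : lmodType R[i]).
Definition cfun2 (R : realType) : lmodType R[i] := (cfun R * cfun R)%type.

Section Equation.
Context {R : realType}.
Notation leb := (@lebesgue_measure R).
Notation B := (measurableTypeR R).
Variables (om : set B -> R) (up : set B -> \bar R).

(** [f'] is the left-continuous representative of the derivative of [f]. *)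
Definition is_solution (z : R[i]) (f f' : R -> R[i]) :=
  [/\ locally_abs_continuous setT f,
      left_continuous f',
      {ae leb, forall x, f' x = cderiv f x}
    & forall x y : R,
        - f' y + f' x + 4^-1 * oriented (fun D => cintegral leb D f) x y =
        z * oriented (fun D => signed_integral om D f) x y
        + z ^+ 2 * oriented (fun D => cintegral up D f) x y].

Definition wronskian (f f' g g' : R -> R[i]) (x : R) : R[i] :=
  f x * g' x - f' x * g x.

Definition lin_independent (f g : R -> R[i]) :=
  forall a b : R[i], (forall x, a * f x + b * g x = 0) -> a = 0 /\ b = 0.

Definition is_test_function (h : R -> R) :=
  (forall n x, derivable (derive1n n h) x 1) /\
  exists a b, forall x, ~ `[a, b] x -> h x = 0.

Definition H_loc (f : cfun2 R) :=
  [/\ locally_abs_continuous setT f.1,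
      forall a b, L2 leb `[a, b] (cderiv f.1)
    & forall a b, L2 up `[a, b] f.2].

(** In the differential equation both sides are distributions; evaluating them
    at real test functions suffices, by linearity. *)
Definition T_loc : set (cfun2 R * cfun2 R) :=
  [set p | let f := p.1 in let tf := p.2 in
    [/\ H_loc f, H_loc tf,
        (forall h : R -> R, is_test_function h ->
          - cintegral leb setT (fun x => f.1 x * (derive1n 2 h x)%:C)
          + 4^-1 * cintegral leb setT (fun x => f.1 x * (h x)%:C) =
          signed_integral om setT (fun x => tf.1 x * (h x)%:C)
          + cintegral up setT (fun x => tf.2 x * (h x)%:C))
      & {ae up, forall x, f.2 x = tf.1 x}]].

(** * The half-lines; [plus] selects the sign *)

Variables (c : R) (plus : bool).

Definition half_line : set R := if plus then `[c, +oo[ else `]-oo, c[.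
Notation J := half_line.

Definition vanishes_at_c (f : R -> R[i]) :=
  if plus then f c = 0
  else ComplexField.Normc.normc (f x) @[x --> c^'-] --> (0 : R).

Definition H10_space : repr_space (cfun R) := {|
  pts := [set f | H1 J f /\ vanishes_at_c f] ;
  eqv := fun f g => forall x, J x -> f x = g x ;
  nrm := fun f => Num.sqrt (complex.Re (H1_dot J f f)) |}.

Definition H1c (f : cfun R) := pts H10_space f /\
  exists a b : R, `[a, b] `<=` interior J /\
    forall x, J x -> ~ `[a, b] x -> f x = 0.

Definition H0_dot (f g : cfun2 R) : R[i] :=
  H1_dot J f.1 g.1 + cintegral up J (fun x => f.2 x * (g.2 x)^*).

Definition H0_space : repr_space (cfun2 R) := {|
  pts := [set f | pts H10_space f.1 /\ L2 up J f.2] ;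
  eqv := fun f g => (forall x, J x -> f.1 x = g.1 x) /\
                    {ae up, forall x, J x -> f.2 x = g.2 x} ;
  nrm := fun f => Num.sqrt (complex.Re (H0_dot f f)) |}.

Definition T_half : set (cfun2 R * cfun2 R) :=
  [set p | [/\ pts H0_space p.1, pts H0_space p.2 &
    exists2 q, T_loc q & eqv H0_space q.1 p.1 /\ eqv H0_space q.2 p.2]].

Definition sinh (x : R) : R := (expR x - expR (- x)) / 2.

Definition free_green (x s : R) : R :=
  if plus then
    if s <= x then 2 * expR (- ((x - c) / 2)) * sinh ((s - c) / 2)
    else 2 * expR (- ((s - c) / 2)) * sinh ((x - c) / 2)
  else
    if x <= s then - (2 * expR ((x - c) / 2) * sinh ((s - c) / 2))
    else - (2 * expR ((s - c) / 2) * sinh ((x - c) / 2)).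

Definition is_Omega (Omega : cfun R -> cfun R) :=
  is_bounded_operator H10_space Omega /\
  forall g, H1c g -> forall x, J x ->
    Omega g x = signed_integral om J (fun s => (free_green x s)%:C * g s).

Definition is_Upsilon (Upsilon : cfun R -> cfun R) :=
  is_bounded_operator H10_space Upsilon /\
  forall g, pts H10_space g -> forall x, J x ->
    Upsilon g x = cintegral up J (fun s => (free_green x s)%:C * g s).

(** [H^1] near [+oo] or [-oo], according to the sign. *)
Definition H1_near_infty (f : R -> R[i]) := exists a : R,
  let D : set R := if plus then `[a, +oo[ else `]-oo, a] in
  L2 leb D f /\ L2 leb D (cderiv f).

Definition is_fundamental_pair (z : R[i]) (psi psi' phi phi' : R -> R[i]) :=
  [/\ is_solution z psi psi', is_solution z phi phi',
      lin_independent psi phi, H1_near_infty psi & phi c = 0].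

(** [W] is the value of the Wronskian of [psi] and [phi]. *)
Definition green (W : R[i]) (psi phi : R -> R[i]) (x s : R) : R[i] :=
  if plus then W^-1 * (if s <= x then psi x * phi s else psi s * phi x)
  else - W^-1 * (if x <= s then psi x * phi s else psi s * phi x).

End Equation.

(* Main.v *)
From HB Require Import structures.
From mathcomp Require Import all_boot all_order all_algebra.
From mathcomp Require Import all_classical all_reals all_analysis.
From mathcomp Require Import measurable_realfun complex ring lra.
Require Import Defs.
Set Implicit Arguments.
Unset Strict Implicit.
Unset Printing Implicit Defensive.
Import Order.TTheory GRing.Theory Num.Theory.
Import numFieldNormedType.Exports.
Local Open Scope ring_scope.
Local Open Scope complex_scope.
Local Open Scope classical_set_scope.
Require Import Defs.
From HB Require Import structures.
From mathcomp Require Import all_boot all_order all_algebra.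
From mathcomp Require Import all_classical all_reals all_analysis.
From mathcomp Require Import measurable_realfun complex ring lra.
Set Implicit Arguments.
Unset Strict Implicit.
Unset Printing Implicit Defensive.
Import Order.TTheory GRing.Theory Num.Theory.
Import numFieldNormedType.Exports.
Local Open Scope ring_scope.
Local Open Scope complex_scope.
Local Open Scope classical_set_scope.

(** The inverse of [T] is explicit. The free Green function is the reproducing
    kernel of [H^1_0] ([free_green_reproducing]); testing the equation of [T]
    against it shows that the inverse maps [(g1, g2)] to
    [(Omega g1 + Upsilon g2, g1)]. So the two operators can be read off the
    inverse of [T], which gives their existence and boundedness
    ([operators_exist]), and conversely kernel formulas and boundedness tie any
    such pair of operators to [T] ([Omega_T], [Upsilon_T]).

    It follows that [L z f = g] holds if and only if [T] maps [(f - g, z f)] to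
    [(z f, z ^ 2 f)], that is, if and only if [(f - g, z f)] solves the resolvent
    equation of [T] at [z] with right-hand side [(z g, 0)] ([pencil_eqP]). This
    solves the equation of the pencil when [z] is in the resolvent set of [T]. In
    the other direction an arbitrary right-hand side is reduced to this one by
    means of the inverse of [T] at zero. Hence the spectra agree
    ([pencil_spectrum_eq]).

    For the Green function [G] with pole [x], integrating by parts on both sides
    of the pole gives, for compactly supported [h],
    [<h, G^*> = h x + z int G h d om + z ^ 2 int G h d up] ([gr_reproducing]).
    Testing [T] against [G] identifies the two integrals as [<Omega h, G^*>] and
    [<Upsilon h, G^*>], so that [<L z h, G^*> = h x]. Both sides are bounded in
    [h] and compactly supported functions are dense ([H1c_dense]), which is the
    formula for the inverse ([green_formula]).

    A fundamental pair is found by applying the inverse of [L z] to the free Green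
    function with pole [x]: the result solves the homogeneous equation on either
    side of the pole, vanishes at [c] and is integrable at infinity
    ([fundamental_pair_exists]).

    All equations are brought to the form [F'' = sum_i a_i w_i mu_i] with finitely
    many nonnegative measures, integrated once ([qeq]). For the relation [T] this
    rests on the du Bois-Reymond lemma ([T_loc_qeq]), for solutions on the fact
    that absolutely continuous functions are the primitives of locally integrable
    ones ([ac_primitive], [primitive_ac]). Existence and uniqueness for initial
    values come from Picard iteration in exponentially weighted norms
    ([ivp_exists], [qeq_unique]). *)

(** * Complex numbers and complex-valued integrals *)

Notation normc := ComplexField.Normc.normc.

Section ComplexNumbers.
Context {R : realType}.
Implicit Types z w : R[i].

Lemma complex_eq z w :
  complex.Re z = complex.Re w -> complex.Im z = complex.Im w -> z = w.
Proof. by case: z => a b; case: w => c d /= -> ->. Qed.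

Lemma cReD z w : complex.Re (z + w) = complex.Re z + complex.Re w.
Proof. by case: z; case: w. Qed.

Lemma cImD z w : complex.Im (z + w) = complex.Im z + complex.Im w.
Proof. by case: z; case: w. Qed.

Lemma cReN z : complex.Re (- z) = - complex.Re z.
Proof. by case: z. Qed.

Lemma cImN z : complex.Im (- z) = - complex.Im z.
Proof. by case: z. Qed.

Lemma cReM z w : complex.Re (z * w) =
  complex.Re z * complex.Re w - complex.Im z * complex.Im w.
Proof. by case: z; case: w. Qed.

Lemma cImM z w : complex.Im (z * w) =
  complex.Re z * complex.Im w + complex.Im z * complex.Re w.
Proof. by case: z; case: w. Qed.

Lemma cReJ z : complex.Re (z^*)%R = complex.Re z.
Proof. by case: z. Qed.

Lemma cImJ z : complex.Im (z^*)%R = - complex.Im z.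
Proof. by case: z. Qed.

Lemma cReC (x : R) : complex.Re x%:C = x. Proof. by []. Qed.
Lemma cImC (x : R) : complex.Im x%:C = 0. Proof. by []. Qed.

Lemma normc_sqr z : normc z ^+ 2 = complex.Re z ^+ 2 + complex.Im z ^+ 2.
Proof. by case: z => a b; rewrite /= sqr_sqrtr// addr_ge0// sqr_ge0. Qed.

Lemma normc_ge0 z : 0 <= normc z.
Proof. by case: z => a b; exact: sqrtr_ge0. Qed.

Lemma normcJ z : normc (z^*)%R = normc z.
Proof. by case: z => a b /=; rewrite sqrrN. Qed.

Lemma normcM z w : normc (z * w) = normc z * normc w.
Proof. exact: ComplexField.Normc.normcM. Qed.

Lemma normc_real (x : R) : normc x%:C = `|x|.
Proof. by rewrite /= expr0n addr0 sqrtr_sqr. Qed.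

Lemma ler_normcD z w : normc (z + w) <= normc z + normc w.
Proof. exact: le_normcD. Qed.

Lemma normcN z : normc (- z) = normc z.
Proof. by case: z => a b /=; rewrite !sqrrN. Qed.

Lemma ler_normcB z w : normc (z - w) <= normc z + normc w.
Proof. by rewrite (le_trans (ler_normcD _ _))// normcN. Qed.

Lemma normcBC z w : normc (z - w) = normc (w - z).
Proof. by rewrite -normcN opprB. Qed.

Lemma normc0 : normc (0 : R[i]) = 0.
Proof. exact: ComplexField.Normc.normc0. Qed.

Lemma normc0_eq0 z : normc z = 0 -> z = 0.
Proof. exact: ComplexField.Normc.eq0_normc. Qed.

Lemma ler_Re_normc z : `|complex.Re z| <= normc z.
Proof.
rewrite -(ler_pXn2r (n := 2)) ?nnegrE ?normc_ge0//.
by rewrite normc_sqr real_normK ?num_real// lerDl sqr_ge0.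
Qed.

Lemma ler_Im_normc z : `|complex.Im z| <= normc z.
Proof.
rewrite -(ler_pXn2r (n := 2)) ?nnegrE ?normc_ge0//.
by rewrite normc_sqr real_normK ?num_real// lerDr sqr_ge0.
Qed.

Lemma ler_normc_ReIm z : normc z <= `|complex.Re z| + `|complex.Im z|.
Proof.
rewrite -(ler_pXn2r (n := 2)) ?nnegrE ?normc_ge0// ?addr_ge0//.
rewrite normc_sqr -(real_normK (num_real (complex.Re z))).
rewrite -(real_normK (num_real (complex.Im z))) sqrrD.
by rewrite -addrA lerD2l lerDr mulrn_wge0// mulr_ge0.
Qed.

End ComplexNumbers.

Definition complexE {R : realType} := (@cReD R, @cImD R, @cReN R, @cImN R, @cReM R,
  @cImM R, @cReJ R, @cImJ R, @cReC R, @cImC R).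

Section ComplexIntegral.
Context {R : realType}.
Local Notation B := (measurableTypeR R).
Implicit Types (D : set B) (f g : R -> R[i]) (M : R).

Definition cmeasurable D f :=
  measurable_fun D (fun x : B => complex.Re (f x)) /\
  measurable_fun D (fun x : B => complex.Im (f x)).

Lemma cmeasurableS D E f : measurable E -> D `<=` E ->
  cmeasurable E f -> cmeasurable D f.
Proof. by move=> mE DE [fr fi]; split; exact: measurable_funS DE _. Qed.

Lemma cmeasurableD D f g : cmeasurable D f -> cmeasurable D g ->
  cmeasurable D (fun x => f x + g x).
Proof.
move=> [fr fi] [gr gi]; split.
  by under eq_fun do rewrite cReD; exact: measurable_funD.
by under eq_fun do rewrite cImD; exact: measurable_funD.
Qed.

Lemma cmeasurableM D f g : cmeasurable D f -> cmeasurable D g ->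
  cmeasurable D (fun x => f x * g x).
Proof.
move=> [fr fi] [gr gi]; split.
  under eq_fun do rewrite cReM.
  by apply: measurable_funB; exact: measurable_funM.
under eq_fun do rewrite cImM.
by apply: measurable_funD; exact: measurable_funM.
Qed.

Lemma cmeasurable_cst D (z : R[i]) : cmeasurable D (fun=> z).
Proof. by split; exact: measurable_cst. Qed.

Lemma cmeasurableJ D f : cmeasurable D f -> cmeasurable D (fun x => (f x)^*)%R.
Proof.
move=> [fr fi]; split.
  by under eq_fun do rewrite cReJ.
by under eq_fun do rewrite cImJ; exact: measurable_funN.
Qed.

Lemma cmeasurable_real D (h : R -> R) : measurable_fun D (h : B -> R) ->
  cmeasurable D (fun x => (h x)%:C).
Proof. by move=> mh; split => //; exact: measurable_cst. Qed.

Lemma eq_cmeasurable D f g : (forall x, D x -> f x = g x) ->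
  cmeasurable D f -> cmeasurable D g.
Proof.
move=> fg [fr fi]; split.
- by apply: eq_measurable_fun fr => x /set_mem Dx; rewrite fg.
- by apply: eq_measurable_fun fi => x /set_mem Dx; rewrite fg.
Qed.

Lemma measurable_normc D f : cmeasurable D f ->
  measurable_fun D (fun x : B => normc (f x)).
Proof.
move=> [fr fi]; rewrite (_ : (fun x => _) =
    (Num.sqrt \o (fun x => complex.Re (f x) ^+ 2 + complex.Im (f x) ^+ 2))).
  apply: measurableT_comp; first by apply: continuous_measurable_fun; exact: sqrt_continuous.
  by apply: measurable_funD; exact: measurable_funX.
by apply/funext => x /=; case: (f x).
Qed.

Variable mu : {measure set B -> \bar R}.

Definition cintegrable D f :=
  mu.-integrable D (fun x : B => (complex.Re (f x))%:E) /\
  mu.-integrable D (fun x : B => (complex.Im (f x))%:E).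

Lemma cintegrable_measurable D f : cintegrable D f -> cmeasurable D f.
Proof.
by move=> [/measurable_int fr /measurable_int fi]; split; apply/measurable_EFinP.
Qed.

Lemma eq_cintegrable D f g : measurable D -> (forall x, D x -> f x = g x) ->
  cintegrable D f -> cintegrable D g.
Proof.
move=> mD fg [fr fi]; split.
- by apply: eq_integrable fr => // x /set_mem Dx; rewrite fg.
- by apply: eq_integrable fi => // x /set_mem Dx; rewrite fg.
Qed.

Lemma cintegrableS D E f : measurable D -> measurable E -> D `<=` E ->
  cintegrable E f -> cintegrable D f.
Proof. by move=> mD mE DE [fr fi]; split; exact: (integrableS mE mD DE). Qed.

Lemma cintegrableD D f g : measurable D -> cintegrable D f -> cintegrable D g ->
  cintegrable D (fun x => f x + g x).
Proof.
move=> mD [fr fi] [gr gi]; split.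
- under eq_fun do rewrite cReD EFinD; exact: integrableD.
- under eq_fun do rewrite cImD EFinD; exact: integrableD.
Qed.

Lemma cintegrableZ D z f : measurable D -> cintegrable D f ->
  cintegrable D (fun x => z * f x).
Proof.
move=> mD [fr fi]; split.
- under eq_fun do rewrite cReM EFinB !EFinM.
  by apply: integrableB => //; exact: integrableZl.
- under eq_fun do rewrite cImM EFinD !EFinM.
  by apply: integrableD => //; exact: integrableZl.
Qed.

Lemma cintegrableN D f : measurable D -> cintegrable D f ->
  cintegrable D (fun x => - f x).
Proof.
move=> mD /(cintegrableZ (-1) mD); apply: eq_cintegrable => // x _.
by rewrite mulN1r.
Qed.

Lemma cintegrableB D f g : measurable D -> cintegrable D f -> cintegrable D g ->
  cintegrable D (fun x => f x - g x).
Proof. by move=> mD fD gD; apply: cintegrableD => //; exact: cintegrableN. Qed.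

Lemma cintegrable0 D : cintegrable D (fun=> 0).
Proof. by split; exact: integrable0. Qed.

Lemma cintegrableJ D f : measurable D -> cintegrable D f ->
  cintegrable D (fun x => (f x)^*)%R.
Proof.
move=> mD [fr fi]; split; first by under eq_fun do rewrite cReJ.
by under eq_fun do rewrite cImJ EFinN; exact: integrableN.
Qed.

Lemma cintegrable_normc D f : measurable D -> cmeasurable D f ->
  mu.-integrable D (fun x : B => (normc (f x))%:E) -> cintegrable D f.
Proof.
move=> mD [fr fi] fn; split; apply: le_integrable fn => //.
- exact/measurable_EFinP.
- by move=> x _ /=; rewrite lee_fin (ger0_norm (normc_ge0 _)) ler_Re_normc.
- exact/measurable_EFinP.
- by move=> x _ /=; rewrite lee_fin (ger0_norm (normc_ge0 _)) ler_Im_normc.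
Qed.

Lemma integrable_normc D f : measurable D -> cintegrable D f ->
  mu.-integrable D (fun x : B => (normc (f x))%:E).
Proof.
move=> mD fD; have [fr fi] := fD.
apply: (le_integrable mD _ _ (integrableD mD (integrable_abse fr) (integrable_abse fi))).
  by apply/measurable_EFinP; apply: measurable_normc; exact: cintegrable_measurable fD.
move=> x _ /=; rewrite lee_fin ger0_norm ?normc_ge0// ger0_norm ?addr_ge0//.
exact: ler_normc_ReIm.
Qed.

Lemma le_cintegrable D f (h : R -> R) : measurable D -> cmeasurable D f ->
  mu.-integrable D (EFin \o h) -> (forall x, D x -> normc (f x) <= h x) ->
  cintegrable D f.
Proof.
move=> mD mf hD fh; apply: cintegrable_normc => //.
apply: le_integrable hD => //; first by apply/measurable_EFinP; exact: measurable_normc.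
move=> x Dx /=; rewrite lee_fin ger0_norm ?normc_ge0//.
exact: le_trans (fh _ Dx) (ler_norm _).
Qed.

Lemma cintegrable_bounded D f M : measurable D -> (mu D < +oo)%E ->
  cmeasurable D f -> (forall x, D x -> normc (f x) <= M) -> cintegrable D f.
Proof.
move=> mD Dfin mf fM; apply: (@le_cintegrable D f (fun=> M)) => //.
apply: measurable_bounded_integrable => //; exact: bounded_cst.
Qed.

Lemma cintegrableM D f g M : measurable D -> cintegrable D f ->
  cmeasurable D g -> (forall x, D x -> normc (g x) <= M) ->
  cintegrable D (fun x => f x * g x).
Proof.
move=> mD fD mg gM.
apply: (@le_cintegrable D _ (fun x => normc (f x) * M)) => //.
- by apply: cmeasurableM => //; exact: cintegrable_measurable fD.
- under eq_fun do rewrite /= mulrC.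
  exact: (integrableZl mD M (integrable_normc mD fD)).
- by move=> x Dx; rewrite normcM ler_wpM2l ?normc_ge0// gM.
Qed.

Lemma cintE D f : cintegral mu D f =
  (\int[mu]_(x in D) complex.Re (f x)) +i* (\int[mu]_(x in D) complex.Im (f x)).
Proof. by []. Qed.

Lemma Re_cint D f : complex.Re (cintegral mu D f) =
  \int[mu]_(x in D) complex.Re (f x).
Proof. by []. Qed.

Lemma Im_cint D f : complex.Im (cintegral mu D f) =
  \int[mu]_(x in D) complex.Im (f x).
Proof. by []. Qed.

Lemma eq_cint D f g : (forall x, D x -> f x = g x) ->
  cintegral mu D f = cintegral mu D g.
Proof.
move=> fg; rewrite !cintE; congr (_ +i* _).
- by apply: eq_Rintegral => x /set_mem Dx; rewrite fg.
- by apply: eq_Rintegral => x /set_mem Dx; rewrite fg.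
Qed.

Lemma cintD D f g : measurable D -> cintegrable D f -> cintegrable D g ->
  cintegral mu D (fun x => f x + g x) = cintegral mu D f + cintegral mu D g.
Proof.
move=> mD [fr fi] [gr gi]; apply: complex_eq; rewrite ?(cReD, cImD, cReM, cImM, cReJ, cImJ) ?Re_cint ?Im_cint.
- by rewrite -[RHS](RintegralD mD fr gr); apply: eq_Rintegral => x _; rewrite cReD.
- by rewrite -[RHS](RintegralD mD fi gi); apply: eq_Rintegral => x _; rewrite cImD.
Qed.

Lemma cintZ D z f : measurable D -> cintegrable D f ->
  cintegral mu D (fun x => z * f x) = z * cintegral mu D f.
Proof.
move=> mD [fr fi]; apply: complex_eq; rewrite ?(cReD, cImD, cReM, cImM, cReJ, cImJ) ?Re_cint ?Im_cint.
- rewrite -(RintegralZl _ mD fr) -(RintegralZl _ mD fi).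
  rewrite -(RintegralB mD); last 2 first.
  + exact: (integrableZl mD _ fr).
  + exact: (integrableZl mD _ fi).
  by apply: eq_Rintegral => x _; rewrite cReM.
- rewrite -(RintegralZl _ mD fr) -(RintegralZl _ mD fi).
  rewrite -(RintegralD mD); last 2 first.
  + exact: (integrableZl mD _ fi).
  + exact: (integrableZl mD _ fr).
  by apply: eq_Rintegral => x _; rewrite cImM.
Qed.

Lemma cintN D f : measurable D -> cintegrable D f ->
  cintegral mu D (fun x => - f x) = - cintegral mu D f.
Proof.
move=> mD fD; rewrite -mulN1r -cintZ//.
by apply: eq_cint => x _; rewrite mulN1r.
Qed.

Lemma cintB D f g : measurable D -> cintegrable D f -> cintegrable D g ->
  cintegral mu D (fun x => f x - g x) = cintegral mu D f - cintegral mu D g.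
Proof. by move=> mD fD gD; rewrite cintD ?cintN//; exact: cintegrableN. Qed.

Lemma cint0 D : cintegral mu D (fun=> 0) = 0.
Proof. by rewrite cintE /= /Rintegral integral0 fine0. Qed.

Lemma cint_set0 f : cintegral mu set0 f = 0.
Proof. by rewrite cintE !Rintegral_set0. Qed.

Lemma cintJ D f : measurable D -> cintegrable D f ->
  cintegral mu D (fun x => (f x)^*)%R = ((cintegral mu D f)^*)%R.
Proof.
move=> mD [fr fi]; apply: complex_eq; rewrite ?(cReD, cImD, cReM, cImM, cReJ, cImJ) ?Re_cint ?Im_cint.
- by apply: eq_Rintegral => x _; rewrite cReJ.
- rewrite -mulN1r -(RintegralZl _ mD fi).
  by apply: eq_Rintegral => x _; rewrite cImJ mulN1r.
Qed.

Lemma cintU D E f : measurable D -> measurable E -> cintegrable (D `|` E) f ->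
  D `&` E = set0 ->
  cintegral mu (D `|` E) f = cintegral mu D f + cintegral mu E f.
Proof.
move=> mD mE [fr fi] /disj_set2P DE.
by apply: complex_eq; rewrite ?(cReD, cImD) ?Re_cint ?Im_cint Rintegral_setU.
Qed.

Lemma cint_mkcond D f : cintegral mu D f =
  cintegral mu setT (fun x => if x \in D then f x else 0).
Proof.
apply: complex_eq => /=.
- rewrite -/(Rintegral mu D (fun x => complex.Re (f x))) Rintegral_mkcond.
  by apply: eq_Rintegral => x _; rewrite patchE; case: ifPn.
- rewrite -/(Rintegral mu D (fun x => complex.Im (f x))) Rintegral_mkcond.
  by apply: eq_Rintegral => x _; rewrite patchE; case: ifPn.
Qed.

Lemma cint_restrict D E f : D `<=` E -> (forall x, E x -> ~ D x -> f x = 0) ->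
  cintegral mu E f = cintegral mu D f.
Proof.
move=> DE f0; rewrite [LHS]cint_mkcond [RHS]cint_mkcond; apply: eq_cint => x _.
have [/set_mem Ex|/negP Ex] := boolP (x \in E); have [/set_mem Dx|/negP Dx] := boolP (x \in D) => //.
- by rewrite f0// => Dx'; apply: Dx; exact/mem_set.
- by exfalso; apply: Ex; exact/mem_set/DE.
Qed.

Lemma cint_ae_eq D f g : measurable D -> cmeasurable D f -> cmeasurable D g ->
  {ae mu, forall x, D x -> f x = g x} -> cintegral mu D f = cintegral mu D g.
Proof.
move=> mD [fr fi] [gr gi] fg; rewrite /cintegral; congr (fine _ +i* fine _).
- apply: ae_eq_integral => //; [exact/measurable_EFinP..|].
  by apply: filterS fg => x fg Dx; rewrite fg.
- apply: ae_eq_integral => //; [exact/measurable_EFinP..|].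
  by apply: filterS fg => x fg Dx; rewrite fg.
Qed.

Lemma cintegrable_ae_eq D f g : measurable D -> cintegrable D f ->
  cmeasurable D g -> {ae mu, forall x, D x -> f x = g x} -> cintegrable D g.
Proof.
move=> mD [/integrableP[fr frI] /integrableP[fi fiI]] [gr gi] fg.
split; apply/integrableP; split; try exact/measurable_EFinP.
- apply: le_lt_trans frI; rewrite (@ae_eq_integral _ _ _ mu _ (fun x => `|(complex.Re (f x))%:E|)%E)//.
  + by apply: measurableT_comp => //; exact/measurable_EFinP.
  + by apply: measurableT_comp.
  + by apply: filterS fg => x fg Dx; rewrite fg.
- apply: le_lt_trans fiI; rewrite (@ae_eq_integral _ _ _ mu _ (fun x => `|(complex.Im (f x))%:E|)%E)//.
  + by apply: measurableT_comp => //; exact/measurable_EFinP.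
  + by apply: measurableT_comp.
  + by apply: filterS fg => x fg Dx; rewrite fg.
Qed.

(** The constant [2] is not sharp; it avoids rotating the integral onto the
    real axis. *)
Lemma ler_normc_cint D f (h : R -> R) : measurable D -> cintegrable D f ->
  mu.-integrable D (EFin \o h) -> (forall x, D x -> normc (f x) <= h x) ->
  normc (cintegral mu D f) <= 2 * \int[mu]_(x in D) h x.
Proof.
move=> mD [fr fi] hD fh.
rewrite (le_trans (ler_normc_ReIm _))// mulr_natl mulr2n; apply: lerD.
- apply: (le_trans (le_normr_Rintegral mD fr)); apply: le_Rintegral => //.
    exact: integrable_norm.
  by move=> x Dx; rewrite (le_trans (ler_Re_normc _))// fh.
- apply: (le_trans (le_normr_Rintegral mD fi)); apply: le_Rintegral => //.
    exact: integrable_norm.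
  by move=> x Dx; rewrite (le_trans (ler_Im_normc _))// fh.
Qed.

Lemma ler_normc_cint_bounded D f M : measurable D -> (mu D < +oo)%E ->
  cmeasurable D f -> (forall x, D x -> normc (f x) <= M) ->
  normc (cintegral mu D f) <= 2 * (M * fine (mu D)).
Proof.
move=> mD Dfin mf fM; rewrite -Rintegral_cst//; apply: ler_normc_cint => //.
- exact: cintegrable_bounded fM.
- by apply: measurable_bounded_integrable => //; exact: bounded_cst.
Qed.

End ComplexIntegral.

(** * The Jordan decomposition of a locally finite signed measure *)

Section JordanDecomposition.
Context {R : realType}.
Local Notation B := (measurableTypeR R).
Implicit Types (om : set B -> R) (A D : set B).

Lemma bounded_setE (A : set R) :
  bounded_set A <-> exists M : R, forall x, A x -> `|x| <= M.
Proof.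
split=> [[M [_ H]]|[M H]].
  by exists (M + 1) => x Ax; apply: H => //; rewrite ltrDl.
exists M; split; first exact: num_real.
by move=> N /ltW MN x /H /le_trans; apply.
Qed.

Lemma bounded_borelI A D : bounded_borel A -> measurable D ->
  bounded_borel (A `&` D).
Proof.
move=> [mA /bounded_setE[M bA]] mD; split; first exact: measurableI.
by apply/bounded_setE; exists M => x [/bA].
Qed.

Lemma bounded_borel0 : bounded_borel (set0 : set B).
Proof. by split => //; apply/bounded_setE; exists 0. Qed.

Lemma bounded_borelU A D : bounded_borel A -> bounded_borel D ->
  bounded_borel (A `|` D).
Proof.
move=> [mA /bounded_setE[M bA]] [mD /bounded_setE[N bD]].
split; first exact: measurableU.
apply/bounded_setE; exists (Num.max M N) => x.
by rewrite le_max => -[/bA ->//|/bD ->]; rewrite orbT.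
Qed.

Lemma bounded_borel_itv (x y : R) b1 b2 :
  bounded_borel [set` Interval (BSide b1 x) (BSide b2 y)].
Proof.
split; first exact: measurable_itv.
apply/bounded_setE; exists (`|x| + `|y|) => t /=.
rewrite in_itv /= => /andP[xt ty]; rewrite ler_norml.
have {}xt : x <= t by case: b1 xt => // /ltW.
have {}ty : t <= y by case: b2 ty => // /ltW.
have := ler_norm y; have := lerNnormlW (lexx `|x|).
by have := normr_ge0 x; have := normr_ge0 y; lra.
Qed.

Lemma signed_measure0 om : is_signed_measure om -> om set0 = 0.
Proof.
move=> /(_ (fun=> set0)) H.
have t0 : trivIset setT (fun _ : nat => set0 : set B).
  by apply/trivIsetP => i j _ _ _; rewrite setI0.
have {H} := H (fun=> bounded_borel0) t0.
rewrite bigcup0// => /(_ bounded_borel0) H.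
have H1 : (fun n : nat => \sum_(i < n.+1) om set0) @ \oo --> om set0.
  by move: H; rewrite -(cvg_shiftS (fun n : nat => \sum_(i < n) om set0)).
have : (fun n : nat => \sum_(i < n.+1) om set0 - \sum_(i < n) om set0) @ \oo --> om set0 - om set0.
  exact: cvgB.
rewrite subrr; under eq_fun do rewrite big_ord_recr /= addrAC subrr add0r.
move=> H0; apply: (cvg_unique _ _ H0) => //; exact: cvg_cst.
Qed.

Lemma signed_measureU om A D : is_signed_measure om ->
  bounded_borel A -> bounded_borel D -> A `&` D = set0 ->
  om (A `|` D) = om A + om D.
Proof.
move=> som bA bD AD.
have bF n : bounded_borel (bigcup2 A D n).
  by case: n => [//|[//|n]]; exact: bounded_borel0.
have tF : trivIset setT (bigcup2 A D) by rewrite -trivIset_bigcup2.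
have := som _ bF tF.
rewrite bigcup2E => /(_ (bounded_borelU bA bD)) H.
suff H2 : (fun n : nat => \sum_(i < n) om (bigcup2 A D i)) @ \oo --> om A + om D.
  exact: (cvg_unique _ H H2).
rewrite -(cvg_shiftn 2); apply: cvg_near_cst; apply: nearW => n.
rewrite /= addn2 !big_ord_recl /= big1 ?addr0// => i _.
exact: signed_measure0.
Qed.

Lemma signed_measureN om : is_signed_measure om ->
  is_signed_measure (fun A => - om A).
Proof.
move=> som F bF tF bU; under eq_fun do rewrite sumrN; apply: cvgN; exact: som.
Qed.

(** The proof argument lets [upper_variation om] carry a measure structure. *)
Definition upvar om (_ : is_signed_measure om) : set B -> \bar R :=
  upper_variation om.

Section upper_variation.
Variables (om : set B -> R) (som : is_signed_measure om).
Local Notation v := (upvar som).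

Lemma upvar_ub A D : bounded_borel D -> D `<=` A -> ((om D)%:E <= v A)%E.
Proof. by move=> bD DA; apply: ereal_sup_ubound; exists D. Qed.

Let v0 : v set0 = 0%E.
Proof.
apply/eqP; rewrite eq_le; apply/andP; split.
  apply: ge_ereal_sup => _ [D [bD D0] <-].
  move: D0; rewrite subset0 => ->.
  by rewrite signed_measure0.
by have := upvar_ub bounded_borel0 (@subset_refl _ set0); rewrite signed_measure0.
Qed.

Let v_ge0 A : (0 <= v A)%E.
Proof. 
have -> : 0%E = (om set0)%:E :> \bar R by rewrite signed_measure0.
by apply: upvar_ub => //; exact: bounded_borel0.
Qed.

Let v_le A D : A `<=` D -> (v A <= v D)%E.
Proof.
move=> AD; apply: ge_ereal_sup => _ [E [bE EA] <-].
by apply: upvar_ub => //; exact: subset_trans AD.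
Qed.

Let v_superadditive A D : A `&` D = set0 -> (v A + v D <= v (A `|` D))%E.
Proof.
move=> AD.
have [->|vDfin] := eqVneq (v (A `|` D)) +oo%E; first by rewrite leey.
have Dfin : v D \is a fin_num.
  rewrite ge0_fin_numE//; apply: le_lt_trans (v_le (@subsetUr _ A D)) _.
  by rewrite ltey.
rewrite -leeBrDr//; apply: ge_ereal_sup => _ [A' [bA' A'A] <-].
rewrite leeBrDr// addeC -leeBrDr//; apply: ge_ereal_sup => _ [D' [bD' D'D] <-].
rewrite leeBrDr// addeC -EFinD -signed_measureU//; last first.
  by apply/seteqP; split => // x [/A'A Ax /D'D Dx]; rewrite -AD.
by apply: upvar_ub; [exact: bounded_borelU|exact: setUSS].
Qed.

(** A bounded set splits along the pieces, and its part in each piece is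
    bounded by the variation of that piece. *)
Let v_sigma : semi_sigma_additive v.
Proof.
move=> F mF tF mU.
have cv : cvgn (fun n => \sum_(0 <= i < n) v (F i))%E.
  by apply: is_cvg_nneseries => n _ _.
suff <- : limn (fun n => \sum_(0 <= i < n) v (F i))%E = v (\bigcup_n F n) by [].
apply/eqP; rewrite eq_le; apply/andP; split.
  apply: lime_le => //; apply: nearW => n.
  apply: le_trans (v_le (_ : \big[setU/set0]_(0 <= i < n) F i `<=` _)); last first.
    by rewrite big_mkord; exact: bigsetU_bigcup.
  elim: n => [|n IH]; first by rewrite !big_geq.
  rewrite !big_nat_recr//=.
  apply: le_trans (v_superadditive _); first exact: leeD2r.
  rewrite big_mkord big_distrl /=; apply: big1 => i _.
  by move/trivIsetP : tF => -> //; rewrite neq_ltn ltn_ord.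
apply: ge_ereal_sup => _ [D [bD DU] <-].
have bF n : bounded_borel (D `&` F n) by exact: bounded_borelI.
have tDF : trivIset setT (fun n => D `&` F n).
  apply/trivIsetP => i j _ _ ij; rewrite setIACA setIid.
  by move/trivIsetP : tF => ->//; rewrite setI0.
have := som bF tDF; rewrite -setI_bigcupr setIidl// => /(_ bD) H.
have {}H : (fun n : nat => (\sum_(i < n) om (D `&` F i))%:E) @ \oo --> (om D)%:E.
  by apply: cvg_EFin => //; exact: nearW.
rewrite -(cvg_lim _ H)//; apply: lee_lim => //; first by apply/cvg_ex; exists (om D)%:E.
apply: nearW => n; rewrite -sumEFin big_mkord; apply: lee_sum => i _.
by apply: upvar_ub => //; exact: subIsetr.
Qed.

HB.instance Definition _ := isMeasure.Build _ _ _ v v0 v_ge0 v_sigma.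

End upper_variation.

(** Cut off to a bounded set, [om] becomes a finite charge, which has a Hahn
    decomposition. *)
Definition sm_restr om (_ : is_signed_measure om) A (_ : bounded_borel A) D :
  \bar R := (om (A `&` D))%:E.

Section local_finiteness.
Variables (om : set B -> R) (som : is_signed_measure om).
Variables (A : set B) (bA : bounded_borel A).
Local Notation nu := (sm_restr som bA).

Let nu0 : nu set0 = 0%E.
Proof. by rewrite /sm_restr setI0 signed_measure0. Qed.

Let nu_fin D : measurable D -> nu D \is a fin_num.
Proof. by []. Qed.

Let nu_sigma : semi_sigma_additive nu.
Proof.
move=> F mF tF mU; rewrite /sm_restr.
have tDF : trivIset setT (fun n => A `&` F n).
  apply/trivIsetP => i j _ _ ij; rewrite setIACA setIid.
  by move/trivIsetP : tF => ->//; rewrite setI0.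
have := @som (fun n => A `&` F n) (fun n => bounded_borelI bA (mF n)) tDF.
rewrite -setI_bigcupr => /(_ (bounded_borelI bA mU)) H.
apply: cvg_EFin; first by apply: nearW => n; rewrite sumEFin.
apply: cvg_trans H; apply: near_eq_cvg; apply: nearW => n /=.
by rewrite sumEFin /= big_mkord.
Qed.

HB.instance Definition _ := isCharge.Build _ _ _ nu nu0 nu_fin nu_sigma.

(** The supremum is attained on the positive part of a Hahn decomposition. *)
Lemma upvar_lty : (upvar som A < +oo)%E.
Proof.
have [P [N [[mP Ppos] [mN Nneg] PN PN0]]] := Hahn_decomposition nu.
apply: (@le_lt_trans _ _ (nu P)); last by rewrite ltry.
apply: ge_ereal_sup => _ [D [bD DA] <-].
have mD := bD.1.
have -> : (om D)%:E = nu D by rewrite /sm_restr setIidr.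
have -> : nu D = (nu (D `&` P) + nu (D `&` N))%E.
  rewrite -chargeU//; [|exact: measurableI..|]; first by rewrite -setIUr PN setIT.
  by rewrite setIACA PN0 setI0.
have NleD : (nu (D `&` N) <= 0)%E.
  by apply: Nneg; [exact: measurableI|exact: subIsetr].
have PD : nu P = (nu (P `\` D) + nu (P `&` D))%E by exact: chargeDI.
rewrite PD setIC [leRHS]addeC; apply: leeD2l.
apply: (le_trans NleD); apply: Ppos; [exact: measurableD|exact: subDsetl].
Qed.

End local_finiteness.

Lemma upvar_locally_finite om (som : is_signed_measure om) :
  locally_finite (upvar som).
Proof. by move=> A bA; exact: upvar_lty. Qed.

End JordanDecomposition.

(** * Integration by parts against a measure *)

Section FubiniTriangle.
Context {R : realType}.
Local Notation B := (measurableTypeR R).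
Local Notation leb := (@lebesgue_measure R).

Lemma integral_mfrestr (mu : {measure set B -> \bar R}) (D : set B)
    (mD : measurable D) (Dfin : (mu D < +oo)%E) (g : B -> \bar R) :
  (forall x, ~ D x -> g x = 0%E) ->
  (\int[mfrestr mD Dfin]_x g x = \int[mu]_(x in D) g x)%E.
Proof.
move=> g0; transitivity (\int[mfrestr mD Dfin]_(x in D) g x)%E.
  rewrite [RHS]integral_mkcond; congr integral; apply/funext => x.
  by rewrite patchE; case: ifPn => // /negP xD; rewrite g0// => Dx; apply/xD/mem_set.
apply: eq_measure_integral => A mA AD.
by rewrite /= /mfrestr /mrestr setIidl.
Qed.

Lemma integrable_mfrestr (mu : {measure set B -> \bar R}) (D : set B)
    (mD : measurable D) (Dfin : (mu D < +oo)%E) (g h : B -> \bar R) :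
  (forall x, D x -> g x = h x) ->
  (mfrestr mD Dfin).-integrable setT g -> mu.-integrable D h.
Proof.
move=> gh /(integrableS measurableT mD (@subsetT _ D)) gI.
apply: (@eq_integrable _ _ _ mu D mD g) => [x /set_mem /gh //|].
move: gI => /integrableP[mg gI]; apply/integrableP; split => //.
apply: le_lt_trans gI; rewrite le_eqVlt; apply/orP; left; apply/eqP.
apply: eq_measure_integral => A mA AD.
by rewrite /= /mfrestr /mrestr setIidl.
Qed.

(** Fubini on the triangle [a <= s < t <= b]: integration by parts for a
    primitive of [k] against a primitive of [w mu]. *)
Lemma fubini_triangle_real (mu : {measure set B -> \bar R}) (a b : R)
    (w k : R -> R) : (mu `[a, b[ < +oo)%E ->
  mu.-integrable `[a, b[ (EFin \o w) -> leb.-integrable `[a, b] (EFin \o k) ->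
  let W t := \int[mu]_(s in `[a, t[) w s in
  let K s := \int[leb]_(t in `[s, b]) k t in
  [/\ leb.-integrable `[a, b] (EFin \o (fun t => k t * W t)),
      mu.-integrable `[a, b[ (EFin \o (fun s => w s * K s))
    & \int[leb]_(t in `[a, b]) (k t * W t) = \int[mu]_(s in `[a, b[) (w s * K s)].
Proof.
move=> mufin wI kI W K.
have mD1 : measurable (`[a, b[ : set B) by exact: measurable_itv.
have mD2 : measurable (`[a, b] : set B) by exact: measurable_itv.
have lebfin : (leb `[a, b] < +oo)%E.
  by rewrite lebesgue_measure_itv; case: ifP => _; rewrite ?ltry.
pose w_ := w \_ `[a, b[; pose k_ := k \_ `[a, b].
have w0 s : ~ `[a, b[ s -> w_ s = 0.
  by move=> Ds; rewrite /w_ patchE; case: ifPn => // /set_mem.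
have k0 t : ~ `[a, b] t -> k_ t = 0.
  by move=> Dt; rewrite /k_ patchE; case: ifPn => // /set_mem.
have wE s : `[a, b[ s -> w_ s = w s by move=> Ds; rewrite /w_ patchE mem_set.
have kE t : `[a, b] t -> k_ t = k t by move=> Dt; rewrite /k_ patchE mem_set.
have w_I : mu.-integrable `[a, b[ (EFin \o w_).
  by apply: eq_integrable wI => // s /set_mem Ds /=; rewrite wE.
have k_I : leb.-integrable `[a, b] (EFin \o k_).
  by apply: eq_integrable kI => // s /set_mem Ds /=; rewrite kE.
have mw : measurable_fun setT (w_ : B -> R).
  apply/(measurable_restrictT _ mD1).
  by apply/measurable_EFinP; exact: measurable_int wI.
have mk : measurable_fun setT (k_ : B -> R).
  apply/(measurable_restrictT _ mD2).
  by apply/measurable_EFinP; exact: measurable_int kI.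
(* With both factors extended by zero, the condition [x.1 < x.2] cuts the
   triangle out of the square. *)
pose f (x : B * B) := (w_ x.1 * k_ x.2 * (if x.1 < x.2 then 1 else 0))%:E.
pose m1 : {finite_measure set B -> \bar R} := mfrestr mD1 mufin.
pose m2 : {finite_measure set B -> \bar R} := mfrestr mD2 lebfin.
have mf : measurable_fun setT f.
  apply/measurable_EFinP; apply: measurable_funM.
    apply: measurable_funM.
      exact: (measurableT_comp mw (@measurable_fst _ _ B B)).
    exact: (measurableT_comp mk (@measurable_snd _ _ B B)).
  apply: measurable_fun_if => //; try exact: measurable_cst.
  apply: measurable_fun_ltr; [exact: measurable_fst|exact: measurable_snd].
have fI : (m1 \x m2)%E.-integrable setT f.
  apply/integrable12ltyP => //.
  apply: (@le_lt_trans _ _ (\int[m1]_x ((`|w_ x| * \int[leb]_(t in `[a, b]) `|k_ t|)%:E))%E).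
    apply: ge0_le_integral => //.
    - by move=> x _; exact: integral_ge0.
    - apply: (@measurable_fun_fubini_tonelli_F _ _ B B R m2 (abse \o f)).
        exact: measurableT_comp.
      by move=> x; exact: abse_ge0.
    - apply/measurable_EFinP; apply: measurable_funM => //.
      exact: measurableT_comp.
    move=> s _; rewrite integral_mfrestr; last first.
      by move=> t Dt; rewrite /f /= k0// mulr0 mul0r normr0.
    have kN := integrable_norm k_I.
    rewrite EFinM /Rintegral fineK ?integrable_fin_num//.
    rewrite -integralZl//; apply: ge0_le_integral => //.
    - apply: measurableT_comp => //; apply: (measurable_funS measurableT) => //.
      by apply: (measurableT_comp mf); exact: measurable_pair1.
    - apply: emeasurable_funM => //; exact: measurable_int kN.
    move=> t _ /=; rewrite lee_fin !normrM.
    by rewrite ler_piMr ?mulr_ge0//; case: ifP; rewrite ?normr1 ?normr0.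
  rewrite integral_mfrestr; last by move=> s Ds; rewrite w0// normr0 mul0r.
  have wN := integrable_norm w_I.
  apply: integrable_lty => //.
  have := integrableZr mD1 (\int[leb]_(t in `[a, b]) `|k_ t|) wN.
  by apply: eq_integrable => // s _ /=; rewrite EFinM.
have EF s : `[a, b[ s -> (w s * K s)%:E = (\int[m2]_y f (s, y))%E.
  move=> Ds.
  rewrite integral_mfrestr; last first.
    by move=> t Dt; rewrite /f /= k0// mulr0 mul0r.
  have sab : `[s, b] `<=` `[a, b].
    move: Ds; rewrite /= in_itv /= => /andP[as_ sb].
    by apply: subset_itvr; rewrite bnd_simp.
  have kS : leb.-integrable `[s, b] (EFin \o k).
    by apply: integrableS kI => //; exact: measurable_itv.
  transitivity (\int[leb]_(x in `]s, b]) ((w s)%:E * (k x)%:E))%E.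
    rewrite integralZl//; last first.
      by apply: integrableS kS => //; exact: subset_itv_oc_cc.
    rewrite EFinM; congr (_ * _)%E; rewrite integral_itv_obnd_cbnd; last first.
      apply: measurable_funS (measurable_int leb kS) => //.
      exact: subset_itv_oc_cc.
    by rewrite fineK//; apply: integrable_fin_num.
  symmetry; rewrite integral_mkcond [RHS]integral_mkcond; apply: eq_integral => t _.
  rewrite !patchE; case: ifPn => [/set_mem tab|tab]; last first.
    case: ifPn => // /set_mem tsb; move: tab; rewrite mem_set//.
    by apply: sab; move: tsb; rewrite /= !in_itv /= => /andP[/ltW -> ->].
  rewrite /f /= wE// kE//.
  case: ifPn => st; case: ifPn => tsb //; rewrite ?mulr1 ?mulr0 ?EFinM//.
    move: tsb; rewrite notin_setE; case; move: tab.
    by rewrite /= !in_itv /= st => /andP[].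
  by move: tsb => /set_mem /=; rewrite in_itv /= (negbTE st).
have EG t : `[a, b] t -> (\int[m1]_x f (x, t))%E = (k t * W t)%:E.
  move=> Dt.
  rewrite integral_mfrestr; last first.
    by move=> s Ds; rewrite /f /= w0// !mul0r.
  have tab : `[a, t[ `<=` `[a, b[.
    by move: Dt; rewrite /= in_itv /= => /andP[at_ tb]; apply: subset_itvl; rewrite bnd_simp.
  have wS : mu.-integrable `[a, t[ (EFin \o w).
    by apply: integrableS wI => //; exact: measurable_itv.
  transitivity (\int[mu]_(x in `[a, t[) ((k t)%:E * (w x)%:E))%E; last first.
    by rewrite integralZl// EFinM fineK//; apply: integrable_fin_num.
  rewrite integral_mkcond [RHS]integral_mkcond; apply: eq_integral => s _.
  rewrite !patchE; case: ifPn => [/set_mem sab|sab]; last first.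
    by case: ifPn => // /set_mem st; move: sab; rewrite mem_set//; exact: tab.
  rewrite /f /= wE// kE//.
  case: ifPn => st; case: ifPn => tsb //; rewrite ?mulr1 ?mulr0 ?EFinM// 1?muleC//.
    move: tsb; rewrite notin_setE; case; move: sab.
    by rewrite /= !in_itv /= st => /andP[-> _].
  by move: tsb => /set_mem /=; rewrite in_itv /= (negbTE st) andbF.
split.
- suff GI : m2.-integrable setT (fun y => \int[m1]_x f (x, y))%E.
    by apply: integrable_mfrestr GI => t /EG.
  apply/integrableP; split; first exact: measurable_fubini_G fI.
  apply: le_lt_trans ((integrable21ltyP m1 m2 mf).1 fI).
  apply: ge0_le_integral => //.
  + by apply: measurableT_comp => //; exact: measurable_fubini_G fI.
  + apply: (@measurable_fun_fubini_tonelli_G _ _ B B R m1 (abse \o f)).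
      exact: measurableT_comp.
    by move=> x; exact: abse_ge0.
  + move=> y _; apply: le_abse_integral => //.
    by apply: (measurableT_comp mf); exact: measurable_pair2.
- by apply: integrable_mfrestr (integrable_fubini_F fI) => s /EF.
have := Fubini fI.
rewrite integral_mfrestr; last first.
  by move=> s Ds; apply: integral0_eq => t _; rewrite /f /= w0// !mul0r.
rewrite [RHS]integral_mfrestr; last first.
  by move=> s Ds; apply: integral0_eq => t _; rewrite /f /= k0// mulr0 mul0r.
move=> /(congr1 fine) H; rewrite /Rintegral.
transitivity (fine (\int[leb]_(y in `[a, b]) \int[m1]_x f (x, y))%E).
  by congr fine; apply: eq_integral => t /set_mem /EG.
by rewrite -H; congr fine; apply: eq_integral => s /set_mem /EF.
Qed.

Lemma fubini_triangle (mu : {measure set B -> \bar R}) (a b : R)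
    (w k : R -> R[i]) : (mu `[a, b[ < +oo)%E ->
  cintegrable mu `[a, b[ w -> cintegrable leb `[a, b] k ->
  let W t := cintegral mu `[a, t[ w in
  let K s := cintegral leb `[s, b] k in
  [/\ cintegrable leb `[a, b] (fun t => k t * W t),
      cintegrable mu `[a, b[ (fun s => w s * K s)
    & cintegral leb `[a, b] (fun t => k t * W t) =
      cintegral mu `[a, b[ (fun s => w s * K s)].
Proof.
move=> mufin [wr wi] [kr ki] W K.
have mD1 : measurable (`[a, b[ : set B) by exact: measurable_itv.
have mD2 : measurable (`[a, b] : set B) by exact: measurable_itv.
have [rr1 rr2 rr3] := fubini_triangle_real mufin wr kr.
have [ri1 ri2 ri3] := fubini_triangle_real mufin wr ki.
have [ir1 ir2 ir3] := fubini_triangle_real mufin wi kr.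
have [ii1 ii2 ii3] := fubini_triangle_real mufin wi ki.
split.
- split.
  + by apply: eq_integrable (integrableB mD2 rr1 ii1) => // x _; rewrite cReM.
  + by apply: eq_integrable (integrableD mD2 ri1 ir1) => // x _; rewrite cImM addrC.
- split.
  + by apply: eq_integrable (integrableB mD1 rr2 ii2) => // x _; rewrite cReM.
  + by apply: eq_integrable (integrableD mD1 ri2 ir2) => // x _; rewrite cImM.
apply: complex_eq; rewrite ?Re_cint ?Im_cint.
- transitivity (\int[leb]_(t in `[a, b]) (complex.Re (k t) * complex.Re (W t)) -
    \int[leb]_(t in `[a, b]) (complex.Im (k t) * complex.Im (W t))).
    by rewrite -RintegralB//; apply: eq_Rintegral => t _; rewrite cReM.
  rewrite [X in X - _]rr3 [X in _ - X]ii3 -RintegralB//.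
  by apply: eq_Rintegral => s _; rewrite cReM.
- transitivity (\int[leb]_(t in `[a, b]) (complex.Re (k t) * complex.Im (W t)) +
    \int[leb]_(t in `[a, b]) (complex.Im (k t) * complex.Re (W t))).
    by rewrite -RintegralD//; apply: eq_Rintegral => t _; rewrite cImM.
  rewrite [X in X + _]ir3 [X in _ + X]ri3 -RintegralD//.
  by apply: eq_Rintegral => s _; rewrite cImM addrC.
Qed.

End FubiniTriangle.

(** * Absolutely continuous functions *)

Section AbsolutelyContinuousReal.
Context {R : realType}.
Local Notation TV := total_variation.
Implicit Types (f g : R -> R) (a b : R).

Definition real_abs_continuous a b f :=
  forall e : R, 0 < e -> exists2 d : R, 0 < d &
    forall (n : nat) (u v : 'I_n -> R),
      (forall i, a <= u i /\ u i <= v i /\ v i <= b) ->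
      (forall i j, i != j -> `]u i, v i[ `&` `]u j, v j[ = set0) ->
      \sum_(i < n) (v i - u i) < d ->
      \sum_(i < n) `|f (v i) - f (u i)| < e.

(** Arbitrary finite index types allow partitions of several intervals to be
    collected into one family. *)
Lemma rac_fin a b f : real_abs_continuous a b f ->
  forall e : R, 0 < e -> exists2 d : R, 0 < d &
    forall (I : finType) (u v : I -> R),
      (forall i, a <= u i /\ u i <= v i /\ v i <= b) ->
      (forall i j, i != j -> `]u i, v i[ `&` `]u j, v j[ = set0) ->
      \sum_i (v i - u i) < d ->
      \sum_i `|f (v i) - f (u i)| < e.
Proof.
move=> acf e /acf[d d0 H]; exists d => // I u v uv uvd.
have E (F : I -> R) : \sum_i F i = \sum_(j < #|I|) F (enum_val j).
  by rewrite (reindex (@enum_val I predT)) //=; apply/onW_bij/enum_val_bij.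
rewrite !E; apply: H => [i|i j ij]; first exact: uv.
by apply: uvd; apply: contra ij => /eqP/enum_val_inj ->.
Qed.

Section partition.
Variables (p q : R) (s : seq R).
Hypothesis ps : itv_partition p q s.

Let u (i : 'I_(size s)) := nth q (p :: s) i.
Let v (i : 'I_(size s)) := nth q (p :: s) i.+1.

Lemma partition_mono i j : (i <= j)%N -> (j <= size s)%N ->
  nth q (p :: s) i <= nth q (p :: s) j.
Proof.
move=> ij js; have [pp _] := ps.
have : sorted <=%O (p :: s) by apply: (sub_sorted (@ltW _ _)).
move/(sorted_leq_nth le_trans (@lexx _ _) q); apply => //.
by rewrite inE /= ltnS (leq_trans ij).
Qed.

Lemma partition_uv i : p <= u i /\ u i <= v i /\ v i <= q.
Proof.
split; first by rewrite -[p]/(nth q (p :: s) 0); apply: partition_mono => //; exact: ltnW.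
split; first exact: partition_mono.
rewrite -[leRHS](itv_partition_nth_size q ps); exact: partition_mono.
Qed.

Lemma partition_disj i j : i != j -> `]u i, v i[ `&` `]u j, v j[ = set0.
Proof.
wlog ij : i j / (i < j)%N => [H|_].
  have [ij|ji|/val_inj ->] := ltngtP i j; [exact: H| |by rewrite eqxx].
  by rewrite eq_sym setIC; exact: H.
have vu : v i <= u j by apply: partition_mono => //; exact: ltnW.
apply/seteqP; split => // t [] /=; rewrite !in_itv /= => /andP[_ tv] /andP[ut _].
by have := lt_trans (lt_le_trans tv vu) ut; rewrite ltxx.
Qed.

Lemma partition_sum : \sum_i (v i - u i) = q - p.
Proof.
rewrite -(big_mkord xpredT (fun i => nth q (p :: s) i.+1 - nth q (p :: s) i)).
by rewrite telescope_sumr// (itv_partition_nth_size q ps).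
Qed.

Lemma partition_variation f :
  variation p q f s = \sum_i `|f (v i) - f (u i)|.
Proof. by rewrite /variation big_mkord. Qed.

End partition.

Lemma rac_tv_small a b f : real_abs_continuous a b f -> forall e, 0 < e ->
  exists2 d : R, 0 < d & forall p q, a <= p -> p <= q -> q <= b ->
    q - p < d -> (TV p q f <= e%:E)%E.
Proof.
move=> /rac_fin acf e /acf[d d0 H]; exists d => // p q ap pq qb qpd.
apply: ge_ereal_sup => _ [_ [s ps <-] <-]; rewrite lee_fin ltW//.
rewrite partition_variation; apply: H.
- move=> i; have [pu [uv vq]] := partition_uv ps i.
  by split; [exact: le_trans pu|split => //; exact: le_trans qb].
- exact: partition_disj.
- by rewrite partition_sum.
Qed.

(** The variation is at most one on short intervals, and finitely many of
    these cover [a, b]. *)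
Lemma rac_BV a b f : a <= b -> real_abs_continuous a b f -> bounded_variation a b f.
Proof.
move=> ab /rac_tv_small /(_ _ ltr01)[d d0 H].
suff K n : (TV a (Num.min b (a + n%:R * (d / 2)))%R f < +oo)%E.
  apply/(bounded_variationP _ ab).
  rewrite ge0_fin_numE ?total_variation_ge0//.
  have [n nP] : exists n : nat, (b - a) / (d / 2) < n%:R.
    by exists (Num.bound ((b - a) / (d / 2))); apply: archi_boundP; rewrite divr_ge0 ?subr_ge0// ltW// divr_gt0.
  have := K n; rewrite (_ : Num.min _ _ = b)//; apply/min_idPl.
  by rewrite -lerBlDl -ler_pdivrMr ?divr_gt0// ltW.
elim: n => [|n IH].
  by rewrite mul0r addr0 (_ : Num.min _ _ = a) ?total_variationxx//; exact/min_idPr.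
set x := Num.min _ _ in IH; set y := Num.min _ _.
have d2 : 0 < d / 2 by rewrite divr_gt0.
have ax : a <= x by rewrite le_min ab lerDl mulr_ge0// ltW.
have xy : x <= y.
  have nn : n%:R * (d / 2) <= n.+1%:R * (d / 2) by rewrite ler_wpM2r ?(ltW d2)// ler_nat.
  by rewrite le_min !ge_min lexx /= lerD2l nn orbT.
rewrite (total_variationD f ax xy) lte_add_pinfty//.
apply: le_lt_trans (H x y ax xy _ _) (ltry _); first by rewrite ge_min lexx.
have -> : d = d / 2 + d / 2 by rewrite -splitr.
have yx : y <= x + d / 2.
  rewrite /x addr_minl le_min !ge_min; apply/andP; split; first by rewrite lerDl (ltW d2).
  have -> : n.+1%:R * (d / 2) = n%:R * (d / 2) + d / 2 by rewrite -natr1 mulrDl mul1r.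
  by rewrite addrA lexx orbT.
by move: yx d2; lra.
Qed.

(** Near-optimal partitions of the given intervals form one family of the same
    total length. *)
Lemma rac_tv a b f : a <= b -> real_abs_continuous a b f ->
  real_abs_continuous a b (fine \o TV a ^~ f).
Proof.
move=> ab acf e e0; have bv := rac_BV ab acf.
have [d d0 H] := rac_fin acf (divr_gt0 e0 (ltr0Sn _ 1)).
exists d => // n u v uv uvd sd.
have uE i := (uv i).1; have vE i := (uv i).2.1; have bE i := (uv i).2.2.
have av i : a <= v i by exact: le_trans (vE i).
have fin p q : a <= p -> p <= q -> q <= b -> TV p q f \is a fin_num.
  move=> ap pq qb; apply/bounded_variationP => //.
  apply: (@bounded_variationr _ a) => //.
  exact: bounded_variationl (le_trans ap pq) qb bv.
have D i : fine (TV a (v i) f) - fine (TV a (u i) f) = fine (TV (u i) (v i) f).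
  rewrite (total_variationD f (uE i) (vE i)) fineD ?fin//.
    by rewrite addrAC subrr add0r.
  exact: le_trans (vE i) (bE i).
have -> : \sum_(i < n) `|(fine \o TV a ^~ f) (v i) - (fine \o TV a ^~ f) (u i)| =
    \sum_(i < n) fine (TV (u i) (v i) f).
  apply: eq_bigr => i _ /=; rewrite D ger0_norm//.
  by apply: fine_ge0; exact: total_variation_ge0.
suff : \sum_(i < n) fine (TV (u i) (v i) f) <= e / 2.
  by move/le_lt_trans; apply; rewrite ltr_pdivrMr// ltr_pMr// ltr1n.
apply/ler_addgt0Pr => h h0.
have n1 : 0 < n%:R + 1 :> R by rewrite ltr_wpDl.
have [s sP] : exists s : 'I_n -> seq R, forall i, itv_partition (u i) (v i) (s i) /\
    fine (TV (u i) (v i) f) <= variation (u i) (v i) f (s i) + h / (n%:R + 1).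
  apply: (@fin_all_exists _ (fun=> seq R) (fun i s => itv_partition (u i) (v i) s /\
    fine (TV (u i) (v i) f) <= variation (u i) (v i) f s + h / (n%:R + 1))) => i.
  have h' : 0 < h / (n%:R + 1) by rewrite divr_gt0.
  have [_ [x [s ps <-] <-] xP] := ub_ereal_sup_adherent h' (fin _ _ (uE i) (vE i) (bE i)).
  exists s; split => //; rewrite -lee_fin fineK ?fin// EFinD -leeBlDr//.
  exact: ltW.
have ps i := (sP i).1.
apply: (@le_trans _ _ (\sum_(i < n) (variation (u i) (v i) f (s i) + h / (n%:R + 1)))).
  by apply: ler_sum => i _; exact: (sP i).2.
rewrite big_split /= sumr_const card_ord lerD//; last first.
  rewrite -[leLHS]mulr_natl mulrCA ler_piMr ?(ltW h0)// ler_pdivrMr// mul1r.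
  by rewrite lerDl.
under eq_bigr => i _ do rewrite partition_variation.
rewrite (sig_big_dep _ (fun _ => xpredT)
  (fun i (j : 'I_(size (s i))) => `|f (nth (v i) (u i :: s i) j.+1) - f (nth (v i) (u i :: s i) j)|)) /=.
apply/ltW/(H {i : 'I_n & 'I_(size (s i))}
  (fun p => nth (v (tag p)) (u (tag p) :: s (tag p)) (tagged p))
  (fun p => nth (v (tag p)) (u (tag p) :: s (tag p)) (tagged p).+1)).
- move=> [i j] /=; have [pu [uv' vq]] := partition_uv (ps i) j.
  by split; [exact: le_trans (uE i) pu|split => //; exact: le_trans vq (bE i)].
- move=> [i j] [i' j'] /=; have [ii'|ii' _] := eqVneq i i'.
    subst i' => jj'; apply: partition_disj => //; apply: contra jj' => /eqP ->.
    by [].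
  apply/seteqP; split => // t [] /=; rewrite !in_itv /= => /andP[t1 t2] /andP[t3 t4].
  have : (`]u i, v i[ `&` `]u i', v i'[) t.
    have [pu [_ vq]] := partition_uv (ps i) j.
    have [pu' [_ vq']] := partition_uv (ps i') j'.
    split; rewrite /= in_itv /=; apply/andP; split.
    + exact: le_lt_trans pu t1.
    + exact: lt_le_trans t2 vq.
    + exact: le_lt_trans pu' t3.
    + exact: lt_le_trans t4 vq'.
  by rewrite uvd.
- rewrite [ltLHS](_ : _ = \sum_(i < n) \sum_(j < size (s i))
      (nth (v i) (u i :: s i) j.+1 - nth (v i) (u i :: s i) j)); last first.
    by rewrite (sig_big_dep _ (fun _ => xpredT) (fun i (j : 'I_(size (s i))) =>
      nth (v i) (u i :: s i) j.+1 - nth (v i) (u i :: s i) j)).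
  by under eq_bigr => i _ do rewrite partition_sum//.
Qed.

End AbsolutelyContinuousReal.

Section Density.
Context {R : realType}.
Local Notation B := (measurableTypeR R).
Local Notation leb := (@lebesgue_measure R).
Implicit Types (f g : R -> R) (a b : R).

Lemma lsm_itv (G : cumulative R R) (x y : R) : x <= y ->
  lebesgue_stieltjes_measure G `]x, y] = (G y - G x)%:E.
Proof.
move=> xy; rewrite /lebesgue_stieltjes_measure /measure_extension.
by rewrite measurable_mu_extE/=; [rewrite wlength_itv_bnd|exact: is_ocitv].
Qed.

(** Applied to the components of an open set of small measure. *)
Lemma open_interval_bounded (I : set R) : open I -> is_interval I ->
  (leb I < +oo)%E -> exists x y : R, x <= y /\ I = `]x, y[.
Proof.
move=> oI iI; have [-> _|I0] := eqVneq I set0.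
  by exists 0, 0; rewrite lexx set_itvoo0.
have IE : I = [set` Rhull I] by rewrite RhullK// inE.
move: (Rhull I) IE => [[b1 x|[]] [b2 y|[]]] IE; rewrite IE in I0 oI *.
- move=> _; have [t /= txy] : [set` Interval (BSide b1 x) (BSide b2 y)] !=set0 by apply/set0P.
  have xy : x <= y.
    move: txy; rewrite in_itv /= => /andP[xt ty].
    have {}xt : x <= t by case: (b1) xt => // /ltW.
    by apply: (le_trans xt); case: (b2) ty => // /ltW.
  have Nx : ~ [set` Interval (BSide b1 x) (BSide b2 y)] x.
    move=> /oI; rewrite -nbhs_ballE => -[e /= e0 H].
    have : [set` Interval (BSide b1 x) (BSide b2 y)] (x - e / 2).
      apply: H; rewrite /ball /= opprB addrCA subrr addr0 gtr0_norm ?divr_gt0//.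
      by rewrite ltr_pdivrMr// ltr_pMr// ltr1n.
    rewrite /= in_itv /= => /andP[+ _]; case: (b1) => /=; move: e0; lra.
  have Ny : ~ [set` Interval (BSide b1 x) (BSide b2 y)] y.
    move=> /oI; rewrite -nbhs_ballE => -[e /= e0 H].
    have : [set` Interval (BSide b1 x) (BSide b2 y)] (y + e / 2).
      apply: H; rewrite /ball /= opprD addrA subrr add0r normrN gtr0_norm ?divr_gt0//.
      by rewrite ltr_pdivrMr// ltr_pMr// ltr1n.
    rewrite /= in_itv /= => /andP[_]; case: (b2) => /=; move: e0; lra.
  exists x, y; split => //; apply/seteqP; split => s /= ; rewrite !in_itv /=.
    move=> sxy; rewrite !lt_neqAle; apply/andP; split.
      apply/andP; split; first by apply/eqP => xs; apply: Nx; rewrite /= in_itv /=; move: sxy; rewrite -xs.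
      by move: sxy => /andP[+ _]; case: (b1) => // /ltW.
    apply/andP; split; first by apply/eqP => ys; apply: Ny; rewrite /= in_itv /=; move: sxy; rewrite ys.
    by move: sxy => /andP[_]; case: (b2) => // /ltW.
  move=> /andP[xs sy]; apply/andP; split; first by case: (b1) => //=; exact: ltW.
  by case: (b2) => //=; exact: ltW.
- by rewrite set_itvE eqxx in I0.
- by rewrite lebesgue_measure_itv /= ltry.
- by rewrite lebesgue_measure_itv /= ltNyr.
- by rewrite set_itvE eqxx in I0.
- by rewrite lebesgue_measure_itv /=.
- by rewrite set_itvE eqxx in I0.
- by rewrite set_itvE eqxx in I0.
- by rewrite set_itvE eqxx in I0.
Qed.

(** The retraction onto [a, b]; composing with it extends a function on the
    segment by constants. *)
Definition clip a b (x : R) : R := Num.max a (Num.min x b).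

Lemma clip_id a b x : a <= x -> x <= b -> clip a b x = x.
Proof. by move=> ax xb; rewrite /clip (min_idPl xb); apply/max_idPr. Qed.

Lemma clip_itv a b x : a <= b -> a <= clip a b x /\ clip a b x <= b.
Proof.
by move=> ab; rewrite /clip le_max lexx ge_max ab ge_min lexx orbT.
Qed.

Lemma clip_nd a b x y : x <= y -> clip a b x <= clip a b y.
Proof.
move=> xy; rewrite /clip ge_max !le_max lexx /= le_min !ge_min xy lexx /= orbT.
by rewrite orbT.
Qed.

Lemma clip_lip a b x y : x <= y -> clip a b y - clip a b x <= y - x.
Proof.
by move=> xy; rewrite /clip /Num.max /Num.min; repeat case: ifPn; rewrite -?leNgt; lra.
Qed.

Lemma clip_itvoo a b x y t : a <= b -> clip a b x < t < clip a b y -> x < t < y.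
Proof.
by move=> ab; rewrite /clip /Num.max /Num.min; repeat case: ifPn; rewrite -?leNgt; lra.
Qed.

(** Clipping shortens intervals and keeps them disjoint. *)
Lemma rac_clip a b f : a <= b -> real_abs_continuous a b f ->
  forall e : R, 0 < e -> exists2 d : R, 0 < d &
    forall (n : nat) (u v : 'I_n -> R), (forall i, u i <= v i) ->
      (forall i j, i != j -> `]u i, v i[ `&` `]u j, v j[ = set0) ->
      \sum_(i < n) (v i - u i) < d ->
      \sum_(i < n) `|f (clip a b (v i)) - f (clip a b (u i))| < e.
Proof.
move=> ab acf e /acf[d d0 H]; exists d => // n u v uv uvd sd.
apply: (H n (clip a b \o u) (clip a b \o v)) => /=.
- move=> i; have [au ub] := clip_itv (u i) ab; have [av vb] := clip_itv (v i) ab.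
  by split => //; split => //; exact: clip_nd.
- move=> i j ij; apply/seteqP; split => // t [] /=; rewrite !in_itv /=.
  move=> /(clip_itvoo ab) t1 /(clip_itvoo ab) t2.
  by suff : (set0 : set R) t by []; rewrite -(uvd _ _ ij); split; rewrite /= in_itv.
- by apply: le_lt_trans sd; apply: ler_sum => i _; exact: clip_lip.
Qed.

(** A null set lies in an open set of small measure, over whose components the
    increments of [g] have a small sum. Thus the Lebesgue-Stieltjes measure of
    [g] is dominated by Lebesgue measure, and its Radon-Nikodym derivative is
    the density. *)
Lemma rac_mono_density a b g : a <= b ->
  (forall p q, a <= p -> p <= q -> q <= b -> g p <= g q) ->
  real_abs_continuous a b g -> exists k : R -> R,
    leb.-integrable `[a, b] (EFin \o k) /\
    forall x, a <= x -> x <= b -> g x - g a = \int[leb]_(t in `[a, x]) k t.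
Proof.
move=> ab ndg /(rac_clip ab) acg; pose G := g \o clip a b.
have ndG : nondecreasing G.
  move=> x y xy; have [ax xb] := clip_itv x ab; have [ay yb] := clip_itv y ab.
  by apply: ndg => //; exact: clip_nd.
have rcG : right_continuous G.
  apply: right_continuousW => x; apply/cvgrPdist_lt => e /acg[d d0 H].
  near=> y.
  have [xy|yx] := leP x y.
    have := H 1 (fun=> x) (fun=> y) (fun=> xy); rewrite !big_ord_recl !big_ord0 !addr0 distrC.
    apply.
      by move=> i j; rewrite !ord1 eqxx.
    have : `|x - y| < d by near: y; apply: cvgr_dist_lt.
    by rewrite distrC ger0_norm// subr_ge0.
  have := H 1 (fun=> y) (fun=> x) (fun=> ltW yx); rewrite !big_ord_recl !big_ord0 !addr0.
  apply.
    by move=> i j; rewrite !ord1 eqxx.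
  have : `|x - y| < d by near: y; apply: cvgr_dist_lt.
  by rewrite ger0_norm// subr_ge0 ltW.
pose GC : cumulative R R := HB.pack G (isCumulative.Build R _ R G ndG rcG).
pose mu := lebesgue_stieltjes_measure GC.
have mD : measurable (`]a, b] : set B) by exact: measurable_itv.
have Dfin : (mu `]a, b] < +oo)%E by rewrite /mu lsm_itv// ltry.
pose nu : {finite_measure set B -> \bar R} := mfrestr mD Dfin.
pose nuc := charge_of_finite_measure nu.
have dom : nuc `<< leb.
  apply/null_content_dominatesP => A mA A0.
  apply/eqP; rewrite eq_le measure_ge0 andbT.
  apply/lee_addgt0Pr => e e0; rewrite add0e.
  have [d d0 H] := acg _ e0.
  have [|U [oU AU Ud]] := @lebesgue_regularity_outer R A d mA _ d0.
    by rewrite A0 ltry.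
  have mU : measurable (U : set B) by exact: open_measurable.
  have {Ud} Ud : (leb U < d%:E)%E.
    apply: le_lt_trans Ud; rewrite -[leRHS]add0e -A0.
    rewrite -measureU//; [|exact: measurableD|]; last first.
      by apply/seteqP; split => // x [? []].
    rewrite le_measure ?inE//; last by rewrite setDE setUIr setUCr setIT; exact: subsetUr.
    by apply: measurableU => //; exact: measurableD.
  apply: (@le_trans _ _ (mu U)).
    rewrite /nuc /charge_of_finite_measure /nu /= /mfrestr /mrestr.
    apply: le_measure; rewrite ?inE//; first exact: measurableI.
    by apply: subset_trans AU; exact: subIsetl.
  pose I := open_disjoint_itv oU.
  have mI i : measurable (I i : set B).
    by apply: open_measurable; exact: open_disjoint_itv_open.
  have tI : trivIset setT I by exact: open_disjoint_itv_trivIset.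
  have UE : U = \bigcup_i I i by exact: open_disjoint_itv_bigcup.
  have leI n : (\sum_(i < n) leb (I i) < d%:E)%E.
    apply: le_lt_trans Ud; rewrite UE -(@measure_bigsetU_ord _ _ _ leb n xpredT I)//; last first.
      by apply/trivIsetP => i j _ _ ij; have /trivIsetP := tI; apply.
    apply: le_measure; rewrite ?inE//.
    - by apply: bigsetU_measurable.
    - by apply: bigcup_measurable.
    - exact: bigsetU_bigcup.
  have Ifin i : (leb (I i) < +oo)%E.
    apply: le_lt_trans (lt_trans (leI i.+1) (ltry _)).
    by rewrite big_ord_recr /= leeDr// sume_ge0.
  have /choice[u] : forall i, exists xy : R * R, xy.1 <= xy.2 /\ I i = `]xy.1, xy.2[.
    move=> i; have [x [y [xy IE]]] := open_interval_bounded (@open_disjoint_itv_open _ _ oU i)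
      (@open_disjoint_itv_is_interval _ _ oU i) (Ifin i).
    by exists (x, y).
  move=> uP; have u12 i := (uP i).1; have IE i := (uP i).2.
  have cvmu : (fun n => \sum_(0 <= i < n) mu (I i))%E @ \oo --> mu U.
    by rewrite UE; apply: measure_semi_sigma_additive => //; rewrite -UE.
  rewrite -(cvg_lim _ cvmu)//; apply: lime_le; first by apply/cvg_ex; exists (mu U).
  apply: nearW => n; rewrite big_mkord.
  apply: (@le_trans _ _ (\sum_(i < n) (G (u i).2 - G (u i).1)%:E)%E).
    apply: lee_sum => i _; rewrite IE -(@lsm_itv GC _ _ (u12 i)).
    by apply: le_measure; rewrite ?inE//; exact: subset_itv_oo_oc.
  rewrite sumEFin lee_fin ltW//.
  apply: le_lt_trans (H n (fun i => (u i).1) (fun i => (u i).2) _ _ _).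
  - by apply: ler_sum => i _; exact: ler_norm.
  - by move=> i; exact: u12.
  - move=> i j ij; rewrite -!IE; have /trivIsetP := tI; apply => //.
  - rewrite -lte_fin -sumEFin; apply: le_lt_trans (leI n).
    apply: lee_sum => i _; rewrite IE lebesgue_measure_itv /= lte_fin.
    by have := u12 i; case: ltgtP => // ->; rewrite subrr.
exists (fine \o Radon_Nikodym nuc leb); split.
  apply: (@eq_integrable _ _ _ leb _ _ (Radon_Nikodym nuc leb)) => //.
    by move=> x _; rewrite /= fineK// Radon_Nikodym_fin_num.
  exact: integrableS (Radon_Nikodym_integrable dom).
move=> x ax xb.
have mx : measurable (`]a, x] : set B) by exact: measurable_itv.
have := Radon_Nikodym_integral dom mx.
rewrite /nuc /charge_of_finite_measure /nu /= /mfrestr /mrestr setIidl; last first.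
  by apply: subset_itvl; rewrite bnd_simp.
rewrite /mu lsm_itv//= /G /= !clip_id// => /(congr1 fine) /= ->.
rewrite /Rintegral integral_itv_obnd_cbnd.
  by congr fine; apply: eq_integral => t _; rewrite /= fineK// Radon_Nikodym_fin_num.
apply: measurable_funS (measurable_int _ (Radon_Nikodym_integrable dom)) => //.
Unshelve. all: by end_near. Qed.

Lemma racD a b f g : real_abs_continuous a b f -> real_abs_continuous a b g ->
  real_abs_continuous a b (f \+ g).
Proof.
move=> acf acg e e0; have e2 : 0 < e / 2 by rewrite divr_gt0.
have [d d0 H] := acf _ e2; have [d' d'0 H'] := acg _ e2.
exists (Num.min d d'); first by rewrite lt_min d0.
move=> n u v uv uvd; rewrite lt_min => /andP[sd sd'].
rewrite [ltRHS]splitr; apply: le_lt_trans (ltrD (H n u v uv uvd sd) (H' n u v uv uvd sd')).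
rewrite -big_split /=; apply: ler_sum => i _.
by rewrite opprD addrACA ler_normD.
Qed.

Lemma racN a b f : real_abs_continuous a b f -> real_abs_continuous a b (\- f).
Proof.
move=> acf e /acf[d d0 H]; exists d => // n u v uv uvd sd.
apply: le_lt_trans (H n u v uv uvd sd); apply: ler_sum => i _ /=.
by rewrite -opprD normrN.
Qed.

(** The variation [V] of [f] and the difference [V - f] are both monotone and
    absolutely continuous. *)
Lemma rac_density a b f : a <= b -> real_abs_continuous a b f ->
  exists k : R -> R, leb.-integrable `[a, b] (EFin \o k) /\
    forall x, a <= x -> x <= b -> f x - f a = \int[leb]_(t in `[a, x]) k t.
Proof.
move=> ab acf; pose V x := fine (total_variation a x f).
have bv := rac_BV ab acf.
have acV : real_abs_continuous a b V by exact: rac_tv.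
have fin p q : a <= p -> p <= q -> q <= b -> total_variation p q f \is a fin_num.
  move=> ap pq qb; apply/bounded_variationP => //.
  apply: (@bounded_variationr _ a) => //.
  exact: bounded_variationl (le_trans ap pq) qb bv.
have VD p q : a <= p -> p <= q -> q <= b -> V q - V p = fine (total_variation p q f).
  move=> ap pq qb; rewrite /V (total_variationD f ap pq) fineD ?fin//.
    by rewrite addrAC subrr add0r.
  exact: le_trans pq qb.
have ndV p q : a <= p -> p <= q -> q <= b -> V p <= V q.
  move=> ap pq qb.
  by rewrite -subr_ge0 VD// fine_ge0// total_variation_ge0.
have ndVf p q : a <= p -> p <= q -> q <= b -> (V \- f) p <= (V \- f) q.
  move=> ap pq qb /=.
  have : f q - f p <= V q - V p.
    rewrite VD// -lee_fin fineK ?fin//.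
    by apply: le_trans (total_variation_ge f pq); rewrite lee_fin; exact: ler_norm.
  by lra.
have [k1 [k1I k1E]] := rac_mono_density ab ndV acV.
have [k2 [k2I k2E]] := rac_mono_density ab ndVf (racD acV (racN acf)).
exists (k1 \- k2); split.
  by apply: eq_integrable (integrableB _ k1I k2I).
move=> x ax xb; rewrite RintegralB//; first last.
- by apply: integrableS k2I => //; apply: subset_itvl; rewrite bnd_simp.
- by apply: integrableS k1I => //; apply: subset_itvl; rewrite bnd_simp.
by rewrite -k1E// -k2E//=; lra.
Qed.

End Density.

(** * Derivatives and primitives *)

#[global] Instance ae_lebesgue_filter (R : realType) :
  Filter (almost_everywhere (@lebesgue_measure R)) := ae_filter_ringOfSetsType _.

Section DerivativeMeasurable.
Context {R : realType}.
Local Notation B := (measurableTypeR R).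
Implicit Types (f g : R -> R) (x h : R).

Let quo f x h : R := h^-1 *: (f (h + x) - f x).

(** Differentiability of a continuous function at [x], in Cauchy form: a
    countable combination of conditions each of which is closed in [x]. *)
Let cauchy_quo f (m n : nat) : set R :=
  [set x | forall h k, h != 0 -> k != 0 -> `|h| < n.+1%:R^-1 -> `|k| < n.+1%:R^-1 ->
     `|quo f x h - quo f x k| <= m.+1%:R^-1].

Let quo_continuous f h : continuous f -> continuous (quo f ^~ h).
Proof.
move=> cf x; apply: cvgZr; apply: cvgB; last exact: cf.
apply: (@continuous_comp _ _ _ (fun x => h + x) f); last exact: cf.
by apply: cvgD; [exact: cvg_cst|exact: cvg_id].
Qed.

Let closed_cauchy_quo f m n : continuous f -> closed (cauchy_quo f m n).
Proof.
move=> cf; rewrite (_ : cauchy_quo f m n =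
    \bigcap_(hk in [set hk : R * R | [/\ hk.1 != 0, hk.2 != 0,
       `|hk.1| < n.+1%:R^-1 & `|hk.2| < n.+1%:R^-1]])
      [set x | `|quo f x hk.1 - quo f x hk.2| <= m.+1%:R^-1]); last first.
  apply/seteqP; split => x /= H; first by move=> [h k] /= [h0 k0 hn kn]; exact: H.
  by move=> h k h0 k0 hn kn; exact: (H (h, k)).
apply: closed_bigI => -[h k] _ /=.
rewrite (_ : [set x | _] = (fun x => `|quo f x h - quo f x k|) @^-1` [set y | y <= m.+1%:R^-1]); last by [].
apply: preimage_closed; [|exact: closed_le].
move=> x _; apply: (@continuous_comp _ _ _ (fun x => quo f x h - quo f x k)); last exact: norm_continuous.
by apply: cvgB; exact: quo_continuous.
Qed.

Let cvg_quoP f x : cvg (quo f x h @[h --> 0^']) <->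
  (\bigcap_m \bigcup_n cauchy_quo f m n) x.
Proof.
split=> [/cvg_ex[l fl] m _|H].
  have m0 : 0 < m.+1%:R^-1 / 2 :> R by rewrite divr_gt0.
  have /cvgrPdist_lt/(_ _ m0) := fl.
  rewrite near_withinE -nbhs_ballE => -[e /= e0 {}H].
  have [n nP] : exists n : nat, n.+1%:R^-1 < e.
    have [n nP] := ltr_add_invr e0; by exists n; rewrite add0r in nP.
  have {}H h : h != 0 -> `|h| < n.+1%:R^-1 -> `|l - quo f x h| < m.+1%:R^-1 / 2.
    move=> h0 hn; apply: H => //; rewrite /ball /= sub0r normrN.
    exact: lt_trans hn nP.
  exists n => //= h k h0 k0 hn kn; rewrite [leRHS]splitr.
  rewrite (_ : quo f x h - quo f x k = (l - quo f x k) - (l - quo f x h)); last by lra.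
  by rewrite (le_trans (ler_normB _ _))// lerD// ltW// H.
apply/cauchy_cvgP/cauchyP => e e0.
have [m mP] : exists m : nat, m.+1%:R^-1 < e.
  have [m mP] := ltr_add_invr e0; by exists m; rewrite add0r in mP.
have [n _ /= {}H] := H m I.
have n0 : 0 < n.+1%:R^-1 / 2 :> R by rewrite divr_gt0.
exists (quo f x (n.+1%:R^-1 / 2)).
rewrite near_simpl near_withinE -nbhs_ballE; exists n.+1%:R^-1 => //=.
move=> h; rewrite /ball /= sub0r normrN => hn h0.
apply: le_lt_trans mP; apply: H => //.
by rewrite gtr0_norm// ltr_pdivrMr// ltr_pMr// ltr1n.
Qed.

(** Where the derivative exists it is a limit of continuous difference
    quotients; elsewhere it has the default value zero. *)
Lemma measurable_derive1_continuous f : continuous f ->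
  measurable_fun setT (f^`()%classic : B -> R).
Proof.
move=> cf; pose E := \bigcap_m \bigcup_n cauchy_quo f m n.
have mE : measurable (E : set B).
  apply: bigcap_measurable => // m _; apply: bigcup_measurable => n _.
  by apply: closed_measurable; exact: closed_cauchy_quo.
pose g n := (fun x : B => if x \in E then quo f x n.+1%:R^-1 else 0).
apply: (@measurable_fun_cvg _ _ _ _ g) => [n|x _].
  apply: measurable_fun_ifT => //.
  - apply: (measurable_fun_bool true); rewrite setTI (_ : _ @^-1` _ = E)//.
    by apply/seteqP; split => x /=; [move/set_mem|move/mem_set].
  - by apply: continuous_measurable_fun; exact: quo_continuous.
rewrite /g; have [xE|] := boolP (x \in E).
  move/set_mem/cvg_quoP : (xE) => cvx.
  apply: (cvg_trans _ cvx); rewrite -[X in X --> _]/(_ @ _).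
  apply: (@cvg_comp _ _ _ (fun n : nat => n.+1%:R^-1) (quo f x)); last exact: cvg_id.
  move=> A; rewrite /= /dnbhs /within /= nbhs_filterE -nbhs_ballE => -[e /= e0 eA].
  near=> n; apply: eA; last by rewrite /= invr_eq0 pnatr_eq0.
  rewrite /ball /= sub0r normrN gtr0_norm ?invr_gt0//.
  by near: n; apply: near_infty_natSinv_lt (PosNum e0).
rewrite notin_setE => /cvg_quoP dv.
rewrite /derive1 dvgP//; exact: cvg_cst.
Unshelve. all: by end_near. Qed.

End DerivativeMeasurable.

Section Primitives.
Context {R : realType}.
Local Notation B := (measurableTypeR R).
Local Notation leb := (@lebesgue_measure R).
Implicit Types (J : set R) (a b x y : R).

Lemma near_itvoo a b x : `]a, b[ x -> \forall y \near x, `]a, b[ y.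
Proof. by move=> xab; apply: open_nbhs_nbhs; split => //; exact: itv_open. Qed.

Lemma near_eq_derive1 (f g : R -> R) x : (\near x, f x = g x) ->
  f^`()%classic x = g^`()%classic x.
Proof. by move=> fg; rewrite !derive1E; exact: near_eq_derive. Qed.

Lemma near_clip (f : R -> R) a b x : `]a, b[ x -> \near x, f (clip a b x) = f x.
Proof.
move=> /near_itvoo; apply: filterS => y; rewrite /= in_itv /= => /andP[ay yb].
by rewrite clip_id// ltW.
Qed.

Lemma rac_clip_continuous a b (f : R -> R) : a <= b -> real_abs_continuous a b f ->
  continuous (f \o clip a b).
Proof.
move=> ab /(rac_clip ab) acg x; apply/cvgrPdist_lt => e /acg[d d0 H].
near=> y.
have xyd : `|x - y| < d by near: y; apply: cvgr_dist_lt.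
have [xy|yx] := leP x y.
  have := H 1 (fun=> x) (fun=> y) (fun=> xy); rewrite !big_ord_recl !big_ord0 !addr0 distrC.
  apply; first by move=> i j; rewrite !ord1 eqxx.
  by move: xyd; rewrite distrC ger0_norm// subr_ge0.
have := H 1 (fun=> y) (fun=> x) (fun=> ltW yx); rewrite !big_ord_recl !big_ord0 !addr0.
apply; first by move=> i j; rewrite !ord1 eqxx.
by move: xyd; rewrite ger0_norm// subr_ge0 ltW.
Unshelve. all: by end_near. Qed.

Lemma measurable_derive1_rac a b (f : R -> R) : a <= b -> real_abs_continuous a b f ->
  measurable_fun `]a, b[ (f^`()%classic : B -> R).
Proof.
move=> ab acf.
apply: (@eq_measurable_fun _ _ _ _ _ ((f \o clip a b)^`()%classic : B -> R)).
  by move=> x /set_mem xab; apply: near_eq_derive1; exact: near_clip.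
apply: measurable_funS (measurable_derive1_continuous _) => //.
exact: rac_clip_continuous.
Qed.

(** Lebesgue's differentiation theorem for a primitive. *)
Lemma primitive_derivable a b (f k : R -> R) : leb.-integrable `[a, b] (EFin \o k) ->
  (forall x, a <= x -> x <= b -> f x - f a = \int[leb]_(t in `[a, x]) k t) ->
  {ae leb, forall x, `]a, b[ x -> derivable f x 1 /\ f^`()%classic x = k x}.
Proof.
move=> kI fE; pose k_ := k \_ `[a, b].
have mab : measurable (`[a, b] : set B) by exact: measurable_itv.
have kT : leb.-integrable setT (EFin \o k_).
  by rewrite /k_ -restrict_EFin; apply/(integrable_mkcond _ mab).
have lk : locally_integrable setT k_ by exact: integrable_locally_restrict.
have intk y : leb.-integrable [set` Interval (BLeft a) (BRight y)] (EFin \o k_).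
  by apply: integrableS kT.
have := FTC1 intk lk; apply: filterS => x H xab.
have ax : a < x.
  by move: xab; rewrite /= in_itv /= => /andP[+ _].
have [dF FE] : derivable (fun x => \int[leb]_(t in `[a, x]) k_ t) x 1 /\
    (fun x => \int[leb]_(t in `[a, x]) k_ t)^`()%classic x = k_ x.
  exact: H ax.
have nf : \near x, (\int[leb]_(t in `[a, x]) k_ t + f a) = f x.
  have := near_itvoo xab; apply: filterS => y; rewrite /= in_itv /= => /andP[ay yb].
  rewrite (_ : \int[leb]_(t in `[a, y]) k_ t = \int[leb]_(t in `[a, y]) k t).
    by rewrite -fE ?subrK// ltW.
  apply: eq_Rintegral => t; rewrite inE /= in_itv /= => /andP[at_ ty].
  by rewrite /k_ patchE mem_set//= in_itv /= at_ (le_trans ty)// ltW.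
split.
  apply: near_eq_derivable nf _; apply: derivableD => //; exact: derivable_cst.
rewrite -(near_eq_derive1 nf) derive1E deriveD//.
rewrite derive_cst addr0 -derive1E FE /k_ patchE mem_set//.
by apply: subset_itv_oo_cc.
Qed.

(** [k] may be any representative of the derivative of [f], for instance a
    left-continuous one. *)
Definition primitive J (f k : R -> R[i]) :=
  (forall a b, `[a, b] `<=` J -> cintegrable leb `[a, b] k) /\
  (forall x y, J x -> J y -> x <= y -> f y - f x = cintegral leb `[x, y] k).

Lemma ac_real a b (f : R -> R[i]) : abs_continuous_on a b f ->
  real_abs_continuous a b (fun x => complex.Re (f x)) /\
  real_abs_continuous a b (fun x => complex.Im (f x)).
Proof.
move=> acf; split => e /acf[d d0 H]; exists d => // n u v uv uvd sd;
  apply: le_lt_trans (H n u v uv uvd sd); apply: ler_sum => i _.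
- by rewrite -cReN -cReD ler_Re_normc.
- by rewrite -cImN -cImD ler_Im_normc.
Qed.

Lemma itv_split_cc a b : a <= b -> `[a, b] = [set a] `|` (`]a, b[ `|` [set b]) :> set R.
Proof.
move=> ab; apply/seteqP; split => x /=; rewrite !in_itv /=.
  move=> /andP[]; rewrite le_eqVlt => /orP[/eqP->|ax]; first by left.
  by rewrite le_eqVlt => /orP[/eqP->|xb]; right; [right|left; apply/andP].
by move=> [->|[/andP[/ltW -> /ltW ->]|->]]//; rewrite lexx ?ab.
Qed.

Lemma cmeasurable_cc a b (f : R -> R[i]) : a <= b -> cmeasurable `]a, b[ f ->
  cmeasurable `[a, b] f.
Proof.
move=> ab [fr fi]; rewrite itv_split_cc//.
have H (g : B -> R) : measurable_fun `]a, b[ g ->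
    measurable_fun ([set a] `|` (`]a, b[ `|` [set b])) g.
  move=> mg; apply/measurable_funU => //; first exact: measurableU.
  split; first exact: measurable_fun_set1.
  by apply/measurable_funU => //; split => //; exact: measurable_fun_set1.
by split; exact: H.
Qed.

(** The density given by [rac_density] is almost everywhere the pointwise
    derivative. *)
Lemma ac_cderiv a b (f : R -> R[i]) : a <= b -> abs_continuous_on a b f ->
  cintegrable leb `[a, b] (cderiv f) /\
  f b - f a = cintegral leb `[a, b] (cderiv f).
Proof.
move=> ab acf; have [fr fi] := ac_real acf.
have [k [kI kE]] := rac_density ab fr; have [l [lI lE]] := rac_density ab fi.
have md : cmeasurable `[a, b] (cderiv f).
  by apply: cmeasurable_cc => //; split; exact: measurable_derive1_rac.
have klI : cintegrable leb `[a, b] (fun x => k x +i* l x) by split.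
have kld : {ae leb, forall x, `[a, b] x -> k x +i* l x = cderiv f x}.
  have nab : {ae leb, forall x, x != a /\ x != b}.
    exists ([set a] `|` [set b]); split.
    - exact: measurableU.
    - by apply/null_set_setU => //; exact: lebesgue_measure_set1.
    - move=> x /= /not_andP[] /negP; rewrite negbK => /eqP ->; [by left|by right].
  have := primitive_derivable kI kE; have := primitive_derivable lI lE.
  apply: filterS3 nab => x [xa xb] Hl Hk xab.
  have xoo : `]a, b[ x.
    move: xab; rewrite /= !in_itv /= => /andP[ax bx].
    by rewrite !lt_neqAle eq_sym xa ax xb.
  by rewrite /cderiv (Hk xoo).2 (Hl xoo).2.
split; first exact: cintegrable_ae_eq klI md kld.
rewrite -(cint_ae_eq _ (cintegrable_measurable klI) md kld)//.
by apply: complex_eq; rewrite ?(cReD, cImD, cReN, cImN) ?kE ?lE.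
Qed.

Lemma itv_sub J a b x y : is_interval J -> J x -> J y -> `[x, y] `<=` J.
Proof.
by move=> iJ Jx Jy t /=; rewrite in_itv /= => txy; exact: iJ Jx Jy _ txy.
Qed.

Lemma ac_primitive J (f : R -> R[i]) : is_interval J ->
  locally_abs_continuous J f -> primitive J f (cderiv f).
Proof.
move=> iJ acf; split => [a b abJ|x y Jx Jy xy].
  have [ab|ba] := leP a b; first by have [] := ac_cderiv ab (acf _ _ abJ).
  by rewrite set_itv_ge ?bnd_simp -?ltNge//; split; exact: integrable_set0.
by have [] := ac_cderiv xy (acf _ _ (itv_sub 0 0 iJ Jx Jy)).
Qed.

(** Absolute continuity of the integral of [normc k]. *)
Lemma primitive_ac J (f k : R -> R[i]) : primitive J f k ->
  locally_abs_continuous J f.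
Proof.
move=> [kI fE] a b abJ e e0.
have mab : measurable (`[a, b] : set B) by exact: measurable_itv.
have nI := integrable_normc mab (kI _ _ abJ).
have nT : leb.-integrable setT (EFin \o ((fun x => normc (k x)) \_ `[a, b])).
  by rewrite -restrict_EFin; apply/(integrable_mkcond _ mab).
have [d [d0 H]] := integral_normr_continuous nT (divr_gt0 e0 (ltr0Sn _ 1)).
exists d => // n u v uv uvd sd.
pose A := \big[setU/set0]_(i < n) `]u i, v i[.
have mA : measurable (A : set B) by apply: bigsetU_measurable => i _; exact: measurable_itv.
have tA : trivIset setT (fun i : 'I_n => `]u i, v i[ : set B).
  by apply/trivIsetP => i j _ _; exact: uvd.
have lA : (leb A < d%:E)%E.
  rewrite /A measure_bigsetU_ord//=.
  rewrite (eq_bigr (fun i => (v i - u i)%:E)); first by rewrite sumEFin lte_fin.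
  move=> i _; rewrite lebesgue_measure_itv /= lte_fin; have := (uv i).2.1.
  by case: ltgtP => // ->; rewrite subrr.
have sub i : `]u i, v i[ `<=` `[a, b].
  move=> t /=; rewrite !in_itv /= => /andP[ut tv].
  by rewrite (le_trans (uv i).1 (ltW ut)) (le_trans (ltW tv) (uv i).2.2).
have subc i : `[u i, v i] `<=` `[a, b].
  move=> t /=; rewrite !in_itv /= => /andP[ut tv].
  by rewrite (le_trans (uv i).1 ut) (le_trans tv (uv i).2.2).
have uJ i : J (u i) by apply: abJ; rewrite /= in_itv /= (uv i).1 (le_trans (uv i).2.1 (uv i).2.2).
have vJ i : J (v i) by apply: abJ; rewrite /= in_itv /= (uv i).2.2 (le_trans (uv i).1 (uv i).2.1).
have {H} := H A mA lA.
set S := (X in X < _ -> _).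
have -> : S = \sum_(i < n) \int[leb]_(t in `]u i, v i[) normc (k t).
  have nS i : leb.-integrable `]u i, v i[ (fun x => (normc (k x))%:E).
    by apply: integrableS nI => //; exact: measurable_itv.
  apply: EFin_inj; rewrite -sumEFin.
  have SI := integrable_norm (integrableS measurableT mA (@subsetT _ _) nT).
  rewrite /S /Rintegral fineK; last exact: integrable_fin_num.
  rewrite /A ge0_integral_bigsetU//=; first last.
  - exact: measurable_int SI.
  - by apply: sub_trivIset tA.
  - exact: index_enum_uniq.
  apply: eq_bigr => i _; rewrite /Rintegral fineK; last exact: integrable_fin_num.
  apply: eq_integral => x xi; rewrite patchE mem_set; last by apply: (sub i); exact: set_mem.
  by rewrite ger0_norm// normc_ge0.
rewrite ltr_pdivlMr// mulrC; apply: le_lt_trans; rewrite mulr_sumr.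
apply: ler_sum => i _; rewrite fE//; last exact: (uv i).2.1.
have mi : measurable (`[u i, v i] : set B) by exact: measurable_itv.
have kS : cintegrable leb `[u i, v i] k by apply: cintegrableS (kI _ _ abJ).
apply: le_trans (ler_normc_cint mi kS (integrable_normc mi kS) (fun x _ => lexx _)) _.
rewrite ler_pM2l// le_eqVlt; apply/orP; left; apply/eqP; congr fine.
apply: integral_itv_bndoo.
by apply: measurable_funS (measurable_int _ nI).
Qed.

End Primitives.

(** * Square integrable functions and [H^1] *)

Section SquareIntegrable.
Context {R : realType}.
Local Notation B := (measurableTypeR R).
Implicit Types (D : set B) (f g : R -> R[i]).
Variable mu : {measure set B -> \bar R}.

Lemma L2_cmeasurable D f : L2 mu D f -> cmeasurable D f.
Proof. by case. Qed.

Lemma L2P D f : measurable D -> L2 mu D f <->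
  cmeasurable D f /\ mu.-integrable D (fun x => (normc (f x) ^+ 2)%:E).
Proof.
move=> mD; split=> [[fr fi fI]|[mf /integrableP[_ fI]]].
  have mf : cmeasurable D f by split.
  split => //; apply/integrableP; split.
    by apply/measurable_EFinP; apply: measurable_funX; exact: measurable_normc.
  apply: le_lt_trans fI; rewrite le_eqVlt; apply/orP; left; apply/eqP.
  by apply: eq_integral => x _; rewrite /= ger0_norm// exprn_ge0// normc_ge0.
have [fr fi] := mf; split => //.
apply: le_lt_trans fI; rewrite le_eqVlt; apply/orP; left; apply/eqP.
by apply: eq_integral => x _; rewrite /= ger0_norm// exprn_ge0// normc_ge0.
Qed.

Lemma le_L2 D f (h : R -> R) : measurable D -> cmeasurable D f ->
  mu.-integrable D (EFin \o h) -> (forall x, D x -> normc (f x) ^+ 2 <= h x) ->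
  L2 mu D f.
Proof.
move=> mD mf hI fh; apply/(L2P _ mD); split => //.
apply: le_integrable hI => //.
  by apply/measurable_EFinP; apply: measurable_funX; exact: measurable_normc.
move=> x Dx /=; rewrite lee_fin ger0_norm ?exprn_ge0 ?normc_ge0//.
exact: le_trans (fh _ Dx) (ler_norm _).
Qed.

Lemma L2S D E f : measurable D -> measurable E -> D `<=` E -> L2 mu E f -> L2 mu D f.
Proof.
move=> mD mE DE /(L2P _ mE)[mf fI]; apply/(L2P _ mD); split.
  exact: cmeasurableS mf.
exact: integrableS fI.
Qed.

Lemma L2_linear D (z : R[i]) f g : measurable D -> L2 mu D f -> L2 mu D g ->
  L2 mu D (fun x => z * f x + g x).
Proof.
move=> mD /(L2P _ mD)[mf fI] /(L2P _ mD)[mg gI].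
apply: (@le_L2 _ _ (fun x => 2 * normc z ^+ 2 * normc (f x) ^+ 2 + 2 * normc (g x) ^+ 2)) => //.
- by apply: cmeasurableD => //; apply: cmeasurableM => //; exact: cmeasurable_cst.
- exact: (integrableD mD (integrableZl mD (2 * normc z ^+ 2) fI) (integrableZl mD 2 gI)).
- move=> x _; apply: (@le_trans _ _ ((normc (z * f x) + normc (g x)) ^+ 2)).
    by rewrite ler_pXn2r ?nnegrE ?addr_ge0 ?normc_ge0// ler_normcD.
  rewrite normcM; set a := normc z * normc (f x); set b := normc (g x).
  rewrite -mulrA -exprMn -/a; have : 0 <= (a - b) ^+ 2 by exact: sqr_ge0.
  by rewrite sqrrB sqrrD; lra.
Qed.

Lemma L20 D : L2 mu D (fun=> 0).
Proof.
split; [exact: measurable_cst..|].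
by under eq_integral do rewrite normc0 expr0n /=; rewrite integral0.
Qed.

Lemma L2Z D z f : measurable D -> L2 mu D f -> L2 mu D (fun x => z * f x).
Proof.
move=> mD fL; have := L2_linear z mD fL (L20 D).
by under eq_fun do rewrite addr0.
Qed.

Lemma L2D D f g : measurable D -> L2 mu D f -> L2 mu D g ->
  L2 mu D (fun x => f x + g x).
Proof.
move=> mD fL gL; have := L2_linear 1 mD fL gL.
by under eq_fun do rewrite mul1r.
Qed.

Lemma L2J D f : L2 mu D f -> L2 mu D (fun x => (f x)^*)%R.
Proof.
move=> [fr fi fI]; split; first by under eq_fun do rewrite cReJ.
  by under eq_fun do rewrite cImJ; exact: measurable_funN.
by under eq_integral do rewrite normcJ.
Qed.

Lemma eq_L2 D f g : measurable D -> (forall x, D x -> f x = g x) ->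
  L2 mu D f -> L2 mu D g.
Proof.
move=> mD fg /(L2P _ mD)[mf fI]; apply/(L2P _ mD); split.
  exact: eq_cmeasurable mf.
by apply: eq_integrable fI => // x /set_mem Dx; rewrite fg.
Qed.

Lemma L2_ae_eq D f g : measurable D -> cmeasurable D g ->
  {ae mu, forall x, D x -> f x = g x} -> L2 mu D f -> L2 mu D g.
Proof.
move=> mD mg fg [fr fi fI]; have [gr gi] := mg; split => //.
have mf : cmeasurable D f by split.
have E : (\int[mu]_(x in D) (normc (f x) ^+ 2)%:E =
          \int[mu]_(x in D) (normc (g x) ^+ 2)%:E)%E.
  apply: ae_eq_integral => //.
  - by apply/measurable_EFinP; apply: measurable_funX; exact: measurable_normc.
  - by apply/measurable_EFinP; apply: measurable_funX; exact: measurable_normc.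
  - by apply: filterS fg => x fg Dx; rewrite fg.
by rewrite -E.
Qed.

Lemma L2_mul D f g : measurable D -> L2 mu D f -> L2 mu D g ->
  cintegrable mu D (fun x => f x * g x).
Proof.
move=> mD /(L2P _ mD)[mf fI] /(L2P _ mD)[mg gI].
apply: (@le_cintegrable _ _ _ _ (fun x => normc (f x) ^+ 2 + normc (g x) ^+ 2)) => //.
- exact: cmeasurableM.
- exact: (integrableD mD fI gI).
- move=> x _; rewrite normcM; set a := normc (f x); set b := normc (g x).
  have : 0 <= (a - b) ^+ 2 by exact: sqr_ge0.
  have : 0 <= a ^+ 2 + b ^+ 2 by rewrite addr_ge0 ?sqr_ge0.
  by rewrite sqrrB; lra.
Qed.

Lemma L2_cintegrable D f : measurable D -> (mu D < +oo)%E -> L2 mu D f ->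
  cintegrable mu D f.
Proof.
move=> mD Dfin fL; have oneL : L2 mu D (fun=> 1).
  apply: (@le_L2 _ _ (fun=> 1)); [exact: mD|exact: cmeasurable_cst| |].
    by apply: measurable_bounded_integrable => //; exact: bounded_cst.
  by move=> x _; rewrite normc_real normr1 expr1n.
by have := L2_mul mD fL oneL; apply: eq_cintegrable => // x _; rewrite mulr1.
Qed.

Lemma L2_bounded D f (M : R) : measurable D -> (mu D < +oo)%E -> cmeasurable D f ->
  (forall x, D x -> normc (f x) <= M) -> L2 mu D f.
Proof.
move=> mD Dfin mf fM; apply: (@le_L2 _ _ (fun=> M ^+ 2)) => //.
  by apply: measurable_bounded_integrable => //; exact: bounded_cst.
move=> x Dx; rewrite ler_pXn2r// ?nnegrE ?normc_ge0 ?fM//.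
exact: le_trans (normc_ge0 (f x)) (fM _ Dx).
Qed.

End SquareIntegrable.

Section CountableUnions.
Context {R : realType}.
Local Notation B := (measurableTypeR R).
Local Notation leb := (@lebesgue_measure R).
Implicit Types (J : set R) (f k : R -> R[i]).

(** Statements about almost all points of [J] reduce to compact segments,
    whether or not the ends belong to [J]. *)
Definition sigma_itv J (a b : nat -> R) :=
  (forall n, a n <= b n) /\ J = \bigcup_n `[a n, b n].

Lemma sigma_itv_sub J a b n : sigma_itv J a b -> `[a n, b n] `<=` J.
Proof. by move=> [_ ->] x abx; exists n. Qed.

Lemma sigma_itv_measurable J a b : sigma_itv J a b -> measurable (J : set B).
Proof. by move=> [_ ->]; apply: bigcup_measurable => n _; exact: measurable_itv. Qed.

Lemma cmeasurable_bigcup (E : nat -> set B) f : (forall n, measurable (E n)) ->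
  (forall n, cmeasurable (E n) f) -> cmeasurable (\bigcup_n E n) f.
Proof.
by move=> mE mf; split; apply/(measurable_fun_bigcup _ mE) => n; have [] := mf n.
Qed.

Lemma cderiv_measurable J a b f : sigma_itv J a b ->
  locally_abs_continuous J f -> cmeasurable J (cderiv f).
Proof.
move=> Jab acf; have [ab JE] := Jab; rewrite JE.
apply: cmeasurable_bigcup => [n|n]; first exact: measurable_itv.
apply: (@cintegrable_measurable _ leb).
by have [] := ac_cderiv (ab n) (acf _ _ (sigma_itv_sub Jab)).
Qed.

Lemma primitive_ae_segment (a b : R) f k : primitive `[a, b] f k ->
  {ae leb, forall x, `[a, b] x -> cderiv f x = k x}.
Proof.
move=> [kI fE]; have [ba|ab] := ltP b a.
  by apply: aeW => x /=; rewrite in_itv /= => /andP[ax xb]; move: (lt_le_trans ba (le_trans ax xb)); rewrite ltxx.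
have [kr ki] := kI _ _ (@subset_refl _ _).
have aab : `[a, b]%classic a by rewrite /= in_itv /= lexx.
have fEx x : a <= x -> x <= b -> f x - f a = cintegral leb `[a, x] k.
  by move=> ax xb; apply: fE => //; rewrite /= in_itv /= ax.
have Hr := primitive_derivable (f := fun x => complex.Re (f x)) kr.
have Hi := primitive_derivable (f := fun x => complex.Im (f x)) ki.
have {Hr}Hr : {ae leb, forall x, `]a, b[ x ->
    (fun x => complex.Re (f x))^`()%classic x = complex.Re (k x)}.
  apply: filterS (Hr _) => [x H /H[]//|x ax xb].
  by rewrite -cReN -cReD fEx.
have {Hi}Hi : {ae leb, forall x, `]a, b[ x ->
    (fun x => complex.Im (f x))^`()%classic x = complex.Im (k x)}.
  apply: filterS (Hi _) => [x H /H[]//|x ax xb].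
  by rewrite -cImN -cImD fEx.
have nab : {ae leb, forall x, x != a /\ x != b}.
  exists ([set a] `|` [set b]); split.
  - exact: measurableU.
  - by apply/null_set_setU => //; exact: lebesgue_measure_set1.
  - move=> x /= /not_andP[] /negP; rewrite negbK => /eqP ->; [by left|by right].
apply: filterS3 nab Hr Hi => x [xa xb] Hr Hi xab.
have xoo : `]a, b[ x.
  move: xab; rewrite /= !in_itv /= => /andP[ax bx].
  by rewrite !lt_neqAle eq_sym xa ax xb.
by rewrite /cderiv Hr// Hi//; case: (k x).
Qed.

Lemma primitiveS J J' f k : J' `<=` J -> primitive J f k -> primitive J' f k.
Proof.
move=> JJ [kI fE]; split => [a b abJ|x y /JJ Jx /JJ Jy]; last exact: fE.
by apply: kI; exact: subset_trans JJ.
Qed.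

Lemma primitive_ae J a b f k : sigma_itv J a b -> primitive J f k ->
  {ae leb, forall x, J x -> cderiv f x = k x}.
Proof.
move=> Jab fk; have [ab JE] := Jab.
have : {ae leb, forall x n, `[a n, b n] x -> cderiv f x = k x}.
  apply: (@ae_foralln _ _ _ leb (fun n x => `[a n, b n] x -> cderiv f x = k x)) => n.
  by apply: primitive_ae_segment; apply: primitiveS fk; exact: sigma_itv_sub Jab.
by apply: filterS => x H; rewrite JE => -[n _]; exact: H.
Qed.

Lemma primitive_H1 J a b f k : sigma_itv J a b -> primitive J f k ->
  L2 leb J f -> L2 leb J k -> H1 J f.
Proof.
move=> Jab fk fL kL; have acf := primitive_ac fk; split => //.
apply: L2_ae_eq kL; [exact: sigma_itv_measurable Jab|exact: cderiv_measurable Jab _|].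
by apply: filterS (primitive_ae Jab fk) => x H /H.
Qed.

Lemma H1_primitive J f : is_interval J -> H1 J f -> primitive J f (cderiv f).
Proof. by move=> iJ [acf _ _]; exact: ac_primitive. Qed.

(** The scalar product does not depend on the representatives of the
    derivatives. *)
Lemma H1_dotE J a b f k g l : sigma_itv J a b -> H1 J f -> H1 J g ->
  primitive J f k -> primitive J g l -> cmeasurable J k -> cmeasurable J l ->
  H1_dot J f g = 4^-1 * cintegral leb J (fun x => f x * (g x)^*)%R
    + cintegral leb J (fun x => k x * (l x)^*)%R.
Proof.
move=> Jab fH gH fk gl mk ml; rewrite /H1_dot; congr (_ + _).
have mJ := sigma_itv_measurable Jab.
have [_ _ /L2_cmeasurable mf'] := fH; have [_ _ /L2_cmeasurable mg'] := gH.
apply: (@cint_ae_eq _ leb) => //.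
- by apply: cmeasurableM => //; exact: cmeasurableJ.
- by apply: cmeasurableM => //; exact: cmeasurableJ.
apply: filterS2 (primitive_ae Jab fk) (primitive_ae Jab gl) => x fE gE Jx.
by rewrite fE// gE.
Qed.

Lemma primitive_linear J (z : R[i]) f k g l : is_interval J ->
  primitive J f k -> primitive J g l ->
  primitive J (fun x => z * f x + g x) (fun x => z * k x + l x).
Proof.
move=> iJ [kI fE] [lI gE]; split => [a b abJ|x y Jx Jy xy].
  have mab : measurable (`[a, b] : set B) by exact: measurable_itv.
  apply: cintegrableD => //; last exact: lI.
  by apply: cintegrableZ => //; exact: kI.
have mxy : measurable (`[x, y] : set B) by exact: measurable_itv.
have xyJ : `[x, y] `<=` J by exact: itv_sub.
have kx := kI _ _ xyJ; have lx := lI _ _ xyJ.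
rewrite cintD//; last exact: cintegrableZ.
by rewrite cintZ// -fE// -gE//; ring.
Qed.

End CountableUnions.

(** * Sesquilinear forms and the spaces on a half-line *)

Section SesquilinearForm.
Context {R : realType} {V : lmodType R[i]}.
Variables (P : set V) (dot : V -> V -> R[i]).
Hypothesis Plin : forall z f g, P f -> P g -> P (z *: f + g).
Hypothesis dot_linear : forall z f g h, P f -> P g -> P h ->
  dot (z *: f + g) h = z * dot f h + dot g h.
Hypothesis dot_herm : forall f g, P f -> P g -> dot g f = ((dot f g)^*)%R.
Hypothesis dot_ge0 : forall f, P f -> 0 <= complex.Re (dot f f).

Let n f : R := Num.sqrt (complex.Re (dot f f)).

Let dot_self z f g : P f -> P g ->
  complex.Re (dot (z *: f + g) (z *: f + g)) =
  normc z ^+ 2 * complex.Re (dot f f) + 2 * complex.Re (z * dot f g) +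
  complex.Re (dot g g).
Proof.
move=> Pf Pg; have Pz := Plin z Pf Pg.
rewrite dot_linear// (dot_herm Pz Pf) (dot_herm Pz Pg) !dot_linear//.
rewrite (dot_herm Pf Pg).
have := congr1 (@complex.Im R) (dot_herm Pf Pf); have := congr1 (@complex.Im R) (dot_herm Pg Pg).
rewrite !(cImJ) normc_sqr => Ig If.
rewrite !(cReD, cImD, cReM, cImM, cReJ, cImJ).
move: Ig If; set a := complex.Re (dot f f); set b := complex.Im (dot f f).
set u := complex.Re (dot f g); set v := complex.Im (dot f g).
set a' := complex.Re (dot g g); set b' := complex.Im (dot g g).
move=> Ig If; have -> : b = 0 by lra.
ring.
Qed.

Lemma cauchy_schwarz f g : P f -> P g -> normc (dot f g) <= n f * n g.
Proof.
move=> Pf Pg; have a0 := dot_ge0 Pf; have b0 := dot_ge0 Pg.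
rewrite -(ler_pXn2r (n := 2)) ?nnegrE ?normc_ge0 ?mulr_ge0 ?sqrtr_ge0//.
rewrite exprMn !sqr_sqrtr//.
set a := complex.Re (dot f f) in a0 *; set b := complex.Re (dot g g) in b0 *.
set C := normc (dot f g) ^+ 2.
have C0 : 0 <= C by exact: sqr_ge0.
have H (t : R) : 0 <= t ^+ 2 * C * a - 2 * t * C + b.
  have := dot_ge0 (Plin ((- t)%:C * ((dot f g)^*)%R) Pf Pg).
  rewrite dot_self// normcM normcJ normc_real normrN exprMn -/a -/b -/C.
  rewrite -normrX ger0_norm ?sqr_ge0// -mulrA.
  rewrite (_ : complex.Re ((- t)%:C * ((dot f g)^*)%R * dot f g) = - t * C); first by lra.
  by rewrite /C normc_sqr !(cReM, cImM, cReC, cImC, cReJ, cImJ); ring.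
have [aE|an0] := eqVneq a 0.
  rewrite aE mul0r; have [CE|Cn0] := eqVneq C 0; first by rewrite CE.
  have := H ((b + 1) / (2 * C)).
  rewrite aE mulr0 add0r (_ : 2 * ((b + 1) / (2 * C)) * C = b + 1); last by field.
  by lra.
have a_gt0 : 0 < a by rewrite lt_neqAle eq_sym an0.
have := H a^-1; rewrite (_ : a^-1 ^+ 2 * C * a - 2 * a^-1 * C + b = b - C / a); last by field.
by rewrite subr_ge0 ler_pdivrMr// mulrC.
Qed.

Lemma nrm_triangle f g : P f -> P g -> n (f + g) <= n f + n g.
Proof.
move=> Pf Pg; have a0 := dot_ge0 Pf; have b0 := dot_ge0 Pg.
have := dot_self 1 Pf Pg; rewrite scale1r normc_real normr1 expr1n !mul1r => E.
rewrite -[leRHS]ger0_norm ?addr_ge0 ?sqrtr_ge0// -sqrtr_sqr /n.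
apply: ler_wsqrtr; rewrite E sqrrD !sqr_sqrtr// lerD2r lerD2l -[leRHS]mulr_natl ler_pM2l//.
have := cauchy_schwarz Pf Pg; apply: le_trans.
exact: le_trans (ler_norm _) (ler_Re_normc _).
Qed.

Lemma nrm_scale z f : P f -> n (z *: f) = normc z * n f.
Proof.
move=> Pf; have P0 : P 0 by have := Plin (-1) Pf Pf; rewrite scaleN1r addNr.
have d0 : dot 0 0 = 0.
  by have := dot_linear (-1) P0 P0 P0; rewrite scaler0 addr0 mulN1r addNr.
have d0' : dot f 0 = 0.
  rewrite (dot_herm P0 Pf); have := dot_linear (-1) P0 P0 Pf.
  by rewrite scaler0 addr0 mulN1r addNr => ->; rewrite rmorph0.
have := dot_self z Pf P0; rewrite addr0 d0 d0' mulr0 mulr0 !addr0 /n => ->.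
by rewrite sqrtrM ?sqr_ge0// sqrtr_sqr ger0_norm ?normc_ge0.
Qed.

End SesquilinearForm.

Section HalfLine.
Context {R : realType}.
Local Notation B := (measurableTypeR R).
Variables (c : R) (plus : bool).
Local Notation J := (half_line c plus).

Lemma half_line_interval : is_interval J.
Proof. by rewrite /half_line; case: plus; exact: interval_is_interval. Qed.

Lemma half_line_measurable : measurable (J : set B).
Proof. by rewrite /half_line; case: plus; exact: measurable_itv. Qed.

Lemma half_line_interior : interior J = if plus then `]c, +oo[ else `]-oo, c[.
Proof. by rewrite /half_line; case: plus; rewrite interior_itv. Qed.

Definition inner_half_line : set R := if plus then `]c, +oo[ else `]-oo, c[.

Lemma inner_sub : inner_half_line `<=` J.
Proof.
rewrite /inner_half_line /half_line; case: plus => x //=.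
by rewrite !in_itv /= !andbT => /ltW.
Qed.

(** Exhausting segments that keep away from [c] and have at least unit length.
    *)
Definition inner_l (n : nat) : R := if plus then c + n.+1%:R^-1 else c - n.+2%:R.
Definition inner_r (n : nat) : R := if plus then c + n.+2%:R else c - n.+1%:R^-1.

Lemma invn_lt1 n : n.+1%:R^-1 <= 1 :> R.
Proof. by rewrite invf_le1// ler1n. Qed.

Lemma inner_lt n : inner_l n + 1 <= inner_r n.
Proof.
have h := invn_lt1 n; have h2 : 2 <= n.+2%:R :> R by rewrite ler_nat.
rewrite /inner_l /inner_r; move: (n.+1%:R^-1) (n.+2%:R) h h2 => e N h h2.
by case: plus; lra.
Qed.

Lemma inner_inside n : inner_half_line (inner_l n) /\ inner_half_line (inner_r n).
Proof.
have h : 0 < n.+1%:R^-1 :> R by rewrite invr_gt0.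
have h2 : 0 < n.+2%:R :> R by [].
rewrite /inner_half_line /inner_l /inner_r.
move: (n.+1%:R^-1) (n.+2%:R) h h2 => e N h h2.
by case: plus; rewrite /= !in_itv /= ?andbT; split; lra.
Qed.

Lemma inner_interval : is_interval inner_half_line.
Proof. by rewrite /inner_half_line; case: plus; exact: interval_is_interval. Qed.

Lemma inner_mono m n : (m <= n)%N ->
  inner_l n <= inner_l m /\ inner_r m <= inner_r n.
Proof.
move=> mn; have h : n.+1%:R^-1 <= m.+1%:R^-1 :> R.
  by rewrite lef_pV2 ?posrE// ler_nat.
have h2 : m.+2%:R <= n.+2%:R :> R by rewrite ler_nat.
rewrite /inner_l /inner_r.
move: (n.+1%:R^-1) (n.+2%:R) (m.+1%:R^-1) (m.+2%:R) h h2 => e N e' N' h h2.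
by case: plus; split; lra.
Qed.

Lemma inner_cover x : inner_half_line x -> exists n, inner_l n < x /\ x < inner_r n.
Proof.
move=> xJ; pose d := `|x - c|; have d0 : 0 < d.
  rewrite normr_gt0 subr_eq0; apply/eqP => xc; move: xJ; rewrite /inner_half_line xc.
  by case: plus; rewrite /= in_itv /= ltxx.
have [m mP] := ltr_add_invr d0; rewrite add0r in mP.
have [k kP] : exists k : nat, d < k%:R by exists (Num.bound d); exact: archi_boundP (ltW d0).
exists (maxn m k).
have h : (maxn m k).+1%:R^-1 <= m.+1%:R^-1 :> R.
  by rewrite lef_pV2 ?posrE// ler_nat ltnS leq_maxl.
have h2 : k%:R <= (maxn m k).+2%:R :> R.
  by rewrite ler_nat; apply: (leq_trans (leq_maxr m k)); rewrite -addn2 leq_addr.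
move: xJ mP kP; rewrite /inner_half_line /inner_l /inner_r /d.
move: ((maxn m k).+1%:R^-1) ((maxn m k).+2%:R) (m.+1%:R^-1) (k%:R) h h2 => e N e' N' h h2.
case: plus; rewrite /= in_itv /= ?andbT => xc.
  by rewrite gtr0_norm ?subr_gt0//; lra.
by rewrite ltr0_norm ?subr_lt0//; lra.
Qed.

Definition half_l (n : nat) : R := if plus then c else c - n.+2%:R.
Definition half_r (n : nat) : R := if plus then c + n.+2%:R else c - n.+1%:R^-1.

Lemma half_sigma : sigma_itv J half_l half_r.
Proof.
split => [n|].
  have := inner_lt n; have h : 0 < n.+1%:R^-1 :> R by rewrite invr_gt0.
  rewrite /half_l /half_r /inner_l /inner_r; move: (n.+1%:R^-1) (n.+2%:R) h => e N h.
  by case: plus; lra.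
apply/seteqP; split => x.
  have [->|xc] := eqVneq x c.
    by move=> Jc; exists 0%N => //; move: Jc; rewrite /half_line /half_l /half_r;
      case: plus; rewrite /= !in_itv /=; [by move=> _; rewrite lexx lerDl /=|by rewrite ltxx].
  move=> Jx; have /inner_cover[n [nl nr]] : inner_half_line x.
    move: Jx; rewrite /half_line /inner_half_line; case: plus => //=.
    by rewrite !in_itv /= !andbT lt_neqAle eq_sym xc.
  exists n => //; move: Jx nl nr; rewrite /half_line /half_l /half_r /inner_l /inner_r.
  case: plus; rewrite /= !in_itv /= ?andbT.
    by move=> -> _ /ltW ->.
  by move=> _ /ltW -> /ltW ->.
move=> [n _]; rewrite /half_line /half_l /half_r.
have h : 0 < n.+1%:R^-1 :> R by rewrite invr_gt0.
move: (n.+1%:R^-1) (n.+2%:R) h => e N h.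
case: plus; rewrite /= !in_itv /= ?andbT => /andP[] //.
by move=> _ xe; rewrite (le_lt_trans xe)// gtrBl.
Qed.

Lemma setT_sigma : sigma_itv (setT : set R) (fun n => - n%:R) (fun n => n%:R).
Proof.
split => [n|]; first by have := ler0n R n; lra.
apply/seteqP; split => x // _.
have xb : `|x| < (Num.bound `|x|)%:R by apply: archi_boundP.
exists (Num.bound `|x|) => //=; rewrite in_itv /= -ler_norml; exact: ltW.
Qed.

End HalfLine.

Section HalfLineSpace.
Context {R : realType}.
Local Notation leb := (@lebesgue_measure R).
Variables (c : R) (plus : bool).
Local Notation J := (half_line c plus).
Local Notation H10 := (H10_space c plus).
Implicit Types (f g k l : R -> R[i]) (z : R[i]).

Let mJ := half_line_measurable c plus.
Let iJ := @half_line_interval R c plus.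
Let sJ := @half_sigma R c plus.

Lemma H1J_primitive f : H1 J f -> primitive J f (cderiv f).
Proof. exact: H1_primitive. Qed.

Lemma half_primitive_H1 f k : primitive J f k -> L2 leb J f -> L2 leb J k -> H1 J f.
Proof. exact: primitive_H1 sJ. Qed.

Lemma half_dotE f k g l : H1 J f -> H1 J g ->
  primitive J f k -> primitive J g l -> cmeasurable J k -> cmeasurable J l ->
  H1_dot J f g = 4^-1 * cintegral leb J (fun x => f x * (g x)^*)%R
    + cintegral leb J (fun x => k x * (l x)^*)%R.
Proof. exact: H1_dotE sJ. Qed.

Lemma H1_linear z f g : H1 J f -> H1 J g -> H1 J (fun x => z * f x + g x).
Proof.
move=> fH gH; have [_ fL kL] := fH; have [_ gL lL] := gH.
apply: (half_primitive_H1 (primitive_linear z iJ (H1J_primitive fH) (H1J_primitive gH))).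
  exact: (L2_linear z mJ fL gL).
exact: (L2_linear z mJ kL lL).
Qed.

Lemma primitiveJ (E : set R) f k : is_interval E -> primitive E f k ->
  primitive E (fun x => (f x)^*)%R (fun x => (k x)^*)%R.
Proof.
move=> iE [kI fE]; split => [a b abJ|x y Jx Jy xy].
  by apply: cintegrableJ; [exact: measurable_itv|exact: kI].
rewrite cintJ//; first by rewrite -fE// rmorphB.
by apply: kI; exact: itv_sub.
Qed.

Lemma H1J f : H1 J f -> H1 J (fun x => (f x)^*)%R.
Proof.
move=> fH; have [_ fL kL] := fH.
by apply: (half_primitive_H1 (primitiveJ iJ (H1J_primitive fH))); exact: L2J.
Qed.

Lemma H1_dot_linear z f g h : H1 J f -> H1 J g -> H1 J h ->
  H1_dot J (fun x => z * f x + g x) h = z * H1_dot J f h + H1_dot J g h.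
Proof.
move=> fH gH hH; have [_ fL kL] := fH; have [_ gL lL] := gH; have [_ hL mL] := hH.
have pf := H1J_primitive fH; have pg := H1J_primitive gH; have ph := H1J_primitive hH.
rewrite (half_dotE (H1_linear z fH gH) hH (primitive_linear z iJ pf pg) ph); last 2 first.
- exact: L2_cmeasurable (L2_linear z mJ kL lL).
- exact: L2_cmeasurable mL.
have I1 : cintegrable leb J (fun x => f x * (h x)^*)%R by exact: (L2_mul mJ fL (L2J hL)).
have I2 : cintegrable leb J (fun x => g x * (h x)^*)%R by exact: (L2_mul mJ gL (L2J hL)).
have I3 : cintegrable leb J (fun x => cderiv f x * (cderiv h x)^*)%R by exact: (L2_mul mJ kL (L2J mL)).
have I4 : cintegrable leb J (fun x => cderiv g x * (cderiv h x)^*)%R by exact: (L2_mul mJ lL (L2J mL)).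
rewrite (@eq_cint _ leb _ _ (fun x => z * (f x * (h x)^*) + g x * (h x)^*)%R); last first.
  by move=> x _; ring.
rewrite (@eq_cint _ leb _ (fun x => _ * (cderiv h x)^*)%R
  (fun x => z * (cderiv f x * (cderiv h x)^*) + cderiv g x * (cderiv h x)^*)%R); last first.
  by move=> x _; ring.
rewrite (cintD mJ (cintegrableZ z mJ I1) I2) (cintD mJ (cintegrableZ z mJ I3) I4).
rewrite (cintZ z mJ I1) (cintZ z mJ I3) /H1_dot.
move: (cintegral leb J _) (cintegral leb J _) (cintegral leb J _) (cintegral leb J _) => A C D F.
by ring.
Qed.

Lemma H1_dot_herm f g : H1 J f -> H1 J g -> H1_dot J g f = ((H1_dot J f g)^*)%R.
Proof.
move=> [_ fL kL] [_ gL lL].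
have I1 : cintegrable leb J (fun x => f x * (g x)^*)%R by exact: (L2_mul mJ fL (L2J gL)).
have I2 : cintegrable leb J (fun x => cderiv f x * (cderiv g x)^*)%R by exact: (L2_mul mJ kL (L2J lL)).
have e1 := cintJ mJ I1; have e2 := cintJ mJ I2.
have conj4 (x y : R[i]) : ((4^-1 * x + y)^* = 4^-1 * x^* + y^*)%R.
  by rewrite rmorphD rmorphM fmorphV rmorph_nat.
rewrite /H1_dot conj4 -e1 -e2.
congr (_ * _ + _); apply: eq_cint => x _; rewrite rmorphM mulrC; congr (_ * _).
  exact: esym (conjCK _).
exact: esym (conjCK _).
Qed.

Lemma H1_dotDl f g h : H1 J f -> H1 J g -> H1 J h ->
  H1_dot J (fun x => f x + g x) h = H1_dot J f h + H1_dot J g h.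
Proof.
move=> fH gH hH; have := H1_dot_linear 1 fH gH hH; rewrite mul1r => <-.
suff -> : (fun x => f x + g x) = (fun x => 1 * f x + g x) by [].
by apply/funext => x; rewrite mul1r.
Qed.

Lemma H1_dotJDr f g h : H1 J f -> H1 J g -> H1 J h ->
  H1_dot J h (fun x => (f x + g x)^*)%R =
  H1_dot J h (fun x => (f x)^*)%R + H1_dot J h (fun x => (g x)^*)%R.
Proof.
move=> fH gH hH; have fJ := H1J fH; have gJ := H1J gH.
have -> : (fun x => (f x + g x)^*)%R = (fun x => 1 * (f x)^* + (g x)^*)%R.
  by apply/funext => x; rewrite mul1r rmorphD.
rewrite (H1_dot_herm (H1_linear 1 fJ gJ) hH) (H1_dot_linear 1 fJ gJ hH) mul1r rmorphD.
by rewrite (H1_dot_herm fJ hH) (H1_dot_herm gJ hH).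
Qed.

Lemma Re_dot_self f : H1 J f -> complex.Re (H1_dot J f f) =
  4^-1 * \int[leb]_(x in J) (normc (f x) ^+ 2) + \int[leb]_(x in J) (normc (cderiv f x) ^+ 2).
Proof.
move=> _; rewrite /H1_dot cReD (_ : 4^-1 = (4^-1 : R)%:C); last first.
  by rewrite rmorphV ?unitfE//= rmorph_nat.
rewrite cReM cReC cImC mul0r subr0 !Re_cint.
by congr (_ * _ + _); apply: eq_Rintegral => x _; rewrite normc_sqr cReM cReJ cImJ; ring.
Qed.

Lemma H1_dot_ge0 f : H1 J f -> 0 <= complex.Re (H1_dot J f f).
Proof.
move=> fH; rewrite Re_dot_self//.
apply: addr_ge0; first apply: mulr_ge0 => //; by apply: Rintegral_ge0 => x _; exact: sqr_ge0.
Qed.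

Lemma vanishes_linear z f g : vanishes_at_c c plus f -> vanishes_at_c c plus g ->
  vanishes_at_c c plus (fun x => z * f x + g x).
Proof.
rewrite /vanishes_at_c; case: plus; first by move=> -> ->; rewrite mulr0 addr0.
move=> f0 g0.
have u0 : (normc z * normc (f x) + normc (g x)) @[x --> c^'-] --> (0 : R).
  by rewrite -(addr0 0) -{1}(mulr0 (normc z)); apply: cvgD => //; apply: cvgMr.
apply: (squeeze_cvgr _ (cvg_cst 0) u0).
by apply: nearW => x; rewrite normc_ge0 /= -normcM ler_normcD.
Qed.

Lemma H10_linear z (f g : cfun R) : pts H10 f -> pts H10 g -> pts H10 (z *: f + g).
Proof.
move=> [fH f0] [gH g0]; split; first exact: H1_linear.
exact: vanishes_linear.
Qed.

Lemma eqv_near_derive f g x : inner_half_line c plus x ->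
  (forall y, J y -> f y = g y) -> cderiv f x = cderiv g x.
Proof.
move=> Jx fg; have n : \near x, f x = g x.
  have oJ : open (inner_half_line c plus) by rewrite /inner_half_line; case: plus; exact: itv_open_ends_open.
  have := open_nbhs_nbhs (conj oJ Jx).
  by apply: filterS => y /(@inner_sub R c plus); exact: fg.
by rewrite /cderiv; congr (_ +i* _); apply: near_eq_derive1; apply: filterS n => y ->.
Qed.

Lemma inner_ae : {ae leb, forall x, J x -> inner_half_line c plus x}.
Proof.
exists [set c]; split; [exact: measurable_set1|exact: lebesgue_measure_set1|].
move=> x /= /not_implyP[Jx nJx]; apply: contrapT => /eqP xc; apply: nJx.
move: Jx; rewrite /half_line /inner_half_line; case: plus => //=.
by rewrite !in_itv /= !andbT lt_neqAle eq_sym xc.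
Qed.

Lemma H1_dot_eqv f f' g g' : H1 J f -> H1 J f' -> H1 J g -> H1 J g' ->
  (forall y, J y -> f y = f' y) -> (forall y, J y -> g y = g' y) ->
  H1_dot J f g = H1_dot J f' g'.
Proof.
move=> [_ _ k1] [_ _ k2] [_ _ k3] [_ _ k4] ff' gg'.
rewrite /H1_dot (@eq_cint _ leb J _ (fun x => f' x * (g' x)^*)%R); last first.
  by move=> x Jx; rewrite ff'// gg'.
have m1 : cmeasurable J (fun x => cderiv f x * (cderiv g x)^*)%R.
  by apply: cmeasurableM; [exact: L2_cmeasurable k1|apply: cmeasurableJ; exact: L2_cmeasurable k3].
have m2 : cmeasurable J (fun x => cderiv f' x * (cderiv g' x)^*)%R.
  by apply: cmeasurableM; [exact: L2_cmeasurable k2|apply: cmeasurableJ; exact: L2_cmeasurable k4].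
suff e : {ae leb, forall x, J x -> cderiv f x * (cderiv g x)^* = cderiv f' x * (cderiv g' x)^*}%R.
  by rewrite (cint_ae_eq mJ m1 m2 e).
apply: filterS inner_ae => x Jx /Jx {}Jx.
by rewrite (eqv_near_derive Jx ff') (eqv_near_derive Jx gg').
Qed.

Lemma nrmE f : nrm H10 f = Num.sqrt (complex.Re (H1_dot J f f)).
Proof. by []. Qed.

Lemma nrm_ge0 f : 0 <= nrm H10 f. Proof. exact: sqrtr_ge0. Qed.

Lemma H1_CS f g : H1 J f -> H1 J g -> normc (H1_dot J f g) <= nrm H10 f * nrm H10 g.
Proof.
move=> fH gH; exact: (@cauchy_schwarz R (cfun R) (H1 J) (H1_dot J) H1_linear H1_dot_linear H1_dot_herm H1_dot_ge0 f g).
Qed.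

Lemma H10_triangle (f g : cfun R) : H1 J f -> H1 J g ->
  nrm H10 (f + g) <= nrm H10 f + nrm H10 g.
Proof.
move=> fH gH; exact: (@nrm_triangle R (cfun R) (H1 J) (H1_dot J) H1_linear H1_dot_linear H1_dot_herm H1_dot_ge0 f g).
Qed.

Lemma H10_scale z (f : cfun R) : H1 J f -> nrm H10 (z *: f) = normc z * nrm H10 f.
Proof.
move=> fH; exact: (@nrm_scale R (cfun R) (H1 J) (H1_dot J) H1_linear H1_dot_linear H1_dot_herm z f).
Qed.

End HalfLineSpace.

(** * Gluing primitives *)

Section Gluing.
Context {R : realType}.
Local Notation B := (measurableTypeR R).
Local Notation leb := (@lebesgue_measure R).
Implicit Types (J : set R) (f k : R -> R[i]) (a b q x y : R).

Lemma cintegrable_setU (mu : {measure set B -> \bar R}) (D E : set B) f :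
  measurable D -> measurable E -> cintegrable mu D f -> cintegrable mu E f ->
  cintegrable mu (D `|` E) f.
Proof.
move=> mD mE fD fE.
have mf : cmeasurable (D `|` E) f.
  have [dr di] := cintegrable_measurable fD; have [er ei] := cintegrable_measurable fE.
  by split; apply/measurable_funU.
apply: cintegrable_normc => //; first exact: measurableU.
apply/integrableP; split.
  by apply/measurable_EFinP; exact: measurable_normc.
have mn : measurable_fun (D `|` E) (fun x => `|(normc (f x))%:E|%E).
  by apply: measurableT_comp => //; apply/measurable_EFinP; exact: measurable_normc.
have -> : D `|` E = D `|` (E `\` D) by rewrite setUDr setDv setD0.
rewrite ge0_integral_setU//; first last.
- by rewrite disj_set2E setDIK.
- rewrite setUDr setDv setD0; exact: mn.
- exact: measurableD.
have /integrableP[_ H1] := integrable_normc mD fD.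
have /integrableP[_ H2] := integrable_normc mE fE.
rewrite lte_add_pinfty//; apply: le_lt_trans H2.
apply: ge0_subset_integral => //; first exact: measurableD.
by apply: measurable_funS mn; [exact: measurableU|exact: subsetUr].
Qed.

Lemma cint_cc_split (mu : {measure set B -> \bar R}) a b q f : a <= q -> q <= b ->
  cintegrable mu `[a, b] f ->
  cintegral mu `[a, b] f = cintegral mu `[a, q] f + cintegral mu `]q, b] f.
Proof.
move=> aq qb fI.
have E : `[a, b] = `[a, q] `|` `]q, b] :> set R.
  by rewrite -(@itv_bndbnd_setU _ _ (BLeft a) (BRight q) (BRight b)) ?bnd_simp.
rewrite {1}E cintU//; first by rewrite -E.
by apply/seteqP; split => // x [] /=; rewrite !in_itv /=; lra.
Qed.

Lemma cint_oc_cc q b f : cmeasurable `]q, b] f ->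
  cintegral leb `]q, b] f = cintegral leb `[q, b] f.
Proof.
move=> [fr fi]; rewrite /cintegral; congr (fine _ +i* fine _).
- by apply: integral_itv_obnd_cbnd; apply/measurable_EFinP.
- by apply: integral_itv_obnd_cbnd; apply/measurable_EFinP.
Qed.

Lemma primitive_glue J q f1 k1 f2 k2 : is_interval J -> f1 q = f2 q ->
  primitive (J `&` `]-oo, q]) f1 k1 -> primitive (J `&` `[q, +oo[) f2 k2 ->
  primitive J (fun x => if x <= q then f1 x else f2 x)
              (fun x => if x <= q then k1 x else k2 x).
Proof.
move=> iJ fq [k1I f1E] [k2I f2E].
have mcc a b : measurable (`[a, b] : set B) by exact: measurable_itv.
have moc a b : measurable (`]a, b] : set B) by exact: measurable_itv.
have left_ a b : `[a, b] `<=` J -> b <= q ->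
    cintegrable leb `[a, b] (fun x => if x <= q then k1 x else k2 x).
  move=> abJ bq; apply: (@eq_cintegrable _ _ _ k1) => //.
    by move=> x /=; rewrite in_itv /= => /andP[_ xb]; rewrite (le_trans xb bq).
  apply: k1I => x xab; split; first exact: abJ.
  by move: xab; rewrite /= !in_itv /= => /andP[_ /le_trans]; exact.
have right_ a b : `[a, b] `<=` J -> q <= a ->
    cintegrable leb `]a, b] (fun x => if x <= q then k1 x else k2 x).
  move=> abJ qa; apply: (@eq_cintegrable _ _ _ k2) => //.
    move=> x /=; rewrite in_itv /= => /andP[ax _].
    by rewrite leNgt (le_lt_trans qa ax).
  apply: (@cintegrableS _ _ _ `[a, b]) => //; first exact: subset_itv_oc_cc.
  apply: k2I => x xab; split; first exact: abJ.
  by move: xab; rewrite /= !in_itv /= andbT => /andP[/(le_trans qa)].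
split => [a b abJ|x y Jx Jy xy].
  have [bq|qb] := leP b q; first exact: left_.
  have [aq|qa] := leP a q.
    have E : `[a, b] = `[a, q] `|` `]q, b] :> set R.
      by rewrite -(@itv_bndbnd_setU _ _ (BLeft a) (BRight q) (BRight b)) ?bnd_simp// ltW.
    rewrite E; apply: cintegrable_setU => //.
      by apply: left_ => // t; move=> /= taq; apply: abJ; move: taq; rewrite /= !in_itv /=; move: qb; lra.
    by apply: right_ => // t; move=> /= taq; apply: abJ; move: taq; rewrite /= !in_itv /=; move: qb; lra.
  apply: (@eq_cintegrable _ _ _ k2) => //.
    move=> x /=; rewrite in_itv /= => /andP[ax _].
    by rewrite leNgt (lt_le_trans qa ax).
  apply: k2I => x xab; split; first exact: abJ.
  by move: xab; rewrite /= !in_itv /= andbT => /andP[/(le_trans (ltW qa))].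
have L s t : J s -> J t -> s <= t -> t <= q -> f1 t - f1 s =
    cintegral leb `[s, t] (fun x => if x <= q then k1 x else k2 x).
  move=> Js Jt st tq; have H1 : (J `&` `]-oo, q]) s by split; [exact: Js|rewrite /= in_itv /= (le_trans st tq)].
  have H2 : (J `&` `]-oo, q]) t by split; [exact: Jt|rewrite /= in_itv].
  rewrite (f1E _ _ H1 H2 st).
  by apply: eq_cint => u /=; rewrite in_itv /= => /andP[_ ut]; rewrite (le_trans ut).
have RR s t : J s -> J t -> s <= t -> q <= s -> f2 t - f2 s =
    cintegral leb `]s, t] (fun x => if x <= q then k1 x else k2 x).
  move=> Js Jt st qs; have stJ : `[s, t] `<=` J `&` `[q, +oo[.
    move=> u us; split; first exact: (itv_sub 0 0 iJ Js Jt).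
    by move: us; rewrite /= !in_itv /= andbT => /andP[/(le_trans qs)].
  have H1 : (J `&` `[q, +oo[) s by split; [exact: Js|rewrite /= in_itv /= qs].
  have H2 : (J `&` `[q, +oo[) t by split; [exact: Jt|rewrite /= in_itv /= (le_trans qs st)].
  rewrite (f2E _ _ H1 H2 st).
  rewrite -cint_oc_cc; last first.
    apply: (@cintegrable_measurable _ leb); apply: (@cintegrableS _ _ _ `[s, t]) => //; last exact: k2I.
    exact: subset_itv_oc_cc.
  apply: eq_cint => u /=; rewrite in_itv /= => /andP[su _].
  by rewrite leNgt (le_lt_trans qs su).
have xyJ := itv_sub 0 0 iJ Jx Jy.
have [yq|qy] := leP y q; first by rewrite (le_trans xy yq) L.
have [xq|qx] := leP x q; last first.
  rewrite RR// ?(ltW qx)//; apply: cint_oc_cc.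
  by apply: (@cintegrable_measurable _ leb); exact: right_ (ltW qx).
have Jq : J q by apply: iJ Jx Jy _ _; rewrite xq ltW.
rewrite (@cint_cc_split _ _ _ q)//; last 2 first.
- exact: ltW.
- have E : `[x, y] = `[x, q] `|` `]q, y] :> set R.
    by rewrite -(@itv_bndbnd_setU _ _ (BLeft x) (BRight q) (BRight y)) ?bnd_simp// ltW.
  rewrite E; apply: cintegrable_setU => //.
    by apply: left_ => //; exact: itv_sub.
  by apply: right_ => //; exact: itv_sub.
by rewrite -L// -RR// ?ltW// fq; ring.
Qed.

Lemma primitive_cst J (z : R[i]) : primitive J (fun=> z) (fun=> 0).
Proof.
split => [a b _|x y _ _ _]; first exact: cintegrable0.
by rewrite subrr cint0.
Qed.

Lemma leb_cc_fin a b : (leb `[a, b] < +oo)%E.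
Proof. by rewrite lebesgue_measure_itv /=; case: ifP => _; rewrite ?ltry// -EFinD ltry. Qed.

Lemma Rint_cst a b (r : R) : a <= b -> \int[leb]_(x in `[a, b]) r = r * (b - a).
Proof.
move=> ab; rewrite /Rintegral integral_cst; last exact: measurable_itv.
have E : leb `[a, b] = (b - a)%:E.
  rewrite lebesgue_measure_itv /= lte_fin; case: ltgtP ab => // -> _.
  by rewrite subrr.
by transitivity (fine (r%:E * (b - a)%:E)); [congr (fine (_ * _)); exact: E|].
Qed.

Lemma primitive_id J : primitive J (fun x => x%:C) (fun=> 1).
Proof.
split => [a b _|x y _ _ xy].
  apply: (@cintegrable_bounded _ _ _ _ 1); [exact: measurable_itv|exact: leb_cc_fin|exact: cmeasurable_cst|].
  by move=> x _; rewrite normc_real normr1.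
apply: complex_eq; rewrite ?(cReD, cImD, cReN, cImN, cReC, cImC) ?Re_cint ?Im_cint /=.
  by apply: esym; apply: etrans (Rint_cst 1 xy) _; rewrite mul1r.
by rewrite subrr /Rintegral integral0.
Qed.

Lemma primitive_affine J (z w : R[i]) : is_interval J ->
  primitive J (fun x => z * x%:C + w) (fun=> z).
Proof.
move=> iJ; have := primitive_linear z iJ (primitive_id J) (primitive_cst J w).
by under [X in primitive _ _ X -> _]eq_fun do rewrite mulr1 addr0.
Qed.

End Gluing.

(** * Point evaluations and density of compactly supported functions *)

Section SobolevBound.
Context {R : realType}.
Local Notation B := (measurableTypeR R).
Local Notation leb := (@lebesgue_measure R).
Implicit Types (f k : R -> R[i]).

(** The pointwise values of an [H^1] function are bounded by its norm on a
    neighbouring unit interval: average [f x = f y + (f x - f y)] over [y]. *)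
Lemma local_sup (p x : R) f k : primitive `[p, p + 1] f k ->
  L2 leb `[p, p + 1] f -> L2 leb `[p, p + 1] k -> p <= x -> x <= p + 1 ->
  normc (f x) ^+ 2 <= 8 * (\int[leb]_(t in `[p, p + 1]) (normc (f t) ^+ 2) +
                           \int[leb]_(t in `[p, p + 1]) (normc (k t) ^+ 2)).
Proof.
move=> [kI fE] fL kL px xp; set D := (`[p, p + 1] : set B).
have mD : measurable D by exact: measurable_itv.
have leb1 : leb D = 1%E.
  by rewrite /D lebesgue_measure_itv /= lte_fin ltrDl ltr01 -EFinB addrAC subrr add0r.
have Dfin : (leb D < +oo)%E by rewrite leb1 ltry.
have avg r : \int[leb]_(t in D) r = r by rewrite Rint_cst ?lerDl// addrAC subrr add0r mulr1.
have csti r : leb.-integrable D (EFin \o (fun=> r)).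
  by apply: measurable_bounded_integrable => //; exact: bounded_cst.
have nk := integrable_normc mD (kI _ _ (@subset_refl _ D)).
have [mf f2] := (L2P leb f mD).1 fL; have [mk k2] := (L2P leb k mD).1 kL.
set I := \int[leb]_(t in D) normc (k t).
have I0 : 0 <= I by apply: Rintegral_ge0 => t _; exact: normc_ge0.
have II : I ^+ 2 <= \int[leb]_(t in D) (normc (k t) ^+ 2).
  have : 0 <= \int[leb]_(t in D) ((normc (k t) ^+ 2 - 2 * I * normc (k t)) + I ^+ 2).
    apply: Rintegral_ge0 => t _.
    by rewrite (_ : _ + _ = (normc (k t) - I) ^+ 2) ?sqr_ge0//; ring.
  have i1 : leb.-integrable D (EFin \o (fun t => 2 * I * normc (k t))).
    exact: (integrableZl mD (2 * I) nk).
  rewrite RintegralD//; last exact: (integrableB mD k2 i1).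
  by rewrite RintegralB// RintegralZl// avg -/I; lra.
have key y : D y -> normc (f x) ^+ 2 <= 2 * normc (f y) ^+ 2 + 8 * I ^+ 2.
  move=> Dy; have {}Dy := Dy; rewrite /D /= in_itv /= in Dy.
  have bnd s t : p <= s -> t <= p + 1 -> s <= t -> normc (f t - f s) <= 2 * I.
    move=> ps tp st; have sD : D s by rewrite /D /= in_itv /= ps (le_trans st).
    have tD : D t by rewrite /D /= in_itv /= tp (le_trans ps).
    rewrite fE//; have mst : measurable (`[s, t] : set B) by exact: measurable_itv.
    have stD : `[s, t] `<=` D by move=> u; rewrite /D /= !in_itv /=; lra.
    have kst : cintegrable leb `[s, t] k by exact: cintegrableS (kI _ _ (@subset_refl _ D)).
    apply: le_trans (ler_normc_cint mst kst (integrable_normc mst kst) (fun x _ => lexx _)) _.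
    rewrite ler_pM2l// /Rintegral fine_le ?integrable_fin_num//.
    - exact: integrable_normc.
    - apply: ge0_subset_integral => //; first by case/integrableP: nk.
      by move=> u _; rewrite lee_fin normc_ge0.
  have H : normc (f x) <= normc (f y) + 2 * I.
    rewrite -[f x](subrK (f y)) addrC (le_trans (ler_normcD _ _))// lerD2l.
    have [xy|/ltW yx] := leP x y; first by rewrite normcBC; apply: bnd => //; lra.
    by apply: bnd => //; lra.
  have := normc_ge0 (f x); have := normc_ge0 (f y) => fy0 fx0.
  have : normc (f x) ^+ 2 <= (normc (f y) + 2 * I) ^+ 2.
    by rewrite ler_pXn2r ?nnegrE// addr_ge0// mulr_ge0.
  have : 0 <= (normc (f y) - 2 * I) ^+ 2 by exact: sqr_ge0.
  by rewrite sqrrB sqrrD !exprMn; lra.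
have := @le_Rintegral _ _ _ leb D (fun=> normc (f x) ^+ 2)
  (fun y => 2 * normc (f y) ^+ 2 + 8 * I ^+ 2) mD (csti _).
rewrite avg RintegralD// ?RintegralZl// ?avg; last exact: (integrableZl mD 2 f2).
have W : leb.-integrable D (EFin \o (fun y => 2 * normc (f y) ^+ 2 + 8 * I ^+ 2)).
  exact: (integrableD mD (integrableZl mD 2 f2) (csti (8 * I ^+ 2))).
move=> /(_ W key) H; apply: (le_trans H).
have : 0 <= \int[leb]_(t in D) (normc (f t) ^+ 2) by apply: Rintegral_ge0 => t _; exact: sqr_ge0.
by rewrite mulrDr; move: II; lra.
Qed.

End SobolevBound.

Section HalfLineBounds.
Context {R : realType}.
Local Notation B := (measurableTypeR R).
Local Notation leb := (@lebesgue_measure R).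
Variables (c : R) (plus : bool).
Local Notation J := (half_line c plus).
Local Notation H10 := (H10_space c plus).
Implicit Types (f g k l : R -> R[i]) (z : R[i]).

Let mJ := half_line_measurable c plus.
Let iJ := @half_line_interval R c plus.
Let sJ := @half_sigma R c plus.

Lemma ac_cmeasurable a b f : a <= b -> abs_continuous_on a b f ->
  cmeasurable (`[a, b] : set B) f.
Proof.
move=> ab /ac_real[fr fi]; split.
- apply: (@eq_measurable_fun _ _ _ _ _ ((fun x => complex.Re (f x)) \o clip a b)).
    by move=> x; rewrite inE /= in_itv /= => /andP[ax xb]; rewrite clip_id.
  apply: (@measurable_funS _ _ _ _ setT) => //.
  by apply: continuous_measurable_fun; exact: rac_clip_continuous.
- apply: (@eq_measurable_fun _ _ _ _ _ ((fun x => complex.Im (f x)) \o clip a b)).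
    by move=> x; rewrite inE /= in_itv /= => /andP[ax xb]; rewrite clip_id.
  apply: (@measurable_funS _ _ _ _ setT) => //.
  by apply: continuous_measurable_fun; exact: rac_clip_continuous.
Qed.

Lemma primitive_cmeasurable (E : set R) (a b : nat -> R) f k : sigma_itv E a b ->
  primitive E f k -> cmeasurable (E : set B) f /\ cmeasurable (E : set B) k.
Proof.
move=> Eab fk; have [ab EE] := Eab; have acf := primitive_ac fk; have [kI _] := fk.
have mab n : measurable (`[a n, b n] : set B) by exact: measurable_itv.
rewrite {1 2}EE; split; apply: cmeasurable_bigcup => // n.
  by apply: ac_cmeasurable => //; apply: acf; exact: sigma_itv_sub Eab.
by apply: (@cintegrable_measurable _ leb); apply: kI; exact: sigma_itv_sub Eab.
Qed.

(** The integrand of the squared norm of [H^1]. *)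
Definition dens f k (x : R) : R := 4^-1 * normc (f x) ^+ 2 + normc (k x) ^+ 2.

Lemma dens_ge0 f k x : 0 <= dens f k x.
Proof. by rewrite addr_ge0 ?mulr_ge0 ?invr_ge0 ?exprn_ge0 ?normc_ge0. Qed.

Lemma dens_integrable (D : set B) f k : measurable D -> L2 leb D f -> L2 leb D k ->
  leb.-integrable D (EFin \o dens f k).
Proof.
move=> mD /(L2P _ _ mD)[_ fI] /(L2P _ _ mD)[_ kI].
exact: (integrableD mD (integrableZl mD 4^-1 fI) kI).
Qed.

Lemma Rint_dens (D : set B) f k : measurable D -> L2 leb D f -> L2 leb D k ->
  \int[leb]_(x in D) dens f k x =
  4^-1 * \int[leb]_(x in D) (normc (f x) ^+ 2) + \int[leb]_(x in D) (normc (k x) ^+ 2).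
Proof.
move=> mD /(L2P _ _ mD)[_ fI] /(L2P _ _ mD)[_ kI].
rewrite /dens RintegralD//; last exact: (integrableZl mD 4^-1 fI).
by rewrite RintegralZl.
Qed.

Lemma nrm_sqr f k : H1 J f -> primitive J f k -> L2 leb J k ->
  nrm H10 f ^+ 2 = \int[leb]_(x in J) dens f k x.
Proof.
move=> fH fk kL; have [_ fL _] := fH; have mk := L2_cmeasurable kL.
rewrite nrmE sqr_sqrtr ?H1_dot_ge0// (half_dotE fH fH fk fk mk mk) Rint_dens//.
rewrite cReD (_ : 4^-1 = (4^-1 : R)%:C); last by rewrite rmorphV ?unitfE//= rmorph_nat.
rewrite cReM cReC cImC mul0r subr0 !Re_cint.
by congr (_ * _ + _); apply: eq_Rintegral => x _; rewrite normc_sqr cReM cReJ cImJ; ring.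
Qed.

Lemma ge0_Rint_sub (D E : set B) (h : R -> R) : measurable D -> measurable E -> D `<=` E ->
  leb.-integrable E (EFin \o h) -> (forall x, 0 <= h x) ->
  \int[leb]_(x in D) h x <= \int[leb]_(x in E) h x.
Proof.
move=> mD mE DE hI h0; have hD := integrableS mE mD DE hI.
rewrite /Rintegral fine_le ?integrable_fin_num//.
apply: ge0_subset_integral => //; first by case/integrableP: hI.
by move=> x _; rewrite lee_fin.
Qed.

Lemma unit_interval (x : R) : J x -> exists2 p, `[p, p + 1] `<=` J & p <= x <= p + 1.
Proof.
rewrite /half_line; case: plus => /=; rewrite in_itv /= ?andbT => cx.
  exists x; last by apply/andP; split; lra.
  by move=> t /=; rewrite !in_itv /= andbT; lra.
exists (x - 1); last by apply/andP; split; lra.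
by move=> t /=; rewrite !in_itv /=; lra.
Qed.

Lemma local_sup_dens p x f k : `[p, p + 1] `<=` J -> primitive J f k ->
  L2 leb J f -> L2 leb J k -> p <= x <= p + 1 ->
  normc (f x) ^+ 2 <= 32 * \int[leb]_(t in `[p, p + 1]) dens f k t.
Proof.
move=> pJ fk fL kL /andP[px xp].
have mD : measurable (`[p, p + 1] : set B) by exact: measurable_itv.
have fD := L2S mD mJ pJ fL; have kD := L2S mD mJ pJ kL.
have := local_sup (primitiveS pJ fk) fD kD px xp.
rewrite (Rint_dens mD fD kD).
have : 0 <= \int[leb]_(t in `[p, p + 1]) (normc (k t) ^+ 2).
  by apply: Rintegral_ge0 => t _; exact: sqr_ge0.
move: (\int[leb]_(t in `[p, p + 1]) _) (\int[leb]_(t in `[p, p + 1]) _) => I1 I2.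
by lra.
Qed.

(** Every point of [J] lies in a unit segment contained in [J], to which
    [local_sup] applies. *)
Lemma sup_bound f x : H1 J f -> J x -> normc (f x) <= 6 * nrm H10 f.
Proof.
move=> fH Jx; have [p pJ pxp] := unit_interval Jx; have [_ fL kL] := fH.
have fk := H1J_primitive fH.
have mD : measurable (`[p, p + 1] : set B) by exact: measurable_itv.
have h := local_sup_dens pJ fk fL kL pxp.
have h2 := ge0_Rint_sub mD mJ pJ (dens_integrable mJ fL kL) (dens_ge0 f _).
have h3 := nrm_sqr fH fk kL.
rewrite -(ler_pXn2r (n := 2)) ?nnegrE ?normc_ge0 ?mulr_ge0 ?nrm_ge0//.
rewrite exprMn h3; move: h h2.
have : 0 <= \int[leb]_(t in J) dens f (cderiv f) t.
  by apply: Rintegral_ge0 => t _; exact: dens_ge0.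
move: (\int[leb]_(t in `[p, p + 1]) _) (\int[leb]_(t in J) _) (normc _ ^+ 2) => I1 I2 N.
by lra.
Qed.

Definition tail n : set R := J `\` `]inner_l c plus n, inner_r c plus n[.

Lemma tail_measurable n : measurable (tail n : set B).
Proof. by apply: measurableD => //; exact: measurable_itv. Qed.

Lemma tail_cvg (h : R -> R) : leb.-integrable J (EFin \o h) -> (forall x, 0 <= h x) ->
  forall e : R, 0 < e -> exists N, forall n, (N <= n)%N -> \int[leb]_(x in tail n) h x < e.
Proof.
move=> hI h0 e e0.
pose F n : set B := `]inner_l c plus n, inner_r c plus n[.
have mF n : measurable (F n) by exact: measurable_itv.
have FJ n : F n `<=` J.
  have [l_in r_in] := inner_inside c plus n.
  move=> x; rewrite /F /= in_itv /= => /andP[lx xr]; apply: inner_sub.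
  by apply: (@inner_interval R c plus _ _ l_in r_in); rewrite !ltW.
have ndF : nondecreasing_seq F.
  move=> m n mn; apply/subsetPset => x; rewrite /F /= !in_itv /=.
  have [h1 h2] := inner_mono c plus mn; move=> /andP[a b].
  by rewrite (le_lt_trans h1 a) (lt_le_trans b h2).
have UF : \bigcup_n F n = inner_half_line c plus.
  apply/seteqP; split => [x [n _]|x /inner_cover[n [lx xr]]].
    have [l_in r_in] := inner_inside c plus n.
    rewrite /F /= in_itv /= => /andP[lx xr].
    by apply: (@inner_interval R c plus _ _ l_in r_in); rewrite !ltW.
  by exists n => //; rewrite /F /= in_itv /= lx.
have mh : measurable_fun J (EFin \o h) by case/integrableP: hI.
have := @ge0_nondecreasing_set_cvg_integral _ _ _ F (EFin \o h) leb ndF mF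
  (fun i => measurable_funS mJ (FJ i) mh) (fun i x _ => h0 x).
have mI : measurable (inner_half_line c plus : set B).
  by rewrite -UF; exact: bigcup_measurable.
rewrite UF.
have -> : (\int[leb]_(x in inner_half_line c plus) (EFin \o h) x =
           (\int[leb]_(x in J) h x)%:E)%E.
  rewrite /Rintegral fineK ?integrable_fin_num//.
  rewrite [RHS](@negligible_integral _ _ _ leb J [set c] _ (measurable_set1 c) mJ hI (lebesgue_measure_set1 c)).
  congr (integral _ _ _); apply/seteqP; split => x.
    move=> xi; split; first exact: inner_sub xi.
    move=> xc; move: xi; rewrite xc /inner_half_line.
    by case: plus => /=; rewrite in_itv /= ltxx.
  move=> [Jx /eqP xc]; move: Jx; rewrite /half_line /inner_half_line.
  by case: plus; rewrite /= !in_itv /= ?andbT => // cx; rewrite lt_neqAle eq_sym xc.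
move=> /fine_cvg /= /cvgrPdist_lt /(_ e e0)[N _ HN]; exists N => n Nn.
have := HN n Nn; rewrite /= -/(Rintegral _ _ _).
have hT := integrableS mJ (tail_measurable n) (@subDsetl _ _ _) hI.
have hF := integrableS mJ (mF n) (FJ n) hI.
have -> : \int[leb]_(x in J) h x = \int[leb]_(x in tail n) h x + \int[leb]_(x in F n) h x.
  have JE : J = tail n `|` F n by rewrite /tail setUC setDUK//; exact: FJ.
  rewrite {1}JE Rintegral_setU//; [exact: tail_measurable|by rewrite -JE|].
  by rewrite disj_set2E /tail setDKI.
rewrite /Rintegral /= addrK ger0_norm//.
by apply: fine_ge0; apply: integral_ge0 => x _; rewrite lee_fin.
Qed.

(** The end of the segment that tends to [c], and the one that tends to
    infinity. *)
Let near_end n := if plus then inner_l c plus n else inner_r c plus n.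
Let far_end n := if plus then inner_r c plus n else inner_l c plus n.

Lemma near_end_cvg f : H1 J f -> vanishes_at_c c plus f ->
  forall e : R, 0 < e -> exists N, forall n, (N <= n)%N -> normc (f (near_end n)) < e.
Proof.
move=> [acf _ _]; rewrite /near_end /inner_l /inner_r; move: acf.
rewrite /half_line /vanishes_at_c; case: plus => [acf fc e e0|_].
  have cJ : `[c, c + 1] `<=` `[c, +oo[ by move=> x /=; rewrite !in_itv /= andbT => /andP[].
  have [d d0 H] := acf _ _ cJ _ e0.
  have [N _ HN] := near_infty_natSinv_lt (PosNum d0).
  exists N => n Nn; have /= nd := HN n Nn; have n1 : n.+1%:R^-1 <= 1 :> R by exact: invn_lt1.
  have n0 : 0 < n.+1%:R^-1 :> R by rewrite invr_gt0.
  have := H 1%N (fun=> c) (fun=> c + n.+1%:R^-1).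
  rewrite !big_ord_recl !big_ord0 !addr0 fc subr0; apply.
  - by move=> _; rewrite lexx lerDl lerD2l ltW.
  - by move=> i j; rewrite !ord1.
  - by rewrite addrAC subrr add0r.
move=> /cvgrPdist_lt H e e0.
have [d /= d0 Hd] := H e e0.
have [N _ HN] := near_infty_natSinv_lt (PosNum d0).
exists N => n Nn; have /= nd := HN n Nn.
have n0 : 0 < n.+1%:R^-1 :> R by rewrite invr_gt0.
have H1 : ball_ [eta Num.Def.normr] c d (c - n.+1%:R^-1).
  by rewrite /ball_ /= opprB addrC subrK ger0_norm// ltW.
have H2 : c - n.+1%:R^-1 < c by rewrite ltrBlDr ltrDl.
by have := Hd _ H1 H2; rewrite sub0r normrN ger0_norm ?normc_ge0.
Qed.

(** The unit segment beyond the far end lies in the tail. *)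
Lemma far_end_bound f n : H1 J f ->
  normc (f (far_end n)) ^+ 2 <= 32 * \int[leb]_(t in tail n) dens f (cderiv f) t.
Proof.
move=> fH; have fk := H1J_primitive fH; have [_ fL kL] := fH.
pose p := if plus then inner_r c plus n else inner_l c plus n - 1.
have [l_in r_in] := inner_inside c plus n.
have pT : `[p, p + 1] `<=` tail n.
  move: l_in r_in; rewrite /p /tail /half_line /inner_half_line.
  move: (inner_l c plus n) (inner_r c plus n) => l r.
  by case: plus; rewrite /= !in_itv /= ?andbT => lc rc x /=; rewrite !in_itv /= ?andbT => xp; split; lra.
have pJ : `[p, p + 1] `<=` J by apply: subset_trans pT _; exact: subDsetl.
have mD : measurable (`[p, p + 1] : set B) by exact: measurable_itv.
have fI := dens_integrable mJ fL kL.
have h1 : normc (f (far_end n)) ^+ 2 <= 32 * \int[leb]_(t in `[p, p + 1]) dens f (cderiv f) t.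
  apply: local_sup_dens => //; rewrite /p /far_end; case: plus; apply/andP; split; lra.
apply: le_trans h1 _; rewrite ler_pM2l//.
have mT := tail_measurable n.
exact: (ge0_Rint_sub mD mT pT (integrableS mJ mT (@subDsetl _ _ _) fI) (dens_ge0 f _)).
Qed.

Lemma inner_lt2 n : inner_l c plus n.+1 + 2 <= inner_r c plus n.+1.
Proof.
have h : n.+2%:R^-1 <= 1 :> R by exact: invn_lt1.
have h2 : 3 <= n.+3%:R :> R by rewrite ler_nat.
rewrite /inner_l /inner_r; move: (n.+2%:R^-1) (n.+3%:R) h h2 => e N h h2.
by case: plus; lra.
Qed.

Section Cut.
Variables (f : R -> R[i]) (a b : R).
Hypotheses (fH : H1 J f) (Ja : inner_half_line c plus a) (Jb : inner_half_line c plus b).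
Hypothesis ab : a + 2 <= b.
Let k := cderiv f.

(** [f - cut] is the approximation of [f] with compact support. The part
    removed consists of the tails of [f] and of two linear ramps of unit
    length with slopes [- f a] and [f b]. *)
Definition cut (x : R) : R[i] := if x <= a then f x else
  if x <= a + 1 then - f a * x%:C + f a * (1 + a)%:C else
  if x <= b - 1 then 0 else if x <= b then f b * x%:C + f b * (1 - b)%:C else f x.

Definition dcut (x : R) : R[i] := if x <= a then k x else
  if x <= a + 1 then - f a else if x <= b - 1 then 0 else if x <= b then f b else k x.

Lemma primitive_cut : primitive J cut dcut.
Proof.
have fk : primitive J f k := H1J_primitive fH.
have pS E g l : E `<=` J -> primitive J g l -> primitive E g l by exact: primitiveS.
have abh := ab.
have iN (q : R) (E : set R) : is_interval E -> is_interval (E `&` `[q, +oo[).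
  move=> iE u v [Eu qu] [Ev _] w uw; split; first exact: iE Eu Ev _ uw.
  by move: qu uw; rewrite /= !in_itv /= !andbT; lra.
have IJ E F : E `<=` J -> E `&` F `<=` J by move=> EJ x [/EJ].
apply: primitive_glue => //; [|by apply: pS fk; apply/IJ|].
  by rewrite ifT ?lerDl// rmorphD /= rmorph1; ring.
apply: primitive_glue; [exact/iN| |by apply: pS (primitive_affine _ _ iJ); apply/IJ/IJ|].
  rewrite ifT; last by lra.
  by rewrite !rmorphD /= rmorph1; ring.
apply: primitive_glue; [exact/iN/iN| |by apply: pS (primitive_cst _ _); apply/IJ/IJ/IJ|].
  rewrite ifT; last by lra.
  by rewrite !rmorphB /= rmorph1; ring.
apply: primitive_glue; [exact/iN/iN/iN| |by apply: pS (primitive_affine _ _ iJ); apply/IJ/IJ/IJ/IJ|].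
  by rewrite !rmorphB /= rmorph1; ring.
by apply: pS fk; apply/IJ/IJ/IJ/IJ.
Qed.

Lemma cut_out (x : R) : ~ `]a, b[ x -> cut x = f x.
Proof.
have abh := ab; move=> nx; rewrite /cut; have [//|ax] := leP x a.
have bx : b <= x by rewrite leNgt; apply/negP => xb; apply: nx; rewrite /= in_itv /= ax.
do 2 (rewrite ifF; last by apply/negbTE; rewrite -ltNge; lra).
case: (leP x b) => // xb; have -> : x = b by lra.
by rewrite rmorphD rmorphN /= rmorph1; ring.
Qed.

Lemma dens_cut_out (x : R) : ~ `]a, b] x -> dens cut dcut x = dens f k x.
Proof.
have abh := ab; move=> nx; rewrite /dens cut_out; last first.
  by apply: contra_not nx => /=; rewrite !in_itv /=; lra.
rewrite /dcut; have [//|ax] := leP x a.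
have bx : b < x by rewrite ltNge; apply/negP => xb; apply: nx; rewrite /= in_itv /= ax.
by do 3 (rewrite ifF; last by apply/negbTE; rewrite -ltNge; lra).
Qed.

Let slope (z : R[i]) (t : R) : 0 <= t -> t <= 1 ->
  4^-1 * normc (z * t%:C) ^+ 2 + normc z ^+ 2 <= 2 * normc z ^+ 2.
Proof.
move=> t0 t1; rewrite normcM normc_real (ger0_norm t0) exprMn.
have : normc z ^+ 2 * t ^+ 2 <= normc z ^+ 2 by rewrite ler_piMr ?sqr_ge0// expr_le1.
have := sqr_ge0 (normc z); move: (normc z ^+ 2) (_ * t ^+ 2) => A C; lra.
Qed.

Lemma dens_cut_l (x : R) : `]a, a + 1] x -> dens cut dcut x <= 2 * normc (f a) ^+ 2.
Proof.
have abh := ab.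
rewrite /= in_itv /= => /andP[ax xa]; rewrite /dens /cut /dcut (leNgt x a) ax /= xa.
rewrite (_ : _ + _ * (1 + a)%:C = f a * (1 + a - x)%:C); last first.
  by rewrite !(rmorphD, rmorphN)/=; ring.
by rewrite normcN; apply: slope; lra.
Qed.

Lemma dens_cut_r (x : R) : `]b - 1, b] x -> dens cut dcut x <= 2 * normc (f b) ^+ 2.
Proof.
have abh := ab.
rewrite /= in_itv /= => /andP[bx xb]; rewrite /dens /cut /dcut xb.
do 3 (rewrite ifF; last by apply/negbTE; rewrite -ltNge; lra).
rewrite (_ : _ + _ * (1 - b)%:C = f b * (1 - b + x)%:C); last first.
  by rewrite !(rmorphD, rmorphN)/=; ring.
do 3 (rewrite ifF; last by apply/negbTE; rewrite -ltNge; lra).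
by apply: slope; lra.
Qed.

Lemma dens_cut_mid (x : R) : `]a + 1, b - 1] x -> dens cut dcut x = 0.
Proof.
have abh := ab.
rewrite /= in_itv /= => /andP[ax xb]; rewrite /dens /cut /dcut xb.
do 2 (rewrite ifF; last by apply/negbTE; rewrite -ltNge; lra).
do 2 (rewrite ifF; last by apply/negbTE; rewrite -ltNge; lra).
by rewrite normc0 expr0n /= mulr0 addr0.
Qed.

Lemma cut_estimate : [/\ H1 J cut, (forall x, ~ `]a, b[ x -> cut x = f x) &
  nrm H10 cut ^+ 2 <= \int[leb]_(x in J `\` `]a, b[) dens f k x
    + 2 * normc (f a) ^+ 2 + 2 * normc (f b) ^+ 2].
Proof.
have abh := ab; have [mg ml] := primitive_cmeasurable sJ primitive_cut.
have [_ fL kL] := fH; have fI := dens_integrable mJ fL kL.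
pose D : R -> \bar R := EFin \o dens cut dcut.
have mD : measurable_fun (J : set B) D.
  apply/measurable_EFinP; apply: measurable_funD.
    apply: measurable_funM; first exact: measurable_cst.
    by apply: measurable_funX; exact: measurable_normc.
  by apply: measurable_funX; exact: measurable_normc.
have D0 x : (0 <= D x)%E by rewrite lee_fin dens_ge0.
have Jsub x : `]a, b] x -> J x.
  rewrite /= in_itv /= => /andP[ax xb]; apply: inner_sub.
  by apply: (@inner_interval R c plus _ _ Ja Jb); rewrite xb ltW.
have mi u v : measurable (`]u, v] : set B) by exact: measurable_itv.
pose T : set B := J `\` `]a, b].
have mT : measurable T by exact: measurableD.
have abE : `]a, b] = `]a, a + 1] `|` (`]a + 1, b - 1] `|` `]b - 1, b]) :> set R.
  apply/seteqP; split => x /=; rewrite !in_itv /=; last by move=> [|[]]; lra.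
  move=> /andP[ax xb]; have [xa|xa] := leP x (a + 1); first by left; rewrite ax.
  by right; have [xc|xc] := leP x (b - 1); [left|right]; apply/andP; split.
have JE : J = T `|` `]a, b] by rewrite /T setUC setDUK.
have split4 : (\int[leb]_(x in J) D x = \int[leb]_(x in T) D x +
   (\int[leb]_(x in `]a, (a + 1)%R]) D x + (\int[leb]_(x in `](a + 1)%R, (b - 1)%R]) D x
     + \int[leb]_(x in `](b - 1)%R, b]) D x)))%E.
  have m2 : measurable_fun (`]a, b] : set B) D by exact: measurable_funS mD.
  rewrite {1}JE ge0_integral_setU//; last 2 first.
  - by rewrite -JE.
  - by rewrite disj_set2E /T setDKI.
  congr (_ + _)%E; rewrite abE in m2; rewrite {1}abE ge0_integral_setU//; last 2 first.
  - exact: measurableU.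
  - by rewrite disj_set2E; apply/eqP; apply/seteqP; split => // x [] /=; rewrite !in_itv /= => h [|]; move: h; lra.
  congr (_ + _)%E; rewrite ge0_integral_setU//.
  - apply: measurable_funS m2; [by apply: measurableU => //; exact: measurableU|].
    exact: subsetUr.
  - by rewrite disj_set2E; apply/eqP; apply/seteqP; split => // x [] /=; rewrite !in_itv /= => h; move: h; lra.
have piece u v (M : R) : u <= v -> `]u, v] `<=` `]a, b] -> 0 <= M ->
    (forall x, `]u, v] x -> dens cut dcut x <= M) ->
    (\int[leb]_(x in `]u, v]) D x <= (M * (v - u))%:E)%E.
  move=> uv uvs M0 H.
  have -> : (M * (v - u))%:E = (\int[leb]_(x in `]u, v]) (cst M%:E) x)%E.
    rewrite integral_cst//.
    have E : leb `]u, v] = (v - u)%:E.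
      rewrite lebesgue_measure_itv /= lte_fin; case: ltgtP uv => // -> _.
      by rewrite subrr.
    by transitivity ((M%:E * (v - u)%:E)%E); [rewrite EFinM|congr (_ * _)%E; exact: esym E].
  apply: ge0_le_integral => //.
  apply: measurable_funS mD => //; by move=> x /uvs /Jsub.
have p1 : (\int[leb]_(x in `]a, (a + 1)%R]) D x <= (2 * normc (f a) ^+ 2)%:E)%E.
  rewrite -[X in (_ <= (_ * X)%:E)%E]mulr1 mulrA.
  rewrite -[X in (_ <= (_ * X)%:E)%E](_ : a + 1 - a = 1); last by ring.
  apply: piece; [lra| |by rewrite mulr_ge0 ?sqr_ge0|exact: dens_cut_l].
  by move=> x /=; rewrite !in_itv /=; lra.
have p3 : (\int[leb]_(x in `](b - 1)%R, b]) D x <= (2 * normc (f b) ^+ 2)%:E)%E.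
  rewrite -[X in (_ <= (_ * X)%:E)%E]mulr1 mulrA.
  rewrite -[X in (_ <= (_ * X)%:E)%E](_ : b - (b - 1) = 1); last by ring.
  apply: piece; [lra| |by rewrite mulr_ge0 ?sqr_ge0|exact: dens_cut_r].
  by move=> x /=; rewrite !in_itv /=; lra.
have p2 : (\int[leb]_(x in `](a + 1)%R, (b - 1)%R]) D x <= 0%:E)%E.
  rewrite -(mul0r (b - 1 - (a + 1))); apply: piece; [lra| |by []|].
    by move=> x /=; rewrite !in_itv /=; lra.
  by move=> x /dens_cut_mid ->.
have TT : T `<=` J `\` `]a, b[.
  by move=> x [Jx nx]; split => //; apply: contra_not nx; rewrite /= !in_itv /=; lra.
have mTT : measurable (J `\` `]a, b[ : set B) by apply: measurableD => //; exact: measurable_itv.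
have fIT := integrableS mJ mTT (@subDsetl _ _ _) fI.
have p0 : (\int[leb]_(x in T) D x <= (\int[leb]_(x in J `\` `]a, b[) dens f k x)%:E)%E.
  rewrite /Rintegral fineK ?integrable_fin_num//.
  rewrite (@eq_integral _ _ _ leb T (EFin \o dens f k) D); last first.
    by move=> x; rewrite inE => -[_ nx]; rewrite /D /= dens_cut_out.
  apply: ge0_subset_integral => //; first by case/integrableP: fIT.
  by move=> x _; rewrite lee_fin dens_ge0.
have bound : (\int[leb]_(x in J) D x <= (\int[leb]_(x in J `\` `]a, b[) dens f k x
    + 2 * normc (f a) ^+ 2 + 2 * normc (f b) ^+ 2)%:E)%E.
  rewrite split4; apply: le_trans (leeD p0 (leeD p1 (leeD p2 p3))) _.
  by rewrite -!EFinD add0r addrA lexx.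
have DI : leb.-integrable (J : set B) D.
  apply/integrableP; split => //.
  rewrite (@eq_integral _ _ _ leb J D (fun x => `|D x|%E)); last by move=> x _; rewrite gee0_abs.
  by apply: le_lt_trans bound _; rewrite ltry.
have gH : H1 J cut.
  apply: (half_primitive_H1 primitive_cut).
    apply: (@le_L2 _ leb _ _ (fun x => 4 * dens cut dcut x)) => //.
      exact: (integrableZl mJ 4 DI).
    move=> x _; rewrite /dens; have := sqr_ge0 (normc (dcut x)); lra.
  apply: (@le_L2 _ leb _ _ (dens cut dcut)) => //.
  move=> x _; rewrite /dens; have := sqr_ge0 (normc (cut x)); lra.
split => //; first exact: cut_out.
have lL : L2 leb J dcut.
  apply: (@le_L2 _ leb _ _ (dens cut dcut)) => //.
  move=> x _; rewrite /dens; have := sqr_ge0 (normc (cut x)); lra.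
rewrite (nrm_sqr gH primitive_cut lL) /Rintegral -lee_fin fineK//.
by apply: integrable_fin_num.
Qed.

End Cut.

(** Subtract [cut] along an exhausting sequence of segments. The values of [f]
    at their ends tend to zero, by the boundary condition at [c] and by the
    tail of the norm at infinity. *)
Lemma H1c_dense (f : cfun R) (e : R) : pts H10 f -> 0 < e ->
  exists h : cfun R, H1c c plus h /\ nrm H10 (f - h) < e.
Proof.
move=> [fH f0] e0.
have [_ fL kL] := fH; have fI := dens_integrable mJ fL kL.
pose d := e ^+ 2 / 200; have d0 : 0 < d by rewrite divr_gt0// exprn_gt0.
have [N1 HN1] := tail_cvg fI (dens_ge0 f _) d0.
have e10 : 0 < e / 10 by rewrite divr_gt0.
have [N2 HN2] := near_end_cvg fH f0 e10.
pose n := (maxn N1 N2).+1.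
have t1 := HN1 n (leqW (leq_maxl _ _)).
have t2 := HN2 n (leqW (leq_maxr _ _)).
have t3 := far_end_bound n fH.
have [Ja Jb] := inner_inside c plus n; have ab := inner_lt2 (maxn N1 N2).
have [gH g_out gN] := cut_estimate fH Ja Jb ab.
pose a := inner_l c plus n; pose b := inner_r c plus n.
rewrite -/a -/b in g_out gN Ja Jb; pose g : cfun R := cut f a b.
pose h : cfun R := fun x => -1 * g x + f x.
have fhg : f - h = g by apply/funext => x; change (f x - (-1 * g x + f x) = g x); ring.
have h_out x : ~ `]a, b[ x -> h x = 0 by move=> nx; rewrite /h /g g_out//; ring.
exists h; split.
  split.
    split; first exact: H1_linear.
    move: h_out Ja Jb; rewrite /vanishes_at_c /inner_half_line; case: plus => h_out.
      by rewrite /= !in_itv /= !andbT => ca cb; apply: h_out; rewrite /= in_itv /=; lra.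
    rewrite /= !in_itv /= => ac bc; apply: cvg_near_cst; near=> x.
    rewrite h_out ?normc0//= in_itv /=; suff : b < x by lra.
    by near: x; exact: nbhs_left_gt.
  exists a, b; split => [|x _ nx].
    by rewrite half_line_interior; exact: (itv_sub 0 0 (@inner_interval R c plus) Ja Jb).
  by apply: h_out; apply: contra_not nx; rewrite /= !in_itv /=; lra.
rewrite fhg -(ltr_pXn2r (n := 2)) ?nnegrE ?nrm_ge0 ?ltW//.
apply: le_lt_trans gN _.
have t2' : normc (f (near_end n)) ^+ 2 < (e / 10) ^+ 2.
  by rewrite ltr_pXn2r ?nnegrE ?normc_ge0// ltW.
have ee : (e / 10) ^+ 2 = e ^+ 2 / 100 by field.
have e2 : 0 < e ^+ 2 by rewrite exprn_gt0.
move: t1 t2' t3; rewrite ee /d /tail /near_end /far_end -/a -/b.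
case: plus; move: (\int[leb]_(x in _) _) (normc (f a) ^+ 2) (normc (f b) ^+ 2) (e ^+ 2) e2 => I A C E2 E20; lra.
Unshelve. all: by end_near. Qed.

End HalfLineBounds.

(** The form in which density is used: an identity both sides of which are
    additive and bounded in [f] need only be checked on compactly supported
    functions. *)
Lemma functional_vanishes (R : realType) (c : R) (plus : bool) (F : cfun R -> R[i]) (C : R) :
  (forall f g, pts (H10_space c plus) f -> pts (H10_space c plus) g -> F (f + g) = F f + F g) ->
  (forall f, pts (H10_space c plus) f -> normc (F f) <= C * nrm (H10_space c plus) f) ->
  (forall h, H1c c plus h -> F h = 0) ->
  forall f, pts (H10_space c plus) f -> F f = 0.
Proof.
move=> FD FC F0 f fH; apply: normc0_eq0; apply/eqP; rewrite eq_le normc_ge0 andbT.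
apply/ler_addgt0Pr => e e0; rewrite add0r.
have D0 : 0 < `|C| + 1 by rewrite ltr_wpDl.
have [h [hc hf]] := H1c_dense fH (divr_gt0 e0 D0); have [hH _] := hc.
have dH : pts (H10_space c plus) (f - h) by rewrite addrC -scaleN1r; exact: H10_linear.
have -> : F f = F (f - h) by have := FD _ _ dH hH; rewrite subrK (F0 h hc) addr0.
apply: (le_trans (FC _ dH)); have := ltW hf; rewrite ler_pdivlMr//; apply: le_trans.
rewrite mulrC ler_wpM2l ?nrm_ge0//; apply: (le_trans (ler_norm C)); by rewrite lerDl.
Qed.

(** * The differential equation with several measures *)

Section MeasureEquation.
Context {R : realType}.
Local Notation B := (measurableTypeR R).
Local Notation leb := (@lebesgue_measure R).
Variables (I : finType) (mu : I -> {measure set B -> \bar R}).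
Hypothesis mu_fin : forall i, locally_finite (mu i).
Implicit Types (J : set R) (a : I -> R[i]) (w : I -> R -> R[i]) (F k h : R -> R[i]).

Definition wint a w (D : set B) : R[i] := \sum_i a i * cintegral (mu i) D (w i).

(** The equation [F'' = sum_i a_i w_i mu_i] on the interval [J], in integrated
    form. Keeping [w] apart from [F] lets one notion serve homogeneous
    equations, where all [w_i] are [F], and the relation [T]. *)
Definition qeq J a w F F' :=
  [/\ primitive J F F',
      forall i x y, J x -> J y -> cintegrable (mu i) `[x, y[ (w i)
    & forall x y, J x -> J y -> x <= y -> F' y - F' x = wint a w `[x, y[].

Lemma mu_co_fin i x y : (mu i `[x, y[ < +oo)%E.
Proof. by apply: mu_fin; exact: bounded_borel_itv. Qed.

Lemma mu_cc_fin i x y : (mu i `[x, y] < +oo)%E.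
Proof. by apply: mu_fin; exact: bounded_borel_itv. Qed.

Lemma qeqS J J' a w F F' : J' `<=` J -> qeq J a w F F' -> qeq J' a w F F'.
Proof.
move=> J'J [Fp wI FE]; split; first exact: primitiveS Fp.
  by move=> i x y /J'J Jx /J'J Jy; exact: wI.
by move=> x y /J'J Jx /J'J Jy; exact: FE.
Qed.

Lemma primitive_bounded x y F k : primitive `[x, y] F k ->
  exists M, 0 <= M /\ forall t, `[x, y] t -> normc (F t) <= M.
Proof.
move=> [kI FE]; have kxy := kI _ _ (@subset_refl _ _).
have mxy : measurable (`[x, y] : set B) by exact: measurable_itv.
have nk := integrable_normc mxy kxy.
exists (normc (F x) + 2 * \int[leb]_(t in `[x, y]) normc (k t)).
have I0 : 0 <= \int[leb]_(t in `[x, y]) normc (k t).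
  by apply: Rintegral_ge0 => t _; exact: normc_ge0.
split; first by rewrite addr_ge0 ?normc_ge0 ?mulr_ge0.
move=> t; rewrite /= in_itv /= => /andP[xt ty].
rewrite -[F t](subrK (F x)) addrC (le_trans (ler_normcD _ _))// lerD2l.
rewrite FE//; last 2 first.
- by rewrite /= in_itv /= lexx (le_trans xt).
- by rewrite /= in_itv /= xt.
have mxt : measurable (`[x, t] : set B) by exact: measurable_itv.
have txy : `[x, t] `<=` `[x, y] by move=> s /=; rewrite !in_itv /=; lra.
have kxt : cintegrable leb `[x, t] k by exact: cintegrableS kxy.
apply: le_trans (ler_normc_cint mxt kxt (integrable_normc mxt kxt) (fun _ _ => lexx _)) _.
by rewrite ler_pM2l//; apply: ge0_Rint_sub => // s; exact: normc_ge0.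
Qed.

Lemma primitive_cmeasurable_co x y F k : primitive `[x, y] F k ->
  cmeasurable (`[x, y[ : set B) F.
Proof.
move=> Fp; have [xy|yx] := leP x y; last first.
  by rewrite set_itv_ge ?bnd_simp -?leNgt ?(ltW yx)//; split; exact: measurable_fun_set0.
apply: (@cmeasurableS _ _ `[x, y]); [exact: measurable_itv|exact: subset_itv_co_cc|].
by apply: ac_cmeasurable => //; exact: (primitive_ac Fp).
Qed.

Lemma cintegrable_weight i x y (v : R -> R[i]) F k : primitive `[x, y] F k ->
  cintegrable (mu i) `[x, y[ v -> cintegrable (mu i) `[x, y[ (fun s => v s * F s).
Proof.
move=> Fp vI; have [M [M0 HM]] := primitive_bounded Fp.
have mxy : measurable (`[x, y[ : set B) by exact: measurable_itv.
apply: (@cintegrableM _ _ _ _ _ M) => //.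
  exact: primitive_cmeasurable_co Fp.
by move=> s sxy; apply: HM; exact: subset_itv_co_cc sxy.
Qed.

Lemma primitive_cintegrable i x y F k : primitive `[x, y] F k ->
  cintegrable (mu i) `[x, y[ F.
Proof.
move=> Fp; have [M [M0 HM]] := primitive_bounded Fp.
apply: (@cintegrable_bounded _ _ _ _ M); [exact: measurable_itv|exact: mu_co_fin| |].
  exact: primitive_cmeasurable_co Fp.
by move=> s sxy; apply: HM; exact: subset_itv_co_cc sxy.
Qed.

Lemma wint_linear z a w v D : measurable D ->
  (forall i, cintegrable (mu i) D (w i)) -> (forall i, cintegrable (mu i) D (v i)) ->
  wint a (fun i s => z * w i s + v i s) D = z * wint a w D + wint a v D.
Proof.
move=> mD wI vI; rewrite /wint mulr_sumr -big_split; apply: eq_bigr => i _ /=.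
rewrite cintD//; last exact: cintegrableZ.
by rewrite cintZ// mulrDr mulrCA.
Qed.

Lemma eq_wint a w v D : (forall i s, D s -> w i s = v i s) -> wint a w D = wint a v D.
Proof. by move=> wv; apply: eq_bigr => i _; congr (_ * _); apply: eq_cint => s; exact: wv. Qed.

Lemma wint0 a D : wint a (fun _ _ => 0) D = 0.
Proof. by rewrite /wint big1// => i _; rewrite cint0 mulr0. Qed.

Lemma wint_set0 a w : wint a w set0 = 0.
Proof. by rewrite /wint big1// => i _; rewrite cint_set0 mulr0. Qed.

Lemma itv_co_split (x y t : R) : x <= y -> y <= t ->
  `[x, t[ = `[x, y[ `|` `[y, t[ :> set R.
Proof.
by move=> xy yt; rewrite -(@itv_bndbnd_setU _ _ (BLeft x) (BLeft y) (BLeft t)) ?bnd_simp.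
Qed.

Lemma wint_split a w x y t : x <= y -> y <= t ->
  (forall i, cintegrable (mu i) `[x, t[ (w i)) ->
  wint a w `[x, t[ = wint a w `[x, y[ + wint a w `[y, t[.
Proof.
move=> xy yt wI; rewrite /wint -big_split; apply: eq_bigr => i _ /=.
rewrite -mulrDr (itv_co_split xy yt) cintU//.
  by rewrite -itv_co_split.
by apply/seteqP; split => // s [] /=; rewrite !in_itv /=; lra.
Qed.

Lemma qeq_linear J z a w F F' v G G' : is_interval J ->
  qeq J a w F F' -> qeq J a v G G' ->
  qeq J a (fun i s => z * w i s + v i s) (fun s => z * F s + G s) (fun s => z * F' s + G' s).
Proof.
move=> iJ [Fp wI FE] [Gp vI GE]; split.
- exact: primitive_linear.
- move=> i x y Jx Jy; apply: cintegrableD; [exact: measurable_itv| |exact: vI].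
  by apply: cintegrableZ; [exact: measurable_itv|exact: wI].
- move=> x y Jx Jy xy; rewrite wint_linear; [|exact: measurable_itv|..].
  + by rewrite -FE// -GE//; ring.
  + by move=> i; exact: wI.
  + by move=> i; exact: vI.
Qed.

Lemma wintZ z a w D : measurable D -> (forall i, cintegrable (mu i) D (w i)) ->
  wint a (fun i s => z * w i s) D = z * wint a w D.
Proof.
move=> mD wI; rewrite /wint mulr_sumr; apply: eq_bigr => i _.
by rewrite cintZ// mulrCA.
Qed.

Lemma cint_sum (D : set B) (r : seq I) (c : I -> R[i]) (v : I -> R -> R[i]) :
  measurable D -> (forall i, cintegrable leb D (v i)) ->
  cintegrable leb D (fun t => \sum_(i <- r) c i * v i t) /\
  cintegral leb D (fun t => \sum_(i <- r) c i * v i t) =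
  \sum_(i <- r) c i * cintegral leb D (v i).
Proof.
move=> mD vI; elim: r => [|i r [rI rE]].
  under [X in cintegrable _ _ X]eq_fun do rewrite big_nil.
  under [X in cintegral _ _ X]eq_fun do rewrite big_nil.
  by rewrite big_nil cint0; split => //; exact: cintegrable0.
under [X in cintegrable _ _ X]eq_fun do rewrite big_cons.
under [X in cintegral _ _ X]eq_fun do rewrite big_cons.
have ciI : cintegrable leb D (fun t => c i * v i t) by exact: cintegrableZ.
by rewrite big_cons cintD// cintZ// rE; split => //; exact: cintegrableD.
Qed.

(** Integration by parts, from [fubini_triangle] for each of the measures. *)
Lemma qeq_weak p q a w F F' h k : p <= q -> qeq `[p, q] a w F F' ->
  primitive `[p, q] h k ->
  cintegrable leb `[p, q] (fun t => F' t * k t) /\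
  cintegral leb `[p, q] (fun t => F' t * k t) =
  F' q * h q - F' p * h p - wint a (fun i s => w i s * h s) `[p, q[.
Proof.
move=> pq [Fp wI FE] hk; have [kI hE] := hk.
have pI : `[p, q] p by rewrite /= in_itv /= lexx.
have qI : `[p, q] q by rewrite /= in_itv /= lexx pq.
have mcc : measurable (`[p, q] : set B) by exact: measurable_itv.
have mco : measurable (`[p, q[ : set B) by exact: measurable_itv.
have kpq : cintegrable leb `[p, q] k by exact: kI.
have wpq i : cintegrable (mu i) `[p, q[ (w i) by exact: wI.
have fub i := @fubini_triangle R (mu i) p q (w i) k (mu_co_fin i p q) (wpq i) kpq.
pose W i t := cintegral (mu i) `[p, t[ (w i).
have W1 i : cintegrable leb `[p, q] (fun t => k t * W i t) by have [] := fub i.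
have [S1 S2] := @cint_sum `[p, q] (index_enum I) a (fun i t => k t * W i t) mcc W1.
have E t : `[p, q] t -> F' p * k t + \sum_i a i * (k t * W i t) = F' t * k t.
  move=> tpq; have pt : p <= t by move: tpq; rewrite /= in_itv /= => /andP[].
  have -> : F' t = F' p + wint a w `[p, t[ by rewrite -(FE _ _ pI tpq pt); ring.
  rewrite mulrDl; congr (_ + _); rewrite /wint mulr_suml; apply: eq_bigr => i _.
  by rewrite mulrA mulrAC.
have kZ : cintegrable leb `[p, q] (fun t => F' p * k t) by exact: cintegrableZ.
split; first by apply: eq_cintegrable E _ => //; exact: cintegrableD.
rewrite -(eq_cint leb E) cintD// S2 cintZ// -hE//.
have -> : \sum_i a i * cintegral leb `[p, q] (fun t => k t * W i t) =
    wint a (fun i s => -1 * (w i s * h s) + h q * w i s) `[p, q[.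
  apply: eq_bigr => i _; congr (_ * _); have [_ _ ->] := fub i.
  apply: eq_cint => s spq; rewrite -hE//; first by ring.
  - exact: subset_itv_co_cc spq.
  - by move: spq; rewrite /= in_itv /= => /andP[_ /ltW].
have whI i : cintegrable (mu i) `[p, q[ (fun s => w i s * h s).
  exact: cintegrable_weight hk (wpq i).
have hwI i : cintegrable (mu i) `[p, q[ (fun s => h q * w i s) by exact: cintegrableZ.
rewrite (wint_linear (-1) a mco whI hwI) (wintZ (h q) a mco wpq) -(FE _ _ pI qI pq).
by ring.
Qed.

(** The weak form for affine [h] is the Taylor formula with integral
    remainder, forwards and backwards. *)
Lemma qeq_taylor p q a w F F' : p <= q -> qeq `[p, q] a w F F' ->
  (F q = F p + F' p * (q - p)%:C + wint a (fun i s => w i s * (q - s)%:C) `[p, q[) /\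
  (F p = F q - F' q * (q - p)%:C + wint a (fun i s => w i s * (s - p)%:C) `[p, q[).
Proof.
move=> pq Fq; have [[F'I FE] wI F'E] := Fq.
have pI : `[p, q] p by rewrite /= in_itv /= lexx.
have qI : `[p, q] q by rewrite /= in_itv /= lexx pq.
have mco : measurable (`[p, q[ : set B) by exact: measurable_itv.
have aff u : primitive `[p, q] (fun s => (s - u)%:C) (fun=> 1).
  have := @primitive_affine R `[p, q] 1 (- u%:C) (@interval_is_interval _ _).
  by under [X in primitive _ X _ -> _]eq_fun do rewrite mul1r -rmorphB.
have key u : F q - F p = F' q * (q - u)%:C - F' p * (p - u)%:C
    - wint a (fun i s => w i s * (s - u)%:C) `[p, q[.
  have [_ <-] := qeq_weak pq Fq (aff u).
  by rewrite FE//; apply: eq_cint => t _; rewrite mulr1.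
split.
  have -> : wint a (fun i s => w i s * (q - s)%:C) `[p, q[ =
     wint a (fun i s => -1 * (w i s * (s - q)%:C)) `[p, q[.
    by apply: eq_wint => i s _; rewrite -opprB rmorphN; ring.
  rewrite wintZ//; last by move=> i; apply: cintegrable_weight (aff q) _; exact: wI.
  have := key q; rewrite subrr mulr0 sub0r -(opprB q p) rmorphN /= => h.
  by rewrite -[LHS](subrK (F p)) h; ring.
have := key p; rewrite subrr mulr0 subr0 => h.
by rewrite -[LHS](subKr (F q)) h; ring.
Qed.

End MeasureEquation.

(** * The initial value problem *)

Section InitialValueProblem.
Context {R : realType}.
Local Notation B := (measurableTypeR R).
Local Notation leb := (@lebesgue_measure R).
Variables (I : finType) (mu : I -> {measure set B -> \bar R}).
Hypothesis mu_fin : forall i, locally_finite (mu i).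
Implicit Types (J : set R) (a : I -> R[i]) (w : I -> R -> R[i]) (F k h : R -> R[i]).

Lemma is_intervalT : is_interval (setT : set R). Proof. by []. Qed.

Lemma wint_cintegrable p q a w : (forall i, cintegrable (mu i) `[p, q[ (w i)) ->
  cintegrable leb `[p, q] (fun t => wint mu a w `[p, t[).
Proof.
move=> wI; have mcc : measurable (`[p, q] : set B) by exact: measurable_itv.
have k1 : cintegrable leb `[p, q] (fun=> 1).
  by have [+ _] := @primitive_id R `[p, q]; apply.
have W1 i : cintegrable leb `[p, q] (fun t => 1 * cintegral (mu i) `[p, t[ (w i)).
  by have [] := @fubini_triangle R (mu i) p q (w i) _ (mu_co_fin mu_fin i p q) (wI i) k1.
have [S1 _] := @cint_sum R I `[p, q] (index_enum I) a _ mcc W1.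
by apply: eq_cintegrable S1 => // t _; apply: eq_bigr => i _; rewrite mul1r.
Qed.

Section RightHandSide.
Variables (a : I -> R[i]) (w : I -> R -> R[i]) (al be : R[i]) (x0 : R).
Hypothesis wI : forall i x y, cintegrable (mu i) `[x, y[ (w i).

Definition rhs_slope (x : R) : R[i] := be +
  if x0 <= x then wint mu a w `[x0, x[ else - wint mu a w `[x, x0[.

Definition rhs_value (x : R) : R[i] := al +
  if x0 <= x then cintegral leb `[x0, x] rhs_slope else - cintegral leb `[x, x0] rhs_slope.

Lemma rhs_slopeB x y : x <= y -> rhs_slope y - rhs_slope x = wint mu a w `[x, y[.
Proof.
move=> xy; have wI' := wI; rewrite /rhs_slope.
have [x0x|xx0] := leP x0 x.
  by rewrite (le_trans x0x xy) (wint_split a x0x xy)//; ring.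
have [x0y|yx0] := leP x0 y.
  by rewrite (wint_split a (ltW xx0) x0y)//; ring.
by rewrite (wint_split a xy (ltW yx0))//; ring.
Qed.

Lemma rhs_slope_cintegrable p q : cintegrable leb `[p, q] rhs_slope.
Proof.
have mcc : measurable (`[p, q] : set B) by exact: measurable_itv.
have h := wint_cintegrable a (fun i => wI i p q).
have c1 : cintegrable leb `[p, q] (fun=> rhs_slope p).
  by have [+ _] := @primitive_affine R `[p, q] (rhs_slope p) 0 (@interval_is_interval _ _); apply.
apply: eq_cintegrable (cintegrableD mcc c1 h) => // t.
rewrite /= in_itv /= => /andP[pt _]; rewrite -rhs_slopeB//; ring.
Qed.

Lemma rhs_ivp : [/\ qeq mu setT a w rhs_value rhs_slope, rhs_value x0 = al & rhs_slope x0 = be].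
Proof.
have sI := rhs_slope_cintegrable.
have spl p q t : p <= q -> q <= t -> cintegral leb `[p, t] rhs_slope =
    cintegral leb `[p, q] rhs_slope + cintegral leb `[q, t] rhs_slope.
  move=> pq qt; rewrite (cint_cc_split pq qt (sI p t)) cint_oc_cc//.
  apply: (@cintegrable_measurable _ leb); apply: (@cintegrableS _ _ _ `[q, t]) => //.
  exact: subset_itv_oc_cc.
split.
- split; [split => [p q _|x y _ _ xy]|by move=> i x y _ _; exact: wI|by move=> x y _ _; exact: rhs_slopeB].
    exact: sI.
  rewrite /rhs_value; have [x0x|xx0] := leP x0 x.
    by rewrite (le_trans x0x xy) (spl _ _ _ x0x xy); ring.
  have [x0y|yx0] := leP x0 y.
    by rewrite (spl _ _ _ (ltW xx0) x0y); ring.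
  by rewrite (spl _ _ _ xy (ltW yx0)); ring.
- rewrite /rhs_value lexx [X in al + X](_ : _ = 0) ?addr0//.
  have : cintegral leb `[x0, x0] rhs_slope = cintegral leb `[x0, x0] rhs_slope + cintegral leb `[x0, x0] rhs_slope.
    by rewrite -spl.
  by move=> h; apply: (@addrI _ (cintegral leb `[x0, x0] rhs_slope)); rewrite addr0 -h.
- by rewrite /rhs_slope lexx set_itv_ge ?bnd_simp ?ltxx// wint_set0 addr0.
Qed.

End RightHandSide.

Lemma ler_normc_wint a w (D : set B) (M : R) : measurable D ->
  (forall i, (mu i D < +oo)%E) -> (forall i, cmeasurable D (w i)) ->
  (forall i x, D x -> normc (w i x) <= M) ->
  normc (wint mu a w D) <= 2 * M * \sum_i normc (a i) * fine (mu i D).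
Proof.
move=> mD Dfin mw wM; rewrite /wint.
apply: (@le_trans _ _ (\sum_i normc (a i * cintegral (mu i) D (w i)))).
  elim/big_ind2 : _ => [|x1 x2 y1 y2 h1 h2|//]; first by rewrite normc0.
  by apply: le_trans (ler_normcD _ _) _; exact: lerD.
rewrite mulr_sumr; apply: ler_sum => i _; rewrite normcM.
have := ler_normc_cint_bounded mD (Dfin i) (mw i) (wM i) => /(ler_wpM2l (normc_ge0 (a i))).
by move/le_trans; apply; rewrite le_eqVlt; apply/orP; left; apply/eqP; ring.
Qed.

Lemma ler_expR_id (lam t : R) : 0 < lam -> t <= expR (lam * t) / lam.
Proof.
move=> l0; rewrite ler_pdivlMr// mulrC.
by apply: le_trans (expR_ge1Dx _); rewrite lerDr.
Qed.

(** In the supremum norm with weight [expR (- lam * `|x - x0|)] the map from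
    the right-hand side to the solution contracts by a factor of two, once
    [lam] is large compared with the mass of the measures on the segment. *)
Lemma contraction a (u v x0 : R) : u <= x0 <= v -> exists2 lam : R, 0 < lam &
  forall w F F' (M : R), qeq mu `[u, v] a w F F' -> F x0 = 0 -> F' x0 = 0 -> 0 <= M ->
  (forall i x, `[u, v] x -> normc (w i x) <= M * expR (lam * `|x - x0|)) ->
  forall x, `[u, v] x -> normc (F x) <= M / 2 * expR (lam * `|x - x0|).
Proof.
move=> /andP[ux0 x0v]; pose K := \sum_i normc (a i) * fine (mu i `[u, v]%classic).
have K0 : 0 <= K by apply: sumr_ge0 => i _; rewrite mulr_ge0 ?normc_ge0 ?fine_ge0.
have l0 : 0 < 4 * K + 1 by lra.
exists (4 * K + 1) => // w F F' M Fq Fx0 F'x0 M0 wM x xuv; set lam := 4 * K + 1 in l0 wM *.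
have [_ wI _] := Fq.
have /andP[ux xv] : u <= x <= v by move: xuv; rewrite /= in_itv.
have bound p q (kap : R -> R) : u <= p -> q <= v ->
    primitive `[p, q] (fun s => (kap s)%:C) (fun=> (kap 1 - kap 0)%:C) ->
    (forall s, `[p, q[ s -> 0 <= kap s /\ lam * `|s - x0| + lam * kap s = lam * `|x - x0|) ->
    normc (wint mu a (fun i s => w i s * (kap s)%:C) `[p, q[) <= M / 2 * expR (lam * `|x - x0|).
  move=> up qv kp kapP.
  have [pq|qp] := leP p q; last first.
    rewrite set_itv_ge ?bnd_simp -?leNgt ?(ltW qp)// wint_set0 normc0.
    by rewrite mulr_ge0 ?expR_ge0// divr_ge0.
  have sub : `[p, q[ `<=` `[u, v] by move=> s /=; rewrite !in_itv /=; lra.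
  have mco : measurable (`[p, q[ : set B) by exact: measurable_itv.
  have puv : `[u, v] p by rewrite /= in_itv /=; apply/andP; split; lra.
  have quv : `[u, v] q by rewrite /= in_itv /=; apply/andP; split; lra.
  pose M' := M * expR (lam * `|x - x0|) / lam.
  have M'0 : 0 <= M' by rewrite !mulr_ge0 ?expR_ge0 ?invr_ge0// ltW.
  have wk i : cintegrable (mu i) `[p, q[ (fun s => w i s * (kap s)%:C).
    exact: cintegrable_weight kp (wI i _ _ puv quv).
  have h := @ler_normc_wint a (fun i s => w i s * (kap s)%:C) `[p, q[ M' mco
    (fun i => mu_co_fin mu_fin i p q) (fun i => cintegrable_measurable (wk i)).
  apply: le_trans (h _) _.
    move=> i s spq; have [k0 kE] := kapP s spq.
    rewrite normcM normc_real ger0_norm// /M' -kE expRD mulrA -mulrA.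
    apply: ler_pM; rewrite ?normc_ge0//; first exact: wM (sub _ spq).
    exact: ler_expR_id.
  have le1 : \sum_i normc (a i) * fine (mu i `[p, q[%classic) <= K.
    apply: ler_sum => i _; apply: ler_wpM2l; first exact: normc_ge0.
    apply: fine_le; [rewrite ge0_fin_numE//; exact: mu_co_fin|rewrite ge0_fin_numE//; exact: mu_cc_fin|].
    by apply: le_measure => //; rewrite inE; exact: measurable_itv.
  apply: le_trans (ler_wpM2l _ le1) _; first by rewrite mulr_ge0.
  have -> : 2 * M' * K = M / 2 * expR (lam * `|x - x0|) * (4 * K / lam).
    by rewrite /M'; field; rewrite gt_eqF.
  rewrite ler_piMr//; first by rewrite mulr_ge0 ?expR_ge0// divr_ge0.
  by rewrite ler_pdivrMr// mul1r /lam; lra.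
have affp p q (s e : R) : primitive `[p, q] (fun t => (s * t + e)%:C) (fun=> (s * 1 + e - (s * 0 + e))%:C).
  have := @primitive_affine R `[p, q] s%:C e%:C (@interval_is_interval _ _).
  under [X in primitive _ X _ -> _]eq_fun do rewrite -rmorphM -rmorphD.
  by rewrite (_ : s * 1 + e - _ = s)//; ring.
have [x0x|xx0] := leP x0 x.
  have Fq' : qeq mu `[x0, x] a w F F' by apply: qeqS Fq => s /=; rewrite !in_itv /=; lra.
  have [-> _] := qeq_taylor mu_fin x0x Fq'; rewrite Fx0 F'x0 mul0r !add0r.
  have := bound x0 x (fun s => -1 * s + x) ux0 xv (affp _ _ _ _).
  rewrite (_ : (fun i s => w i s * (-1 * s + x)%:C) = (fun i s => w i s * (x - s)%:C)).
    apply=> s; rewrite /= in_itv /= => /andP[x0s sx]; split; first by lra.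
    by rewrite !ger0_norm; [ring|lra|lra].
  by apply/funext => i; apply/funext => s; rewrite mulN1r addrC.
have Fq' : qeq mu `[x, x0] a w F F' by apply: qeqS Fq => s /=; rewrite !in_itv /=; lra.
have [_ ->] := qeq_taylor mu_fin (ltW xx0) Fq'; rewrite Fx0 F'x0 mul0r subrr add0r.
have := bound x x0 (fun s => 1 * s + - x) ux x0v (affp _ _ _ _).
rewrite (_ : (fun i s => w i s * (1 * s + - x)%:C) = (fun i s => w i s * (s - x)%:C)).
  apply=> s; rewrite /= in_itv /= => /andP[xs sx0]; split; first by lra.
  by rewrite !ler0_norm; [ring|lra|lra].
by apply/funext => i; apply/funext => s; rewrite mul1r.
Qed.

Lemma le0_halves (y C : R) : (forall n, y <= C / 2 ^+ n) -> y <= 0.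
Proof.
move=> H; apply/ler_addgt0Pr => e e0; rewrite add0r.
have [C0|C0] := leP C 0.
  by apply: (le_trans (H 0%N)); rewrite expr0 divr1 (le_trans C0)// ltW.
have [n nP] : exists n : nat, C / e < n%:R.
  by exists (Num.bound (C / e)); apply: archi_boundP; rewrite divr_ge0// ltW.
apply: (le_trans (H n)); rewrite ler_pdivrMr ?exprn_gt0// mulrC -ler_pdivrMr//.
apply: (le_trans (ltW nP)); rewrite -natrX ler_nat ltnW//.
exact: ltn_expl.
Qed.

(** Iterate [contraction] with the solution itself as right-hand side. *)
Lemma qeq_unique J a F F' x0 : is_interval J -> J x0 ->
  qeq mu J a (fun=> F) F F' -> F x0 = 0 -> F' x0 = 0 ->
  forall x, J x -> F x = 0 /\ F' x = 0.
Proof.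
move=> iJ Jx0 Fq Fx0 F'x0.
have F0 x : J x -> F x = 0.
  move=> Jx; pose u := Num.min x x0; pose v := Num.max x x0.
  have uvJ : `[u, v] `<=` J.
    by rewrite /u /v; case: (leP x x0) => _; exact: (itv_sub 0 0 iJ).
  have xuv : `[u, v] x by rewrite /= in_itv /= /u /v ge_min le_max !lexx.
  have x0uv : u <= x0 <= v by rewrite /u /v ge_min le_max !lexx !orbT.
  have [lam l0 H] := contraction a x0uv.
  have Fq' : qeq mu `[u, v] a (fun=> F) F F' by exact: qeqS Fq.
  have [Fp _ _] := Fq'; have [M [M0 HM]] := primitive_bounded Fp.
  have bnd n y : `[u, v] y -> normc (F y) <= M / 2 ^+ n * expR (lam * `|y - x0|).
    elim: n y => [|n IHn] y yuv.
      rewrite expr0 divr1; apply: (le_trans (HM y yuv)); rewrite ler_peMr//.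
      by rewrite -expR0 ler_expR mulr_ge0// ltW.
    have := H (fun=> F) F F' (M / 2 ^+ n) Fq' Fx0 F'x0 _ (fun _ => IHn) y yuv.
    rewrite exprSr invfM mulrA; apply.
    by rewrite divr_ge0 ?exprn_ge0.
  apply: normc0_eq0; apply/eqP; rewrite eq_le normc_ge0 andbT.
  apply: (@le0_halves _ (M * expR (lam * `|x - x0|))) => n.
  by rewrite mulrAC; exact: bnd.
move=> x Jx; split; first exact: F0.
have [_ wI FE] := Fq.
have z y t : J y -> J t -> wint mu a (fun=> F) `[y, t[ = 0.
  move=> Jy Jt; apply: etrans (wint0 mu a `[y, t[); apply: eq_wint => i s /=.
  rewrite in_itv /= => /andP[ys st]; apply: F0; apply: iJ Jy Jt _ _.
  by rewrite ys ltW.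
have [xx0|x0x] := leP x x0.
  by have := FE _ _ Jx Jx0 xx0; rewrite F'x0 sub0r [RHS]z// => /eqP; rewrite oppr_eq0 => /eqP.
by have := FE _ _ Jx0 Jx (ltW x0x); rewrite F'x0 subr0 [RHS]z.
Qed.

(** The intervals of radius [2 * C / 2 ^+ n] about [r n] are nested. *)
Lemma geometric_limit (r : nat -> R) (C : R) :
  (forall n, `|r n.+1 - r n| <= C / 2 ^+ n) ->
  exists l, forall n, `|r n - l| <= 2 * C / 2 ^+ n.
Proof.
move=> rC; pose u n := r n - 2 * C / 2 ^+ n; pose v n := r n + 2 * C / 2 ^+ n.
have C0 n : 0 <= C / 2 ^+ n by exact: le_trans (rC n).
have half n : C / 2 ^+ n.+1 = (C / 2 ^+ n) / 2 by rewrite exprSr invfM mulrA.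
have uS n : u n <= u n.+1.
  rewrite /u -!mulrA half; have := rC n; rewrite ler_norml => /andP[h _].
  by move: h (C0 n); move: (C / 2 ^+ n) (r n) (r n.+1) => A X Y; lra.
have vS n : v n.+1 <= v n.
  rewrite /v -!mulrA half; have := rC n; rewrite ler_norml => /andP[_ h].
  by move: h (C0 n); move: (C / 2 ^+ n) (r n) (r n.+1) => A X Y; lra.
have um m n : (m <= n)%N -> u m <= u n.
  exact: (@homo_leq R u (fun x y => x <= y) lexx le_trans uS m n).
have vm m n : (m <= n)%N -> v n <= v m.
  have tr (y x z : R) : y <= x -> z <= y -> z <= x by move=> h1 h2; exact: le_trans h1.
  exact: (@homo_leq R v (fun x y => y <= x) lexx tr vS m n).
have uv m n : u m <= v n.
  apply: (le_trans (um _ _ (leq_maxl m n))); apply: le_trans (vm _ _ (leq_maxr m n)).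
  by rewrite /u /v -!mulrA; have := C0 (maxn m n); move: (C / _) (r _) => A X; lra.
pose S := [set u n | n in [set: nat]].
have Sub m : ubound S (v m) by move=> _ [n _ <-]; exact: uv.
have S0 : S !=set0 by exists (u 0%N); exists 0%N.
exists (sup S) => n; rewrite ler_distlC; apply/andP; split.
  by apply: ub_le_sup; [exists (v 0%N); exact: Sub|exists n].
by apply: ge_sup => //; exact: Sub.
Qed.

Lemma cgeometric_limit (r : nat -> R[i]) (C : R) :
  (forall n, normc (r n.+1 - r n) <= C / 2 ^+ n) ->
  exists l, forall n, normc (r n - l) <= 4 * C / 2 ^+ n.
Proof.
move=> rC.
have key n : `|complex.Re (r n.+1) - complex.Re (r n)| <= C / 2 ^+ n /\
             `|complex.Im (r n.+1) - complex.Im (r n)| <= C / 2 ^+ n.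
  split; apply: le_trans (rC n); rewrite -?cReN -?cImN -?cReD -?cImD.
    exact: ler_Re_normc.
  exact: ler_Im_normc.
have [l1 H1] := geometric_limit (fun n => (key n).1).
have [l2 H2] := geometric_limit (fun n => (key n).2).
exists (l1 +i* l2) => n; apply: (le_trans (ler_normc_ReIm _)).
rewrite !complexE /=; apply: (le_trans (lerD (H1 n) (H2 n))).
by rewrite -!mulrA; move: (C / _) => A; lra.
Qed.

(** Picard iteration: by [contraction] the successive approximations converge
    geometrically on every segment that contains [x0], and the limit is a
    fixed point. *)
Lemma ivp_exists a al be x0 : exists F F',
  [/\ qeq mu setT a (fun=> F) F F', F x0 = al & F' x0 = be].
Proof.
pose T := R -> R[i].
pose Phi (f : T) : T := rhs_value a (fun=> f) al be x0.
pose Phi' (f : T) : T := rhs_slope a (fun=> f) be x0.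
pose loc_int (f : T) := forall i x y, cintegrable (mu i) `[x, y[ f.
have PhiP f : loc_int f -> [/\ qeq mu setT a (fun=> f) (Phi f) (Phi' f), Phi f x0 = al & Phi' f x0 = be].
  by move=> fI; exact: (rhs_ivp a al be x0 fI).
pose f n : T := iter n Phi (fun=> 0).
have f_int n : loc_int (f n).
  elim: n => [|n IHn] i x y /=; first exact: cintegrable0.
  have [[Pp _ _] _ _] := PhiP _ IHn.
  by apply: (primitive_cintegrable mu_fin i (k := Phi' (f n))); exact: primitiveS Pp.
have f_prim n : primitive setT (f n.+1) (Phi' (f n)) by have [[]] := PhiP _ (f_int n).
have diff g h : loc_int g -> loc_int h ->
    [/\ qeq mu setT a (fun _ s => -1 * h s + g s) (fun s => -1 * Phi h s + Phi g s)
      (fun s => -1 * Phi' h s + Phi' g s), -1 * Phi h x0 + Phi g x0 = 0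
      & -1 * Phi' h x0 + Phi' g x0 = 0].
  move=> gI hI; have [gq g0 g1] := PhiP g gI; have [hq h0 h1] := PhiP h hI.
  split; [|by rewrite g0 h0; ring|by rewrite g1 h1; ring].
  exact: (qeq_linear (-1) is_intervalT hq gq).
pose contr u v (lam : R) := forall w F F' (M : R), qeq mu `[u, v] a w F F' -> F x0 = 0 ->
  F' x0 = 0 -> 0 <= M ->
  (forall i x, `[u, v] x -> normc (w i x) <= M * expR (lam * `|x - x0|)) ->
  forall x, `[u, v] x -> normc (F x) <= M / 2 * expR (lam * `|x - x0|).
have geo u v : u <= x0 <= v -> exists lam M, [/\ 0 < lam, 0 <= M, contr u v lam &
    forall n x, `[u, v] x -> normc (f n.+1 x - f n x) <= M * expR (lam * `|x - x0|) / 2 ^+ n].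
  move=> ux0v; have [lam l0 H] := contraction a ux0v; exists lam.
  have [M [M0 HM]] := primitive_bounded (primitiveS (@subsetT _ `[u, v]) (f_prim 0%N)).
  exists M; split => //; elim => [|n IHn] x xuv.
    rewrite subr0 expr0 divr1; apply: (le_trans (HM x xuv)); rewrite ler_peMr//.
    by rewrite -expR0 ler_expR mulr_ge0// ltW.
  have [dq d0 d1] := diff _ _ (f_int n.+1) (f_int n).
  have := H _ _ _ (M / 2 ^+ n) (qeqS (@subsetT _ `[u, v]) dq) d0 d1.
  rewrite (_ : f n.+2 x - f n.+1 x = -1 * Phi (f n) x + Phi (f n.+1) x); last first.
    by rewrite mulN1r addrC.
  have -> : M * expR (lam * `|x - x0|) / 2 ^+ n.+1 = M / 2 ^+ n / 2 * expR (lam * `|x - x0|).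
    by rewrite exprSr invfM; ring.
  apply => //; first by rewrite divr_ge0 ?exprn_ge0.
  by move=> _ t tuv; rewrite mulN1r addrC (mulrAC M); exact: IHn.
have seg x : Num.min x x0 <= x0 <= Num.max x x0 /\ `[Num.min x x0, Num.max x x0] x.
  by rewrite /= in_itv /= !ge_min !le_max !lexx !orbT.
have lim x : exists l, exists M, forall n, normc (f n x - l) <= M / 2 ^+ n.
  have [xx xin] := seg x; have [lam [M [l0 M0 _ H]]] := geo _ _ xx.
  have [l Hl] := cgeometric_limit (fun n => H n x xin).
  by exists l, (4 * (M * expR (lam * `|x - x0|))).
have [F HF] := choice lim.
have eq_halves (y z : R[i]) C : (forall n, normc (y - z) <= C / 2 ^+ n) -> y = z.
  move=> /le0_halves h; apply/eqP; rewrite -subr_eq0; apply/eqP; apply: normc0_eq0.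
  by apply/eqP; rewrite eq_le h normc_ge0.
have Fgeo u v : u <= x0 <= v -> exists lam M, [/\ 0 < lam, 0 <= M, contr u v lam &
    forall n x, `[u, v] x -> normc (f n x - F x) <= M / 2 ^+ n * expR (lam * `|x - x0|)].
  move=> ux0v; have [lam [M [l0 M0 H1 H]]] := geo _ _ ux0v; exists lam, (4 * M).
  split => // [|n x xuv]; first by rewrite mulr_ge0.
  have [l Hl] := cgeometric_limit (fun n => H n x xuv).
  have [M' HM'] := HF x.
  have <- : l = F x.
    apply: (eq_halves _ _ (M' + 4 * (M * expR (lam * `|x - x0|)))) => m.
    rewrite -(subrKA (f m x)) (le_trans (ler_normcD _ _))// mulrDl addrC.
    by apply: lerD; [exact: HM'|rewrite normcBC; exact: Hl].
  by apply: le_trans (Hl n) _; rewrite le_eqVlt; apply/orP; left; apply/eqP; ring.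
have mf n : cmeasurable setT (f n).
  case: n => [|n]; first exact: cmeasurable_cst.
  by have [] := primitive_cmeasurable (@setT_sigma R) (f_prim n).
have cvg_halves (r : nat -> R) l C : (forall n, `|r n - l| <= C / 2 ^+ n) -> r @ \oo --> l.
  move=> rl; have C0 : 0 <= C by have := rl 0%N; rewrite expr0 divr1; apply: le_trans.
  apply/cvgrPdist_lt => e e0; have e1 : 0 < e / (C + 1) by rewrite divr_gt0// ltr_wpDl.
  have [N _ HN] := near_infty_natSinv_expn_lt (PosNum e1).
  exists N => // n Nn; rewrite /= distrC; apply: le_lt_trans (rl n) _.
  have /= := HN n Nn; rewrite ltr_pdivlMr ?ltr_wpDl// mul1r mulrC; apply: le_lt_trans.
  by rewrite ler_wpM2r ?invr_ge0 ?exprn_ge0// lerDl.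
have mF : cmeasurable setT F.
  split.
  - apply: (@measurable_fun_cvg _ _ _ setT (fun n x => complex.Re (f n x))) => [n|x _].
      by have [] := mf n.
    have [M HM] := HF x; apply: (cvg_halves _ _ M) => n.
    by rewrite -cReN -cReD; apply: le_trans (HM n); exact: ler_Re_normc.
  - apply: (@measurable_fun_cvg _ _ _ setT (fun n x => complex.Im (f n x))) => [n|x _].
      by have [] := mf n.
    have [M HM] := HF x; apply: (cvg_halves _ _ M) => n.
    by rewrite -cImN -cImD; apply: le_trans (HM n); exact: ler_Im_normc.
have FI : loc_int F.
  move=> i x y; pose u := Num.min x x0; pose v := Num.max y x0.
  have uv : u <= x0 <= v by rewrite /u /v ge_min le_max !lexx !orbT.
  have [lam [M [l0 M0 _ H]]] := Fgeo _ _ uv.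
  apply: (@cintegrable_bounded _ _ _ _ (M * expR (lam * (v - u)))).
  - exact: measurable_itv.
  - exact: mu_co_fin.
  - exact: cmeasurableS mF.
  move=> t; rewrite /= in_itv /= => /andP[xt ty].
  have tuv : u <= t <= v by rewrite /u /v ge_min le_max xt (ltW ty).
  have := H 0%N t; rewrite /= sub0r normcN expr0 divr1 in_itv => /(_ tuv)/le_trans; apply.
  rewrite ler_wpM2l// ler_expR; apply: (ler_wpM2l (ltW l0)).
  have gen (p q r s : R) : p <= r <= q -> p <= s <= q -> `|s - r| <= q - p.
    by move=> h1 h2; rewrite ler_norml; lra.
  exact: gen uv tuv.
have PF : Phi F = F.
  apply/funext => x; have [xx xin] := seg x; have [lam [M [l0 M0 Hc H]]] := Fgeo _ _ xx.
  apply: (eq_halves _ _ (M * expR (lam * `|x - x0|))) => n.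
  have [dq d0 d1] := diff _ _ FI (f_int n).
  have h1 := Hc _ _ _ (M / 2 ^+ n) (qeqS (@subsetT _ _) dq) d0 d1.
  have {}h1 : normc (-1 * f n.+1 x + Phi F x) <= M / 2 ^+ n / 2 * expR (lam * `|x - x0|).
    apply: h1 => //; first by rewrite divr_ge0 ?exprn_ge0.
    by move=> _ t tuv; rewrite mulN1r addrC normcBC; exact: H.
  rewrite -(subrKA (f n.+1 x)) (le_trans (ler_normcD _ _))//.
  rewrite mulN1r addrC in h1; apply: (le_trans (lerD h1 (H n.+1 x xin))).
  rewrite exprSr invfM le_eqVlt; apply/orP; left; apply/eqP.
  by field; rewrite expf_neq0.
have [Pq P0 P1] := PhiP F FI; exists F, (Phi' F).
by split => //; [rewrite -{2}PF|rewrite -PF].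
Qed.

End InitialValueProblem.

(** * Wronskians and Green functions *)

Section Wronskian.
Context {R : realType}.
Local Notation B := (measurableTypeR R).
Local Notation leb := (@lebesgue_measure R).
Variables (I : finType) (mu : I -> {measure set B -> \bar R}).
Hypothesis mu_fin : forall i, locally_finite (mu i).
Variable a : I -> R[i].
Implicit Types (J : set R) (F G h k : R -> R[i]).

Lemma eq_qeq J w v F F' : (forall i s, J s -> w i s = v i s) -> is_interval J ->
  qeq mu J a w F F' -> qeq mu J a v F F'.
Proof.
move=> wv iJ [Fp wI FE].
have sub x y : J x -> J y -> `[x, y[ `<=` J.
  by move=> Jx Jy s /=; rewrite in_itv /= => /andP[xs sy]; apply: iJ Jx Jy _ _; rewrite xs ltW.
split => // [i x y Jx Jy|x y Jx Jy xy].
  apply: eq_cintegrable (wI i _ _ Jx Jy); first exact: measurable_itv.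
  by move=> s sxy; apply: wv; exact: sub sxy.
by rewrite FE//; apply: eq_wint => i s sxy; apply: wv; exact: sub sxy.
Qed.

Lemma homogeneous_linear J z F F' G G' : is_interval J ->
  qeq mu J a (fun=> F) F F' -> qeq mu J a (fun=> G) G G' ->
  qeq mu J a (fun=> (fun s => z * F s + G s)) (fun s => z * F s + G s)
    (fun s => z * F' s + G' s).
Proof. by move=> iJ; exact: qeq_linear. Qed.

(** Testing each solution against the other gives two values of the same
    integral of the product of the derivatives. *)
Lemma wronskian_const_le F F' G G' p q : p <= q ->
  qeq mu `[p, q] a (fun=> F) F F' -> qeq mu `[p, q] a (fun=> G) G G' ->
  wronskian F F' G G' q = wronskian F F' G G' p.
Proof.
move=> pq Fq Gq; have [Fp _ _] := Fq; have [Gp _ _] := Gq.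
have [_ e1] := qeq_weak mu_fin pq Fq Gp; have [_ e2] := qeq_weak mu_fin pq Gq Fp.
have e : F' q * G q - F' p * G p = G' q * F q - G' p * F p.
  have c1 : cintegral leb `[p, q] (fun t => F' t * G' t) = cintegral leb `[p, q] (fun t => G' t * F' t).
    by apply: eq_cint => t _; exact: mulrC.
  have c2 : wint mu a (fun=> (fun s => F s * G s)) `[p, q[ = wint mu a (fun=> (fun s => G s * F s)) `[p, q[.
    by apply: eq_wint => i s _; exact: mulrC.
  by apply: (addIr (- wint mu a (fun=> (fun s => F s * G s)) `[p, q[)); rewrite -e1 c1 e2 c2.
rewrite /wronskian; apply/eqP; rewrite -subr_eq0; apply/eqP.
transitivity ((G' q * F q - G' p * F p) - (F' q * G q - F' p * G p)); first by ring.
by rewrite e subrr.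
Qed.

Lemma wronskian_const F F' G G' x y :
  qeq mu setT a (fun=> F) F F' -> qeq mu setT a (fun=> G) G G' ->
  wronskian F F' G G' x = wronskian F F' G G' y.
Proof.
move=> Fq Gq; have [xy|/ltW yx] := leP x y; [symmetry|];
  by apply: wronskian_const_le => //; [apply: qeqS Fq|apply: qeqS Gq].
Qed.

(** Were it zero, the combinations of [F] and [G] with coefficients [(G' x, -
    F' x)] and [(G x, - F x)] would have zero initial data at [x], hence
    vanish; so [F] and [G] would themselves have zero initial data. *)
Lemma wronskian_neq0 F F' G G' x :
  qeq mu setT a (fun=> F) F F' -> qeq mu setT a (fun=> G) G G' ->
  lin_independent F G -> wronskian F F' G G' x != 0.
Proof.
move=> Fq Gq ind; apply/eqP => W0; have iT := @is_intervalT R.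
have comb (al be : R[i]) : al * F x + be * G x = 0 -> al * F' x + be * G' x = 0 ->
    al = 0 /\ be = 0.
  move=> h0 h1; apply: ind => s.
  have [zp zw zE] := Gq.
  have Z : qeq mu setT a (fun=> (fun s => 0 : R[i])) (fun=> 0) (fun=> 0).
    split; first exact: primitive_cst.
      by move=> i u v _ _; exact: cintegrable0.
    by move=> u v _ _ _; rewrite subrr wint0.
  have q1 := homogeneous_linear be iT Gq Z.
  have q2 := homogeneous_linear al iT Fq q1.
  have [] := @qeq_unique _ _ _ mu_fin setT a _ _ x iT Logic.I q2 _ _ s Logic.I.
  - by rewrite addr0.
  - by rewrite addr0.
  - by rewrite addr0.
move: W0; rewrite /wronskian => W0.
have [G'0 _] : G' x = 0 /\ - F' x = 0.
  by apply: comb; [rewrite -[RHS]W0; ring|ring].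
have [G0 _] : G x = 0 /\ - F x = 0.
  by apply: comb; [ring|rewrite -[RHS]oppr0 -W0; ring].
have [_ /eqP] : (0 : R[i]) = 0 /\ (1 : R[i]) = 0.
  by apply: comb; rewrite mul0r mul1r add0r.
by rewrite oner_eq0.
Qed.

End Wronskian.

Section GreenFunction.
Context {R : realType}.
Local Notation B := (measurableTypeR R).
Local Notation leb := (@lebesgue_measure R).
Variables (I : finType) (mu : I -> {measure set B -> \bar R}).
Hypothesis mu_fin : forall i, locally_finite (mu i).
Variables (a : I -> R[i]) (l l' r r' : R -> R[i]) (x : R).
Implicit Types (J : set R) (h k : R -> R[i]).

Let W := wronskian r r' l l' x.

(** [l] satisfies the condition at the left end, [r] that at the right end. *)
Definition lr_green s := if s <= x then W^-1 * r x * l s else W^-1 * l x * r s.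
Definition lr_dgreen s := if s <= x then W^-1 * r x * l' s else W^-1 * l x * r' s.

Lemma primitive_Z J (z : R[i]) F k : is_interval J -> primitive J F k ->
  primitive J (fun s => z * F s) (fun s => z * k s).
Proof.
move=> iJ Fk; have := primitive_linear z iJ Fk (primitive_cst J 0).
under [X in primitive _ X _ -> _]eq_fun do rewrite addr0.
by under [X in primitive _ _ X -> _]eq_fun do rewrite addr0.
Qed.

Lemma primitive_green J : is_interval J -> primitive J l l' -> primitive J r r' ->
  primitive J lr_green lr_dgreen.
Proof.
move=> iJ ll rr; apply: primitive_glue => //; first by ring.
  by apply: primitiveS (primitive_Z _ iJ ll); exact: subIsetl.
by apply: primitiveS (primitive_Z _ iJ rr); exact: subIsetl.
Qed.

Lemma wint_green p q h k : p <= x -> x <= q -> 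
  primitive `[p, q] l l' -> primitive `[p, q] r r' -> primitive `[p, q] h k ->
  wint mu a (fun=> (fun s => lr_green s * h s)) `[p, q[ =
  W^-1 * r x * wint mu a (fun=> (fun s => l s * h s)) `[p, x[ +
  W^-1 * l x * wint mu a (fun=> (fun s => r s * h s)) `[x, q[.
Proof.
move=> px xq ll rr hk; have ipq : is_interval `[p, q] by exact: interval_is_interval.
have GI i : cintegrable (mu i) `[p, q[ (fun s => lr_green s * h s).
  apply: (cintegrable_weight hk).
  by apply: (primitive_cintegrable mu_fin); exact: primitive_green.
have px_pq : `[p, x] `<=` `[p, q] by move=> s /=; rewrite !in_itv /=; lra.
have xq_pq : `[x, q] `<=` `[p, q] by move=> s /=; rewrite !in_itv /=; lra.
rewrite (wint_split a px xq)//; congr (_ + _); rewrite -wintZ.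
- apply: eq_wint => i s; rewrite /= in_itv /= => /andP[_ sx].
  by rewrite /lr_green (ltW sx) !mulrA.
- exact: measurable_itv.
- move=> i; apply: (cintegrable_weight (primitiveS px_pq hk)).
  by apply: (primitive_cintegrable mu_fin); exact: primitiveS ll.
- apply: eq_wint => i s; rewrite /= in_itv /= => /andP[xs _].
  rewrite /lr_green; have [sx|_] := leP s x; last by rewrite !mulrA.
  by rewrite (_ : s = x); [ring|apply/eqP; rewrite eq_le sx].
- exact: measurable_itv.
- move=> i; apply: (cintegrable_weight (primitiveS xq_pq hk)).
  by apply: (primitive_cintegrable mu_fin); exact: primitiveS rr.
Qed.

(** The weak form of the equation on either side of [x]; the boundary terms at
    [x] add up to the Wronskian. *)
Lemma green_weak p q h k : p <= x -> x <= q -> W != 0 ->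
  qeq mu `[p, q] a (fun=> l) l l' -> qeq mu `[p, q] a (fun=> r) r r' ->
  primitive `[p, q] h k -> h p = 0 -> h q = 0 ->
  cintegral leb `[p, q] (fun s => lr_dgreen s * k s) +
  wint mu a (fun=> (fun s => lr_green s * h s)) `[p, q[ = h x.
Proof.
move=> px xq W0 lq rq hk hp hq; have pq := le_trans px xq.
have [ll _ _] := lq; have [rr _ _] := rq.
rewrite (wint_green px xq ll rr hk).
have px_pq : `[p, x] `<=` `[p, q] by move=> s /=; rewrite !in_itv /=; lra.
have xq_pq : `[x, q] `<=` `[p, q] by move=> s /=; rewrite !in_itv /=; lra.
have [i1 e1] := qeq_weak mu_fin px (qeqS px_pq lq) (primitiveS px_pq hk).
have [i2 e2] := qeq_weak mu_fin xq (qeqS xq_pq rq) (primitiveS xq_pq hk).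
have mcc u v : measurable (`[u, v] : set B) by exact: measurable_itv.
have j1 : cintegrable leb `[p, x] (fun s => lr_dgreen s * k s).
  apply: eq_cintegrable (cintegrableZ (W^-1 * r x) (mcc p x) i1) => // s.
  by rewrite /= in_itv /= => /andP[_ sx]; rewrite /lr_dgreen sx !mulrA.
have eo s : `]x, q] s -> W^-1 * l x * (r' s * k s) = lr_dgreen s * k s.
  by rewrite /= in_itv /= => /andP[xs _]; rewrite /lr_dgreen leNgt xs /= !mulrA.
have j2 : cintegrable leb `]x, q] (fun s => lr_dgreen s * k s).
  apply: eq_cintegrable eo _; first exact: measurable_itv.
  apply: (@cintegrableS _ _ _ `[x, q]); [exact: measurable_itv|exact: mcc|exact: subset_itv_oc_cc|].
  exact: (cintegrableZ _ (mcc x q) i2).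
have pqE : `[p, q] = `[p, x] `|` `]x, q] :> set R.
  by rewrite -(@itv_bndbnd_setU _ _ (BLeft p) (BRight x) (BRight q)) ?bnd_simp.
have jI : cintegrable leb `[p, q] (fun s => lr_dgreen s * k s).
  by rewrite pqE; apply: cintegrable_setU => //; exact: measurable_itv.
rewrite (cint_cc_split px xq jI).
have -> : cintegral leb `[p, x] (fun s => lr_dgreen s * k s) =
    W^-1 * r x * cintegral leb `[p, x] (fun s => l' s * k s).
  rewrite -cintZ//; apply: eq_cint => s; rewrite /= in_itv /= => /andP[_ sx].
  by rewrite /lr_dgreen sx !mulrA.
have -> : cintegral leb `]x, q] (fun s => lr_dgreen s * k s) =
    W^-1 * l x * cintegral leb `[x, q] (fun s => r' s * k s).
  rewrite -cintZ// -cint_oc_cc; first by apply: eq_cint => s sxq; rewrite eo.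
  apply: (@cintegrable_measurable _ leb).
  apply: (@cintegrableS _ _ _ `[x, q]); [exact: measurable_itv|exact: mcc|exact: subset_itv_oc_cc|].
  exact: (cintegrableZ _ (mcc x q) i2).
rewrite e1 e2 hp hq.
have WE : r x * l' x - r' x * l x = W by [].
transitivity (W^-1 * (r x * l' x - r' x * l x) * h x); last by rewrite WE mulVf// mul1r.
by move: (W^-1) => V; ring.
Qed.

End GreenFunction.

(** * Solutions of the spectral equation *)

Definition vec4 (T : Type) (t0 t1 t2 t3 : T) (i : 'I_4) : T :=
  match val i with 0%N => t0 | 1%N => t1 | 2%N => t2 | _ => t3 end.

Section Solutions.
Context {R : realType}.
Local Notation B := (measurableTypeR R).
Local Notation leb := (@lebesgue_measure R).
Variables (om : set B -> R) (up : {measure set B -> \bar R}).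
Hypotheses (som : is_signed_measure om) (up_fin : locally_finite up).
Implicit Types (J : set R) (f g h k : R -> R[i]) (z : R[i]).

(** Splitting [om] into its Jordan parts makes all measures of the equation
    nonnegative. *)
Definition mu4 : 'I_4 -> {measure set B -> \bar R} :=
  vec4 (leb : {measure set B -> \bar R}) (upvar som : {measure set B -> \bar R})
    (upvar (signed_measureN som) : {measure set B -> \bar R}) up.

Lemma mu4_fin i : locally_finite (mu4 i).
Proof.
rewrite /mu4 /vec4; case: i => -[|[|[|i]]] Hi /= A bA.
- have [mA /bounded_setE[M HM]] := bA.
  apply: (@le_lt_trans _ _ (leb `[- M, M])); last exact: leb_cc_fin.
  apply: le_measure; rewrite ?inE//.
  by move=> x /HM; rewrite /= in_itv /= ler_norml.
- exact: upvar_locally_finite.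
- exact: upvar_locally_finite.
- exact: up_fin.
Qed.

Lemma wint4E (a0 a1 a2 a3 : R[i]) (w0 w1 w2 w3 : R -> R[i]) (D : set B) :
  wint mu4 (vec4 a0 a1 a2 a3) (vec4 w0 w1 w2 w3) D =
  a0 * cintegral leb D w0 + a1 * cintegral (upper_variation om) D w1
  + a2 * cintegral (lower_variation om) D w2 + a3 * cintegral up D w3.
Proof. by rewrite /wint !big_ord_recl big_ord0 /= addr0 !addrA. Qed.

Lemma vec4_cst (T : Type) (t : T) : vec4 t t t t = fun=> t.
Proof. by apply/funext => -[[|[|[|i]]] Hi]. Qed.

(** The equation [- f'' + f / 4 = z om f + z^2 up f]. *)
Definition coef z : 'I_4 -> R[i] := vec4 4^-1 (- z) z (- z ^+ 2).

Lemma wint_coef z f (D : set B) : wint mu4 (coef z) (fun=> f) D =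
  4^-1 * cintegral leb D f - z * signed_integral om D f - z ^+ 2 * cintegral up D f.
Proof. by rewrite -vec4_cst wint4E /signed_integral; ring. Qed.

(** The intervals [ [t, x[ ] shrink to the empty set as [t] increases to [x];
    this is where the left continuity of derivatives comes from. *)
Lemma wint_left_cvg a (f k : R -> R[i]) x : primitive setT f k ->
  forall e : R, 0 < e -> \forall t \near x^'-, normc (wint mu4 a (fun=> f) `[t, x[) < e.
Proof.
move=> fk e e0.
have [M [M0 HM]] := primitive_bounded (primitiveS (@subsetT _ `[x - 1, x]) fk).
have small i : forall d : R, 0 < d -> \forall t \near x^'-, fine (mu4 i `[t, x[%classic) < d.
  move=> d d0; pose F n : set B := `[x - n.+1%:R^-1, x[.
  have mF n : measurable (F n) by exact: measurable_itv.
  have F0 : \bigcap_n F n = set0.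
    apply/seteqP; split => // t Ft; have := Ft 0%N Logic.I; rewrite /F /= in_itv /= => /andP[_ tx].
    have xt : 0 < x - t by rewrite subr_gt0.
    have [m Hm] := ltr_add_invr xt; rewrite add0r in Hm.
    have := Ft m Logic.I; rewrite /F /= in_itv /= => /andP[+ _].
    by move: Hm; move: (m.+1%:R^-1) => q; lra.
  have := @nonincreasing_cvg_mu _ _ _ (mu4 i) F _ mF _ _; rewrite F0 measure0.
  have finF n : (mu4 i (F n) < +oo)%E by exact: (mu_co_fin mu4_fin).
  have ni : nonincreasing_seq F.
    move=> m n mn; apply/subsetPset => t; rewrite /F /= !in_itv /= => /andP[h ->]; rewrite andbT.
    have : n.+1%:R^-1 <= m.+1%:R^-1 :> R by rewrite lef_pV2 ?posrE// ler_nat.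
    by move: h; move: (n.+1%:R^-1) (m.+1%:R^-1) => p q; lra.
  move=> /(_ (finF _) measurable0 ni) /fine_cvg /= /cvgrPdist_lt /(_ d d0)[N _ HN].
  have := HN N (leqnn N); rewrite /= sub0r normrN ger0_norm ?fine_ge0// => HNd.
  near=> t; apply: le_lt_trans HNd; apply: fine_le.
  - by rewrite ge0_fin_numE//; exact: (mu_co_fin mu4_fin).
  - by rewrite ge0_fin_numE.
  apply: le_measure; rewrite ?inE//.
  move=> s; rewrite /F /= !in_itv /= => /andP[ts ->]; rewrite andbT; apply: le_trans ts.
  by near: t; apply: nbhs_left_ge; rewrite ltrBlDr ltrDl invr_gt0.
pose K := \sum_i normc (a i) + 1.
have K0 : 0 < K by rewrite ltr_wpDl// sumr_ge0// => i _; exact: normc_ge0.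
pose d := e / (2 * (M + 1) * K).
have d0 : 0 < d by rewrite divr_gt0// !mulr_gt0// ltr_wpDl.
near=> t.
have tx : t < x by near: t; exact: nbhs_left_lt.
have tx1 : x - 1 <= t by near: t; apply: nbhs_left_ge; lra.
have mco : measurable (`[t, x[ : set B) by exact: measurable_itv.
apply: le_lt_trans (@ler_normc_wint _ _ mu4 a (fun=> f) `[t, x[ M mco _ _ _) _.
- by move=> i; exact: (mu_co_fin mu4_fin).
- move=> i; apply: (primitive_cmeasurable_co (k := k)); exact: primitiveS fk.
- by move=> _ s; rewrite /= in_itv /= => stx; apply: HM; rewrite /= in_itv /=; lra.
have le1 : \sum_i normc (a i) * fine (mu4 i `[t, x[%classic) <= K * d.
  rewrite /K mulrDl mulr_suml mul1r -[leLHS]addr0; apply: lerD; last exact: ltW.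
  apply: ler_sum => i _; rewrite ler_wpM2l ?normc_ge0// ltW//.
  by move: i; near: t; apply: filter_forall => i; exact: small.
apply: (@le_lt_trans _ _ (2 * M * (K * d))); first by rewrite ler_wpM2l// mulr_ge0.
have -> : 2 * M * (K * d) = M / (M + 1) * e.
  by rewrite /d; field; rewrite !gt_eqF// ltr_wpDl.
by rewrite gtr_pMl// ltr_pdivrMr ?ltr_wpDl// mul1r ltrDl.
Unshelve. all: by end_near. Qed.

Lemma solution_qeq z f f' : is_solution om up z f f' -> qeq mu4 setT (coef z) (fun=> f) f f'.
Proof.
move=> [acf _ f'E eqn]; have fc := ac_primitive (@is_intervalT R) acf.
have fI i x y : cintegrable (mu4 i) `[x, y[ f.
  by apply: (primitive_cintegrable mu4_fin i (k := cderiv f)); exact: primitiveS fc.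
have step x y : x <= y -> f' y - f' x = wint mu4 (coef z) (fun=> f) `[x, y[.
  rewrite le_eqVlt => /orP[/eqP->|xy].
    by rewrite subrr set_itv_ge ?bnd_simp ?ltxx// wint_set0.
  have := eqn x y; rewrite /oriented xy wint_coef => h.
  rewrite -[LHS]opprK opprB -(addrK (4^-1 * cintegral leb `[x, y[ f) (f' x - f' y)).
  by rewrite (addrC (f' x)) h; ring.
have f'I x y : cintegrable leb `[x, y] f'.
  have mcc : measurable (`[x, y] : set B) by exact: measurable_itv.
  have h := wint_cintegrable mu4_fin (coef z) (fun i => fI i x y).
  have c1 : cintegrable leb `[x, y] (fun=> f' x).
    by have [+ _] := @primitive_affine R `[x, y] (f' x) 0 (@interval_is_interval _ _); apply.
  apply: eq_cintegrable (cintegrableD mcc c1 h) => // t.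
  by rewrite /= in_itv /= => /andP[xt _]; rewrite -step//; ring.
split => [|i x y _ _|x y _ _]; [|exact: fI|exact: step].
have [cI cE] := fc; split => [x y _|x y _ _ xy]; first exact: f'I.
have mcc : measurable (`[x, y] : set B) by exact: measurable_itv.
rewrite cE//; apply: (cint_ae_eq mcc).
- by apply: cintegrable_measurable (cI _ _ _).
- exact: cintegrable_measurable (f'I _ _).
- by apply: filterS f'E => t ->.
Qed.

Lemma qeq_solution z f f' : qeq mu4 setT (coef z) (fun=> f) f f' -> is_solution om up z f f'.
Proof.
move=> [fp fI FE]; split.
- exact: primitive_ac fp.
- move=> x.
  suff key : forall e : R, 0 < e -> \forall t \near x^'-, normc (f' x - f' t) < e.
    by split; apply/cvgrPdist_lt => e e0; apply: filterS (key e e0) => t;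
       apply: le_lt_trans; rewrite -?cReN -?cImN -?cReD -?cImD ?ler_Re_normc ?ler_Im_normc.
  move=> e e0; have h := wint_left_cvg (coef z) x fp e0.
  near=> t; have tx : t <= x by apply: ltW; near: t; exact: nbhs_left_lt.
  by rewrite FE//; near: t; exact: h.
- by apply: filterS (primitive_ae (@setT_sigma R) fp) => t ->.
- have step x y : x < y -> - f' y + f' x + 4^-1 * cintegral leb `[x, y[ f =
      z * signed_integral om `[x, y[ f + z ^+ 2 * cintegral up `[x, y[ f.
    move=> xy; have := FE x y Logic.I Logic.I (ltW xy); rewrite wint_coef => h.
    by rewrite -[X in X + _]opprK opprD opprK h; ring.
  move=> x y; rewrite /oriented; have [xy|yx|->] := ltgtP x y.
  + exact: step.
  + have h := step _ _ yx.
    transitivity (- (- f' x + f' y + 4^-1 * cintegral leb `[y, x[ f)); first by ring.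
    by rewrite h; ring.
  + by ring.
Unshelve. all: by end_near. Qed.

End Solutions.

(** * Smooth test functions *)

Section Smooth.
Context {R : realType}.
Implicit Types (f g h : R -> R) (n k : nat).

(** Phrased through derivatives that are themselves smooth, so that closure
    under the algebraic operations is an induction on [n]. *)
Fixpoint smooth_upto n f : Prop :=
  if n is m.+1 then
    exists2 f' : R -> R, (forall x : R, is_derive x 1 f (f' x)) & smooth_upto m f'
  else True.

Definition smooth f := forall n, smooth_upto n f.

Lemma smooth_uptoS n f : smooth_upto n.+1 f -> smooth_upto n f.
Proof. by elim: n f => [//|n IHn] f [f' ff' /IHn]; exists f'. Qed.

Lemma is_derive1E f f' : (forall x : R, is_derive x 1 f (f' x)) -> f^`()%classic = f'.
Proof. by move=> ff'; apply/funext => x; rewrite derive1E; exact: derive_val. Qed.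

Lemma smooth_derivable f n (x : R) : smooth f -> derivable (derive1n n f) x 1.
Proof.
move=> /(_ n.+1); elim: n f => [|n IHn] f [f' ff' sf']; first exact: ex_derive.
rewrite /derive1n iterSr (is_derive1E ff'); exact: IHn.
Qed.

Lemma smooth_cst n (r : R) : smooth_upto n (fun=> r).
Proof.
elim: n r => [//|n IHn] r; exists (fun=> 0) => // x; exact: is_derive_cst.
Qed.

Lemma smooth_add n f g : smooth_upto n f -> smooth_upto n g ->
  smooth_upto n (fun x => f x + g x).
Proof.
elim: n f g => [//|n IHn] f g [f' ff' sf'] [g' gg' sg'].
by exists (fun x => f' x + g' x); [move=> x; exact: is_deriveD|exact: IHn].
Qed.

Lemma smooth_mul n f g : smooth_upto n f -> smooth_upto n g ->
  smooth_upto n (fun x => f x * g x).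
Proof.
elim: n f g => [//|n IHn] f g sf sg; have [f' ff' sf'] := sf; have [g' gg' sg'] := sg.
exists (fun x => f x * g' x + g x * f' x); first by move=> x; exact: is_deriveM.
by apply: smooth_add; apply: IHn => //; exact: smooth_uptoS.
Qed.

Lemma is_derive_affine (a b x : R) : is_derive x 1 (fun s => a * s + b) a.
Proof.
have := is_deriveD (is_deriveM (is_derive_cst a x 1) (is_derive_id x 1)) (is_derive_cst b x 1).
by rewrite scaler0 !addr0 /GRing.scale /= mulr1.
Qed.

Lemma smooth_affine n f (a b : R) : smooth_upto n f -> smooth_upto n (fun x => f (a * x + b)).
Proof.
elim: n f => [//|n IHn] f [f' ff' sf'].
exists (fun x => f' (a * x + b) * a).
  by move=> x; have := is_derive_affine a b x; exact: is_derive1_comp.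
by apply: smooth_mul; [exact: IHn|exact: smooth_cst].
Qed.

Lemma smooth_id n : smooth_upto n (fun x : R => x).
Proof. by case: n => // n; exists (fun=> 1); [move=> x; exact: is_derive_id|exact: smooth_cst]. Qed.

Lemma smooth_inv n f : (forall x, f x != 0) -> smooth_upto n f ->
  smooth_upto n (fun x => (f x)^-1).
Proof.
move=> f0; elim: n f f0 => [//|n IHn] f f0 sf; have [f' ff' sf'] := sf.
have sV : smooth_upto n (fun x => (f x)^-1) by apply: IHn => //; exact: smooth_uptoS.
exists (fun x => (f x)^-1 * (f x)^-1 * (-1 * f' x)).
  move=> x; have := is_deriveV (f0 x) (ff' x).
  suff -> : - (f x) ^- 2 *: f' x = (f x)^-1 * (f x)^-1 * (-1 * f' x) by [].
  by rewrite /GRing.scale /= expr2 invfM; ring.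
apply: smooth_mul; first exact: smooth_mul.
by apply: smooth_mul => //; exact: smooth_cst.
Qed.

(** [x ^ (- k) * exp (- 1 / x)] for positive [x]; this family is stable under
    derivation. *)
Definition flat k (x : R) : R := if x <= 0 then 0 else x^-1 ^+ k * expR (- x^-1).

Definition dflat k (x : R) : R := flat k.+2 x - k%:R * flat k.+1 x.

Lemma is_derive_of_cvg f (x df : R) :
  h^-1 *: (f (h + x) - f x) @[h --> 0^'] --> df -> is_derive x 1 f df.
Proof.
move=> fdf.
have E : (fun h : R => h^-1 *: ((f \o shift x) (h *: (1 : R)) - f x)) =
         (fun h : R => h^-1 *: (f (h + x) - f x)).
  by apply/funext => h; rewrite /= /shift /GRing.scale /= mulr1.
apply: DeriveDef; first by rewrite /derivable E; apply/cvg_ex; exists df.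
by rewrite /derive E; apply: cvg_lim.
Qed.

Lemma flat_pos_derive k (x : R) : 0 < x ->
  is_derive x 1 (fun y : R => y^-1 ^+ k * expR (- y^-1))
    (x^-1 ^+ k.+2 * expR (- x^-1) - k%:R * (x^-1 ^+ k.+1 * expR (- x^-1))).
Proof.
move=> x0; have xn0 : x != 0 by rewrite gt_eqF.
have dV : is_derive x 1 (fun y : R => y^-1) (- x^-1 ^+ 2).
  have := is_deriveV (f := id) xn0 (is_derive_id x 1).
  by rewrite /GRing.scale /= mulr1 exprVn.
elim: k => [|k IHk].
  have dE : is_derive x 1 (fun y : R => expR (- y^-1)) (expR (- x^-1) * x^-1 ^+ 2).
    have := is_deriveN dV; rewrite opprK => dN.
    exact: (is_derive1_comp (f := expR) (g := fun y : R => - y^-1)).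
  rewrite mul0r subr0 mulrC.
  by under eq_fun do rewrite expr0 mul1r.
have := is_deriveM dV IHk.
have -> : (fun y : R => y^-1) * (fun y : R => y^-1 ^+ k * expR (- y^-1)) =
    (fun y : R => y^-1 ^+ k.+1 * expR (- y^-1)).
  by apply/funext => y; rewrite exprS mulrA.
suff -> : x^-1 *: (x^-1 ^+ k.+2 * expR (- x^-1) - k%:R * (x^-1 ^+ k.+1 * expR (- x^-1))) +
     x^-1 ^+ k * expR (- x^-1) *: - x^-1 ^+ 2 =
     x^-1 ^+ k.+3 * expR (- x^-1) - k.+1%:R * (x^-1 ^+ k.+2 * expR (- x^-1)) by [].
rewrite /GRing.scale /= -[k.+1%:R]natr1 !exprS expr0; ring.
Qed.

(** One term of the exponential series beats any power; the quadratic bound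
    gives the derivative zero at the origin. *)
Lemma flat_le k (x : R) : 0 < x -> flat k x <= (k.+2)`!%:R * x ^+ 2.
Proof.
move=> x0; rewrite /flat (leNgt x 0) x0 /=; have xn0 : x != 0 by rewrite gt_eqF.
have t0 : 0 <= x^-1 by rewrite invr_ge0 ltW.
have F0 : 0 < (k.+2)`!%:R :> R by rewrite ltr0n fact_gt0.
have h : x^-1 ^+ k.+2 <= (k.+2)`!%:R * expR x^-1.
  have := expR_ge1Dxn k.+1 t0; rewrite -ler_pdivrMl// mulrC; apply: le_trans.
  by rewrite lerDr.
rewrite expRN ler_pdivrMr ?expR_gt0// mulrAC.
rewrite -(ler_pM2r (_ : 0 < x^-1 ^+ 2)); last by rewrite exprn_gt0 ?invr_gt0.
rewrite -exprD addn2 (le_trans h)// le_eqVlt; apply/orP; left; apply/eqP.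
by field.
Qed.

Lemma flat_ge0 k (x : R) : 0 <= flat k x.
Proof.
rewrite /flat; case: (leP x 0) => // x0.
by rewrite mulr_ge0 ?expR_ge0// exprn_ge0// invr_ge0 ltW.
Qed.

Lemma is_derive_flat k (x : R) : is_derive x 1 (flat k) (dflat k x).
Proof.
have [x0|x0|x0] := ltgtP x 0.
- have -> : dflat k x = 0 by rewrite /dflat /flat (ltW x0) mulr0 subr0.
  apply: (near_eq_is_derive _ (is_derive_cst 0 x 1)); near=> y.
  by rewrite /flat ifT//; apply: ltW; near: y; exact: lt_nbhsl.
- have -> : dflat k x = x^-1 ^+ k.+2 * expR (- x^-1) - k%:R * (x^-1 ^+ k.+1 * expR (- x^-1)).
    by rewrite /dflat /flat (leNgt x 0) x0.
  apply: (near_eq_is_derive _ (flat_pos_derive k x0)); near=> y.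
  by rewrite /flat ifF//; apply/negbTE; rewrite -ltNge; near: y; exact: lt_nbhsr.
rewrite x0; have -> : dflat k 0 = 0 by rewrite /dflat /flat lexx mulr0 subr0.
apply: is_derive_of_cvg; apply/cvgrPdist_lt => e e0.
have F0 : 0 < (k.+2)`!%:R :> R by rewrite ltr0n fact_gt0.
near=> h; have hn0 : h != 0 by near: h; exact: nbhs_dnbhs_neq.
rewrite addr0 {2}/flat lexx subr0 sub0r normrN /GRing.scale /= normrM normfV.
have hd : `|h| < e / (k.+2)`!%:R.
  by near: h; apply: dnbhs0_lt; rewrite divr_gt0.
have [h0|h0] := leP h 0; first by rewrite /flat h0 normr0 mulr0.
rewrite (ger0_norm (flat_ge0 k h)); move: hd; rewrite gtr0_norm// => hd.
rewrite mulrC ltr_pdivrMr//; apply: (le_lt_trans (flat_le k h0)).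
by rewrite expr2 mulrA ltr_pM2r// mulrC -ltr_pdivlMr.
Unshelve. all: by end_near. Qed.

Lemma smooth_flat n k : smooth_upto n (flat k).
Proof.
elim: n k => [//|n IHn] k; exists (dflat k); first by move=> x; exact: is_derive_flat.
have -> : dflat k = (fun x => flat k.+2 x + (- k%:R) * flat k.+1 x).
  by apply/funext => x; rewrite /dflat mulNr.
by apply: smooth_add => //; apply: smooth_mul => //; exact: smooth_cst.
Qed.

(** Equal to [0] for [x <= 0] and to [x] for [1 <= x]: after rescaling, a
    smooth approximation of the positive part. *)
Definition spos (x : R) : R := x * (flat 0 x * (flat 0 x + flat 0 (1 - x))^-1).

Lemma flat_gt0 (x : R) : 0 < x -> 0 < flat 0 x.
Proof. by move=> x0; rewrite /flat (leNgt x 0) x0 /= expr0 mul1r expR_gt0. Qed.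

Lemma smooth_spos : smooth spos.
Proof.
move=> n; apply: smooth_mul; first exact: smooth_id.
apply: smooth_mul; first exact: smooth_flat.
apply: smooth_inv.
  move=> x; rewrite gt_eqF//; have [x0|x0] := leP x 0.
    by rewrite ltr_wpDl ?flat_ge0// flat_gt0//; lra.
  by rewrite ltr_wpDr ?flat_ge0// flat_gt0.
apply: smooth_add; first exact: smooth_flat.
have -> : (fun x => flat 0 (1 - x)) = (fun x => flat 0 (-1 * x + 1)).
  by apply/funext => x; rewrite mulN1r addrC.
by apply: smooth_affine; exact: smooth_flat.
Qed.

Lemma spos_le0 (x : R) : x <= 0 -> spos x = 0.
Proof. by move=> x0; rewrite /spos /flat x0 mul0r mulr0. Qed.

Lemma spos_ge1 (x : R) : 1 <= x -> spos x = x.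
Proof.
move=> x1; rewrite /spos [flat 0 (1 - x)]/flat ifT ?addr0; last by lra.
by rewrite mulfV ?mulr1// gt_eqF// flat_gt0//; lra.
Qed.

(** Constant on both sides of [0, 1], the derivative is bounded. *)
Lemma spos_derivative : exists dspos : R -> R, exists C : R,
  [/\ forall x : R, is_derive x 1 spos (dspos x), smooth dspos,
      forall x : R, x <= 0 -> dspos x = 0, forall x : R, 1 < x -> dspos x = 1
    & forall x, `|dspos x| <= C].
Proof.
pose d : R -> R := spos^`()%classic.
have dP (x : R) : is_derive x 1 spos (d x).
  have [d' d'P _] := smooth_spos 1; rewrite /d (is_derive1E d'P); exact: d'P.
have sd : smooth d.
  by move=> n; have [d' d'P sd'] := smooth_spos n.+1; rewrite /d (is_derive1E d'P).
have cd : continuous d.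
  move=> x; have [d' d'P _] := sd 1%N.
  by apply: differentiable_continuous; apply/derivable1_diffP; exact: ex_derive.
have d_lt0 (x : R) : x < 0 -> d x = 0.
  move=> x0; have [_ <-] := dP x; have [_ <-] := is_derive_cst (0 : R) x (1 : R).
  by apply: near_eq_derive; near=> y; apply: spos_le0; apply: ltW; near: y; exact: lt_nbhsl.
have d_gt1 (x : R) : 1 < x -> d x = 1.
  move=> x1; have [_ e1] := dP x; have [_ e2] := is_derive_id x (1 : R).
  rewrite -e1 -[RHS]e2.
  by apply: near_eq_derive; near=> y; apply: spos_ge1; apply: ltW; near: y; exact: lt_nbhsr.
have d0 : d 0 = 0.
  have h : d x @[x --> 0^'-] --> d 0.
    by apply: cvg_at_left_filter; exact: cd.
  suff h0 : d x @[x --> 0^'-] --> (0 : R) by apply: (cvg_unique _ h h0).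
  apply: cvg_near_cst; near=> y; apply: d_lt0; near: y; exact: nbhs_left_lt.
have [c0 _ Hmax] := @EVT_max R (fun x => `|d x|) 0 1 ler01
  (@continuous_subspaceT _ _ _ (fun x : R => `|d x|) (fun x => cvg_norm (cd x))).
exists d, (`|d c0| + 1); split => //.
  by move=> x; rewrite le_eqVlt => /orP[/eqP->|/d_lt0].
move=> x; have [x0|x0] := ltP x 0; first by rewrite d_lt0// normr0 addr_ge0.
have [x1|x1] := ltP 1 x; first by rewrite d_gt1// normr1 lerDr.
by apply: (le_trans (Hmax x _)); rewrite ?in_itv/= ?x0// lerDl.
Unshelve. all: by end_near. Qed.

End Smooth.

(** * The distributional equation *)

Section DuBoisReymond.
Context {R : realType}.
Local Notation B := (measurableTypeR R).
Local Notation leb := (@lebesgue_measure R).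
Implicit Types (F k l : R -> R[i]) (f h : R -> R) (J : set R).

Lemma is_derive_continuous f (f' : R -> R) : (forall x : R, is_derive x 1 f (f' x)) -> continuous f.
Proof.
by move=> ff' x; apply: differentiable_continuous; apply/derivable1_diffP; exact: ex_derive.
Qed.

Lemma primitive_C1 J f (f' : R -> R) : (forall x : R, is_derive x 1 f (f' x)) -> continuous f' ->
  primitive J (fun x => (f x)%:C) (fun x => (f' x)%:C).
Proof.
move=> ff' cf'; have cf := is_derive_continuous ff'.
have mf' (a b : R) : measurable_fun (`[a, b] : set B) f'.
  by apply: (@measurable_funS _ _ _ _ setT) => //; exact: continuous_measurable_fun.
split => [a b _|x y _ _].
  have [ab|ba] := leP a b; last first.
    by rewrite set_itv_ge ?bnd_simp -?ltNge//; split; exact: integrable_set0.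
  have [c _ Hmax] := @EVT_max R (fun x => `|f' x|) a b ab
    (@continuous_subspaceT _ _ _ (fun x : R => `|f' x|) (fun x => cvg_norm (cf' x))).
  apply: (@cintegrable_bounded _ _ _ _ `|f' c|).
  - exact: measurable_itv.
  - exact: leb_cc_fin.
  - exact: cmeasurable_real.
  by move=> x xab; rewrite normc_real; exact: Hmax.
rewrite le_eqVlt => /orP[/eqP->|xy].
  have -> : `[y, y] = [set y] :> set R by rewrite set_itv1.
  rewrite subrr; apply: complex_eq.
    by rewrite Re_cint /Rintegral integral_set1.
  by rewrite Im_cint /Rintegral integral_set1.
have FTC := @continuous_FTC2 R f' f x y xy (continuous_subspaceT cf').
have H1 : derivable_oo_LRcontinuous f x y.
  split=> [t _||]; first exact: ex_derive.
    by apply: cvg_at_right_filter; exact: cf.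
  by apply: cvg_at_left_filter; exact: cf.
have H2 : {in `]x, y[%R, f^`()%classic =1 f'}.
  by move=> t _; rewrite derive1E; exact: derive_val.
rewrite -rmorphB; apply: complex_eq.
  by rewrite cReC Re_cint /Rintegral /= (FTC H1 H2).
by rewrite cImC Im_cint /Rintegral /= integral0 fine0.
Qed.

Lemma cint_co_cc a b k : cmeasurable `[a, b[ k ->
  cintegral leb `[a, b[ k = cintegral leb `[a, b] k.
Proof.
move=> [fr fi]; rewrite /cintegral; congr (fine _ +i* fine _).
- by apply: integral_itv_bndo_bndc; apply/measurable_EFinP.
- by apply: integral_itv_bndo_bndc; apply/measurable_EFinP.
Qed.

Lemma leb_co_fin a b : (leb `[a, b[ < +oo)%E.
Proof.
apply: le_lt_trans (leb_cc_fin a b); apply: le_measure; rewrite ?inE//.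
exact: subset_itv_co_cc.
Qed.

Lemma primitive_ibp p q F k (H l : R -> R[i]) : p <= q ->
  primitive `[p, q] F k -> primitive `[p, q] H l ->
  cintegrable leb `[p, q] (fun s => F s * l s) /\
  cintegral leb `[p, q] (fun s => F s * l s) =
  F q * H q - F p * H p - cintegral leb `[p, q] (fun s => k s * H s).
Proof.
move=> pq Fk Hl; have [kI FE] := Fk; have [lI HE] := Hl.
have pI : `[p, q] p by rewrite /= in_itv /= lexx.
have qI : `[p, q] q by rewrite /= in_itv /= lexx pq.
have mcc u v : measurable (`[u, v] : set B) by exact: measurable_itv.
have mco u v : measurable (`[u, v[ : set B) by exact: measurable_itv.
have sub : `[p, q[ `<=` `[p, q] by exact: subset_itv_co_cc.
have kpq := kI _ _ (@subset_refl _ _); have lpq := lI _ _ (@subset_refl _ _).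
have kco : cintegrable leb `[p, q[ k by exact: cintegrableS kpq.
have [fI _ fE] := fubini_triangle (leb_co_fin p q) kco lpq.
have W t : `[p, q] t -> cintegral leb `[p, t[ k = F t - F p.
  move=> tpq; move: (tpq); rewrite /= in_itv /= => /andP[pt tq].
  rewrite (FE p t pI tpq pt); apply: cint_co_cc; apply: (@cintegrable_measurable _ leb).
  by apply: (@cintegrableS _ leb _ `[p, q]) => // s /=; rewrite !in_itv /=; lra.
have e1 t : `[p, q] t -> l t * cintegral leb `[p, t[ k + F p * l t = F t * l t.
  by move=> /W ->; ring.
have FpI : cintegrable leb `[p, q] (fun t => F p * l t) by exact: cintegrableZ.
split; first by apply: (eq_cintegrable (mcc p q) e1); exact: cintegrableD.
rewrite -(eq_cint leb e1) (cintD (mcc p q) fI FpI) fE (cintZ _ (mcc p q) lpq) -(HE p q pI qI pq).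
have HI : cintegrable leb `[p, q] (fun s => k s * H s).
  have [M [M0 HM]] := primitive_bounded Hl.
  apply: (@cintegrableM _ leb _ _ _ M (mcc p q) kpq _ HM).
  by apply: ac_cmeasurable => //; exact: (primitive_ac Hl).
have e2 s : `[p, q[ s -> k s * cintegral leb `[s, q] l = H q * k s - k s * H s.
  move=> spq; have sq : s <= q by move: spq; rewrite /= in_itv /= => /andP[_ /ltW].
  by rewrite -(HE s q (sub _ spq) qI sq); ring.
have HIco : cintegrable leb `[p, q[ (fun s => k s * H s) by exact: cintegrableS HI.
rewrite (eq_cint leb e2) (cintB (mco p q) (cintegrableZ (H q) (mco p q) kco) HIco).
rewrite (cintZ (H q) (mco p q) kco) (cint_co_cc (cintegrable_measurable kco)).
rewrite (cint_co_cc (cintegrable_measurable HIco)) -(FE p q pI qI pq).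
by move: (cintegral leb _ _) => X; ring.
Qed.

(** The steps converge boundedly to the indicator of [p < s]. *)
Lemma step_limit (dsp : R -> R) (C : R) P Q p F k :
  continuous dsp -> (forall x : R, x <= 0 -> dsp x = 0) ->
  (forall x : R, 1 < x -> dsp x = 1) -> (forall x, `|dsp x| <= C) ->
  primitive `[P, Q] F k -> P <= p -> p <= Q ->
  forall e : R, 0 < e -> exists N, forall n, (N <= n)%N ->
  cintegrable leb `[P, Q] (fun s => k s * (dsp (n.+1%:R * s + - (n.+1%:R * p)))%:C) /\
  normc (cintegral leb `[P, Q] (fun s => k s * (dsp (n.+1%:R * s + - (n.+1%:R * p)))%:C)
         - (F Q - F p)) < e.
Proof.
move=> cd d0 d1 dC [kI FE] Pp pQ e e0.
have mcc : measurable (`[P, Q] : set B) by exact: measurable_itv.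
have kPQ := kI _ _ (@subset_refl _ _).
have C0 : 0 <= C by exact: le_trans (dC 0).
pose st (s : R) : R := if s <= p then 0 else 1.
pose dn n (s : R) := dsp (n.+1%:R * s + - (n.+1%:R * p)).
have mst : measurable_fun (setT : set B) st.
  have -> : st = \1_(`]p, +oo[) :> (R -> R).
    apply/funext => s; rewrite /st indicE; have [sp|ps] := leP s p.
      by rewrite memNset//= in_itv /= andbT; apply/negP; rewrite -leNgt.
    by rewrite mem_set//= in_itv /= andbT.
  by apply: measurable_indic; exact: measurable_itv.
have mdn n : measurable_fun (setT : set B) (dn n).
  apply: continuous_measurable_fun => s; apply: continuous_comp; last exact: cd.
  by apply: cvgD; [apply: cvgM; [exact: cvg_cst|exact: cvg_id]|exact: cvg_cst].
have mS (u : R -> R) : measurable_fun (setT : set B) u -> measurable_fun (`[P, Q] : set B) u.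
  by apply: measurable_funS.
have knI n : cintegrable leb `[P, Q] (fun s => k s * (dn n s)%:C).
  apply: (@cintegrableM _ leb _ _ _ C mcc kPQ).
    by apply: cmeasurable_real; exact: mS.
  by move=> s _; rewrite normc_real; exact: dC.
have stI : cintegrable leb `[P, Q] (fun s => k s * (st s)%:C).
  apply: (@cintegrableM _ leb _ _ _ 1 mcc kPQ).
    by apply: cmeasurable_real; exact: mS.
  by move=> s _; rewrite normc_real /st; case: ifP => _; rewrite ?normr0 ?normr1.
have stE : cintegral leb `[P, Q] (fun s => k s * (st s)%:C) = F Q - F p.
  have sub : `]p, Q] `<=` `[P, Q] by move=> s /=; rewrite !in_itv /=; lra.
  have sub2 : `[p, Q] `<=` `[P, Q] by move=> s /=; rewrite !in_itv /=; lra.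
  rewrite (@cint_restrict _ leb `]p, Q] `[P, Q] _ sub); last first.
    move=> s sPQ ns; rewrite /st ifT ?mulr0// leNgt; apply/negP => ps; apply: ns.
    by move: sPQ; rewrite /= !in_itv /=; lra.
  rewrite FE//; [|by rewrite /= in_itv /= Pp|by rewrite /= in_itv /= lexx (le_trans Pp)].
  rewrite -cint_oc_cc; last first.
    apply: (@cintegrable_measurable _ leb); apply: (@cintegrableS _ leb _ `[P, Q]) => //.
  by apply: eq_cint => s; rewrite /= in_itv /= => /andP[ps _]; rewrite /st leNgt ps /= mulr1.
pose g n s := normc (k s) * `|dn n s - st s|.
have [mk _] := conj (cintegrable_measurable kPQ) I.
have nk := integrable_normc mcc kPQ.
have gle n s : g n s <= (C + 1) * normc (k s).
  rewrite /g mulrC ler_wpM2r ?normc_ge0// (le_trans (ler_normB _ _))// lerD ?dC//.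
  by rewrite /st; case: ifP => _; rewrite ?normr0 ?normr1.
have mg n : measurable_fun (`[P, Q] : set B) (g n).
  apply: measurable_funM; first exact: measurable_normc.
  apply: measurableT_comp => //; apply: measurable_funB; exact: mS.
have bI : leb.-integrable `[P, Q] (EFin \o (fun s => (C + 1) * normc (k s))).
  exact: (integrableZl mcc (C + 1) nk).
have gI n : leb.-integrable `[P, Q] (EFin \o g n).
  apply: le_integrable bI => //; first exact/measurable_EFinP.
  move=> s _ /=; rewrite lee_fin !ger0_norm//.
  - by rewrite mulr_ge0 ?normc_ge0// addr_ge0.
  - by rewrite /g mulr_ge0 ?normc_ge0.
have ptw s : g ^~ s @ \oo --> (0 : R).
  apply: cvg_near_cst; have [sp|ps] := leP s p.
    apply: nearW => n; rewrite /g /st sp /dn d0 ?subrr ?normr0 ?mulr0//.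
    by rewrite -mulrBr pmulr_rle0 ?ltr0n// subr_le0.
  have ps0 : 0 < s - p by rewrite subr_gt0.
  have [N _ HN] := near_infty_natSinv_lt (PosNum ps0).
  exists N => // n Nn; have /= hn := HN n Nn.
  rewrite /g /st leNgt ps /= /dn d1 ?subrr ?normr0 ?mulr0//.
  by rewrite -mulrBr mulrC -ltr_pdivrMr ?ltr0n// mul1r.
have mgE n : measurable_fun (`[P, Q] : set B) (EFin \o g n) by exact/measurable_EFinP.
have ptwE : {ae leb, forall s, `[P, Q] s -> (EFin \o g n) s @[n --> \oo] --> 0%E}.
  by apply: aeW => s _; apply: cvg_EFin; [exact: nearW|exact: ptw].
have domE : {ae leb, forall s n, `[P, Q] s -> (`|(EFin \o g n) s| <= ((C + 1) * normc (k s))%:E)%E}.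
  apply: aeW => s n _ /=; rewrite lee_fin ger0_norm//.
  by rewrite /g mulr_ge0 ?normc_ge0.
have [_ _ lim] := dominated_convergence mcc mgE (measurable_cst 0%E) ptwE bI domE.
have : (fine \o (fun n => \int[leb]_(x in `[P, Q]) (EFin \o g n) x)%E) @ \oo --> (0 : R).
  by move: lim; rewrite integral0 => /fine_cvg.
have e2 : 0 < e / 4 by rewrite divr_gt0.
move=> /cvgrPdist_lt /(_ _ e2)[N _ HN]; exists N => n Nn.
split; first exact: knI.
have := HN n Nn; rewrite /= sub0r normrN.
rewrite ger0_norm; last first.
  by apply: fine_ge0; apply: integral_ge0 => s _; rewrite lee_fin /g mulr_ge0 ?normc_ge0.
move=> small; rewrite -stE -(cintB mcc (knI n) stI).
have dI : cintegrable leb `[P, Q] (fun s => k s * (dn n s)%:C - k s * (st s)%:C).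
  exact: cintegrableB.
apply: le_lt_trans (ler_normc_cint mcc dI (gI n) _) _.
  move=> s _; rewrite -mulrBr normcM /g -rmorphB normc_real.
  exact: lexx.
by rewrite /Rintegral; move: small; rewrite /=; move: (fine _) => G; lra.
Qed.

Lemma smooth_continuous f : smooth f -> continuous f.
Proof. by move=> /(_ 1%N)[f' ff' _]; exact: is_derive_continuous ff'. Qed.

(** Test against smoothed tents with vertices at [x], [0] and [1]: in the
    limit their derivative picks out the increments of [F] between the
    vertices. *)
Lemma du_bois_reymond F k : primitive setT F k ->
  (forall h, is_test_function h ->
    cintegral leb setT (fun x => k x * (h^`()%classic x)%:C) = 0) ->
  forall x, F x = F 0 + (F 1 - F 0) * x%:C.
Proof.
move=> Fk test x.
have [dsp [C [dP sd d0 d1 dC]]] := @spos_derivative R.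
have cd := smooth_continuous sd.
pose P := Num.min x 0; pose Q := Num.max x 1 + 1.
have [Px P0 xQ Q1] : [/\ P <= x, P <= 0, x + 1 <= Q & 2 <= Q].
  rewrite /P /Q !ge_min !lexx /= orbT; split => //; first by rewrite lerD2r le_max lexx.
  have -> : 2 = 1 + 1 :> R by ring.
  by rewrite lerD2r le_max lexx orbT.
pose N1 (n : nat) : R := n.+1%:R.
(* The coefficients [1], [x - 1], [- x] annihilate affine functions, so that
   [h n] vanishes beyond [Q]. *)
pose h n (s : R) := spos (N1 n * s + - (N1 n * x)) + (x - 1) * spos (N1 n * s + - (N1 n * 0))
  + (- x) * spos (N1 n * s + - (N1 n * 1)).
pose dh n (s : R) := N1 n * (dsp (N1 n * s + - (N1 n * x)) +
  (x - 1) * dsp (N1 n * s + - (N1 n * 0)) + (- x) * dsp (N1 n * s + - (N1 n * 1))).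
have sh n : smooth (h n).
  move=> m; apply: smooth_add; [apply: smooth_add|].
  - by apply: smooth_affine; exact: smooth_spos.
  - by apply: smooth_mul; [exact: smooth_cst|apply: smooth_affine; exact: smooth_spos].
  - by apply: smooth_mul; [exact: smooth_cst|apply: smooth_affine; exact: smooth_spos].
have N1_ge1 n : 1 <= N1 n by rewrite /N1 ler1n.
have h_l n s : s <= P -> h n s = 0.
  move=> sP; have n1 := N1_ge1 n.
  rewrite /h !spos_le0; first by ring.
  - by rewrite -mulrBr pmulr_rle0; [lra|lra].
  - by rewrite -mulrBr pmulr_rle0; [lra|lra].
  - by rewrite -mulrBr pmulr_rle0; [lra|lra].
have h_r n s : Q <= s -> h n s = 0.
  move=> Qs; have n1 := N1_ge1 n.
  have ge1 p : p + 1 <= s -> 1 <= N1 n * s + - (N1 n * p).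
    move=> ps; rewrite -mulrBr; apply: (le_trans n1).
    by rewrite ler_peMr//; lra.
  rewrite /h !spos_ge1; first by ring.
  - by apply: ge1; lra.
  - by apply: ge1; lra.
  - by apply: ge1; lra.
have hP n (s : R) : is_derive s 1 (h n) (dh n s).
  have aff (p : R) : is_derive s 1 (fun t => spos (N1 n * t + - (N1 n * p)))
      (dsp (N1 n * s + - (N1 n * p)) * N1 n).
    exact: (@is_derive1_comp R spos (fun t => N1 n * t + - (N1 n * p)) s _ _ (dP _)
      (is_derive_affine (N1 n) (- (N1 n * p)) s)).
  have := is_deriveD (is_deriveD (aff x) (is_deriveM (is_derive_cst (x - 1) s 1) (aff 0)))
    (is_deriveM (is_derive_cst (- x) s 1) (aff 1)).
  rewrite !scaler0 !addr0 /GRing.scale /=.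
  suff -> : dsp (N1 n * s + - (N1 n * x)) * N1 n +
     (x - 1) * (dsp (N1 n * s + - (N1 n * 0)) * N1 n) +
     - x * (dsp (N1 n * s + - (N1 n * 1)) * N1 n) = dh n s by [].
  by rewrite /dh; ring.
have dhE n : (h n)^`()%classic = dh n by exact: is_derive1E (hP n).
have h_test n : is_test_function (h n).
  split; first by move=> m s; exact: smooth_derivable.
  exists P, Q => s ns; have [sP|Ps] := leP s P; first exact: h_l.
  apply: h_r; rewrite leNgt; apply/negP => sQ; apply: ns.
  by rewrite /= in_itv /= !ltW.
have PQ : P <= Q by lra.
have dh_out n s : ~ `[P, Q] s -> dh n s = 0.
  move=> ns; rewrite -dhE derive1E -(derive_cst (0 : R) s (1 : R)).
  apply: near_eq_derive.
  have [sP|Ps] := ltP s P.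
    by near=> t; apply: h_l; apply: ltW; near: t; exact: lt_nbhsl.
  have Qs : Q < s by rewrite ltNge; apply/negP => sQ; apply: ns; rewrite /= in_itv /= Ps.
  by near=> t; apply: h_r; apply: ltW; near: t; exact: lt_nbhsr.
have FPQ := primitiveS (@subsetT _ `[P, Q]) Fk.
have mcc : measurable (`[P, Q] : set B) by exact: measurable_itv.
pose I n p := cintegral leb `[P, Q] (fun s => k s * (dsp (N1 n * s + - (N1 n * p)))%:C).
have lim p := step_limit cd d0 d1 dC FPQ (p := p).
pose al := 1 + normc (x - 1)%:C + normc (- x)%:C.
have al0 : 0 < al by rewrite /al -addrA ltr_wpDr// addr_ge0 ?normc_ge0.
pose G := (F Q - F x) + (x - 1)%:C * (F Q - F 0) + (- x)%:C * (F Q - F 1).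
suff G0 : G = 0.
  have -> : F x = F 0 + (F 1 - F 0) * x%:C - G by rewrite /G rmorphB rmorphN /= rmorph1; ring.
  by rewrite G0 subr0.
apply: normc0_eq0; apply/eqP; rewrite eq_le normc_ge0 andbT.
apply/ler_addgt0Pr => e e0; rewrite add0r.
have ea : 0 < e / al by rewrite divr_gt0.
have [||M1 H1] := lim x _ _ _ ea; [exact: Px|lra|].
have [||M2 H2] := lim 0 _ _ _ ea; [exact: P0|lra|].
have [||M3 H3] := lim 1 _ _ _ ea; [lra|lra|].
pose n := maxn M1 (maxn M2 M3).
have [I1 B1] := H1 n (leq_maxl _ _).
have [I2 B2] := H2 n (leq_trans (leq_maxl _ _) (leq_maxr _ _)).
have [I3 B3] := H3 n (leq_trans (leq_maxr _ _) (leq_maxr _ _)).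
have I12 := cintegrableD mcc I1 (cintegrableZ (x - 1)%:C mcc I2).
have sum0 : I n x + (x - 1)%:C * I n 0 + (- x)%:C * I n 1 = 0.
  have := test _ (h_test n); rewrite dhE (@cint_restrict _ leb `[P, Q] setT _ (@subsetT _ _)); last first.
    by move=> s _ /dh_out ->; rewrite mulr0.
  have E s : `[P, Q] s -> k s * (dh n s)%:C =
     (N1 n)%:C * (k s * (dsp (N1 n * s + - (N1 n * x)))%:C +
       (x - 1)%:C * (k s * (dsp (N1 n * s + - (N1 n * 0)))%:C) +
       (- x)%:C * (k s * (dsp (N1 n * s + - (N1 n * 1)))%:C)).
    by move=> _; rewrite /dh !(rmorphM, rmorphD)/=; ring.
  have I123 := cintegrableD mcc I12 (cintegrableZ (- x)%:C mcc I3).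
  rewrite (eq_cint leb E) (cintZ _ mcc I123) (cintD mcc I12 (cintegrableZ _ mcc I3)).
  rewrite (cintD mcc I1 (cintegrableZ _ mcc I2)) (cintZ _ mcc I2) (cintZ _ mcc I3).
  move=> /eqP; rewrite mulf_eq0 => /orP[|/eqP//].
  by rewrite /N1 => /eqP/(congr1 (@complex.Re R)) /= /eqP; rewrite pnatr_eq0.
have -> : G = - ((I n x - (F Q - F x)) + (x - 1)%:C * (I n 0 - (F Q - F 0)) + (- x)%:C * (I n 1 - (F Q - F 1))).
  by rewrite -[LHS]opprK; congr (- _); rewrite -[LHS]add0r -sum0 /G; ring.
rewrite normcN; apply: (le_trans (ler_normcD _ _)).
apply: (le_trans (lerD (ler_normcD _ _) (lexx _))); rewrite !normcM.
have b2 : normc (x - 1)%:C * normc (I n 0 - (F Q - F 0)) <= normc (x - 1)%:C * (e / al).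
  by apply: ler_wpM2l; [exact: normc_ge0|exact: ltW].
have b3 : normc (- x)%:C * normc (I n 1 - (F Q - F 1)) <= normc (- x)%:C * (e / al).
  by apply: ler_wpM2l; [exact: normc_ge0|exact: ltW].
apply: (le_trans (lerD (lerD (ltW B1) b2) b3)).
rewrite le_eqVlt; apply/orP; left; apply/eqP.
have an0 : al != 0 by rewrite gt_eqF.
transitivity (al * (e / al)); first by rewrite /al !mulrDl mul1r.
by rewrite mulrCA mulfV// mulr1.
Unshelve. all: by end_near. Qed.

End DuBoisReymond.

Section DistributionalEquation.
Context {R : realType}.
Local Notation B := (measurableTypeR R).
Local Notation leb := (@lebesgue_measure R).
Variables (om : set B -> R) (up : {measure set B -> \bar R}).
Hypotheses (som : is_signed_measure om) (up_fin : locally_finite up).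
Local Notation mu4 := (mu4 up som).

Lemma test_function_facts (h : R -> R) : is_test_function h ->
  let h1 := h^`()%classic in let h2 := derive1n 2 h in
  [/\ primitive setT (fun x => (h x)%:C) (fun x => (h1 x)%:C),
      primitive setT (fun x => (h1 x)%:C) (fun x => (h2 x)%:C)
    & exists P Q, P < Q /\ forall x, ~ `]P, Q[ x -> [/\ h x = 0, h1 x = 0 & h2 x = 0]].
Proof.
move=> [dh [a [b h0]]] h1 h2.
have der n (x : R) : is_derive x 1 (derive1n n h) (derive1n n.+1 h x).
  by apply: DeriveDef; [exact: dh|rewrite derive1nS derive1E].
have cont n : continuous (derive1n n h) by exact: is_derive_continuous (der n).
split.
- exact: primitive_C1 (der 0%N) (cont 1%N).
- exact: primitive_C1 (der 1%N) (cont 2%N).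
exists (Num.min a b - 1), (Num.max a b + 1); split.
  by case: (leP a b) => ab; lra.
have ab1 : Num.min a b <= a by rewrite ge_min lexx.
have ab2 : b <= Num.max a b by rewrite le_max lexx orbT.
move=> x nx.
have [xa|bx] : x < a \/ b < x.
  have [xa|ax] := ltP x a; [by left|right].
  rewrite ltNge; apply/negP => xb; apply: nx; rewrite /= in_itv /=.
  by apply/andP; split; lra.
- have z n : forall y, y < a -> derive1n n h y = 0.
    elim: n => [|n IHn] y ya.
      by apply: h0; rewrite /= in_itv /= => /andP[]; lra.
    rewrite derive1nS derive1E -(derive_cst (0 : R) y (1 : R)).
    by apply: near_eq_derive; near=> t; apply: IHn; near: t; exact: lt_nbhsl.
  by split; [exact: (z 0%N)|exact: (z 1%N)|exact: (z 2%N)].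
- have z n : forall y, b < y -> derive1n n h y = 0.
    elim: n => [|n IHn] y ya.
      by apply: h0; rewrite /= in_itv /= => /andP[]; lra.
    rewrite derive1nS derive1E -(derive_cst (0 : R) y (1 : R)).
    by apply: near_eq_derive; near=> t; apply: IHn; near: t; exact: lt_nbhsr.
  by split; [exact: (z 0%N)|exact: (z 1%N)|exact: (z 2%N)].
Unshelve. all: by end_near. Qed.

(** The equation [- f'' + f / 4 = om t1 + up t2], for the right-hand sides
    [f], [t1], [t1], [t2]. *)
Definition coef_rel : 'I_4 -> R[i] := vec4 4^-1 (- 1) 1 (- 1).

Lemma primitive_weight (f k : R -> R[i]) (mu : {measure set B -> \bar R}) :
  locally_finite mu -> primitive setT f k -> forall x y, cintegrable mu `[x, y[ f.
Proof.
move=> mu_fin fk x y.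
apply: (@primitive_cintegrable _ unit (fun=> mu) (fun=> mu_fin) tt _ _ _ k).
exact: primitiveS fk.
Qed.

(** Solve the integrated equation with the same right-hand side; the
    difference to [f.1] is affine by [du_bois_reymond], and affine functions
    may be added to a solution. *)
Lemma T_loc_qeq (f tf : cfun2 R) : T_loc om up (f, tf) ->
  exists F', qeq mu4 setT coef_rel (vec4 f.1 tf.1 tf.1 tf.2) f.1 F'.
Proof.
move=> [] /= [acf _ _] [act _ t2L] eqn _.
pose w : 'I_4 -> R -> R[i] := vec4 f.1 tf.1 tf.1 tf.2.
have mf := mu4_fin som up_fin.
have fp := ac_primitive (@is_intervalT R) acf; have tp := ac_primitive (@is_intervalT R) act.
have t2I x y : cintegrable up `[x, y[ tf.2.
  have mcc : measurable (`[x, y] : set B) by exact: measurable_itv.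
  apply: (@cintegrableS _ up _ `[x, y]) => //; first exact: subset_itv_co_cc.
  apply: (L2_cintegrable mcc _ (t2L x y)).
  by apply: up_fin; exact: bounded_borel_itv.
have wI i x y : cintegrable (mu4 i) `[x, y[ (w i).
  rewrite /w; case: i => -[|[|[|i]]] Hi /=.
  - exact: (primitive_weight (mf (Ordinal Hi)) fp).
  - exact: (primitive_weight (mf (Ordinal Hi)) tp).
  - exact: (primitive_weight (mf (Ordinal Hi)) tp).
  - exact: t2I.
have [Vq _ _] := rhs_ivp mf coef_rel 0 0 0 wI.
set V := rhs_value _ _ _ _ _ _ in Vq; set V' := rhs_slope _ _ _ _ _ in Vq.
have [Vp _ _] := Vq.
pose k x := -1 * V' x + cderiv f.1 x.
have Dp : primitive setT (fun x => -1 * V x + f.1 x) k.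
  exact: (primitive_linear (-1) (@is_intervalT R) Vp fp).
have aff := du_bois_reymond Dp.
have {}aff : forall x, -1 * V x + f.1 x =
    -1 * V 0 + f.1 0 + (-1 * V 1 + f.1 1 - (-1 * V 0 + f.1 0)) * x%:C.
  apply: aff => h /[dup] ht /test_function_facts [hp h1p [P [Q [PQ out]]]].
  have mcc : measurable (`[P, Q] : set B) by exact: measurable_itv.
  have mco : measurable (`[P, Q[ : set B) by exact: measurable_itv.
  have subT (A : set R) : A `<=` setT by [].
  have outcc x : ~ `[P, Q] x -> [/\ h x = 0, h^`()%classic x = 0 & derive1n 2 h x = 0].
    by move=> nx; apply: out; apply: contra_not nx; rewrite /= !in_itv /=; lra.
  have outco x : ~ `[P, Q[ x -> [/\ h x = 0, h^`()%classic x = 0 & derive1n 2 h x = 0].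
    by move=> nx; apply: out; apply: contra_not nx; rewrite /= !in_itv /=; lra.
  have [hP h1P _] : [/\ h P = 0, h^`()%classic P = 0 & derive1n 2 h P = 0].
    by apply: out; rewrite /= in_itv /= ltxx.
  have [hQ h1Q _] : [/\ h Q = 0, h^`()%classic Q = 0 & derive1n 2 h Q = 0].
    by apply: out; rewrite /= in_itv /= ltxx andbF.
  rewrite (@cint_restrict _ leb `[P, Q] setT _ (subT _)); last first.
    by move=> x _ /outcc[_ -> _]; rewrite mulr0.
  have [I1 E1] := qeq_weak mf (ltW PQ) (qeqS (subT _) Vq) (primitiveS (subT _) hp).
  have [I2 E2] := primitive_ibp (ltW PQ) (primitiveS (subT _) h1p) (primitiveS (subT `[P, Q]) fp).
  have kE x : `[P, Q] x -> -1 * (V' x * (h^`()%classic x)%:C) +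
      (h^`()%classic x)%:C * cderiv f.1 x = k x * (h^`()%classic x)%:C.
    by move=> _; rewrite /k; ring.
  rewrite -(eq_cint leb kE) (cintD mcc (cintegrableZ _ mcc I1) I2) (cintZ _ mcc I1) E1 E2.
  rewrite hP hQ h1P h1Q !mulr0 !mul0r !subr0 !sub0r.
  have := eqn h ht; rewrite /signed_integral.
  rewrite (@cint_restrict _ leb `[P, Q] setT _ (subT _)); last first.
    move=> x _ /outcc[_ _ h20]; transitivity (f.1 x * (derive1n 2 h x)%:C) => //.
    by rewrite h20 mulr0.
  have re (mu : {measure set B -> \bar R}) (g : R -> R[i]) :
      cintegral mu setT (fun x => g x * (h x)%:C) = cintegral mu `[P, Q[ (fun x => g x * (h x)%:C).
    by apply: cint_restrict => // x _ /outco[-> _ _]; rewrite mulr0.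
  rewrite (re leb) (re (upvar som)) (re (upvar (signed_measureN som))) (re up).
  have -> : wint mu4 coef_rel (fun i s => w i s * (h s)%:C) `[P, Q[ =
     4^-1 * cintegral leb `[P, Q[ (fun s => f.1 s * (h s)%:C)
     - cintegral (upper_variation om) `[P, Q[ (fun s => tf.1 s * (h s)%:C)
     + cintegral (lower_variation om) `[P, Q[ (fun s => tf.1 s * (h s)%:C)
     - cintegral up `[P, Q[ (fun s => tf.2 s * (h s)%:C).
    have -> : (fun i s => w i s * (h s)%:C) = vec4 (fun s => f.1 s * (h s)%:C)
        (fun s => tf.1 s * (h s)%:C) (fun s => tf.1 s * (h s)%:C) (fun s => tf.2 s * (h s)%:C).
      by apply/funext => -[[|[|[|i]]] Hi].
    by rewrite wint4E; ring.
  rewrite (@eq_cint _ leb `[P, Q] (fun s => (derive1n 2 h s)%:C * f.1 s)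
    (fun s => f.1 s * (derive1n 2 h s)%:C)); last by move=> s _; exact: mulrC.
  move: (cintegral leb `[P, Q] _) (cintegral leb `[P, Q[ _)
    (cintegral (upper_variation om) _ _) (cintegral (lower_variation om) _ _) (cintegral up _ _).
  move=> A1 A2 A3 A4 A5 e.
  transitivity ((- A1 + 4^-1 * A2) - ((A3 - A4) + A5)); first by ring.
  by rewrite e subrr.
pose al := -1 * V 0 + f.1 0; pose be := -1 * V 1 + f.1 1 - al.
exists (fun x => V' x + be); split => //.
  have [V'I VE] := Vp; have [lI lE] := @primitive_affine R setT be al (@is_intervalT R).
  have fE x : f.1 x = V x + (be * x%:C + al).
    have := aff x; rewrite -/al -/be => e.
    by rewrite -[LHS](addNKr (V x)) -mulN1r e; ring.
  split => [a b ab|x y Jx Jy xy].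
    apply: cintegrableD; [exact: measurable_itv|exact: V'I|exact: lI].
  rewrite (cintD (measurable_itv _) (V'I _ _ _) (lI _ _ _)) -?VE -?lE//.
  by rewrite !fE; ring.
move=> x y _ _ xy; have [_ _ VE] := Vq.
by rewrite -(VE x y)//; ring.
Qed.

End DistributionalEquation.

(** * The Green function on a half-line *)

Section HalfLineGreen.
Context {R : realType}.
Local Notation B := (measurableTypeR R).
Local Notation leb := (@lebesgue_measure R).
Variables (om : set B -> R) (up : {measure set B -> \bar R}).
Hypotheses (som : is_signed_measure om) (up_fin : locally_finite up).
Local Notation mu4 := (mu4 up som).
Let mf := mu4_fin som up_fin.
Variables (c : R) (plus : bool).
Local Notation J := (half_line c plus).
Local Notation H10 := (H10_space c plus).
Implicit Types (F G h k : R -> R[i]).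

Let mJ := half_line_measurable c plus.
Let iJ := @half_line_interval R c plus.

Lemma L2_setU (mu : {measure set B -> \bar R}) (D E : set B) F : measurable D -> measurable E ->
  L2 mu D F -> L2 mu E F -> L2 mu (D `|` E) F.
Proof.
move=> mD mE [fr fi fI] [gr gi gI].
have mr : measurable_fun (D `|` E) (fun x : B => complex.Re (F x)) by apply/measurable_funU.
have mi : measurable_fun (D `|` E) (fun x : B => complex.Im (F x)) by apply/measurable_funU.
split => //.
have mn : measurable_fun (D `|` E) (fun x => (normc (F x) ^+ 2)%:E).
  by apply/measurable_EFinP; apply: measurable_funX; exact: measurable_normc.
rewrite (_ : D `|` E = D `|` (E `\` D)) in mn *; last by rewrite setUDr setDv setD0.
rewrite ge0_integral_setU//; last 3 first.
- exact: measurableD.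
- by move=> x _; rewrite lee_fin exprn_ge0// normc_ge0.
- by rewrite disj_set2E setDIK.
rewrite lte_add_pinfty//; apply: le_lt_trans gI.
apply: ge0_subset_integral => //; first exact: measurableD.
  apply/measurable_EFinP; apply: measurable_funX; exact: measurable_normc.
by move=> x _; rewrite lee_fin exprn_ge0// normc_ge0.
Qed.

Lemma slope_bounded a p q F F' : p <= q -> qeq mu4 `[p, q] a (fun=> F) F F' ->
  exists M, forall t, `[p, q] t -> normc (F' t) <= M.
Proof.
move=> pq [Fp FI FE]; have [M [M0 HM]] := primitive_bounded Fp.
pose K := \sum_i normc (a i) * fine (mu4 i `[p, q]%classic).
have pI : `[p, q] p by rewrite /= in_itv /= lexx.
exists (normc (F' p) + 2 * M * K) => t tpq.
have /andP[pt tq] : p <= t <= q by move: tpq; rewrite /= in_itv.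
rewrite -[F' t](subrK (F' p)) addrC (le_trans (ler_normcD _ _))// lerD2l FE//.
have sub : `[p, t[ `<=` `[p, q] by move=> s /=; rewrite !in_itv /=; lra.
have mco : measurable (`[p, t[ : set B) by exact: measurable_itv.
apply: le_trans (@ler_normc_wint _ _ mu4 a (fun=> F) `[p, t[ M mco _ _ _) _.
- by move=> i; exact: (mu_co_fin mf).
- by move=> i; exact: cintegrable_measurable (FI i p t pI tpq).
- by move=> _ s /sub; exact: HM.
apply: ler_wpM2l; first by rewrite mulr_ge0.
apply: ler_sum => i _; apply: ler_wpM2l; first exact: normc_ge0.
apply: fine_le.
- by rewrite ge0_fin_numE//; exact: (mu_co_fin mf).
- by rewrite ge0_fin_numE//; exact: (mu_cc_fin mf).
by apply: le_measure; rewrite ?inE//; exact: measurable_itv.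
Qed.

Lemma L2_bounded_itv b1 b2 p q F M : cmeasurable ([set` Interval (BSide b1 p) (BSide b2 q)] : set B) F ->
  (forall t, `[p, q] t -> normc (F t) <= M) ->
  L2 leb [set` Interval (BSide b1 p) (BSide b2 q)] F.
Proof.
move=> mF FM; apply: (@L2_bounded _ leb _ _ M) => //.
  apply: le_lt_trans (leb_cc_fin p q); apply: le_measure; rewrite ?inE//; try exact: measurable_itv.
  by move=> s /=; rewrite !in_itv /=; case: (b1); case: (b2) => /=; lra.
move=> s sI; apply: FM; move: sI; rewrite /= !in_itv /=.
by case: (b1); case: (b2) => /=; lra.
Qed.

Lemma primitive_left_cvg F k x : primitive setT F k -> F x = 0 ->
  normc (F t) @[t --> x^'-] --> (0 : R).
Proof.
move=> Fk Fx; apply/cvgrPdist_lt => e e0.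
have sub : `[x - 1, x] `<=` setT by [].
have [d d0 H] := primitive_ac Fk sub e0.
near=> t.
have t1 : x - 1 <= t by near: t; apply: nbhs_left_ge; lra.
have tx : t <= x by near: t; exact: nbhs_left_le.
have td : x - t < d.
  suff : x - d < t by lra.
  by near: t; apply: nbhs_left_gt; lra.
have := H 1%N (fun=> t) (fun=> x); rewrite !big_ord_recl !big_ord0 !addr0 Fx sub0r normcN.
rewrite sub0r normrN ger0_norm ?normc_ge0//; apply => //.
by move=> i j; rewrite !ord1.
Unshelve. all: by end_near. Qed.

Section Pair.
Variables (z : R[i]) (psi psi' phi phi' : R -> R[i]) (x : R).
Hypotheses (psiq : qeq mu4 setT (coef z) (fun=> psi) psi psi').
Hypotheses (phiq : qeq mu4 setT (coef z) (fun=> phi) phi phi').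
Hypotheses (psiH : H1_near_infty plus psi) (phic : phi c = 0) (Jx : J x).

Let l := if plus then phi else psi.
Let l' := if plus then phi' else psi'.
Let r := if plus then psi else phi.
Let r' := if plus then psi' else phi'.
(** Naming the solutions after the end of [J] at which they satisfy the
    boundary condition treats both signs at once. *)
Definition gr := lr_green l l' r r' x.
Definition dgr := lr_dgreen l l' r r' x.

Let lq : qeq mu4 setT (coef z) (fun=> l) l l'.
Proof. by rewrite /l /l'; case: plus. Qed.

Let rq : qeq mu4 setT (coef z) (fun=> r) r r'.
Proof. by rewrite /r /r'; case: plus. Qed.

Lemma green_gr x0 s : green plus (wronskian psi psi' phi phi' x0) psi phi x s = gr s.
Proof.
rewrite (wronskian_const mf x0 x psiq phiq) /green /gr /lr_green /l /l' /r /r'.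
case: plus; first by case: ifP => _; ring.
have -> : wronskian phi phi' psi psi' x = - wronskian psi psi' phi phi' x.
  by rewrite /wronskian; ring.
rewrite invrN; have [xs|sx] := leP x s.
  have [sx|xs'] := leP s x; last by ring.
  have -> : s = x by apply/eqP; rewrite eq_le sx.
  by ring.
by rewrite (ltW sx); ring.
Qed.

Lemma primitive_gr : primitive J gr dgr.
Proof.
have [lp _ _] := lq; have [rp _ _] := rq.
by apply: primitive_green => //; [exact: primitiveS lp|exact: primitiveS rp].
Qed.

Lemma gr_vanishes : vanishes_at_c c plus gr.
Proof.
have := Jx; rewrite /vanishes_at_c /half_line /gr /lr_green /l /l' /r /r'.
case: plus; first by rewrite /= in_itv /= andbT => ->; rewrite phic mulr0.
rewrite /= in_itv /= => xc.
set W := wronskian _ _ _ _ _.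
have [phip _ _] := phiq.
have lim : (normc (W^-1 * psi x) * normc (phi s)) @[s --> c^'-] --> (0 : R).
  rewrite -[X in _ --> X](mulr0 (normc (W^-1 * psi x))).
  by apply: cvgMr; exact: primitive_left_cvg phip phic.
apply: cvg_trans lim; apply: near_eq_cvg; near=> s.
rewrite ifF ?normcM//; apply/negbTE; rewrite -ltNge.
by near: s; exact: nbhs_left_gt.
Unshelve. all: by end_near. Qed.

(** [J] splits into a bounded part, where [gr] and its derivative are bounded,
    and a part near infinity, where [gr] is a multiple of [psi]. *)
Lemma gr_H1 : H1 J gr.
Proof.
have grp := primitive_gr; have sJ := @half_sigma R c plus.
have [mg md] := primitive_cmeasurable sJ grp.
have [lp _ _] := lq; have [rp _ _] := rq.
have subT (A : set R) : A `<=` setT by [].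
have [a] := psiH.
pose p0 := Num.min x a - 1; pose q0 := Num.max x a + 1.
have [p0x p0a xq0 aq0] : [/\ p0 < x, p0 < a, x < q0 & a < q0].
  rewrite /p0 /q0; split.
  - have h : Num.min x a <= x by rewrite ge_min lexx.
    by move: h; lra.
  - have h : Num.min x a <= a by rewrite ge_min lexx orbT.
    by move: h; lra.
  - have h : x <= Num.max x a by rewrite le_max lexx.
    by move: h; lra.
  - have h : a <= Num.max x a by rewrite le_max lexx orbT.
    by move: h; lra.
pose Wi := (wronskian r r' l l' x)^-1.
have bnd p q : p <= q -> exists M, forall t, `[p, q] t -> normc (gr t) <= M /\ normc (dgr t) <= M.
  move=> pq; have [M1 [M10 H1]] := primitive_bounded (primitiveS (subT `[p, q]) lp).
  have [M2 [M20 H2]] := primitive_bounded (primitiveS (subT `[p, q]) rp).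
  have [M3 H3] := slope_bounded pq (qeqS (subT `[p, q]) lq).
  have [M4 H4] := slope_bounded pq (qeqS (subT `[p, q]) rq).
  have M30 : 0 <= M3 by apply: le_trans (normc_ge0 _) (H3 p _); rewrite /= in_itv /= lexx.
  have M40 : 0 <= M4 by apply: le_trans (normc_ge0 _) (H4 p _); rewrite /= in_itv /= lexx.
  pose N1 := normc (Wi * r x); pose N2 := normc (Wi * l x).
  have N10 : 0 <= N1 := normc_ge0 _; have N20 : 0 <= N2 := normc_ge0 _.
  have e1 := mulr_ge0 N10 M10; have e2 := mulr_ge0 N10 M30.
  have e3 := mulr_ge0 N20 M20; have e4 := mulr_ge0 N20 M40.
  exists (N1 * M1 + N1 * M3 + N2 * M2 + N2 * M4) => t tpq.
  rewrite /gr /dgr /lr_green /lr_dgreen -/Wi; case: ifP => _.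
    have h1 := ler_wpM2l N10 (H1 t tpq); have h2 := ler_wpM2l N10 (H3 t tpq).
    by rewrite [normc (_ * l t)]normcM [normc (_ * l' t)]normcM -/N1; split; lra.
  have h1 := ler_wpM2l N20 (H2 t tpq); have h2 := ler_wpM2l N20 (H4 t tpq).
  by rewrite [normc (_ * r t)]normcM [normc (_ * r' t)]normcM -/N2; split; lra.
have psi'E : {ae leb, forall t, psi' t = cderiv psi t}.
  have [psip _ _] := psiq.
  by apply: filterS (primitive_ae (@setT_sigma R) psip) => t ->.
have far (D E : set B) (w : R[i]) : measurable D -> measurable E -> D `<=` E -> D `<=` J ->
    L2 leb E psi -> L2 leb E (cderiv psi) ->
    (forall s, D s -> gr s = w * psi s /\ dgr s = w * psi' s) ->
    L2 leb D gr /\ L2 leb D dgr.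
  move=> mD mE DE DJ L1 L2' gE; split.
    apply: (@eq_L2 _ leb _ (fun s => w * psi s)) => //.
      by move=> s /gE[->].
    by apply: L2Z => //; exact: L2S L1.
  apply: (@L2_ae_eq _ leb _ (fun s => w * cderiv psi s)) => //.
  - exact: cmeasurableS md.
  - by apply: filterS psi'E => s e Ds; have [_ ->] := gE s Ds; rewrite e.
  - by apply: L2Z => //; exact: L2S L2'.
pose Dinf : set B := if plus then `[a, +oo[ else `]-oo, a].
have [p [q [b2 [D2 [w [pq JE mD2 D2a grE]]]]]] : exists p q b2 (D2 : set B) w,
    [/\ p <= q, J = [set` Interval (BLeft p) (BSide b2 q)] `|` D2, measurable D2,
        D2 `<=` Dinf & forall s, D2 s -> gr s = w * psi s /\ dgr s = w * psi' s].
  have := Jx; rewrite /half_line /Dinf /gr /dgr /lr_green /lr_dgreen /l /l' /r /r'.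
  case: plus; rewrite /= in_itv /= ?andbT => Jx'.
  - exists c, q0, false, `[q0, +oo[, ((wronskian psi psi' phi phi' x)^-1 * phi x).
    split; [lra| |exact: measurable_itv| |].
    + apply/seteqP; split => s /=; rewrite !in_itv /= ?andbT; last by move=> []; lra.
      by move=> cs; have [sq|/ltW qs] := leP s q0; [left|right]; rewrite ?cs.
    + by move=> s /=; rewrite !in_itv /= !andbT; lra.
    + move=> s; rewrite /= in_itv /= andbT => qs.
      by rewrite ifF ?ifF//; apply/negbTE; rewrite -ltNge; lra.
  - exists p0, c, true, `]-oo, p0], ((wronskian phi phi' psi psi' x)^-1 * phi x).
    split; [lra| |exact: measurable_itv| |].
    + apply/seteqP; split => s /=; rewrite !in_itv /= ?andbT; last by move=> []; lra.
      by move=> cs; have [sq|/ltW qs] := leP s p0; [right|left]; rewrite ?cs ?qs.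
    + by move=> s /=; rewrite !in_itv /=; lra.
    + move=> s; rewrite /= in_itv /= => qs.
      by rewrite ifT ?ifT//; lra.
have mDinf : measurable Dinf by rewrite /Dinf; case: plus; exact: measurable_itv.
rewrite -/Dinf => -[psiL1 psiL2].
have [M HM] := bnd p q pq.
have D2J : D2 `<=` J by rewrite JE; exact: subsetUr.
have D1J : [set` Interval (BLeft p) (BSide b2 q)] `<=` J by rewrite JE; exact: subsetUl.
have m1 : measurable ([set` Interval (BLeft p) (BSide b2 q)] : set B) by exact: measurable_itv.
have [F1 F2] := far D2 Dinf w mD2 mDinf D2a D2J psiL1 psiL2 grE.
have B1 : L2 leb [set` Interval (BLeft p) (BSide b2 q)] gr.
  apply: (@L2_bounded_itv true b2 p q gr M); first exact: cmeasurableS mg.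
  by move=> t /HM[].
have B2 : L2 leb [set` Interval (BLeft p) (BSide b2 q)] dgr.
  apply: (@L2_bounded_itv true b2 p q dgr M); first exact: cmeasurableS md.
  by move=> t /HM[].
by apply: (half_primitive_H1 grp); rewrite JE; exact: L2_setU.
Qed.

Lemma gr_H10 : pts H10 gr.
Proof. by split; [exact: gr_H1|exact: gr_vanishes]. Qed.

End Pair.

End HalfLineGreen.

Section GreenPairing.
Context {R : realType}.
Local Notation B := (measurableTypeR R).
Local Notation leb := (@lebesgue_measure R).
Variables (om : set B -> R) (up : {measure set B -> \bar R}).
Hypotheses (som : is_signed_measure om) (up_fin : locally_finite up).
Local Notation mu4 := (mu4 up som).
Let mf := mu4_fin som up_fin.
Variables (c : R) (plus : bool).
Local Notation J := (half_line c plus).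
Local Notation H10 := (H10_space c plus).
Implicit Types (F G h k : R -> R[i]).

Let mJ := half_line_measurable c plus.
Let iJ := @half_line_interval R c plus.

(** The segment is made to contain [x], the pole of a Green function. *)
Lemma H1c_support (h : cfun R) x : H1c c plus h -> J x ->
  exists p q, [/\ p <= x, x <= q, J p, J q & forall s, J s -> ~ `]p, q[ s -> h s = 0].
Proof.
move=> [_ [a [b [abJ h0]]]] Jx.
have [ab|ba] := leP a b; last first.
  exists x, x; split => // s Js _; apply: h0 => //.
  by rewrite /= in_itv /=; move: ba; lra.
have aJ : interior J a by apply: abJ; rewrite /= in_itv /= lexx.
have bJ : interior J b by apply: abJ; rewrite /= in_itv /= lexx ab.
rewrite half_line_interior in aJ bJ.
have [a' [Ja' a'a]] : exists a', J a' /\ a' < a.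
  move: aJ; rewrite /half_line; case: plus; rewrite /= in_itv /= ?andbT => ca.
    by exists c; rewrite /= in_itv /= lexx.
  by exists (a - 1); rewrite /= in_itv /=; split; lra.
have [b' [Jb' bb']] : exists b', J b' /\ b < b'.
  move: bJ; rewrite /half_line; case: plus; rewrite /= in_itv /= ?andbT => cb.
    by exists (b + 1); rewrite /= in_itv /= andbT; split; lra.
  by exists ((b + c) / 2); rewrite /= in_itv /=; split; lra.
exists (Num.min a' x), (Num.max b' x); split.
- by rewrite ge_min lexx orbT.
- by rewrite le_max lexx orbT.
- by case: (leP a' x).
- by case: (leP b' x).
move=> s Js ns; apply: h0 => // /=; rewrite in_itv /= => /andP[as_ sb]; apply: ns.
rewrite /= in_itv /= gt_min lt_max; apply/andP; split; apply/orP; left; lra.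
Qed.

Lemma H1c_primitive (h : cfun R) : H1c c plus h -> primitive J h (cderiv h).
Proof. by move=> [[hH _] _]; exact: H1J_primitive. Qed.

(** Off [p, q] the function vanishes near every interior point of [J]. *)
Lemma support_deriv h p q : primitive J h (cderiv h) -> J p -> J q -> p <= q ->
  (forall s, J s -> ~ `]p, q[ s -> h s = 0) ->
  {ae leb, forall s, J s -> ~ `[p, q] s -> cderiv h s = 0}.
Proof.
move=> hp Jp Jq pq h0.
apply: filterS (@inner_ae R c plus) => s Js_inner Js ns.
have {Js_inner} sJ := Js_inner Js.
have oJ : open (inner_half_line c plus).
  by rewrite /inner_half_line; case: plus; exact: itv_open_ends_open.
have nJ : \forall t \near s, J t.
  by apply: filterS (open_nbhs_nbhs (conj oJ sJ)) => t; exact: inner_sub.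
have n0 : \near s, h s = (fun=> 0) s.
  have [sp|ps] := ltP s p.
    near=> t; apply: h0; first by near: t; exact: nJ.
    rewrite /= in_itv /= => /andP[pt _]; suff : t < p by lra.
    by near: t; exact: lt_nbhsl.
  have qs : q < s by rewrite ltNge; apply/negP => sq; apply: ns; rewrite /= in_itv /= ps.
  near=> t; apply: h0; first by near: t; exact: nJ.
  rewrite /= in_itv /= => /andP[_ tq]; suff : q < t by lra.
  by near: t; exact: lt_nbhsr.
rewrite /cderiv; apply: complex_eq => /=.
  rewrite -(derive1_cst (0 : R) s); apply: near_eq_derive1.
  by apply: filterS n0 => t ->.
rewrite -(derive1_cst (0 : R) s); apply: near_eq_derive1.
by apply: filterS n0 => t ->.
Unshelve. all: by end_near. Qed.

Lemma cint_support_deriv (h : cfun R) g p q : H1c c plus h -> J p -> J q -> p <= q ->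
  (forall s, J s -> ~ `]p, q[ s -> h s = 0) -> cmeasurable (J : set B) g ->
  cintegral leb J (fun s => g s * cderiv h s) = cintegral leb `[p, q] (fun s => g s * cderiv h s).
Proof.
move=> hc Jp Jq pq h0 mg; have hp := H1c_primitive hc; have [[hH _] _] := hc.
have [_ _ /L2_cmeasurable mh] := hH.
have pqJ : `[p, q] `<=` J by exact: (itv_sub 0 0 iJ).
pose g0 s : R[i] := if s \in `[p, q]%classic then g s * cderiv h s else 0.
have mgh : cmeasurable (J : set B) (fun s => g s * cderiv h s) by exact: cmeasurableM.
have ae0 := support_deriv hp Jp Jq pq h0.
have m0 : cmeasurable (J : set B) g0.
  have mi : measurable_fun (J : set B) (\1_(`[p, q]) : R -> R).
    by apply: measurable_indic; exact: measurable_itv.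
  have : cmeasurable (J : set B) (fun s => (g s * cderiv h s) * (\1_(`[p, q]) s)%:C).
    by apply: cmeasurableM => //; exact: cmeasurable_real.
  apply: eq_cmeasurable => s _; rewrite /g0 indicE.
  by case: (s \in _); rewrite /= ?mulr1 ?mulr0.
rewrite (@cint_ae_eq _ leb _ _ g0 mJ mgh m0); last first.
  apply: filterS ae0 => s H Js; rewrite /g0; case: ifPn => // /negP ns.
  by rewrite H ?mulr0// => spq; apply: ns; rewrite inE.
rewrite (@cint_restrict _ leb `[p, q] J g0 pqJ); last first.
  by move=> s _ ns; rewrite /g0 memNset.
by apply: eq_cint => s spq; rewrite /g0 mem_set.
Qed.

Lemma wint_support a (w : 'I_4 -> R -> R[i]) (h : cfun R) p q : J p -> J q ->
  (forall s, J s -> ~ `]p, q[ s -> h s = 0) ->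
  wint mu4 a (fun i s => w i s * h s) J = wint mu4 a (fun i s => w i s * h s) `[p, q[.
Proof.
move=> Jp Jq h0; apply: eq_bigr => i _; congr (_ * _); apply: cint_restrict.
  move=> s; rewrite /= in_itv /= => /andP[ps sq]; apply: iJ Jp Jq _ _.
  by rewrite ps ltW.
move=> s Js ns; rewrite h0 ?mulr0//; apply: contra_not ns.
by rewrite /= !in_itv /= => /andP[/ltW-> ->].
Qed.

Lemma half_line_point : exists x, J x.
Proof.
rewrite /half_line; case: plus; [exists c|exists (c - 1)];
  rewrite /= in_itv /= ?lexx//; lra.
Qed.

(** The boundary terms of [qeq_weak] drop out. *)
Lemma qeq_pairing a w u u' (h : cfun R) : qeq mu4 J a w u u' -> cmeasurable (J : set B) u' ->
  H1c c plus h ->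
  cintegral leb J (fun s => u' s * cderiv h s) + wint mu4 a (fun i s => w i s * h s) J = 0.
Proof.
move=> uq mu' hc; have [x Jx] := half_line_point.
have [p [q [px xq Jp Jq h0]]] := H1c_support hc Jx; have pq := le_trans px xq.
have pqJ : `[p, q] `<=` J by exact: (itv_sub 0 0 iJ).
rewrite (cint_support_deriv hc Jp Jq pq h0 mu') (wint_support a w Jp Jq h0).
have [_ ->] := qeq_weak mf pq (qeqS pqJ uq) (primitiveS pqJ (H1c_primitive hc)).
have -> : h p = 0 by apply: h0 => //; rewrite /= in_itv /= ltxx.
have -> : h q = 0 by apply: h0 => //; rewrite /= in_itv /= ltxx andbF.
by rewrite !mulr0; move: (wint _ _ _ _) => W; ring.
Qed.

Section Pair.
Variables (z : R[i]) (psi psi' phi phi' : R -> R[i]) (x : R).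
Hypotheses (psiq : qeq mu4 setT (coef z) (fun=> psi) psi psi').
Hypotheses (phiq : qeq mu4 setT (coef z) (fun=> phi) phi phi').
Hypotheses (W0 : wronskian psi psi' phi phi' x != 0).
Hypotheses (psiH : H1_near_infty plus psi) (phic : phi c = 0) (Jx : J x).
Local Notation G := (gr plus psi psi' phi phi' x).
Local Notation dG := (dgr plus psi psi' phi phi' x).

(** The jump of the derivative of [G] at its pole leaves [h x]. *)
Lemma gr_pairing (h : cfun R) : H1c c plus h ->
  cintegral leb J (fun s => dG s * cderiv h s) + wint mu4 (coef z) (fun=> (fun s => G s * h s)) J = h x.
Proof.
move=> hc; have [p [q [px xq Jp Jq h0]]] := H1c_support hc Jx; have pq := le_trans px xq.
have pqJ : `[p, q] `<=` J by exact: (itv_sub 0 0 iJ).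
have sJ := @half_sigma R c plus.
have [_ md] := primitive_cmeasurable sJ (primitive_gr c plus x psiq phiq).
rewrite (cint_support_deriv hc Jp Jq pq h0 md) (wint_support _ _ Jp Jq h0).
have subT (A : set R) : A `<=` setT by [].
apply: (green_weak mf px xq).
- move: W0; case: plus => // W0'; rewrite (_ : wronskian _ _ _ _ _ = - wronskian psi psi' phi phi' x).
    by rewrite oppr_eq0.
  by rewrite /wronskian; ring.
- by apply: (qeqS (subT _)); case: plus.
- by apply: (qeqS (subT _)); case: plus.
- by apply: (primitiveS pqJ); exact: H1c_primitive.
- by apply: h0 => //; rewrite /= in_itv /= ltxx.
- by apply: h0 => //; rewrite /= in_itv /= ltxx andbF.
Qed.

Lemma grJ_H10 : pts H10 (fun s => (G s)^*)%R.
Proof.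
have [gH g0] := gr_H10 up_fin psiq phiq psiH phic Jx; split; first exact: H1J.
move: g0; rewrite /vanishes_at_c; case: plus; first by move=> ->; rewrite conjC0.
by under eq_fun do rewrite -normcJ.
Qed.

Lemma dot_grJ f : H1 J f -> H1_dot J f (fun s => (G s)^*)%R =
  4^-1 * cintegral leb J (fun s => G s * f s) + cintegral leb J (fun s => dG s * cderiv f s).
Proof.
move=> fH; have [gH _] := grJ_H10; have [_ _ /L2_cmeasurable mfd] := fH.
have sJ := @half_sigma R c plus; have Gp := primitive_gr c plus x psiq phiq.
have [_ md] := primitive_cmeasurable sJ Gp.
rewrite (half_dotE fH gH (H1J_primitive fH) (primitiveJ iJ Gp) mfd (cmeasurableJ md)).
have e1 : cintegral leb J (fun s => f s * ((G s)^*)^*)%R = cintegral leb J (fun s => G s * f s).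
  by apply: eq_cint => s _; rewrite mulrC; congr (_ * _); exact: conjCK.
have e2 : cintegral leb J (fun s => cderiv f s * ((dG s)^*)^*)%R = cintegral leb J (fun s => dG s * cderiv f s).
  by apply: eq_cint => s _; rewrite mulrC; congr (_ * _); exact: conjCK.
by rewrite e1 e2.
Qed.

(** With [Omega] and [Upsilon] in weak form, this says that [G] represents the
    functional that maps [h - z Omega h - z ^ 2 Upsilon h] to [h x]. *)
Lemma gr_reproducing (h : cfun R) : H1c c plus h ->
  H1_dot J h (fun s => (G s)^*)%R = h x + z * signed_integral om J (fun s => G s * h s)
    + z ^+ 2 * cintegral up J (fun s => G s * h s).
Proof.
move=> hc; have [[hH _] _] := hc; rewrite (dot_grJ hH).
have := gr_pairing hc; rewrite wint_coef => <-.
by move: (signed_integral _ _ _) (cintegral _ _ _) (cintegral _ _ _) (cintegral _ _ _) => A C D F; ring.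
Qed.

End Pair.

End GreenPairing.

(** * The free Green function *)

Section FreeGreen.
Context {R : realType}.
Local Notation B := (measurableTypeR R).
Local Notation leb := (@lebesgue_measure R).
Variables (om : set B -> R) (up : {measure set B -> \bar R}).
Hypotheses (som : is_signed_measure om) (up_fin : locally_finite up).
Local Notation mu4 := (mu4 up som).
Let mf := mu4_fin som up_fin.
Variables (c : R) (plus : bool).
Local Notation J := (half_line c plus).
Local Notation H10 := (H10_space c plus).

(** Monotone convergence along the exhaustion. *)
Lemma L2_exhaust (D : (set B)^nat) f (M : R) : nondecreasing_seq D ->
  (forall n, measurable (D n)) -> cmeasurable (\bigcup_n D n) f ->
  (forall n, (\int[leb]_(x in D n) (normc (f x) ^+ 2)%:E <= M%:E)%E) ->
  L2 leb (\bigcup_n D n) f.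
Proof.
move=> ndD mD mfD H; have [fr fi] := mfD; split => //.
have m2 : measurable_fun (\bigcup_n D n) (fun x => (normc (f x) ^+ 2)%:E).
  by apply/measurable_EFinP; apply: measurable_funX; exact: measurable_normc.
have mU : measurable (\bigcup_n D n) by exact: bigcup_measurable.
have sub n : D n `<=` \bigcup_n D n by move=> x Dx; exists n.
have lim := @ge0_nondecreasing_set_cvg_integral _ _ _ D (fun x => (normc (f x) ^+ 2)%:E) leb
  ndD mD (fun n => measurable_funS mU (sub n) m2)
  (fun n x _ => exprn_ge0 2 (normc_ge0 (f x))).
apply: (@le_lt_trans _ _ M%:E); last by rewrite ltry.
by apply: (cvge_le _ lim); apply: nearW => n; exact: H.
Qed.

Definition expo (r : R) (t : R) : R := expR (r * t + - (r * c)).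

Lemma is_derive_expo r (t : R) : is_derive t 1 (expo r) (r * expo r t).
Proof.
rewrite mulrC; exact: (@is_derive1_comp R expR (fun s => r * s + - (r * c)) t _ _ (is_derive_expR _)
  (is_derive_affine r (- (r * c)) t)).
Qed.

Lemma expo_gt0 r t : 0 < expo r t. Proof. exact: expR_gt0. Qed.

Lemma expo_c r : expo r c = 1. Proof. by rewrite /expo subrr expR0. Qed.

Lemma continuous_expo r : continuous (expo r).
Proof. exact: is_derive_continuous (is_derive_expo r). Qed.

(** For [z = 0] only Lebesgue measure has a nonzero coefficient. *)
Lemma free_qeq (f f' : R -> R) : (forall t : R, is_derive t 1 f (f' t)) ->
  (forall t : R, is_derive t 1 f' (4^-1 * f t)) ->
  qeq mu4 setT (coef 0) (fun=> (fun t => (f t)%:C)) (fun t => (f t)%:C) (fun t => (f' t)%:C).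
Proof.
move=> ff' f'f; have cf := is_derive_continuous ff'; have cf' := is_derive_continuous f'f.
have fp := primitive_C1 setT ff' cf'.
have c4 : continuous (fun t => 4^-1 * f t).
  by move=> t; apply: cvgM; [exact: cvg_cst|exact: cf].
have [f'I f'E] := primitive_C1 setT f'f c4.
split => // [i x y _ _|x y Jx Jy xy].
  exact: (primitive_weight (mf i) fp).
have [fI _] := @primitive_C1 R setT _ _ ff' cf'.
have mcc : measurable (`[x, y] : set B) by exact: measurable_itv.
have fcc : cintegrable leb `[x, y] (fun t => (f t)%:C).
  have := cintegrableZ 4 mcc (f'I x y (@subsetT _ _)); apply: eq_cintegrable => // t _.
  by rewrite rmorphM fmorphV rmorph_nat mulrA mulfV ?mul1r// pnatr_eq0.
rewrite f'E// wint_coef mul0r subr0 expr0n /= mul0r subr0.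
rewrite cint_co_cc; last first.
  apply: (@cintegrable_measurable _ leb); apply: cintegrableS fcc => //.
  exact: subset_itv_co_cc.
rewrite -cintZ//; apply: eq_cint => t _.
by rewrite rmorphM fmorphV rmorph_nat.
Qed.

Let h2 : R := 2^-1.
Let sg : R := if plus then - h2 else h2.

Definition psi0 t : R := expo sg t.
Definition psi0' t : R := sg * expo sg t.
Definition phi0 t : R := expo h2 t - expo (- h2) t.
Definition phi0' t : R := h2 * (expo h2 t + expo (- h2) t).

Let h22 : h2 * h2 = 4^-1.
Proof. by rewrite /h2 -invfM; congr (_^-1); ring. Qed.

Let sg2 : sg * sg = 4^-1.
Proof. by rewrite /sg; case: plus; rewrite ?mulrNN h22. Qed.

Lemma psi0_qeq : qeq mu4 setT (coef 0) (fun=> (fun t => (psi0 t)%:C))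
  (fun t => (psi0 t)%:C) (fun t => (psi0' t)%:C).
Proof.
apply: free_qeq => t; first exact: is_derive_expo.
have := is_deriveM (is_derive_cst sg t 1) (is_derive_expo sg t).
by rewrite scaler0 addr0 /GRing.scale /= mulrA sg2.
Qed.

Lemma phi0_qeq : qeq mu4 setT (coef 0) (fun=> (fun t => (phi0 t)%:C))
  (fun t => (phi0 t)%:C) (fun t => (phi0' t)%:C).
Proof.
apply: free_qeq => t.
  have := is_deriveB (is_derive_expo h2 t) (is_derive_expo (- h2) t).
  by rewrite mulNr opprK -mulrDr.
have := is_deriveM (is_derive_cst h2 t 1) (is_deriveD (is_derive_expo h2 t) (is_derive_expo (- h2) t)).
rewrite scaler0 addr0 /GRing.scale /=.
suff -> : h2 * (h2 * expo h2 t + - h2 * expo (- h2) t) = 4^-1 * phi0 t by [].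
by rewrite -h22 /phi0; ring.
Qed.

Lemma wronskian0 : wronskian (fun t => (psi0 t)%:C) (fun t => (psi0' t)%:C)
  (fun t => (phi0 t)%:C) (fun t => (phi0' t)%:C) c = 1.
Proof.
rewrite /wronskian /psi0 /psi0' /phi0 /phi0' !expo_c subrr mulr0 subr0 mul1r.
by rewrite (_ : h2 * (1 + 1) = 1)// /h2; field.
Qed.

Lemma phi0_c : (phi0 c)%:C = 0.
Proof. by rewrite /phi0 !expo_c subrr. Qed.

(** [psi0 ^ 2] is again an exponential, with an integral of at most one over
    every segment on the decaying side of [c]. *)
Lemma psi0_H1 : H1_near_infty plus (fun t => (psi0 t)%:C).
Proof.
exists c; pose D : set R := if plus then `[c, +oo[ else `]-oo, c].
pose Dn (n : nat) : set B := if plus then `[c, c + n%:R] else `[c - n%:R, c].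
have mDn n : measurable (Dn n) by rewrite /Dn; case: plus; exact: measurable_itv.
have DE : D = \bigcup_n Dn n.
  rewrite /D /Dn; case: plus; apply/seteqP; split => t /=.
  - rewrite in_itv /= andbT => ct; exists (Num.bound (t - c)) => //=.
    by rewrite in_itv /= ct -lerBlDl ltW// archi_boundP// subr_ge0.
  - by move=> [n _] /=; rewrite !in_itv /= andbT => /andP[].
  - rewrite in_itv /= => ct; exists (Num.bound (c - t)) => //=.
    by rewrite in_itv /= ct andbT lerBlDl -lerBlDr ltW// archi_boundP// subr_ge0.
  - by move=> [n _] /=; rewrite !in_itv /= => /andP[].
have ndD : nondecreasing_seq Dn.
  move=> m n mn; apply/subsetPset => t; have h : m%:R <= n%:R :> R by rewrite ler_nat.
  rewrite /Dn; case: plus; rewrite /= !in_itv /=; move: h; move: (m%:R) (n%:R) => p q; lra.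
have psip : primitive setT (fun t => (psi0 t)%:C) (fun t => (psi0' t)%:C) by have [] := psi0_qeq.
have [mp mp'] := primitive_cmeasurable (@setT_sigma R) psip.
have bound n : (\int[leb]_(x in Dn n) (normc (psi0 x)%:C ^+ 2)%:E <= 1%:E)%E.
  pose sg' := sg + sg.
  have sgn0 : sg' != 0.
    by rewrite /sg' /sg /h2; case: plus; rewrite -?opprD ?oppr_eq0 gt_eqF//; lra.
  have der (t : R) : is_derive t 1 (fun s => sg'^-1 * expo sg' s) (expo sg' t).
    have := is_deriveM (is_derive_cst sg'^-1 t 1) (is_derive_expo sg' t).
    by rewrite scaler0 addr0 /GRing.scale /= mulrA mulVf// mul1r.
  have [eI eE] := primitive_C1 setT der (@continuous_expo sg').
  have sq x : (normc (psi0 x)%:C ^+ 2) = expo sg' x.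
    rewrite normc_real gtr0_norm ?expo_gt0// /psi0 /expo expr2 -expRD; congr expR.
    by rewrite /sg'; ring.
  have seg p q : p <= q -> \int[leb]_(x in `[p, q]) expo sg' x = sg'^-1 * expo sg' q - sg'^-1 * expo sg' p.
    by move=> pq; have := eE p q Logic.I Logic.I pq; rewrite -rmorphB => /(congr1 (@complex.Re R)) /= ->.
  have fin p q : (\int[leb]_(x in `[p, q]) (expo sg' x)%:E)%E \is a fin_num.
    have [h _] := eI p q (@subsetT _ _).
    by apply: integrable_fin_num => //; exact: measurable_itv.
  under eq_integral do rewrite sq.
  rewrite /Dn; move: seg fin sgn0; rewrite /sg' /sg.
  have n0 : 0 <= n%:R :> R by [].
  case: plus => seg fin sgn0.
  - rewrite -(fineK (fin _ _)) lee_fin -/(Rintegral _ _ _) seg ?lerDl// expo_c.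
    have := expo_gt0 (- h2 - h2) (c + n%:R).
    have -> : (- h2 - h2)^-1 = -1 :> R by rewrite /h2; field.
    by lra.
  - rewrite -(fineK (fin _ _)) lee_fin -/(Rintegral _ _ _) seg ?lerBlDr ?lerDl// expo_c.
    have := expo_gt0 (h2 + h2) (c - n%:R).
    have -> : (h2 + h2)^-1 = 1 :> R by rewrite /h2; field.
    by lra.
have mT f : cmeasurable (setT : set B) f -> cmeasurable (\bigcup_n Dn n) f.
  by apply: cmeasurableS.
have L1 : L2 leb D (fun t => (psi0 t)%:C).
  by rewrite DE; apply: L2_exhaust bound => //; exact: mT.
split => //.
have mD : measurable (D : set B) by rewrite DE; exact: bigcup_measurable.
apply: (@L2_ae_eq _ leb D (fun t => sg%:C * (psi0 t)%:C)) => //.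
- by rewrite DE; apply: mT; exact: cderiv_measurable (@setT_sigma R) (primitive_ac psip).
- apply: filterS (primitive_ae (@setT_sigma R) psip) => t e _.
  by rewrite e// /psi0' rmorphM.
- exact: L2Z.
Qed.

Section Reproducing.
Variable x : R.
Hypothesis Jx : J x.

Lemma free_greenE s : (free_green c plus x s)%:C = gr plus (fun t => (psi0 t)%:C)
  (fun t => (psi0' t)%:C) (fun t => (phi0 t)%:C) (fun t => (phi0' t)%:C) x s.
Proof.
rewrite -(green_gr up_fin plus x psi0_qeq phi0_qeq c s) wronskian0 /green invr1 /free_green.
have e1 t : expo h2 t = expR ((t - c) / 2) by rewrite /expo /h2; congr expR; ring.
have e2 t : expo (- h2) t = expR (- ((t - c) / 2)) by rewrite /expo /h2; congr expR; ring.
have ph t : phi0 t = 2 * sinh ((t - c) / 2).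
  by rewrite /phi0 /sinh e1 e2 mulrCA mulfV ?mulr1// pnatr_eq0.
have ps t : psi0 t = if plus then expR (- ((t - c) / 2)) else expR ((t - c) / 2).
  by rewrite /psi0 /sg; case: plus; rewrite ?e1 ?e2.
rewrite !ph !ps; case: plus; case: ifP => _; rewrite ?mul1r ?mulN1r -?rmorphM -?rmorphN /=;
  by congr (_%:C); ring.
Qed.

Lemma free_green_H10 : pts H10 (fun s => (free_green c plus x s)%:C).
Proof.
have -> : (fun s => (free_green c plus x s)%:C) = gr plus (fun t => (psi0 t)%:C)
  (fun t => (psi0' t)%:C) (fun t => (phi0 t)%:C) (fun t => (phi0' t)%:C) x.
  by apply/funext => s; exact: free_greenE.
exact: (gr_H10 up_fin psi0_qeq phi0_qeq psi0_H1 phi0_c Jx).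
Qed.

Let K : cfun R := fun s => (free_green c plus x s)%:C.

(** The reproducing kernel of [H^1_0]: on compactly supported functions this
    is [gr_reproducing] at [z = 0], and both sides are bounded. *)
Lemma free_green_reproducing f : pts H10 f -> H1_dot J f K = f x.
Proof.
move=> fH.
have KE : K = (fun s => (gr plus (fun t => (psi0 t)%:C) (fun t => (psi0' t)%:C)
    (fun t => (phi0 t)%:C) (fun t => (phi0' t)%:C) x s)^*)%R.
  by apply/funext => s; rewrite -free_greenE; apply: complex_eq; rewrite ?cReJ ?cImJ //= oppr0.
have W0 : wronskian (fun t => (psi0 t)%:C) (fun t => (psi0' t)%:C)
  (fun t => (phi0 t)%:C) (fun t => (phi0' t)%:C) x != 0.
  by rewrite (wronskian_const mf x c psi0_qeq phi0_qeq) wronskian0 oner_neq0.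
have [KH1 _] := free_green_H10; apply/eqP; rewrite -subr_eq0; apply/eqP.
apply: (@functional_vanishes R c plus (fun f => H1_dot J f K - f x) (nrm H10 K + 6)) => //.
- move=> u v [uH _] [vH _].
  change (H1_dot J (fun t => u t + v t) K - (u x + v x) = H1_dot J u K - u x + (H1_dot J v K - v x)).
  by rewrite (H1_dotDl uH vH KH1); move: (H1_dot _ _ _) (H1_dot _ _ _) => A1 A2; ring.
- move=> u [uH _]; apply: (le_trans (ler_normcB _ _)); rewrite mulrDl; apply: lerD.
    by rewrite mulrC; exact: (H1_CS uH KH1).
  exact: sup_bound.
move=> h hc; rewrite [X in H1_dot J h X]KE.
rewrite (gr_reproducing up_fin psi0_qeq phi0_qeq W0 psi0_H1 phi0_c Jx hc).
by rewrite mul0r expr0n /= mul0r !addr0 subrr.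
Qed.

Lemma free_green_self_neq0 : inner_half_line c plus x -> free_green c plus x x != 0.
Proof.
rewrite /inner_half_line /free_green /sinh lexx; case: plus; rewrite /= in_itv /= ?andbT => h.
- rewrite mulf_neq0//; first by rewrite mulf_neq0// gt_eqF// expR_gt0.
  by rewrite mulf_neq0// subr_eq0 gt_eqF// ltr_expR; lra.
- rewrite oppr_eq0 mulf_neq0//; first by rewrite mulf_neq0// gt_eqF// expR_gt0.
  by rewrite mulf_neq0// subr_eq0 lt_eqF// ltr_expR; lra.
Qed.

End Reproducing.

End FreeGreen.

(** * The linear relation on the half-line *)

#[global] Instance ae_borel_filter (R : realType) (mu : {measure set (measurableTypeR R) -> \bar R}) :
  Filter (almost_everywhere mu) := ae_filter_ringOfSetsType _.

Section HalfLineRelation.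
Context {R : realType}.
Local Notation B := (measurableTypeR R).
Local Notation leb := (@lebesgue_measure R).
Variables (om : set B -> R) (up : {measure set B -> \bar R}).
Hypotheses (som : is_signed_measure om) (up_fin : locally_finite up).
Let mf := mu4_fin som up_fin.
Variables (c : R) (plus : bool).
Local Notation J := (half_line c plus).
Local Notation H10 := (H10_space c plus).
Local Notation H0 := (H0_space up c plus).
Local Notation T := (T_half om up c plus).
Implicit Types (f g h k : cfun R) (z : R[i]).

Let mJ := half_line_measurable c plus.

Definition dot2 f g : R[i] := cintegral up J (fun x => f x * (g x)^*)%R.
Definition nrm2 f : R := Num.sqrt (complex.Re (dot2 f f)).

Lemma L2J_linear z f g : L2 up J f -> L2 up J g -> L2 up J (z *: f + g).
Proof. by move=> fL gL; exact: (L2_linear z mJ fL gL). Qed.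

Lemma dot2_integrable f g : L2 up J f -> L2 up J g -> cintegrable up J (fun x => f x * (g x)^*)%R.
Proof. by move=> fL gL; exact: (L2_mul mJ fL (L2J gL)). Qed.

Lemma dot2_linear z f g h : L2 up J f -> L2 up J g -> L2 up J h ->
  dot2 (z *: f + g) h = z * dot2 f h + dot2 g h.
Proof.
move=> fL gL hL; have I1 := dot2_integrable fL hL; have I2 := dot2_integrable gL hL.
rewrite /dot2 -(cintZ z mJ I1) -(cintD mJ (cintegrableZ z mJ I1) I2).
by apply: eq_cint => x _; change ((z * f x + g x) * (h x)^* = z * (f x * (h x)^*) + g x * (h x)^*)%R; ring.
Qed.

Lemma dot2_herm f g : L2 up J f -> L2 up J g -> dot2 g f = ((dot2 f g)^*)%R.
Proof.
move=> fL gL; rewrite /dot2 -(cintJ mJ (dot2_integrable fL gL)); apply: eq_cint => x _.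
rewrite rmorphM mulrC; congr (_ * _); exact: esym (conjCK _).
Qed.

Lemma Re_dot2 f : complex.Re (dot2 f f) = \int[up]_(x in J) (normc (f x) ^+ 2).
Proof.
rewrite /dot2 Re_cint; apply: eq_Rintegral => x _.
by rewrite normc_sqr cReM cReJ cImJ; ring.
Qed.

Lemma dot2_ge0 f : L2 up J f -> 0 <= complex.Re (dot2 f f).
Proof. by move=> _; rewrite Re_dot2; apply: Rintegral_ge0 => x _; exact: sqr_ge0. Qed.

Lemma dot2_CS f g : L2 up J f -> L2 up J g -> normc (dot2 f g) <= nrm2 f * nrm2 g.
Proof.
exact: (@cauchy_schwarz R (cfun R) (L2 up J) dot2 L2J_linear dot2_linear dot2_herm dot2_ge0 f g).
Qed.

Lemma nrm2_triangle f g : L2 up J f -> L2 up J g -> nrm2 (f + g) <= nrm2 f + nrm2 g.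
Proof.
exact: (@nrm_triangle R (cfun R) (L2 up J) dot2 L2J_linear dot2_linear dot2_herm dot2_ge0 f g).
Qed.

Lemma nrm2_scale z f : L2 up J f -> nrm2 (z *: f) = normc z * nrm2 f.
Proof.
exact: (@nrm_scale R (cfun R) (L2 up J) dot2 L2J_linear dot2_linear dot2_herm z f).
Qed.

Lemma nrm2_ge0 f : 0 <= nrm2 f. Proof. exact: sqrtr_ge0. Qed.

Lemma nrm2_ae f g : L2 up J f -> L2 up J g -> {ae up, forall x, J x -> f x = g x} ->
  nrm2 f = nrm2 g.
Proof.
move=> fL gL fg; rewrite /nrm2 /dot2; congr (Num.sqrt (complex.Re _)).
apply: (cint_ae_eq mJ).
- exact: cintegrable_measurable (dot2_integrable fL fL).
- exact: cintegrable_measurable (dot2_integrable gL gL).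
by apply: filterS fg => x e /e ->.
Qed.

Lemma nrm2_0 : nrm2 0 = 0.
Proof.
rewrite /nrm2 Re_dot2 /Rintegral (eq_integral (fun=> 0%E)) ?integral0 ?sqrtr0// => x _.
by change ((normc (0 : R[i]) ^+ 2)%:E = 0%E); rewrite normc0 expr0n.
Qed.

Lemma nrm2_eq0 f : L2 up J f -> nrm2 f = 0 -> {ae up, forall x, J x -> f x = 0}.
Proof.
move=> fL /eqP; rewrite sqrtr_eq0 Re_dot2 => le0.
have [mfm fI] := (L2P up f mJ).1 fL.
have int0 : (\int[up]_(x in J) `|(normc (f x) ^+ 2)%:E| = 0)%E.
  rewrite (@eq_integral _ _ _ up J (fun x => (normc (f x) ^+ 2)%:E)); last first.
    by move=> x _; rewrite gee0_abs// lee_fin sqr_ge0.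
  rewrite -(fineK (integrable_fin_num mJ fI)); congr (_%:E); apply/eqP.
  rewrite eq_le le0 /=; apply: Rintegral_ge0 => x _; exact: sqr_ge0.
have ms : measurable_fun J (fun x => (normc (f x) ^+ 2)%:E) by case/integrableP: fI.
have [+ _] := ae_eq_integral_abs up mJ ms.
move=> /(_ int0); apply: filterS => x h Jx; apply: normc0_eq0.
by have := h Jx => -[] /eqP; rewrite sqrf_eq0 => /eqP.
Qed.

Lemma H0_nrm_sqr (f : cfun2 R) : pts H0 f ->
  nrm H0 f ^+ 2 = nrm H10 f.1 ^+ 2 + nrm2 f.2 ^+ 2.
Proof.
move=> [[fH _] fL]; have d1 := H1_dot_ge0 fH; have d2 := dot2_ge0 fL.
have d : complex.Re (H0_dot up c plus f f) = complex.Re (H1_dot J f.1 f.1) + complex.Re (dot2 f.2 f.2).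
  exact: cReD.
have d0 : 0 <= complex.Re (H0_dot up c plus f f) by rewrite d addr_ge0.
by rewrite nrmE /nrm2 (sqr_sqrtr d1) (sqr_sqrtr d2) -d; exact: sqr_sqrtr.
Qed.

Lemma H0_nrm_ge0 (f : cfun2 R) : 0 <= nrm H0 f. Proof. exact: sqrtr_ge0. Qed.

Lemma le_nrm_H0_l (f : cfun2 R) : pts H0 f -> nrm H10 f.1 <= nrm H0 f.
Proof.
move=> fH; rewrite -(ler_pXn2r (n := 2)) ?nnegrE ?nrm_ge0 ?H0_nrm_ge0//.
by rewrite (H0_nrm_sqr fH) lerDl sqr_ge0.
Qed.

Lemma le_nrm_H0_r (f : cfun2 R) : pts H0 f -> nrm2 f.2 <= nrm H0 f.
Proof.
move=> fH; rewrite -(ler_pXn2r (n := 2)) ?nnegrE ?nrm2_ge0 ?H0_nrm_ge0//.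
by rewrite (H0_nrm_sqr fH) lerDr sqr_ge0.
Qed.

Lemma H0_nrm_le (f : cfun2 R) : pts H0 f -> nrm H0 f <= nrm H10 f.1 + nrm2 f.2.
Proof.
move=> fH; have a0 := nrm_ge0 c plus f.1; have b0 := nrm2_ge0 f.2.
rewrite -(ler_pXn2r (n := 2)) ?nnegrE ?H0_nrm_ge0 ?addr_ge0//.
rewrite (H0_nrm_sqr fH) sqrrD; have := mulr_ge0 a0 b0.
by move: (_ * _) (_ ^+ 2) (_ ^+ 2) => A C D; lra.
Qed.

Lemma H0_linear z (f g : cfun2 R) : pts H0 f -> pts H0 g -> pts H0 (z *: f + g).
Proof.
by move=> [f1 f2] [g1 g2]; split; [exact: H10_linear|exact: (L2J_linear z f2 g2)].
Qed.

Lemma H10_0 : pts H10 0.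
Proof.
have [x Jx] := half_line_point c plus.
have h := free_green_H10 som up_fin Jx.
have := H10_linear (-1) h h; rewrite (_ : _ + _ = 0)//.
apply/funext => t; change (-1 * (free_green c plus x t)%:C + (free_green c plus x t)%:C = 0).
ring.
Qed.

Lemma eq_primitive (E : set R) (f g k : R -> R[i]) : (forall x, E x -> f x = g x) ->
  primitive E f k -> primitive E g k.
Proof. by move=> fg [kI fE]; split => // x y Ex Ey xy; rewrite -!fg// fE. Qed.

Lemma T_pts (f tf : cfun2 R) : T (f, tf) -> pts H0 f /\ pts H0 tf.
Proof. by case. Qed.

Lemma T_snd (f tf : cfun2 R) : T (f, tf) -> {ae up, forall x, J x -> f.2 x = tf.1 x}.
Proof.
move=> [_ _ [[q tq] [_ _ _ /= qae] [[_ e2] [e3 _]]]].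
by apply: filterS2 qae e2 => x e e' Jx; rewrite /= -e'// e e3.
Qed.

Lemma T_eqv (f tf f' tf' : cfun2 R) : T (f, tf) -> pts H0 f' -> pts H0 tf' ->
  eqv H0 f f' -> eqv H0 tf tf' -> T (f', tf').
Proof.
move=> [/= fH tH [[q tq] qT [[a1 a2] [b1 b2]]]] fH' tH' [c1 c2] [d1 d2].
split => //; exists (q, tq) => //=; split; split.
- by move=> x Jx; rewrite a1// c1.
- by apply: filterS2 a2 c2 => x e e' Jx; rewrite e// e'.
- by move=> x Jx; rewrite b1// d1.
- by apply: filterS2 b2 d2 => x e e' Jx; rewrite e// e'.
Qed.

Lemma H_loc_linear z (f g : cfun2 R) : H_loc up f -> H_loc up g -> H_loc up (z *: f + g).
Proof.
move=> [acf fL f2L] [acg gL g2L]; have iT := @is_intervalT R.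
have fp := ac_primitive iT acf; have gp := ac_primitive iT acg.
have lp := primitive_linear z iT fp gp.
have mcc a b : measurable (`[a, b] : set B) by exact: measurable_itv.
split => [|a b|a b].
- exact: primitive_ac lp.
- apply: (@L2_ae_eq _ leb `[a, b] (fun x => z * cderiv f.1 x + cderiv g.1 x)) => //.
  + apply: (@cmeasurableS _ _ setT) => //.
    exact: cderiv_measurable (@setT_sigma R) (primitive_ac lp).
  + by apply: filterS (primitive_ae (@setT_sigma R) lp) => x e _; rewrite e.
  + exact: (L2_linear z (mcc a b) (fL a b) (gL a b)).
- exact: (L2_linear z (mcc a b) (f2L a b) (g2L a b)).
Qed.

Lemma cint_test (mu : {measure set B -> \bar R}) z (u v : R -> R[i]) (t : R -> R) P Q :
  measurable_fun (setT : set B) t ->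
  (exists M, forall x, `|t x| <= M) ->
  cintegrable mu `[P, Q[ u -> cintegrable mu `[P, Q[ v ->
  (forall x, ~ `]P, Q[ x -> t x = 0) ->
  cintegral mu setT (fun x => (z * u x + v x) * (t x)%:C) =
  z * cintegral mu setT (fun x => u x * (t x)%:C) + cintegral mu setT (fun x => v x * (t x)%:C).
Proof.
move=> mt [M tM] uI vI t0; have mco : measurable (`[P, Q[ : set B) by exact: measurable_itv.
have re (w : R -> R[i]) : cintegral mu setT (fun x => w x * (t x)%:C) =
    cintegral mu `[P, Q[ (fun x => w x * (t x)%:C).
  apply: cint_restrict => // x _ nx; rewrite t0 ?mulr0//; apply: contra_not nx.
  by rewrite /= !in_itv /= => /andP[/ltW-> ->].
have wI (w : R -> R[i]) : cintegrable mu `[P, Q[ w -> cintegrable mu `[P, Q[ (fun x => w x * (t x)%:C).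
  move=> wI; apply: (@cintegrableM _ mu _ _ _ M mco wI).
    by apply: cmeasurable_real; exact: measurable_funS mt.
  by move=> x _; rewrite normc_real.
rewrite !re -(cintZ z mco (wI u uI)) -(cintD mco (cintegrableZ z mco (wI u uI)) (wI v vI)).
by apply: eq_cint => x _; ring.
Qed.

Lemma T_loc_linear z (f tf g tg : cfun2 R) : T_loc om up (f, tf) -> T_loc om up (g, tg) ->
  T_loc om up (z *: f + g, z *: tf + tg).
Proof.
move=> [/= fl tfl feq fae] [/= gl tgl geq gae].
split => /=; [exact: H_loc_linear|exact: H_loc_linear| |]; last first.
  by apply: filterS2 fae gae => x e e'; change (z * f.2 x + g.2 x = z * tf.1 x + tg.1 x); rewrite e e'.
move=> h ht; have [hp h1p [P [Q [PQ out]]]] := test_function_facts ht.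
have [dh _] := ht.
have cont n : continuous (derive1n n h).
  by move=> x; apply: differentiable_continuous; apply/derivable1_diffP; exact: dh.
have mh n : measurable_fun (setT : set B) (derive1n n h) by exact: continuous_measurable_fun.
have bnd (t : R -> R) : continuous t -> (forall x, ~ `]P, Q[ x -> t x = 0) ->
    exists M, forall x, `|t x| <= M.
  move=> ct t0; have [x0 _ Hmax] := @EVT_max R (fun x => `|t x|) P Q (ltW PQ)
    (@continuous_subspaceT _ _ _ (fun x : R => `|t x|) (fun x => cvg_norm (ct x))).
  exists `|t x0| => x; have [xPQ|nx] := pselect (`]P, Q[ x).
    by apply: Hmax; apply: subset_itv_oo_cc xPQ.
  by rewrite t0// normr0.
have out0 x : ~ `]P, Q[ x -> h x = 0 by move=> /out[].
have out2 x : ~ `]P, Q[ x -> derive1n 2 h x = 0 by move=> /out[].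
have b0 := bnd _ (cont 0%N) out0; have b2 := bnd _ (cont 2%N) out2.
have loc (u : cfun2 R) (mu : {measure set B -> \bar R}) : locally_finite mu -> H_loc up u ->
    cintegrable mu `[P, Q[ u.1.
  move=> muf [acu _ _]; exact: (primitive_weight muf (ac_primitive (@is_intervalT R) acu)).
have loc2 (u : cfun2 R) : H_loc up u -> cintegrable up `[P, Q[ u.2.
  move=> [_ _ u2].
  have mcc : measurable (`[P, Q] : set B) by exact: measurable_itv.
  apply: (@cintegrableS _ up _ `[P, Q]) => //; first exact: subset_itv_co_cc.
  apply: (L2_cintegrable mcc _ (u2 P Q)).
  by apply: up_fin; exact: bounded_borel_itv.
have lebf : locally_finite leb := mf ord0.
have mpf := upvar_locally_finite som; have mnf := upvar_locally_finite (signed_measureN som).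
have e1 := cint_test z (mh 2%N) b2 (loc _ leb lebf fl) (loc _ leb lebf gl) out2.
have e2 := cint_test z (mh 0%N) b0 (loc _ leb lebf fl) (loc _ leb lebf gl) out0.
have e3 := cint_test z (mh 0%N) b0 (loc _ _ mpf tfl) (loc _ _ mpf tgl) out0.
have e4 := cint_test z (mh 0%N) b0 (loc _ _ mnf tfl) (loc _ _ mnf tgl) out0.
have e5 := cint_test z (mh 0%N) b0 (loc2 _ tfl) (loc2 _ tgl) out0.
have := feq h ht; have := geq h ht; rewrite /signed_integral => E1 E2.
transitivity (z * (- cintegral leb setT (fun x => f.1 x * (derive1n 2 h x)%:C)
   + 4^-1 * cintegral leb setT (fun x => f.1 x * (h x)%:C)) +
   (- cintegral leb setT (fun x => g.1 x * (derive1n 2 h x)%:C)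
   + 4^-1 * cintegral leb setT (fun x => g.1 x * (h x)%:C))).
  rewrite [X in - X](e1 : _ = _) [X in 4^-1 * X](e2 : _ = _).
  by move: (cintegral _ _ _) (cintegral _ _ _) (cintegral _ _ _) (cintegral _ _ _) => A1 A2 A3 A4; ring.
rewrite E1 E2 [X in _ = X - _ + _](e3 : _ = _) [X in _ = _ - X + _](e4 : _ = _) [X in _ = _ + X](e5 : _ = _).
by move: (cintegral _ _ _) (cintegral _ _ _) (cintegral _ _ _) (cintegral _ _ _) (cintegral _ _ _) (cintegral _ _ _) => A1 A2 A3 A4 A5 A6; ring.
Qed.

Lemma T_linear z (f tf g tg : cfun2 R) : T (f, tf) -> T (g, tg) ->
  T (z *: f + g, z *: tf + tg).
Proof.
move=> [/= fH tfH [[q tq] qT [[a1 a2] [b1 b2]]]] [/= gH tgH [[p tp] pT [[c1 c2] [d1 d2]]]].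
split => /=; [exact: H0_linear|exact: H0_linear|].
exists (z *: q + p, z *: tq + tp); first exact: T_loc_linear.
split; split => /=.
- by move=> x Jx; change (z * q.1 x + p.1 x = z * f.1 x + g.1 x); rewrite a1// c1.
- by apply: filterS2 a2 c2 => x e e' Jx; change (z * q.2 x + p.2 x = z * f.2 x + g.2 x); rewrite e// e'.
- by move=> x Jx; change (z * tq.1 x + tp.1 x = z * tf.1 x + tg.1 x); rewrite b1// d1.
- by apply: filterS2 b2 d2 => x e e' Jx; change (z * tq.2 x + tp.2 x = z * tf.2 x + tg.2 x); rewrite e// e'.
Qed.

End HalfLineRelation.

(** * Testing the relation against functions *)

Section Pairing.
Context {R : realType}.
Local Notation B := (measurableTypeR R).
Local Notation leb := (@lebesgue_measure R).
Variables (om : set B -> R) (up : {measure set B -> \bar R}).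
Hypotheses (som : is_signed_measure om) (up_fin : locally_finite up).
Local Notation mu4 := (mu4 up som).
Variables (c : R) (plus : bool).
Local Notation J := (half_line c plus).
Local Notation H10 := (H10_space c plus).
Local Notation H0 := (H0_space up c plus).
Local Notation T := (T_half om up c plus).
Local Notation nrm2 := (nrm2 up c plus).
Implicit Types (f g h k : cfun R) (z : R[i]).

Let mJ := half_line_measurable c plus.
Let iJ := @half_line_interval R c plus.

(** The right-hand side of the equation of [T], as a functional. *)
Definition source (t : cfun2 R) (k : cfun R) : R[i] :=
  (signed_integral om J (fun s => t.1 s * k s) + cintegral up J (fun s => t.2 s * k s))%R.

(** Elements of [T] satisfy the equation on [J]; only the [up]-component of the
    right-hand side is affected by the choice of representatives. *)
Lemma T_qeq (f tf : cfun2 R) : T (f, tf) ->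
  exists u', qeq mu4 J coef_rel (vec4 f.1 tf.1 tf.1 tf.2) f.1 u'.
Proof.
move=> [_ [_ t2L] [[q tq] qT [/= [a1 _] [b1 b2]]]].
have [F' Fq] := T_loc_qeq som up_fin qT; have [Fp wI FE] := qeqS (@subsetT _ J) Fq.
have cosub x y : J x -> J y -> `[x, y[ `<=` J.
  move=> Jx Jy s; rewrite /= in_itv /= => /andP[xs /ltW sy]; apply: iJ Jx Jy _ _.
  by rewrite xs sy.
have mco x y : measurable (`[x, y[ : set B) by exact: measurable_itv.
have mt2 x y : J x -> J y -> cmeasurable (`[x, y[ : set B) tf.2.
  move=> Jx Jy; apply: cmeasurableS (L2_cmeasurable t2L) => //; exact: cosub.
have ae x y : J x -> J y -> {ae up, forall s, `[x, y[%classic s -> tq.2 s = tf.2 s}.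
  by move=> Jx Jy; apply: filterS b2 => s e /(cosub _ _ Jx Jy); exact: e.
have {}wI i x y : J x -> J y ->
    cintegrable (mu4 i) `[x, y[ (vec4 f.1 tf.1 tf.1 tf.2 i) /\
    cintegral (mu4 i) `[x, y[ (vec4 q.1 tq.1 tq.1 tq.2 i) =
    cintegral (mu4 i) `[x, y[ (vec4 f.1 tf.1 tf.1 tf.2 i).
  move=> Jx Jy; have sub := cosub x y Jx Jy; have := wI i x y Jx Jy.
  case: i => -[|[|[|n]]] ni; rewrite /vec4 /= => I.
  - split; last by apply: eq_cint => s /sub; exact: a1.
    by apply: eq_cintegrable I => // s /sub; exact: a1.
  - split; last by apply: eq_cint => s /sub; exact: b1.
    by apply: eq_cintegrable I => // s /sub; exact: b1.
  - split; last by apply: eq_cint => s /sub; exact: b1.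
    by apply: eq_cintegrable I => // s /sub; exact: b1.
  - split; first exact: (cintegrable_ae_eq (mco x y) I (mt2 x y Jx Jy) (ae x y Jx Jy)).
    exact: (cint_ae_eq (mco x y) (cintegrable_measurable I) (mt2 x y Jx Jy) (ae x y Jx Jy)).
exists F'; split => [|i x y Jx Jy|x y Jx Jy xy].
- exact: eq_primitive a1 Fp.
- by have [] := wI i x y Jx Jy.
- rewrite FE//; apply: eq_bigr => i _; congr (_ * _).
  by have [] := wI i x y Jx Jy.
Qed.

(** The weak form of the equation expresses a scalar product in [H^1]. *)
Lemma T_pairing (f tf : cfun2 R) h : T (f, tf) -> H1c c plus h ->
  H1_dot J f.1 (fun s => (h s)^*)%R = source tf h.
Proof.
move=> fT hc; have [u' uq] := T_qeq fT.
have [[[fH _] _] _] := T_pts fT.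
have [up_ _ _] := uq; have sJ := @half_sigma R c plus.
have [_ mu'] := primitive_cmeasurable sJ up_.
have hH : H1 J h by case: hc => -[].
have hp := H1c_primitive hc; have [_ mh'] := primitive_cmeasurable sJ hp.
rewrite (half_dotE fH (H1J hH) up_ (primitiveJ iJ hp) mu' (cmeasurableJ mh')).
have e1 : cintegral leb J (fun s => f.1 s * ((h s)^*)^*)%R = cintegral leb J (fun s => f.1 s * h s).
  by apply: eq_cint => s _; congr (_ * _); exact: conjCK.
have e2 : cintegral leb J (fun s => u' s * ((cderiv h s)^*)^*)%R = cintegral leb J (fun s => u' s * cderiv h s).
  by apply: eq_cint => s _; congr (_ * _); exact: conjCK.
rewrite e1 e2; have := qeq_pairing up_fin uq mu' hc.
have -> : (fun i s => vec4 f.1 tf.1 tf.1 tf.2 i s * h s) = vec4 (fun s => f.1 s * h s)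
    (fun s => tf.1 s * h s) (fun s => tf.1 s * h s) (fun s => tf.2 s * h s).
  by apply/funext => -[[|[|[|i]]] Hi].
rewrite wint4E /source /signed_integral.
move: (cintegral _ _ _) (cintegral _ _ _) (cintegral _ _ _) (cintegral _ _ _) (cintegral _ _ _) => A1 A2 A3 A4 A5 e.
transitivity ((A5 + (4^-1 * A4 + -1 * A3 + 1 * A2 + -1 * A1)) + (A3 - A2 + A1)); first by ring.
by rewrite e add0r.
Qed.

(** Zero in the resolvent set, as a solvability statement with an estimate. *)
Hypothesis T_onto : forall g : cfun2 R, pts H0 g -> exists f : cfun2 R, T (f, g).
Variable kT : R.
Hypothesis kT_ge0 : 0 <= kT.
Hypothesis T_bound : forall f g : cfun2 R, T (f, g) -> nrm H0 f <= kT * nrm H0 g.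

Lemma H0_fst f : pts H10 f -> pts H0 (f, 0).
Proof. by move=> fH; split => //; exact: L20. Qed.

Lemma H0_snd f : L2 up J f -> pts H0 (0, f).
Proof. by move=> fL; split => //; exact: (H10_0 som up_fin). Qed.

Lemma nrm_H0_fst f : pts H10 f -> nrm H0 (f, 0) = nrm H10 f.
Proof.
move=> fH; have a0 := nrm_ge0 c plus f.
apply/eqP; rewrite -(eqrXn2 (n := 2)) ?H0_nrm_ge0//.
by rewrite (H0_nrm_sqr (H0_fst fH)) /= nrm2_0 expr0n /= addr0.
Qed.

(** Solving with source [(f, 0)] gives an element whose second component is [f]. *)
Lemma H10_embedding f : pts H10 f -> L2 up J f /\ nrm2 f <= kT * nrm H10 f.
Proof.
move=> fH; have [u uT] := T_onto (H0_fst fH).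
have [uH _] := T_pts uT; have [_ u2L] := uH; have [[fH1 _] _] := fH.
have mfJ : cmeasurable (J : set B) f.
  by have [] := primitive_cmeasurable (@half_sigma R c plus) (H1J_primitive (proj1 fH)).
have ae := T_snd uT.
have fL : L2 up J f by apply: L2_ae_eq u2L => //; exact: ae.
split => //; rewrite -(nrm2_ae u2L fL ae) -(nrm_H0_fst fH).
exact: le_trans (le_nrm_H0_r uH) (T_bound uT).
Qed.

(** The measure [om] acts only on the support of [t.1], where [k] is bounded
    by its norm; the part with [up] is a scalar product of square integrable
    functions. *)
Lemma source_le (t : cfun2 R) : H1c c plus t.1 -> L2 up J t.2 ->
  exists2 C : R, 0 <= C & forall k, pts H10 k -> normc (source t k) <= C * nrm H10 k.
Proof.
move=> tc tL; have [[tH _] _] := tc; have [x Jx] := half_line_point c plus.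
have [p [q [px xq Jp Jq t0]]] := H1c_support tc Jx; have pq := le_trans px xq.
have pqJ : `[p, q] `<=` J by exact: (itv_sub 0 0 iJ).
have coJ : `[p, q[ `<=` J by move=> s /subset_itv_co_cc/pqJ.
have M0 : 0 <= 6 * nrm H10 t.1 by rewrite mulr_ge0 ?nrm_ge0.
pose M := 6 * nrm H10 t.1.
have mco : measurable (`[p, q[ : set B) by exact: measurable_itv.
have mJ_ g : H1 J g -> cmeasurable (J : set B) g by move=> [_ /L2_cmeasurable].
have part (mu : {measure set B -> \bar R}) : locally_finite mu ->
    exists2 C : R, 0 <= C & forall k, pts H10 k ->
      normc (cintegral mu J (fun s => t.1 s * k s)) <= C * nrm H10 k.
  move=> muf; have fin : (mu `[p, q[ < +oo)%E by apply: muf; exact: bounded_borel_itv.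
  exists (2 * (M * 6 * fine (mu `[p, q[))).
    have F0 : 0 <= fine (mu `[p, q[) by apply: fine_ge0; exact: measure_ge0.
    by rewrite mulr_ge0 ?ler0n// mulr_ge0// mulr_ge0.
  move=> k [kH _]; rewrite (@cint_restrict _ mu `[p, q[ J _ coJ); last first.
    move=> s Js ns; rewrite t0 ?mul0r//; apply: contra_not ns.
    by rewrite /= !in_itv /= => /andP[/ltW-> ->].
  apply: le_trans (@ler_normc_cint_bounded _ mu _ _ (M * (6 * nrm H10 k)) mco fin _ _) _.
  - by apply: (@cmeasurableS _ _ J) => //; apply: cmeasurableM; exact: mJ_.
  - move=> s /coJ Js; rewrite normcM; exact: (ler_pM (normc_ge0 _) (normc_ge0 _) (sup_bound tH Js) (sup_bound kH Js)).
  - by rewrite le_eqVlt; apply/orP; left; apply/eqP; ring.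
have [C1 C10 H1_] := part _ (upvar_locally_finite som).
have [C2 C20 H2_] := part _ (upvar_locally_finite (signed_measureN som)).
have tJ := L2J tL.
exists (C1 + C2 + kT * nrm2 (fun s => (t.2 s)^*)%R).
  by rewrite !addr_ge0// mulr_ge0// nrm2_ge0.
move=> k kH; have [kL kE] := H10_embedding kH.
have -> : source t k = (cintegral (upvar som) J (fun s => t.1 s * k s)
   - cintegral (upvar (signed_measureN som)) J (fun s => t.1 s * k s)) + dot2 up c plus k (fun s => (t.2 s)^*)%R.
  congr (_ + _); apply: eq_cint => s _; rewrite mulrC; congr (_ * _); exact: esym (conjCK _).
have := dot2_CS kL tJ; have := H1_ k kH; have := H2_ k kH.
move: (cintegral _ _ _) (cintegral _ _ _) (dot2 _ _ _ _ _) => A1 A2 A3 h2 h1 h3.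
have := ler_normcD (A1 - A2) A3; have := ler_normcB A1 A2.
have N0 := nrm2_ge0 up c plus (fun s => (t.2 s)^*)%R.
have := ler_wpM2r N0 kE; move: h1 h2 h3; move: (nrm H10 k) (nrm2 _) (nrm2 _) => a b d.
have -> : (C1 + C2 + kT * b) * a = C1 * a + C2 * a + kT * a * b by ring.
move=> l1 l2 l3 l4 l5 l6; apply: (le_trans l6); apply: lerD; last exact: le_trans l3 l4.
by apply: (le_trans l5); exact: lerD l1 l2.
Qed.

Lemma source_linear (t : cfun2 R) z f g : H1c c plus t.1 -> L2 up J t.2 ->
  pts H10 f -> pts H10 g -> source t (z *: f + g) = z * source t f + source t g.
Proof.
move=> tc tL fH gH; have [x Jx] := half_line_point c plus.
have [fL _] := H10_embedding fH; have [gL _] := H10_embedding gH.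
have [p [q [px xq Jp Jq t0]]] := H1c_support tc Jx; have pq := le_trans px xq.
have pqJ : `[p, q] `<=` J by exact: (itv_sub 0 0 iJ).
have coJ : `[p, q[ `<=` J by move=> s /subset_itv_co_cc/pqJ.
have mco : measurable (`[p, q[ : set B) by exact: measurable_itv.
have part (mu : {measure set B -> \bar R}) : locally_finite mu ->
    cintegral mu J (fun s => t.1 s * (z *: f + g) s) =
    z * cintegral mu J (fun s => t.1 s * f s) + cintegral mu J (fun s => t.1 s * g s).
  move=> muf.
  have re k : cintegral mu J (fun s => t.1 s * k s) = cintegral mu `[p, q[ (fun s => t.1 s * k s).
    apply: cint_restrict => // s Js ns; rewrite t0 ?mul0r//; apply: contra_not ns.
    by rewrite /= !in_itv /= => /andP[/ltW-> ->].
  have fin : (mu `[p, q[ < +oo)%E by apply: muf; exact: bounded_borel_itv.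
  have I k : pts H10 k -> cintegrable mu `[p, q[ (fun s => t.1 s * k s).
    move=> [kH _]; have [[tH _] _] := tc.
    apply: (@cintegrable_bounded _ mu _ _ ((6 * nrm H10 t.1) * (6 * nrm H10 k))) => //.
      apply: (@cmeasurableS _ _ J) => //; apply: cmeasurableM.
        by case: tH => _ /L2_cmeasurable.
      by case: kH => _ /L2_cmeasurable.
    move=> s /coJ Js; rewrite normcM; exact: (ler_pM (normc_ge0 _) (normc_ge0 _) (sup_bound tH Js) (sup_bound kH Js)).
  rewrite !re -(cintZ z mco (I f fH)) -(cintD mco (cintegrableZ z mco (I f fH)) (I g gH)).
  apply: eq_cint => s _; change (t.1 s * (z * f s + g s) = z * (t.1 s * f s) + t.1 s * g s); ring.
have p1 := part _ (upvar_locally_finite som).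
have p2 := part _ (upvar_locally_finite (signed_measureN som)).
have If := L2_mul mJ tL fL; have Ig := L2_mul mJ tL gL.
have p3 : cintegral up J (fun s => t.2 s * (z *: f + g) s) =
    z * cintegral up J (fun s => t.2 s * f s) + cintegral up J (fun s => t.2 s * g s).
  rewrite -(cintZ z mJ If) -(cintD mJ (cintegrableZ z mJ If) Ig).
  apply: eq_cint => s _; change (t.2 s * (z * f s + g s) = z * (t.2 s * f s) + t.2 s * g s); ring.
rewrite /source /signed_integral p3 [X in X - _](p1 : _ = _) [X in _ - X](p2 : _ = _).
move: (cintegral _ _ _) (cintegral _ _ _) (cintegral _ _ _) (cintegral _ _ _) (cintegral _ _ _) (cintegral _ _ _) => A1 A2 A3 A4 A5 A6; ring.
Qed.

Lemma nrm_conj f : pts H10 f -> nrm H10 (fun s => (f s)^*)%R = nrm H10 f.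
Proof.
move=> [fH _]; rewrite !nrmE; apply: (congr1 (fun w => Num.sqrt (complex.Re w))).
have fp := H1J_primitive fH; have [_ md] := primitive_cmeasurable (@half_sigma R c plus) fp.
rewrite (half_dotE (H1J fH) (H1J fH) (primitiveJ iJ fp) (primitiveJ iJ fp) (cmeasurableJ md) (cmeasurableJ md)).
have e1 (w : R -> R[i]) : cintegral leb J (fun s => (w s)^* * ((w s)^*)^*)%R = cintegral leb J (fun s => w s * (w s)^*)%R.
  by apply: eq_cint => s _; rewrite mulrC; congr (_ * _); exact: conjCK.
by rewrite !e1.
Qed.

(** The pairing extends from compactly supported [k] to all of [H^1_0] by
    density, because the source functional is bounded. *)
Lemma T_pairing_H10 (f tf : cfun2 R) k : T (f, tf) -> H1c c plus tf.1 -> pts H10 k ->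
  H1_dot J f.1 (fun s => (k s)^*)%R = source tf k.
Proof.
move=> fT tc kH; have [[[fH _] _] [_ t2L]] := T_pts fT.
have [C C0 CE] := source_le tc t2L; apply/eqP; rewrite -subr_eq0; apply/eqP.
apply: (@functional_vanishes R c plus (fun k => H1_dot J f.1 (fun s => (k s)^*)%R - source tf k)
  (nrm H10 f.1 + C)) => //.
- move=> u v uH vH; have [uH1 _] := uH; have [vH1 _] := vH.
  have := source_linear 1 tc t2L uH vH; rewrite scale1r mul1r => ->.
  change (H1_dot J f.1 (fun s => (u s + v s)^*)%R - (source tf u + source tf v) =
    H1_dot J f.1 (fun s => (u s)^*)%R - source tf u + (H1_dot J f.1 (fun s => (v s)^*)%R - source tf v)).
  rewrite (H1_dotJDr uH1 vH1 fH).
  by move: (source _ _) (source _ _) (H1_dot _ _ _) (H1_dot _ _ _) => A1 A2 A3 A4; ring.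
- move=> u uH; have [uH1 _] := uH; apply: (le_trans (ler_normcB _ _)); rewrite mulrDl.
  apply: lerD; last exact: CE.
  by rewrite -(nrm_conj uH); exact: H1_CS fH (H1J uH1).
- by move=> h hc; rewrite (T_pairing fT hc) subrr.
Qed.

End Pairing.

(** * The quadratic pencil *)

Section Pencil.
Context {R : realType}.
Local Notation B := (measurableTypeR R).
Variables (om : set B -> R) (up : {measure set B -> \bar R}).
Hypotheses (som : is_signed_measure om) (up_fin : locally_finite up).
Variables (c : R) (plus : bool).
Local Notation J := (half_line c plus).
Local Notation H10 := (H10_space c plus).
Local Notation H0 := (H0_space up c plus).
Local Notation T := (T_half om up c plus).
Local Notation nrm2 := (nrm2 up c plus).
Implicit Types (f g h k : cfun R) (z : R[i]).

Let mJ := half_line_measurable c plus.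
Hypothesis T_onto : forall g : cfun2 R, pts H0 g -> exists f : cfun2 R, T (f, g).
Variable kT : R.
Hypothesis kT_ge0 : 0 <= kT.
Hypothesis T_bound : forall f g : cfun2 R, T (f, g) -> nrm H0 f <= kT * nrm H0 g.

Let emb := H10_embedding T_onto T_bound.

Let H10_z : pts H10 0 := H10_0 som up_fin c plus.

Lemma nrm_H10_0 : nrm H10 0 = 0.
Proof.
have [H _] := H10_z.
by rewrite -[X in nrm H10 X](scale0r (0 : cfun R)) (H10_scale 0 H) normc0 mul0r.
Qed.

Lemma nrm_H0_0 : nrm H0 0 = 0.
Proof. by rewrite (nrm_H0_fst up) ?nrm_H10_0//; exact: H10_z. Qed.

Lemma H0_nrm_eq0 (f : cfun2 R) : pts H0 f -> nrm H0 f <= 0 -> eqv H0 f 0.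
Proof.
move=> fH f0; have [[fH1 _] fL] := fH; split => [x Jx|].
  apply: normc0_eq0; apply/eqP; rewrite eq_le normc_ge0 andbT.
  apply: (le_trans (sup_bound fH1 Jx)); rewrite pmulr_rle0//.
  exact: le_trans (le_nrm_H0_l fH) f0.
apply: nrm2_eq0 fL _; apply/eqP; rewrite eq_le nrm2_ge0 andbT.
exact: le_trans (le_nrm_H0_r fH) f0.
Qed.

Lemma eqv_refl (f : cfun2 R) : eqv H0 f f.
Proof. by split => //; apply/aeW => x. Qed.

Lemma eqv_sub (f g : cfun2 R) : eqv H0 (f - g) 0 -> eqv H0 f g.
Proof.
move=> [e1 e2]; split => [x Jx|]; first by apply/eqP; rewrite -subr_eq0; apply/eqP/e1.
by apply: filterS e2 => x e Jx; apply/eqP; rewrite -subr_eq0; apply/eqP/e.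
Qed.

Lemma T_uniq (f f' g g' : cfun2 R) : T (f, g) -> T (f', g') -> eqv H0 g' g -> eqv H0 f f'.
Proof.
move=> fT fT' gg; have [fH gH] := T_pts fT; have [fH' _] := T_pts fT'.
have fT2 := T_eqv fT' fH' gH (eqv_refl _) gg.
apply: eqv_sub; have := T_linear som up_fin (-1) fT2 fT.
rewrite !scaleN1r addNr addrC => dT; apply: H0_nrm_eq0; first by have [] := T_pts dT.
by apply: (le_trans (T_bound dT)); rewrite nrm_H0_0 mulr0.
Qed.

Lemma T_sub (f f' g g' : cfun2 R) : T (f, g) -> T (f', g') -> T (f - f', g - g').
Proof.
by move=> fT fT'; have := T_linear som up_fin (-1) fT' fT; rewrite !scaleN1r ![- _ + _]addrC.
Qed.

Lemma H1c0 : H1c c plus 0.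
Proof.
split; first exact: H10_z.
by exists 1, 0; split => // x; rewrite /= in_itv /= => /andP[/le_trans h /h]; rewrite ler10.
Qed.

Lemma H10_sub f g : pts H10 f -> pts H10 g -> pts H10 (f - g).
Proof. by move=> fH gH; rewrite addrC -scaleN1r; exact: H10_linear. Qed.

Lemma H10_scaled z f : pts H10 f -> pts H10 (z *: f).
Proof. by move=> fH; rewrite -[_ *: _]addr0; apply: H10_linear => //; exact: H10_z. Qed.

Lemma H10_add f g : pts H10 f -> pts H10 g -> pts H10 (f + g).
Proof. by move=> fH gH; rewrite -[f]scale1r; exact: H10_linear. Qed.

Lemma real_conj (r : R) : ((r%:C : R[i])^*)%R = r%:C.
Proof. by apply: complex_eq; rewrite ?cReJ ?cImJ //= oppr0. Qed.

(** Pair with the reproducing kernel. *)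
Lemma kernel_formula (f t : cfun2 R) x : T (f, t) -> H1c c plus t.1 -> J x ->
  f.1 x = source om up c plus t (fun s => (free_green c plus x s)%:C).
Proof.
move=> fT tc Jx; have [[fH _] _] := T_pts fT.
rewrite -(free_green_reproducing som up_fin Jx fH).
have -> : (fun s => (free_green c plus x s)%:C) = (fun s => ((free_green c plus x s)%:C)^*)%R :> (R -> R[i]).
  by apply/funext => s; rewrite real_conj.
rewrite (T_pairing_H10 som up_fin T_onto kT_ge0 T_bound fT tc (free_green_H10 som up_fin Jx)).
by congr (source _ _ _ _ _ _); apply/funext => s; rewrite real_conj.
Qed.

Lemma eq_signed f g : (forall x, J x -> f x = g x) ->
  signed_integral om J f = signed_integral om J g.
Proof.
move=> fg; have e1 := @eq_cint _ (upvar som) J f g fg.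
have e2 := @eq_cint _ (upvar (signed_measureN som)) J f g fg.
by rewrite /signed_integral [X in X - _](e1 : _ = _) [X in _ - X](e2 : _ = _).
Qed.

Lemma solution_kernel_fst (f : cfun2 R) g x : T (f, (g, 0)) -> H1c c plus g -> J x ->
  f.1 x = signed_integral om J (fun s => (free_green c plus x s)%:C * g s).
Proof.
move=> fT gc Jx; rewrite (kernel_formula fT gc Jx) /source /=.
rewrite (_ : cintegral up J _ = 0) ?addr0.
  by apply: eq_signed => s _; rewrite mulrC.
by rewrite -(cint0 up J); apply: eq_cint => s _; rewrite mul0r.
Qed.

Lemma solution_kernel_snd (f : cfun2 R) g x : T (f, (0, g)) -> J x ->
  f.1 x = cintegral up J (fun s => (free_green c plus x s)%:C * g s).
Proof.
move=> fT Jx; rewrite (kernel_formula fT H1c0 Jx) /source /=.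
rewrite (_ : signed_integral _ _ _ = 0) ?add0r.
  by apply: eq_cint => s _; rewrite mulrC.
have z0 (mu : {measure set B -> \bar R}) (k : R -> R[i]) : cintegral mu J (fun s => (0 : cfun R) s * k s) = 0.
  by rewrite -(cint0 mu J); apply: eq_cint => s _; rewrite mul0r.
have z1 := z0 (upvar som); have z2 := z0 (upvar (signed_measureN som)).
by rewrite /signed_integral [X in X - _](z1 : _) [X in _ - X](z2 : _) subrr.
Qed.

Lemma T_solver : exists S : cfun2 R -> cfun2 R, forall g : cfun2 R, pts H0 g -> T (S g, g).
Proof.
have [g|S ST] := @choice _ _ (fun g f : cfun2 R => pts H0 g -> T (f, g)); last by exists S.
have [gH|ng] := pselect (pts H0 g); last by exists 0.
by have [f fT] := T_onto gH; exists f.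
Qed.

Lemma T_bound_fst (f g : cfun2 R) : T (f, g) -> nrm H10 f.1 <= kT * nrm H0 g.
Proof.
by move=> fT; have [fH _] := T_pts fT; apply: le_trans (le_nrm_H0_l fH) (T_bound fT).
Qed.

Section Solver.
Variable S : cfun2 R -> cfun2 R.
Hypothesis ST : forall g : cfun2 R, pts H0 g -> T (S g, g).

Lemma solver_fst g : pts H10 g -> T (S (g, 0), (g, 0)).
Proof. by move=> gH; apply: ST; exact: H0_fst. Qed.

Lemma solver_snd g : pts H10 g -> T (S (0, g), (0, g)).
Proof. by move=> /emb[gL _]; apply: ST; exact: (H0_snd som up_fin). Qed.

Lemma solver_fst_bounded : is_bounded_operator H10 (fun g => (S (g, 0)).1).
Proof.
split => [f fH|z f g fH gH x Jx|].
- by have [[]] := T_pts (solver_fst fH).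
- have lT := T_linear som up_fin z (solver_fst fH) (solver_fst gH).
  have ge : eqv H0 (z *: ((f, 0) : cfun2 R) + (g, 0)) (z *: f + g, 0).
    split => [y _|] //=; apply: aeW => y _; change (z * 0 + 0 = 0 :> R[i]).
    by rewrite mulr0 addr0.
  by have [+ _] := T_uniq (solver_fst (H10_linear z fH gH)) lT ge; exact.
- by exists kT => f fH; rewrite -(nrm_H0_fst up fH); exact: T_bound_fst (solver_fst fH).
Qed.

Lemma solver_snd_bounded : is_bounded_operator H10 (fun g => (S (0, g)).1).
Proof.
split => [f fH|z f g fH gH x Jx|].
- by have [[]] := T_pts (solver_snd fH).
- have lT := T_linear som up_fin z (solver_snd fH) (solver_snd gH).
  have ge : eqv H0 (z *: ((0, f) : cfun2 R) + (0, g)) (0, z *: f + g).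
    split => [y _|] /=; last by apply: aeW.
    by change (z * 0 + 0 = 0 :> R[i]); rewrite mulr0 addr0.
  by have [+ _] := T_uniq (solver_snd (H10_linear z fH gH)) lT ge; exact.
- exists (kT * kT) => f fH; apply: (le_trans (T_bound_fst (solver_snd fH))).
  rewrite -mulrA ler_wpM2l//; have [fL fE] := emb fH.
  apply: (le_trans (H0_nrm_le (H0_snd som up_fin fL))).
  by rewrite nrm_H10_0 add0r.
Qed.

End Solver.

(** The two operators are the first component of the inverse of [T],
    restricted to the two summands of [H_0]. *)
Lemma operators_exist : exists Omega Upsilon,
  is_Omega om c plus Omega /\ is_Upsilon up c plus Upsilon.
Proof.
have [S ST] := T_solver.
exists (fun g => (S (g, 0)).1), (fun g => (S (0, g)).1); split; split.
- exact: solver_fst_bounded.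
- by move=> g gc x Jx; apply: solution_kernel_fst => //; apply: solver_fst => //; case: gc.
- exact: solver_snd_bounded.
- by move=> g gH x Jx; apply: solution_kernel_snd => //; exact: solver_snd.
Qed.

(** Point evaluations are bounded, so density applies to each of them; this
    makes the kernel formula determine [Omega]. *)
Lemma bounded_operator_ext (A D : cfun R -> cfun R) : is_bounded_operator H10 A ->
  is_bounded_operator H10 D ->
  (forall g, H1c c plus g -> forall x, J x -> A g x = D g x) ->
  forall g, pts H10 g -> forall x, J x -> A g x = D g x.
Proof.
move=> [Apts Alin [kA kAE]] [Dpts Dlin [kD kDE]] AD g gH x Jx.
apply/eqP; rewrite -subr_eq0; apply/eqP.
apply: (@functional_vanishes R c plus (fun g => A g x - D g x) (6 * kA + 6 * kD)) => //.
- move=> u v uH vH; have := Alin 1 u v uH vH x Jx; have := Dlin 1 u v uH vH x Jx.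
  rewrite !scale1r => -> ->.
  by change (A u x + A v x - (D u x + D v x) = A u x - D u x + (A v x - D v x)); ring.
- move=> u uH; have [AH _] := Apts u uH; have [DH _] := Dpts u uH.
  apply: (le_trans (ler_normcB _ _)); rewrite mulrDl -!mulrA; apply: lerD.
    by apply: (le_trans (sup_bound AH Jx)); rewrite ler_wpM2l// kAE.
  by apply: (le_trans (sup_bound DH Jx)); rewrite ler_wpM2l// kDE.
- by move=> h hc; rewrite AD// subrr.
Qed.

Section Operators.
Variables Omega Upsilon : cfun R -> cfun R.
Hypotheses (isO : is_Omega om c plus Omega) (isU : is_Upsilon up c plus Upsilon).
Local Notation L := (quadratic_pencil Omega Upsilon).

(** Solving in [T] gives a bounded operator with the same kernel. *)
Lemma Omega_T g : pts H10 g -> T ((Omega g, g), (g, 0)).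
Proof.
move=> gH; have [bO kO] := isO; have [gL _] := emb gH; have [S ST] := T_solver.
have gT := solver_fst ST gH; have [_ tH] := T_pts gT.
have Oe : forall h, pts H10 h -> forall x, J x -> Omega h x = (S (h, 0)).1 x.
  apply: bounded_operator_ext bO (solver_fst_bounded ST) _ => h hc x Jx.
  have [hH _] := hc; by rewrite kO// (solution_kernel_fst (solver_fst ST hH) hc Jx).
have [bp _ _] := bO.
apply: (T_eqv gT) => //.
- by split => //; exact: bp.
- split => [x Jx|] /=; first by rewrite Oe.
  by have := T_snd gT.
- exact: eqv_refl.
Qed.

Lemma Upsilon_T g : pts H10 g -> T ((Upsilon g, 0), (0, g)).
Proof.
move=> gH; have [gL _] := emb gH; have [u uT] := T_onto (H0_snd som up_fin gL).
have [[bp _ _] kU] := isU; have [uH tH] := T_pts uT.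
apply: (T_eqv uT) => //.
- by split; [exact: bp|exact: L20].
- split => [x Jx|] /=; first by rewrite kU// (solution_kernel_snd uT Jx).
  by have := T_snd uT.
- exact: eqv_refl.
Qed.

Lemma pencil_pts z f : pts H10 f -> pts H10 (L z f).
Proof.
have [[bO _ _] _] := isO; have [[bU _ _] _] := isU => fH.
by apply: H10_sub; [apply: H10_sub => //|]; apply: H10_scaled; [exact: bO|exact: bU].
Qed.

Lemma T_scale z (f g : cfun2 R) : T (f, g) -> T (z *: f, z *: g).
Proof.
move=> fT; have fT0 := T_sub fT fT; rewrite !subrr in fT0.
by have := T_linear som up_fin z fT fT0; rewrite !addr0.
Qed.

Lemma T_add (f f' g g' : cfun2 R) : T (f, g) -> T (f', g') -> T (f + f', g + g').
Proof. by move=> fT fT'; have := T_linear som up_fin 1 fT fT'; rewrite !scale1r. Qed.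

(** In terms of [T], the pencil satisfies [T^-1 (z f, z ^ 2 f) = (f - L z f, z f)]. *)
Lemma pencil_T z f : pts H10 f ->
  T ((f - L z f, z *: f), (z *: f, z ^+ 2 *: f)).
Proof.
move=> fH; have := T_add (T_scale z (Omega_T fH)) (T_scale (z ^+ 2) (Upsilon_T fH)).
congr (T (_, _)); congr (_, _); apply/funext => x.
- change (z * Omega f x + z ^+ 2 * Upsilon f x = f x - (f x - z * Omega f x - z ^+ 2 * Upsilon f x)).
  by ring.
- by change (z * f x + z ^+ 2 * 0 = z * f x); ring.
- by change (z * f x + z ^+ 2 * 0 = z * f x); ring.
- by change (z * 0 + z ^+ 2 * f x = z ^+ 2 * f x); ring.
Qed.

(** [L z f = g] is the resolvent equation for [T] at [z] with solution
    [(f - g, z f)] and right-hand side [(z g, 0)]. *)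
Lemma pencil_eqP z f g : pts H10 f -> pts H10 g ->
  eqv H10 g (L z f) <-> T ((f - g, z *: f), (z *: f, z ^+ 2 *: f)).
Proof.
move=> fH gH; have fT := pencil_T z fH; have [fH' tH'] := T_pts fT.
have [fL _] := emb fH; split => [gL|gT].
- apply: (T_eqv fT) => //.
  + by split; [exact: H10_sub|case: fH'].
  + split => [x Jx|] /=; last by apply: aeW.
    by change (f x - L z f x = f x - g x); rewrite gL.
  + exact: eqv_refl.
- have [e _] := T_uniq gT fT (eqv_refl _); move=> x Jx.
  have := e x Jx => /= e1; have : f x - g x = f x - L z f x := e1.
  by move=> /(congr1 (fun w => f x - w)); rewrite !subKr.
Qed.

Lemma rel_shiftE z (h f : cfun2 R) :
  rel_inv (rel_shift T z) (h, f) <-> T (f, h + z *: f).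
Proof.
split => [[f0 [g [gT [-> ->]]]]|fT]; first by rewrite subrK.
by exists f, (h + z *: f); split => //; rewrite addrK.
Qed.

Lemma nrm_add_le f g : pts H10 f -> pts H10 g -> nrm H10 (f + g) <= nrm H10 f + nrm H10 g.
Proof. by move=> [fH _] [gH _]; exact: H10_triangle. Qed.

(** Solve the resolvent equation of [T] with right-hand side [(z g, 0)]; the
    solution is [(f - g, z f)] with [L z f = g]. *)
Lemma resolvent_pencil z : resolvent_set H0 T z -> pencil_resolvent_set H10 L z.
Proof.
move=> [onto uniq [k bound]].
(* The resolvent equation solved by [(f - g, z f)]. *)
have solve f g : op_graph H10 (L z) (f, g) ->
    rel_inv (rel_shift T z) ((z *: g, 0), (f - g, z *: f)).
  move=> [/= fH gH fg]; apply/rel_shiftE; have := (pencil_eqP z fH gH).1 fg.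
  congr (T (_, _)); congr (_, _); apply/funext => x.
  - by change (z * f x = z * g x + z * (f x - g x)); ring.
  - by change (z ^+ 2 * f x = 0 + z * (z * f x)); ring.
split.
- move=> g gH; have gH' : pts H0 (z *: g, 0) by apply: H0_fst; exact: H10_scaled.
  have [u /rel_shiftE uT] := onto _ gH'; have [uH tH] := T_pts uT.
  have fH : pts H10 (g + u.1) by apply: H10_add => //; case: uH.
  have [fL _] := emb fH; exists (g + u.1).
  have mz : L2 up J (z *: (g + u.1)) by exact: L2Z.
  have m2 : L2 up J (z ^+ 2 *: (g + u.1)) by exact: L2Z.
  split => //=; apply/(pencil_eqP z fH gH); apply: (T_eqv uT).
  + by split => //=; apply: H10_sub.
  + by split => //=; exact: H10_scaled.
  + split => [x Jx|] /=; first by change (u.1 x = g x + u.1 x - g x); ring.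
    apply: filterS (T_snd uT) => x e /e -> /=.
    by change (z * g x + z * u.1 x = z * (g x + u.1 x)); ring.
  + split => [x Jx|] /=; first by change (z * g x + z * u.1 x = z * (g x + u.1 x)); ring.
    apply: filterS (T_snd uT) => x e /e /= ux.
    change (0 + z * u.2 x = z ^+ 2 * (g x + u.1 x)); rewrite ux.
    by change (0 + z * (z * g x + z * u.1 x) = z ^+ 2 * (g x + u.1 x)); ring.
- move=> g f1 f2 H1_ H2_ x Jx.
  have [e _] := uniq _ _ _ (solve _ _ H1_) (solve _ _ H2_).
  have e1 : f1 x - g x = f2 x - g x := e x Jx.
  exact: addIr e1.
- exists (k * normc z + 1) => g f fg; have [/= fH gH _] := fg.
  have := bound _ _ (solve _ _ fg); rewrite (nrm_H0_fst up (H10_scaled z gH)).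
  have [gH1 _] := gH; rewrite (H10_scale z gH1) => b.
  have fzH : pts H0 (f - g, z *: f).
    by have [] := T_pts ((rel_shiftE _ _ _).1 (solve _ _ fg)).
  have l := le_trans (le_nrm_H0_l fzH) b.
  have := nrm_add_le (H10_sub fH gH) gH; rewrite subrK => /le_trans; apply.
  by rewrite mulrDl mul1r lerD2r -mulrA.
Qed.

(** Eliminate the second component. If [f] solves the resolvent equation with
    right-hand side [h], then [f.2 = h.1 + z f.1], and [L z f.1] is the first
    component of the inverse of [T] at [(h.1, h.2 + z h.1)]. *)
Lemma pencil_resolvent z : pencil_resolvent_set H10 L z -> resolvent_set H0 T z.
Proof.
move=> [onto uniq [k0 bound0]]; pose k := `|k0|; have k_ge0 : 0 <= k by exact: normr_ge0.
have bound f : pts H10 f -> nrm H10 f <= k * nrm H10 (L z f).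
  move=> fH; have := bound0 (L z f) f; rewrite /rel_inv /op_graph /=.
  move=> /(_ (And3 fH (pencil_pts z fH) (fun x Jx => erefl))) /le_trans; apply.
  by rewrite ler_wpM2r ?nrm_ge0// ler_norm.
(* The estimate also gives uniqueness, by linearity. *)
pose C := k * (kT * (1 + (1 + normc z * kT))).
have C_ge0 : 0 <= C by rewrite !mulr_ge0// !addr_ge0// mulr_ge0// normc_ge0.
have bT (f h : cfun2 R) : pts H0 h -> T (f, h + z *: f) ->
    nrm H0 f <= (C + (kT + normc z * kT * C)) * nrm H0 h.
  move=> hH fT; have [fH _] := T_pts fT; have [fH1 fL2] := fH; have [hH1 hL2] := hH.
  have ae := T_snd fT; have [hL hE] := emb hH1; have [f1L f1E] := emb fH1.
  have LH := pencil_pts z fH1.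
  have h0 := H0_nrm_ge0 up c plus h.
  have e1 : nrm H10 h.1 <= nrm H0 h by exact: le_nrm_H0_l.
  have e2 : nrm2 h.2 <= nrm H0 h by exact: le_nrm_H0_r.
  have vH : pts H0 (h.1, h.2 + z *: h.1).
    by split => //=; apply: L2D => //; exact: L2Z.
  (* Subtracting the identity for the pencil leaves only the data [h]. *)
  have vT : T ((L z f.1, h.1), (h.1, h.2 + z *: h.1)).
    apply: (T_eqv (T_sub fT (pencil_T z fH1))) => //.
    - split => [x Jx|] /=.
        change (f.1 x - (f.1 x - L z f.1 x) = L z f.1 x); ring.
      apply: filterS ae => x e /e fx; change (f.2 x - z * f.1 x = h.1 x); rewrite fx.
      by change (h.1 x + z * f.1 x - z * f.1 x = h.1 x); ring.
    - split => [x Jx|] /=.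
        change (h.1 x + z * f.1 x - z * f.1 x = h.1 x); ring.
      apply: filterS ae => x e /e fx.
      change (h.2 x + z * f.2 x - z ^+ 2 * f.1 x = h.2 x + z * h.1 x); rewrite fx.
      by change (h.2 x + z * (h.1 x + z * f.1 x) - z ^+ 2 * f.1 x = h.2 x + z * h.1 x); ring.
  have vb : nrm H0 (h.1, h.2 + z *: h.1) <= (1 + (1 + normc z * kT)) * nrm H0 h.
    apply: (le_trans (H0_nrm_le vH)); rewrite [leRHS]mulrDl mul1r; apply: (lerD e1).
    apply: (le_trans (nrm2_triangle hL2 (L2Z z mJ hL))).
    rewrite [leRHS]mulrDl mul1r; apply: (lerD e2).
    rewrite (nrm2_scale z hL) -mulrA ler_wpM2l ?normc_ge0//.
    by apply: (le_trans hE); rewrite ler_wpM2l.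
  have b1 : nrm H10 f.1 <= C * nrm H0 h.
    apply: (le_trans (bound _ fH1)); rewrite /C -!mulrA ler_wpM2l//.
    by apply: (le_trans (T_bound_fst vT)); rewrite ler_wpM2l.
  have b2 : nrm2 f.2 <= (kT + normc z * kT * C) * nrm H0 h.
    have wL : L2 up J (h.1 + z *: f.1) by apply: L2D => //; exact: L2Z.
    have ae' : {ae up, forall x, J x -> f.2 x = (h.1 + z *: f.1) x}.
      by apply: filterS ae => x e Jx; exact: e.
    rewrite (nrm2_ae fL2 wL ae'); apply: (le_trans (nrm2_triangle hL (L2Z z mJ f1L))).
    rewrite (nrm2_scale z f1L) mulrDl lerD//.
      by apply: (le_trans hE); rewrite ler_wpM2l.
    rewrite -!mulrA ler_wpM2l ?normc_ge0//; apply: (le_trans f1E).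
    by apply: (ler_wpM2l kT_ge0); apply: (le_trans b1); rewrite /C -!mulrA.
  by apply: (le_trans (H0_nrm_le fH)); rewrite mulrDl lerD.
split.
- move=> h hH; have [hH1 hL2] := hH; have [hL _] := emb hH1.
  have vH : pts H0 (h.1, h.2 + z *: h.1).
    by split => //=; apply: L2D => //; exact: L2Z.
  have [b bT_] := T_onto vH; have [bH _] := T_pts bT_; have [bH1 bL2] := bH.
  have [f [/= fH _ bf]] := onto _ bH1; have [fL _] := emb fH.
  have gT := T_add ((pencil_eqP z fH bH1).1 bf) bT_.
  exists (f, h.1 + z *: f); apply/rel_shiftE; apply: (T_eqv gT).
  + by split => //=; apply: L2D => //; exact: L2Z.
  + split => /=; first by apply: H10_add => //; exact: H10_scaled.
    by apply: L2D => //; apply: L2Z => //; apply: L2D => //; exact: L2Z.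
  + split => [x Jx|] /=; first by change (f x - b.1 x + b.1 x = f x); ring.
    apply: filterS (T_snd bT_) => x e /e bx.
    by change (z * f x + b.2 x = h.1 x + z * f x); rewrite bx /=; ring.
  + split => [x Jx|] /=; first by change (z * f x + h.1 x = h.1 x + z * f x); ring.
    apply: aeW => x _.
    by change (z ^+ 2 * f x + (h.2 x + z * h.1 x) = h.2 x + z * (h.1 x + z * f x)); ring.
- move=> h f1 f2 /rel_shiftE T1 /rel_shiftE T2; apply: eqv_sub.
  have dT := T_sub T1 T2; rewrite opprD addrACA subrr -scalerBr in dT.
  have [dH _] := T_pts dT; apply: (H0_nrm_eq0 dH).
  have z0 : pts H0 0 by split; [exact: H10_z|exact: L20].
  by have := bT _ _ z0 dT; rewrite nrm_H0_0 mulr0.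
- exists (C + (kT + normc z * kT * C)) => h f /rel_shiftE fT; apply: (bT f h _ fT).
  have [fH tH] := T_pts fT; have := H0_linear (- z) fH tH.
  by rewrite scaleNr addrC addrK.
Qed.

Theorem pencil_spectrum_eq : pencil_spectrum H10 L = spectrum H0 T.
Proof.
rewrite /pencil_spectrum /spectrum; congr (~` _); apply/seteqP; split => z.
  exact: pencil_resolvent.
exact: resolvent_pencil.
Qed.

End Operators.
End Pencil.

(** * The Green function of the pencil *)

Section GreenFormula.
Context {R : realType}.
Local Notation B := (measurableTypeR R).
Variables (om : set B -> R) (up : {measure set B -> \bar R}).
Hypotheses (som : is_signed_measure om) (up_fin : locally_finite up).
Local Notation mu4 := (mu4 up som).
Let mf := mu4_fin som up_fin.
Variables (c : R) (plus : bool).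
Local Notation J := (half_line c plus).
Local Notation H10 := (H10_space c plus).
Local Notation H0 := (H0_space up c plus).
Local Notation T := (T_half om up c plus).
Implicit Types (f g h k : cfun R) (z : R[i]).

Hypothesis T_onto : forall g : cfun2 R, pts H0 g -> exists f : cfun2 R, T (f, g).
Variable kT : R.
Hypothesis kT_ge0 : 0 <= kT.
Hypothesis T_bound : forall f g : cfun2 R, T (f, g) -> nrm H0 f <= kT * nrm H0 g.
Variables Omega Upsilon : cfun R -> cfun R.
Hypotheses (isO : is_Omega om c plus Omega) (isU : is_Upsilon up c plus Upsilon).
Local Notation L := (quadratic_pencil Omega Upsilon).

Lemma pencil_bounded z : is_bounded_operator H10 (L z).
Proof.
have [[bO lO [kO kOE]] _] := isO; have [[bU lU [kU kUE]] _] := isU.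
split; first by move=> f fH; exact: (pencil_pts som up_fin isO isU).
  move=> a f g fH gH x Jx; have := lO a f g fH gH x Jx; have := lU a f g fH gH x Jx.
  change (Upsilon (a *: f + g) x = a * Upsilon f x + Upsilon g x ->
    Omega (a *: f + g) x = a * Omega f x + Omega g x ->
    (a * f x + g x) - z * Omega (a *: f + g) x - z ^+ 2 * Upsilon (a *: f + g) x =
    a * (f x - z * Omega f x - z ^+ 2 * Upsilon f x) + (g x - z * Omega g x - z ^+ 2 * Upsilon g x)).
  by move=> -> ->; ring.
exists (1 + normc (- z) * kO + normc (- z ^+ 2) * kU) => f fH.
have oH := H10_scaled som up_fin (- z) (bO f fH).
have uH := H10_scaled som up_fin (- z ^+ 2) (bU f fH).
have -> : L z f = f + (- z) *: Omega f + (- z ^+ 2) *: Upsilon f.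
  by rewrite /quadratic_pencil !scaleNr.
apply: (le_trans (nrm_add_le (H10_add fH oH) uH)); rewrite !mulrDl mul1r; apply: lerD.
  apply: (le_trans (nrm_add_le fH oH)); rewrite lerD2l.
  by have [oH1 _] := bO f fH; rewrite (H10_scale _ oH1) -mulrA ler_wpM2l ?normc_ge0// kOE.
by have [uH1 _] := bU f fH; rewrite (H10_scale _ uH1) -mulrA ler_wpM2l ?normc_ge0// kUE.
Qed.

Variables (z : R[i]) (psi psi' phi phi' : R -> R[i]).
Hypothesis fp : is_fundamental_pair om up c plus z psi psi' phi phi'.
Variable x : R.
Hypothesis Jx : J x.
Local Notation G := (gr plus psi psi' phi phi' x).

Let psiq : qeq mu4 setT (coef z) (fun=> psi) psi psi'.
Proof. by case: fp => /(solution_qeq som up_fin). Qed.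

Let phiq : qeq mu4 setT (coef z) (fun=> phi) phi phi'.
Proof. by case: fp => _ /(solution_qeq som up_fin). Qed.

Let psiH : H1_near_infty plus psi. Proof. by case: fp. Qed.
Let phic : phi c = 0. Proof. by case: fp. Qed.

Let W0 : wronskian psi psi' phi phi' x != 0.
Proof. by apply: (wronskian_neq0 mf _ psiq phiq); case: fp. Qed.

(** Testing [T] against [G] identifies the two weak terms of [gr_reproducing]
    as scalar products of [Omega h] and [Upsilon h] with [G]. *)
Lemma pencil_green_H1c h : H1c c plus h -> H1_dot J (L z h) (fun s => (G s)^*)%R = h x.
Proof.
move=> hc; have [hH _] := hc; have [hH1 _] := hH.
have GH := gr_H10 up_fin psiq phiq psiH phic Jx.
have [GJH _] := grJ_H10 up_fin psiq phiq psiH phic Jx.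
have [[bO _ _] _] := isO; have [[bU _ _] _] := isU.
have [oH _] := bO h hH; have [uH _] := bU h hH.
have rep := gr_reproducing up_fin psiq phiq W0 psiH phic Jx hc.
have Ot := Omega_T som up_fin T_onto kT_ge0 T_bound isO hH.
have Ut := Upsilon_T som up_fin T_onto kT_ge0 T_bound isU hH.
have eO := T_pairing_H10 som up_fin T_onto kT_ge0 T_bound Ot hc GH.
have eU := T_pairing_H10 som up_fin T_onto kT_ge0 T_bound Ut (H1c0 som up_fin c plus) GH.
have sO : source om up c plus (h, 0) G = signed_integral om J (fun s => G s * h s).
  rewrite /source (eq_signed som (g := fun s => G s * h s)); last by move=> s _; rewrite /= mulrC.
  rewrite (_ : cintegral up J _ = 0) ?addr0// -(cint0 up J).
  by apply: eq_cint => s _; exact: mul0r.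
have sU : source om up c plus (0, h) G = cintegral up J (fun s => G s * h s).
  rewrite /source (eq_signed som (g := fun=> 0)); last by move=> s _; exact: mul0r.
  rewrite /signed_integral; have z1 := cint0 (upvar som) J; have z2 := cint0 (upvar (signed_measureN som)) J.
  rewrite [X in X - _ + _](z1 : _) [X in _ - X + _](z2 : _) subrr add0r.
  by apply: eq_cint => s _; exact: mulrC.
have -> : L z h = (fun t => - z * Omega h t + (- z ^+ 2 * Upsilon h t + h t)).
  apply/funext => t; change (h t - z * Omega h t - z ^+ 2 * Upsilon h t =
    - z * Omega h t + (- z ^+ 2 * Upsilon h t + h t)); by ring.
rewrite (H1_dot_linear (- z) oH (H1_linear (- z ^+ 2) uH hH1) GJH).
rewrite (H1_dot_linear (- z ^+ 2) uH hH1 GJH) rep.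
move: eO eU; rewrite /= sO sU => -> ->.
by move: (signed_integral _ _ _) (cintegral _ _ _) => A1 A2; ring.
Qed.

Lemma pencil_green f : pts H10 f -> H1_dot J (L z f) (fun s => (G s)^*)%R = f x.
Proof.
move=> fH; have [GJH _] := grJ_H10 up_fin psiq phiq psiH phic Jx.
have [Lp Ll [k kE]] := pencil_bounded z.
apply/eqP; rewrite -subr_eq0; apply/eqP.
pose N := nrm H10 (fun s => (G s)^*)%R.
apply: (@functional_vanishes R c plus (fun f => H1_dot J (L z f) (fun s => (G s)^*)%R - f x)
  (k * N + 6)) => //.
- move=> u v uH vH; have [uL _] := Lp u uH; have [vL _] := Lp v vH.
  have [uvL _] := Lp _ (H10_add uH vH).
  rewrite (H1_dot_eqv uvL (H1_linear 1 uL vL) GJH GJH _ (fun _ _ => erefl)).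
    rewrite (H1_dot_linear 1 uL vL GJH) mul1r.
    by change (H1_dot J (L z u) (fun s => (G s)^*)%R + H1_dot J (L z v) (fun s => (G s)^*)%R - (u x + v x) =
      (H1_dot J (L z u) (fun s => (G s)^*)%R - u x) + (H1_dot J (L z v) (fun s => (G s)^*)%R - v x));
      move: (H1_dot _ _ _) (H1_dot _ _ _) => A1 A2; ring.
  by move=> y Jy; have := Ll 1 u v uH vH y Jy; rewrite scale1r.
- move=> u uH; have [uL _] := Lp u uH; have [u1 _] := uH.
  apply: (le_trans (ler_normcB _ _)); rewrite mulrDl; apply: lerD.
    apply: (le_trans (H1_CS uL GJH)); rewrite mulrAC ler_wpM2r ?nrm_ge0//.
    exact: kE.
  exact: sup_bound.
- by move=> h hc; rewrite pencil_green_H1c// subrr.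
Qed.

Lemma green_formula x0 (g f : cfun R) :
  let G := green plus (wronskian psi psi' phi phi' x0) psi phi in
  H1 J (fun s => ((G x s)^*)%R) /\
  (rel_inv (op_graph H10 (L z)) (g, f) -> f x = H1_dot J g (fun s => ((G x s)^*)%R)).
Proof.
rewrite /=; have -> : (fun s => ((green plus (wronskian psi psi' phi phi' x0) psi phi x s)^*)%R) =
    (fun s => ((G s)^*)%R).
  by apply/funext => s; rewrite (green_gr up_fin plus x psiq phiq).
have [GJH _] := grJ_H10 up_fin psiq phiq psiH phic Jx.
split => // -[/= fH [gH _] gf]; rewrite -(pencil_green fH).
have [LH _] := pencil_pts som up_fin isO isU z fH.
by apply: H1_dot_eqv => // y Jy; rewrite gf.
Qed.

End GreenFormula.


(** * Existence of a fundamental pair *)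

(** Only the products of coefficients and right-hand sides enter the equation;
    this passes between [coef z] and [coef_rel]. *)
Lemma qeq_rescale (R : realType) (I : finType) (mu : I -> {measure set (measurableTypeR R) -> \bar R})
  (E : set R) (a b : I -> R[i]) (w v : I -> R -> R[i]) (F F' : R -> R[i]) :
  is_interval E -> (forall i s, E s -> a i * w i s = b i * v i s) ->
  (forall i x y, E x -> E y -> cintegrable (mu i) `[x, y[ (v i)) ->
  qeq mu E a w F F' -> qeq mu E b v F F'.
Proof.
move=> iE ab vI [Fp wI FE]; split => // x y Ex Ey xy; rewrite FE//.
apply: eq_bigr => i _; have mco : measurable (`[x, y[ : set (measurableTypeR R)) by exact: measurable_itv.
rewrite -(cintZ _ mco (wI i x y Ex Ey)) -(cintZ _ mco (vI i x y Ex Ey)).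
apply: eq_cint => s; rewrite /= in_itv /= => /andP[xs /ltW sy]; apply: ab.
by apply: iE Ex Ey _ _; rewrite xs sy.
Qed.

Section FundamentalPair.
Context {R : realType}.
Local Notation B := (measurableTypeR R).
Local Notation leb := (@lebesgue_measure R).
Variables (om : set B -> R) (up : {measure set B -> \bar R}).
Hypotheses (som : is_signed_measure om) (up_fin : locally_finite up).
Local Notation mu4 := (mu4 up som).
Let mf := mu4_fin som up_fin.
Variables (c : R) (plus : bool).
Local Notation J := (half_line c plus).
Local Notation H10 := (H10_space c plus).
Local Notation T := (T_half om up c plus).
Implicit Types (f g h k : cfun R) (z : R[i]).

Let mJ := half_line_measurable c plus.
Let iJ := @half_line_interval R c plus.
Variable z : R[i].

(** A solution that vanishes on a segment has slope zero there, so it vanishes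
    identically by uniqueness. *)
Lemma solution_inner_neq0 phi phi' : qeq mu4 setT (coef z) (fun=> phi) phi phi' ->
  phi' c = 1 -> exists x, inner_half_line c plus x /\ phi x != 0.
Proof.
move=> phiq phic1; apply: contrapT => nex.
have phi0 x : inner_half_line c plus x -> phi x = 0.
  by move=> Jx; apply/eqP/negPn/negP => n0; apply: nex; exists x.
have [p [q [pq pqJ]]] : exists p q : R, p < q /\ `[p, q] `<=` inner_half_line c plus.
  rewrite /inner_half_line; case: plus.
    by exists (c + 1), (c + 2); split=> [|s]; rewrite ?ltrD2l ?ltr1n//= !in_itv /= andbT; lra.
  by exists (c - 2), (c - 1); split=> [|s]; rewrite /= ?in_itv /=; lra.
have pqq := qeqS (@subsetT _ `[p, q]) phiq; have [pp _ pE] := pqq.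
have ipq : is_interval (`[p, q] : set R) by exact: interval_is_interval.
have pin : `[p, q]%classic p by rewrite /= in_itv /= lexx ltW.
have qin : `[p, q]%classic q by rewrite /= in_itv /= lexx ltW.
have cst s : `[p, q]%classic s -> phi' s = phi' p.
  move=> sin; have ps : p <= s by move: sin; rewrite /= in_itv /= => /andP[].
  apply/eqP; rewrite -subr_eq0 (pE p s)//; apply/eqP.
  rewrite (@eq_wint _ _ mu4 (coef z) _ (fun=> (fun=> 0)) `[p, s[%classic) ?wint0// => i t.
  rewrite /= in_itv /= => /andP[pt /ltW ts]; apply: phi0; apply: pqJ.
  by move: sin; rewrite /= !in_itv /= pt => /andP[_ /(le_trans ts)].
have [_ aff] := @primitive_affine R `[p, q]%classic (phi' p) 0 ipq.
have [_ pe] := pp.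
have e0 : phi q - phi p = (phi' p * q%:C + 0) - (phi' p * p%:C + 0).
  rewrite pe ?(ltW pq)// aff ?(ltW pq)//; apply: eq_cint => s; exact: cst.
rewrite !phi0 ?subrr ?addr0 -?mulrBr -?rmorphB in e0; try exact: pqJ.
have p0 : phi' p = 0.
  apply/eqP; move/eqP: e0; rewrite eq_sym mulf_eq0 => /orP[//|/eqP/(congr1 (@complex.Re R)) /=].
  by move: pq => /[swap] /eqP; rewrite subr_eq0 => /eqP ->; rewrite ltxx.
have [_ c0] := qeq_unique mf (@is_intervalT R) Logic.I phiq (phi0 p (pqJ p pin)) p0 (x := c) Logic.I.
by move/eqP: phic1; rewrite c0 eq_sym oner_eq0.
Qed.

(** The global solution of the same initial value problem agrees with it by
    uniqueness. *)
Lemma solution_extends (E : set R) F F' x : is_interval E -> E x ->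
  qeq mu4 E (coef z) (fun=> F) F F' ->
  exists G G', qeq mu4 setT (coef z) (fun=> G) G G' /\ forall s, E s -> F s = G s.
Proof.
move=> iE Ex Fq; have [G [G' [Gq Gx G'x]]] := ivp_exists mf (coef z) (F x) (F' x) x.
exists G, G'; split => // s Es.
have dq := homogeneous_linear (-1) iE (qeqS (@subsetT _ E) Gq) Fq.
have [] := qeq_unique mf iE Ex dq _ _ Es; rewrite ?Gx ?G'x; try by ring.
by rewrite mulN1r addrC => e _; apply/eqP; rewrite -subr_eq0; apply/eqP.
Qed.

(** Adding the free equation of [k] to the equation of [f - k] removes the
    source. *)
Lemma resolvent_qeq (E : set R) f k k' : is_interval E -> E `<=` J -> pts H10 f ->
  T ((f - k, z *: f), (z *: f, z ^+ 2 *: f)) ->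
  qeq mu4 E (coef 0) (fun=> k) k k' ->
  exists F', qeq mu4 E (coef z) (fun=> f) f F'.
Proof.
move=> iE EJ [fH _] fT kq; have [u' uq0] := T_qeq som up_fin fT.
have uq := qeqS EJ uq0; have [_ kI _] := kq.
have fp := primitiveS EJ (H1J_primitive fH).
have kq4 : qeq mu4 E coef_rel (vec4 k (fun=> 0) (fun=> 0) (fun=> 0)) k k'.
  apply: qeq_rescale kq => //.
    by move=> -[[|[|[|n]]] ni] s _; rewrite /coef /coef_rel /vec4 //= ?expr0n /= ?oppr0 ?mul0r ?mulr0.
  move=> i x y Ex Ey; have := kI i x y Ex Ey.
  by case: i => -[|[|[|n]]] ni; rewrite /vec4 /= => // _; exact: cintegrable0.
have := qeq_linear 1 iE kq4 uq; set w := fun i s => _; rewrite /= => sq.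
exists (fun s => 1 * k' s + u' s).
have -> : f = (fun s => 1 * k s + (f - k) s).
  by apply/funext => s; change (f s = 1 * k s + (f s - k s)); ring.
apply: qeq_rescale sq => //.
  move=> [[|[|[|n]]] ni] s _; rewrite /w /coef /coef_rel /vec4 /=.
  - by [].
  - by change (-1 * (1 * 0 + z * f s) = - z * (1 * k s + (f s - k s))); ring.
  - by change (1 * (1 * 0 + z * f s) = z * (1 * k s + (f s - k s))); ring.
  - by change (-1 * (1 * 0 + z ^+ 2 * f s) = - z ^+ 2 * (1 * k s + (f s - k s))); ring.
move=> i x y Ex Ey.
have -> : (fun s => 1 * k s + (f - k) s) = f.
  by apply/funext => s; change (1 * k s + (f s - k s) = f s); ring.
apply: (primitive_cintegrable mf); apply: (primitiveS _ fp).
by move=> s; rewrite /= in_itv /= => sxy; exact: iE Ex Ey _ sxy.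
Qed.

(** Subtracting instead recovers the free equation for [k]. *)
Lemma resolvent_qeq_source f f' k : pts H10 f -> pts H10 k ->
  T ((f - k, z *: f), (z *: f, z ^+ 2 *: f)) ->
  qeq mu4 J (coef z) (fun=> f) f f' ->
  exists k', qeq mu4 J (coef 0) (fun=> k) k k'.
Proof.
move=> [fH _] [kH _] fT fq; have [u' uq] := T_qeq som up_fin fT.
have mco x y : measurable (`[x, y[ : set B) by exact: measurable_itv.
have I g i x y : H1 J g -> J x -> J y -> cintegrable (mu4 i) `[x, y[ g.
  move=> gH Jx Jy; apply: (primitive_cintegrable mf); apply: (primitiveS _ (H1J_primitive gH)).
  by move=> s; rewrite /= in_itv /= => sxy; exact: iJ Jx Jy _ sxy.
have fq4 : qeq mu4 J coef_rel (vec4 f (z *: f) (z *: f) (z ^+ 2 *: f)) f f'.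
  apply: qeq_rescale fq => //.
    move=> [[|[|[|[|n]]]] ni] s _; rewrite /coef /coef_rel /vec4 //=.
    - by change (- z * f s = -1 * (z * f s)); ring.
    - by change (z * f s = 1 * (z * f s)); ring.
    - by change (- z ^+ 2 * f s = -1 * (z ^+ 2 * f s)); ring.
  move=> i x y Jx Jy; have If j := I f j x y fH Jx Jy.
  by case: i => -[|[|[|n]]] ni; [exact: If|..]; exact: (cintegrableZ _ (mco x y) (If (Ordinal ni))).
have := qeq_linear (-1) iJ uq fq4; set w := fun i s => _; rewrite /= => sq.
exists (fun s => -1 * u' s + f' s).
have -> : k = (fun s => -1 * (f - k) s + f s).
  by apply/funext => s; change (k s = -1 * (f s - k s) + f s); ring.
apply: qeq_rescale sq => //.
  move=> [[|[|[|n]]] ni] s _; rewrite /w /coef /coef_rel /vec4 /= ?expr0n /= ?oppr0.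
  - by [].
  - by change (-1 * (-1 * (z * f s) + z * f s) = 0 * (-1 * (f s - k s) + f s)); ring.
  - by change (1 * (-1 * (z * f s) + z * f s) = 0 * (-1 * (f s - k s) + f s)); ring.
  - by change (-1 * (-1 * (z ^+ 2 * f s) + z ^+ 2 * f s) = 0 * (-1 * (f s - k s) + f s)); ring.
move=> i x y Jx Jy.
have -> : (fun s => -1 * (f - k) s + f s) = k.
  by apply/funext => s; change (-1 * (f s - k s) + f s = k s); ring.
exact: I.
Qed.

(** Otherwise the weak form would make the scalar product of [h] with the
    kernel vanish for all compactly supported [h]. It equals [h x], so by
    density the kernel itself would vanish at [x]. *)
Lemma free_green_not_qeq x k' : inner_half_line c plus x ->
  ~ qeq mu4 J (coef 0) (fun=> (fun s => (free_green c plus x s)%:C)) (fun s => (free_green c plus x s)%:C) k'.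
Proof.
move=> ix kq; have Jx := inner_sub ix; pose K : cfun R := fun s => (free_green c plus x s)%:C.
have KH : pts H10 K := free_green_H10 som up_fin Jx; have [KH1 _] := KH.
have [Kp _ _] := kq; have sJ := @half_sigma R c plus; have [_ mk'] := primitive_cmeasurable sJ Kp.
have KJ : (fun s => (K s)^*)%R = K by apply/funext => s; exact: real_conj.
have KpJ : primitive J K (fun s => (k' s)^*)%R by have := primitiveJ iJ Kp; rewrite [X in primitive _ X _]KJ.
have Kx : K x = 0.
  apply: (@functional_vanishes R c plus (fun f => f x) 6) => //.
    by move=> f [fH _]; exact: sup_bound.
  move=> h hc; have [hH _] := hc; have [hH1 _] := hH.
  rewrite -(free_green_reproducing som up_fin Jx hH).
  have hp := H1c_primitive hc; have [_ mh'] := primitive_cmeasurable sJ hp.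
  rewrite (half_dotE hH1 KH1 hp KpJ mh' (cmeasurableJ mk')).
  have := qeq_pairing up_fin kq mk' hc; rewrite wint_coef mul0r subr0 expr0n /= mul0r subr0 addrC.
  have e1 : cintegral leb J (fun s => h s * (K s)^*)%R = cintegral leb J (fun s => K s * h s).
    by apply: eq_cint => s _; rewrite [LHS]mulrC; congr (_ * _); exact: real_conj.
  have e2 : cintegral leb J (fun s => cderiv h s * ((k' s)^*)^*)%R = cintegral leb J (fun s => k' s * cderiv h s).
    by apply: eq_cint => s _; rewrite mulrC; congr (_ * _); exact: conjCK.
  by rewrite e1 e2.
have := free_green_self_neq0 ix; move: Kx => /(congr1 (@complex.Re R)) /= ->.
by rewrite eqxx.
Qed.

Lemma eq_homogeneous (a : 'I_4 -> R[i]) (E : set R) F G F' : is_interval E ->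
  (forall s, E s -> F s = G s) ->
  qeq mu4 E a (fun=> F) F F' -> qeq mu4 E a (fun=> G) G F'.
Proof.
move=> iE FG Fq; have [p wI e] : qeq mu4 E a (fun=> G) F F'.
  by apply: eq_qeq Fq => // _; exact: FG.
by split => //; exact: eq_primitive FG p.
Qed.

Lemma homogeneous_scale (a : 'I_4 -> R[i]) (E : set R) w F F' : is_interval E ->
  qeq mu4 E a (fun=> F) F F' ->
  qeq mu4 E a (fun=> (fun s => w * F s)) (fun s => w * F s) (fun s => w * F' s + (-1 * F' s + F' s)).
Proof.
move=> iE Fq; have := homogeneous_linear w iE Fq (homogeneous_linear (-1) iE Fq Fq).
by apply: eq_homogeneous => // s _; ring.
Qed.

Lemma half_interval b x (E : set R) : is_interval E ->
  is_interval (E `&` (if b then `]-oo, x] else `[x, +oo[)).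
Proof.
move=> iE u v [Eu Au] [Ev Av] w uwv; split; first exact: iE Eu Ev _ uwv.
by move: Au Av; case: b; rewrite /= !in_itv /= ?andbT; move: uwv => /andP[]; lra.
Qed.

(** On each side of the pole it is a multiple of [psi0] or of [phi0]. *)
Lemma free_green_side b x : J x -> exists k',
  qeq mu4 (J `&` (if b then `]-oo, x] else `[x, +oo[)) (coef 0)
    (fun=> (fun s => (free_green c plus x s)%:C)) (fun s => (free_green c plus x s)%:C) k'.
Proof.
move=> Jx; have psq := @psi0_qeq R om up som up_fin c plus.
have phq := @phi0_qeq R om up som up_fin c.
pose psi t : R[i] := (psi0 c plus t)%:C; pose psi' t : R[i] := (psi0' c plus t)%:C.
pose phi t : R[i] := (phi0 c t)%:C; pose phi' t : R[i] := (phi0' c t)%:C.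
have KE s : (free_green c plus x s)%:C = gr plus psi psi' phi phi' x s by exact: (free_greenE som up_fin).
pose l := if plus then phi else psi; pose l' := if plus then phi' else psi'.
pose r := if plus then psi else phi; pose r' := if plus then psi' else phi'.
have lq : qeq mu4 setT (coef 0) (fun=> l) l l' by rewrite /l /l'; case: plus.
have rq : qeq mu4 setT (coef 0) (fun=> r) r r' by rewrite /r /r'; case: plus.
pose W := wronskian r r' l l' x.
have iE := @half_interval b x J iJ; set E := J `&` _ in iE *.
have [F [F' [w [Fq KF]]]] : exists F F' w, qeq mu4 setT (coef 0) (fun=> F) F F' /\
    forall s, E s -> w * F s = (free_green c plus x s)%:C.
  rewrite /E; case: b {E iE}; [exists l, l', (W^-1 * r x)|exists r, r', (W^-1 * l x)]; split => // s [_].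
    by rewrite /= in_itv /= KE /gr /lr_green => ->.
  rewrite /= in_itv /= andbT KE /gr /lr_green => xs.
  by have [sx|//] := leP s x; have -> : s = x by [lra|]; rewrite /W /l /r; ring.
eexists; apply: eq_homogeneous KF (homogeneous_scale w iE (qeqS (@subsetT _ E) Fq)) => //.
Qed.

Lemma vanishing_limit nu nu' f x : qeq mu4 setT (coef z) (fun=> nu) nu nu' ->
  x < c -> (forall s, x <= s -> s < c -> f s = nu s) ->
  normc (f t) @[t --> c^'-] --> (0 : R) -> nu c = 0.
Proof.
move=> [nup _ _] xc fnu f0; have iT := @is_intervalT R.
have := @primitive_left_cvg _ _ _ c (primitive_linear 1 iT nup (primitive_cst setT (- nu c))).
rewrite mul1r subrr => /(_ erefl) n0.
apply: normc0_eq0; apply/eqP; rewrite eq_le normc_ge0 andbT.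
apply/ler_addgt0Pr => e e0; rewrite add0r; have e20 : 0 < e / 2 by rewrite divr_gt0.
near (c^'-) => t.
have h1 : normc (1 * nu t + - nu c) < e / 2 by near: t; exact: (cvgr_lt _ n0).
have h2 : normc (f t) < e / 2 by near: t; exact: (cvgr_lt _ f0).
have tc : t < c by [].
have xt : x <= t by near: t; exact: nbhs_left_ge.
rewrite fnu// in h2.
have -> : nu c = nu t - (1 * nu t + - nu c) by ring.
apply: (le_trans (ler_normcB _ _)); apply: ltW; rewrite [ltRHS]splitr.
exact: ltrD.
Unshelve. all: by end_near. Qed.

Lemma H1_near psi f (D : set R) : H1 J f -> measurable (D : set B) -> D `<=` J ->
  (forall s, D s -> \forall t \near s, f t = psi t) ->
  L2 leb D psi /\ L2 leb D (cderiv psi).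
Proof.
move=> [_ fL dL] mD DJ fpsi; split.
  apply: eq_L2 (L2S mD mJ DJ fL) => // s /fpsi; exact: nbhs_singleton.
apply: eq_L2 (L2S mD mJ DJ dL) => // s /fpsi n.
by rewrite /cderiv; congr (_ +i* _); apply: near_eq_derive1; apply: filterS n => y ->.
Qed.

(** Let [f] be the solution whose source is the free Green function with pole
    [x]. It solves the homogeneous equation on both sides of [x]. On the side
    of [c] it is a multiple of the solution [phi] with [phi c = 0]; on the
    other side it continues to a global solution [psi], which is as integrable
    at infinity as [f]. If [psi] were a multiple of [phi], the two multiples
    would agree, as [phi x != 0], and [f] would solve the homogeneous equation
    across the pole, contrary to [free_green_not_qeq]. *)
Theorem fundamental_pair_exists :
  (forall x, J x -> exists f : cfun R, pts H10 f /\
     T ((f - (fun s => (free_green c plus x s)%:C), z *: f), (z *: f, z ^+ 2 *: f))) ->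
  exists psi psi' phi phi', is_fundamental_pair om up c plus z psi psi' phi phi'.
Proof.
move=> solve; have [phi [phi' [phiq phic phi'c]]] := ivp_exists mf (coef z) 0 1 c.
have [x [ix phix]] := solution_inner_neq0 phiq phi'c; have Jx := inner_sub ix.
have [f [fH fT]] := solve x Jx; have [fH1 f0] := fH.
have xside b : (J `&` (if b then `]-oo, x] else `[x, +oo[)) x.
  by split => //; case: b; rewrite /= in_itv /= lexx.
have side b : exists G G', qeq mu4 setT (coef z) (fun=> G) G G' /\
    forall s, (J `&` (if b then `]-oo, x] else `[x, +oo[)) s -> f s = G s.
  have [k' kq] := free_green_side b Jx.
  have iE := @half_interval b x J iJ; have EJ := @subIsetl _ J (if b then `]-oo, x] else `[x, +oo[).
  have [F' Fq] := resolvent_qeq iE EJ fH fT kq.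
  exact: solution_extends iE (xside b) Fq.
have [nu [nu' [nuq fnu]]] := side plus; have [psi [psi' [psiq fpsi]]] := side (~~ plus).
have nuc : nu c = 0.
  move: f0 fnu ix; rewrite /vanishes_at_c /half_line /inner_half_line; case: plus => f0_ fnu_ /=.
    by rewrite in_itv /= andbT => cx; rewrite -fnu_//=; split; rewrite /= in_itv /= ?lexx// ltW.
  rewrite in_itv /= => xc; apply: (vanishing_limit nuq xc _ f0_) => s xs sc.
  by apply: fnu_; split; rewrite /= in_itv /= ?xs ?sc.
have nuE s : nu s = nu' c * phi s.
  have dq := homogeneous_linear (- nu' c) (@is_intervalT R) phiq nuq.
  have [] := qeq_unique mf (@is_intervalT R) (x0 := c) Logic.I dq _ _ (x := s) Logic.I.
  - by rewrite phic nuc; ring.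
  - by rewrite phi'c; ring.
  by rewrite mulNr addrC => e _; apply/eqP; rewrite -subr_eq0; apply/eqP.
have psiH : H1_near_infty plus psi.
  have near_ (E : set R) (s : R) : E = (J `&` (if ~~ plus then `]-oo, x] else `[x, +oo[)) ->
      nbhs s E -> \forall t \near s, f t = psi t.
    by move=> -> ; apply: filterS => t; exact: fpsi.
  have n := H1_near fH1; move: near_ n ix; rewrite /H1_near_infty /half_line /inner_half_line.
  case: plus => /= near_ n; rewrite in_itv /= ?andbT => xc.
  - exists (x + 1); apply: n => [|s|s]; first exact: measurable_itv.
      by rewrite /= !in_itv /= !andbT; move: xc; lra.
    rewrite /= in_itv /= andbT => xs; apply: (near_ _ _ erefl).
    have : nbhs s `]x, +oo[%classic by apply: open_nbhs_nbhs; split; [exact: itv_open_ends_open|rewrite /= in_itv /= andbT; move: xs; lra].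
    by apply: filterS => t; rewrite /= !in_itv /= !andbT => xt; split; move: xt xc; rewrite /= ?in_itv /= ?andbT; lra.
  - exists (x - 1); apply: n => [|s|s]; first exact: measurable_itv.
      by rewrite /= !in_itv /=; move: xc; lra.
    rewrite /= in_itv /= => xs; apply: (near_ _ _ erefl).
    have : nbhs s `]-oo, x[%classic by apply: open_nbhs_nbhs; split; [exact: itv_open_ends_open|rewrite /= in_itv /=; move: xs; lra].
    by apply: filterS => t; rewrite /= !in_itv /= => xt; split; move: xt xc; rewrite /= ?in_itv /=; lra.
exists psi, psi', phi, phi'; split => //; [exact: (qeq_solution up_fin)|exact: (qeq_solution up_fin)|].
move=> a b ab; have a0 : a = 0; last first.
  split => //; have := ab x; rewrite a0 mul0r add0r => /eqP; rewrite mulf_eq0 (negPf phix) orbF.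
  by move/eqP.
apply/eqP/negPn/negP => an0.
(* Otherwise [f] would be the same multiple of [phi] on both sides of [x]. *)
pose be := - b / a; have psiE s : psi s = be * phi s.
  apply: (mulfI an0); have := ab s; rewrite /be mulrA mulrCA mulfV// mulr1 mulNr => /eqP.
  by rewrite addr_eq0 => /eqP.
have beE : be = nu' c.
  by apply: (mulIf phix); rewrite -psiE -nuE -(fnu x (xside _)) -(fpsi x (xside _)).
have fE s : J s -> nu' c * phi s = f s.
  move=> Js; have h d : (if d then `]-oo, x] else `[x, +oo[)%classic s -> f s = nu' c * phi s.
    move=> sd; have [dp|dp] := eqVneq d plus.
      by rewrite -nuE; apply: fnu; split => //; rewrite -dp.
    rewrite -beE -psiE; apply: fpsi; split => //; suff -> : ~~ plus = d by [].
    by move: dp; case: (d); case: plus.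
  have [sx|/ltW xs] := leP s x; apply: esym; [apply: (h true)|apply: (h false)];
    by rewrite /= in_itv /= ?andbT.
have fq := eq_homogeneous iJ fE (homogeneous_scale (nu' c) iJ (qeqS (@subsetT _ J) phiq)).
have [k' kq] := resolvent_qeq_source fH (free_green_H10 som up_fin Jx) fT fq.
exact: free_green_not_qeq ix kq.
Qed.

End FundamentalPair.

Theorem theorem4p8 (R : realType)
  (om : set (measurableTypeR R) -> R)
  (up : {measure set (measurableTypeR R) -> \bar R})
  (c : R) (plus : bool) :
  is_signed_measure om -> locally_finite up ->
  resolvent_set (H0_space up c plus) (T_half om up c plus) 0 ->
  (exists Omega Upsilon,
     is_Omega om c plus Omega /\ is_Upsilon up c plus Upsilon) /\
  forall Omega Upsilon : cfun R -> cfun R,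
    is_Omega om c plus Omega -> is_Upsilon up c plus Upsilon ->
    let L := quadratic_pencil Omega Upsilon in
    pencil_spectrum (H10_space c plus) L =
      spectrum (H0_space up c plus) (T_half om up c plus) /\
    forall z : R[i], pencil_resolvent_set (H10_space c plus) L z ->
      (exists psi psi' phi phi' : R -> R[i],
         is_fundamental_pair om up c plus z psi psi' phi phi') /\
      forall psi psi' phi phi' : R -> R[i],
        is_fundamental_pair om up c plus z psi psi' phi phi' ->
        forall x0 : R,
        let G := green plus (wronskian psi psi' phi phi' x0) psi phi in
        forall x, half_line c plus x ->
          H1 (half_line c plus) (fun s => ((G x s)^*)%R) /\
          forall g f : cfun R,
            rel_inv (op_graph (H10_space c plus) (L z)) (g, f) ->
            f x = H1_dot (half_line c plus) g (fun s => ((G x s)^*)%R).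
Proof.
move=> som up_fin [onto0 _ [k0 bound0]].
(* The shift by [0] disappears, leaving solvability in [T] with an estimate. *)
have T_onto g : pts (H0_space up c plus) g -> exists f : cfun2 R, T_half om up c plus (f, g).
  by move=> /onto0[f /rel_shiftE]; rewrite scale0r addr0 => fT; exists f.
have T_bound (f g : cfun2 R) : T_half om up c plus (f, g) ->
    nrm (H0_space up c plus) f <= `|k0| * nrm (H0_space up c plus) g.
  move=> fT; have : rel_inv (rel_shift (T_half om up c plus) 0) (g, f).
    by apply/rel_shiftE; rewrite scale0r addr0.
  by move=> /bound0/le_trans; apply; rewrite ler_wpM2r ?H0_nrm_ge0// ler_norm.
have kT_ge0 := normr_ge0 k0.
split; first exact: (operators_exist som up_fin T_onto kT_ge0 T_bound).
move=> Omega Upsilon isO isU L; split.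
  exact: (pencil_spectrum_eq som up_fin T_onto kT_ge0 T_bound isO isU).
move=> z Lz; split.
  apply: (fundamental_pair_exists som up_fin) => x Jx; have [onto _ _] := Lz.
  have KH := free_green_H10 som up_fin Jx.
  have [f [/= fH _ Kf]] := onto _ KH; exists f; split => //.
  exact: (pencil_eqP som up_fin T_onto kT_ge0 T_bound isO isU z fH KH).1.
move=> psi psi' phi phi' fp x0 G x Jx; split=> [|g f].
  by have [] := green_formula som up_fin T_onto kT_ge0 T_bound isO isU fp Jx x0 0 0.
by have [_] := green_formula som up_fin T_onto kT_ge0 T_bound isO isU fp Jx x0 g f.
Qed.
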